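(* Let $X, Y$ be dual operator spaces. Then the following are equivalent: (i) $Y\subset_{cb\Delta}X$. (ii) There exist $w^*$-c.b. isomorphisms $\psi : Y\to \psi (Y)$ and $\phi: X\to \phi(X)$, projections $p,q$ such that $p\phi (X)\subseteq \phi(X)$ and $\phi (X)q\subseteq \phi (X)$, a cardinal $I$, and a completely isometric $w^*$-continuous onto map $$\pi : M_I(\psi (Y))\to M_I(p\phi (X)q).$$
   Context: A dual operator space is an operator space completely isometrically isomorphic to the operator space dual of some operator space. For a dual operator space $X$ and a cardinal $I$, $M_I(X)$ is the dual operator space of $I\times I$ matrices over $X$ whose finite submatrices have uniformly bounded norm. $[S]^{-w^*}$ is the $w^*$-closure of the linear span of $S$. A TRO is a subspace $M\subseteq B(H,K)$ ($H,K$ Hilbert spaces) with $m_1m_2^*m_3\in M$ for all $m_i\in M$. For $w^*$-closed spaces $X\subseteq B(H_1,H_2)$, $Y\subseteq B(K_1,K_2)$, $Y\subset_{TRO}X$ (weak TRO-embedding) means that there exist TROs $M_1\subseteq B(H_1,K_1)$, $M_2\subseteq B(H_2,K_2)$ such that $Y=[M_2XM_1^*]^{-w^*}$, $M_2^*YM_1\subseteq X$, $M_2^*M_2X\subseteq X$ and $XM_1^*M_1\subseteq X$. A $w^*$-c.b. isomorphism between dual operator spaces is a bijective, $w^*$-continuous, completely bounded linear map with completely bounded inverse. Here $\phi(X)$, $\psi(Y)$ denote $w^*$-closed spaces of operators between Hilbert spaces. $Y\subset_{cb\Delta}X$ means that there exist $w^*$-c.b. isomorphisms $\phi:X\to\phi(X)$,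 $\psi:Y\to\psi(Y)$ with $\psi(Y)\subset_{TRO}\phi(X)$. If $X\subseteq B(H_1,H_2)$ is $w^*$-closed and $q\in B(H_1)$, $p\in B(H_2)$ are projections with $pX\subseteq X$, $Xq\subseteq X$, then $pXq=\{pxq:x\in X\}$, a $w^*$-closed space. *)

(* Defs.v *)
From HB Require Import structures.
From mathcomp Require Import all_boot all_order all_algebra.
From mathcomp Require Import finmap all_classical all_reals all_analysis.
From mathcomp Require Import sesquilinear.
From mathcomp.analysis.showcase Require Import summability.
From mathcomp.real_closed Require Import complex.

Set Implicit Arguments.
Unset Strict Implicit.
Unset Printing Implicit Defensive.

Import Order.TTheory GRing.Theory Num.Theory.
Import numFieldNormedType.Exports.

Local Open Scope classical_set_scope.
Local Open Scope ring_scope.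

Reserved Notation "''B' ( V , W )" (format "''B' ( V ,  W )").

(* The library's norm over R[i] is R[i]-valued (and real). *)
Definition rnorm {R : realType} {V : normedModType R[i]} (x : V) : R :=
  complex.Re `|x|.

Definition bounded_linear {R : realType} {V W : normedModType R[i]} :
  {pred V -> W} := [pred f | `[< linear f /\ continuous f >]].

Lemma bounded_linear_submod (R : realType) (V W : normedModType R[i]) :
  submod_closed (@bounded_linear R V W).
Proof.
split=> [|a f g /asboolP[lf cf] /asboolP[lg cg]]; apply/asboolP; split.
- by move=> a x y /=; rewrite scaler0 addr0.
- exact: cst_continuous.
- move=> b x y; rewrite !fctE lf lg !scalerDr !scalerA (mulrC a).
  by rewrite addrACA.
- move=> x; apply: (@continuousD _ _ _ (a *: f) g); last exact: cg.
  by apply: continuousZl_tmp; exact: cf.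
Qed.

HB.instance Definition _ (R : realType) (V W : normedModType R[i]) :=
  GRing.isSubmodClosed.Build _ _ (@bounded_linear R V W)
    (bounded_linear_submod V W).

Record bop (R : realType) (V W : normedModType R[i]) := Bop {
  bop_fun :> V -> W;
  bop_proof : bop_fun \in bounded_linear }.

Notation "''B' ( V , W )" := (bop V W) : type_scope.

Section BopInstances.
Context {R : realType} {V W : normedModType R[i]}.

HB.instance Definition _ := [isSub for @bop_fun R V W].
HB.instance Definition _ := [Choice of 'B(V, W) by <:].
HB.instance Definition _ := [SubChoice_isSubLmodule of 'B(V, W) by <:].

Lemma bop_linear (T : 'B(V, W)) : linear T.
Proof. by case: T => f /= /asboolP[]. Qed.

Lemma bop_continuous (T : 'B(V, W)) : continuous T.
Proof. by case: T => f /= /asboolP[]. Qed.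

HB.instance Definition _ (T : 'B(V, W)) :=
  GRing.isLinear.Build R[i] V W _ (bop_fun T) (bop_linear T).

End BopInstances.

Section Composition.
Context {R : realType} {U V W : normedModType R[i]}.

Lemma bcomp_proof (S : 'B(V, W)) (T : 'B(U, V)) : S \o T \in bounded_linear.
Proof.
apply/asboolP; split=> [a x y /=|x]; first by rewrite !linearP.
by apply: continuous_comp; exact: bop_continuous.
Qed.

Definition bcomp (S : 'B(V, W)) (T : 'B(U, V)) : 'B(U, W) :=
  Bop (bcomp_proof S T).

End Composition.

(* [hdot x y] is linear in [x] and conjugate-linear in [y]. *)
HB.mixin Record isHilbert (R : realType) H of CompleteNormedModule R[i] H := {
  hdot : {dot H for (@Num.conj R[i])};
  hdot_norm : forall x : H, `|x| ^+ 2 = hdot x x }.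

#[short(type="hilbertType")]
HB.structure Definition Hilbert (R : realType) :=
  {H of isHilbert R H & CompleteNormedModule R[i] H}.

Section HilbertOperators.
Context {R : realType}.
Implicit Types (H K : hilbertType R).

Definition is_adjoint H K (T : 'B(H, K)) (S : 'B(K, H)) : Prop :=
  forall x y, hdot (T x) y = hdot x (S y).

Definition adjoints H K (M : set 'B(H, K)) : set 'B(K, H) :=
  [set S | exists2 T, M T & is_adjoint T S].

Definition is_projection H (p : 'B(H, H)) : Prop :=
  bcomp p p = p /\ is_adjoint p p.

Definition op_mul (V1 V2 V3 : normedModType R[i])
    (A : set 'B(V2, V3)) (B : set 'B(V1, V2)) : set 'B(V1, V3) :=
  [set bcomp a b | a in A & b in B].

End HilbertOperators.

Section MatrixNorms.
Context {R : realType}.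

Definition l2norm (A : finType) (V : normedModType R[i]) (h : A -> V) : R :=
  Num.sqrt (\sum_a rnorm (h a) ^+ 2).

(* Norm of the matrix [T], acting from the l2-sum of B copies of V to the
   l2-sum of A copies of W. *)
Definition opnorm (A B : finType) (V W : normedModType R[i])
    (T : A -> B -> V -> W) : R :=
  sup [set l2norm (fun a => \sum_b T a b (h b))
      | h in [set h : B -> V | l2norm h <= 1]].

Definition scalar_norm (A B : finType) (a : A -> B -> R[i]) : R :=
  opnorm (fun i j (z : R[i]^o) => a i j * z : R[i]^o).

Definition bop_mxnorm (V W : normedModType R[i]) n (T : 'M['B(V, W)]_n) : R :=
  opnorm (fun i j => T i j : V -> W).

End MatrixNorms.

Section ScalarAction.
Context {R : realType} {V : lmodType R[i]}.

Definition scalar_bimul m n (a : 'M[R[i]]_(n, m)) (x : 'M[V]_m)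
    (b : 'M[R[i]]_(m, n)) : 'M[V]_n :=
  \matrix_(i, j) \sum_k \sum_l (a i k * b l j) *: x k l.

End ScalarAction.

(* Banach spaces with a norm on every M_n(V) satisfying Ruan's axioms. *)
HB.mixin Record isOperatorSpace (R : realType) V
    of CompleteNormedModule R[i] V := {
  mxnorm : forall n, 'M[V]_n -> R;
  mxnorm1 : forall x : V, mxnorm 1 (const_mx x) = rnorm x;
  mxnorm_eq0 : forall n (x : 'M[V]_n), mxnorm n x = 0 -> x = 0;
  mxnormZ : forall n (a : R[i]) (x : 'M[V]_n),
    mxnorm n (map_mx ( *:%R a) x) = rnorm (a : R[i]^o) * mxnorm n x;
  ler_mxnormD : forall n (x y : 'M[V]_n),
    mxnorm n (x + y) <= mxnorm n x + mxnorm n y;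
  mxnorm_dsum : forall m n (x : 'M[V]_m) (y : 'M[V]_n),
    mxnorm (m + n) (block_mx x 0 0 y) = Num.max (mxnorm m x) (mxnorm n y);
  ler_mxnormM : forall m n (a : 'M[R[i]]_(n, m)) (x : 'M[V]_m)
      (b : 'M[R[i]]_(m, n)),
    mxnorm n (scalar_bimul a x b) <= scalar_norm a * mxnorm m x * scalar_norm b
}.

#[short(type="operatorSpaceType")]
HB.structure Definition OperatorSpace (R : realType) :=
  {V of isOperatorSpace R V & CompleteNormedModule R[i] V}.

Arguments mxnorm {R s n} _.

(* The matrix norms of the operator space dual, M_n(V^* ) = CB(V, M_n). *)
Definition dual_mxnorm (R : realType) (V : operatorSpaceType R) n
    (f : 'M['B(V, R[i]^o)]_n) : R :=
  sup [set r | exists m (v : 'M[V]_m), mxnorm v <= 1 /\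
    r = scalar_norm (fun (a b : 'I_n * 'I_m) => f a.1 b.1 (v a.2 b.2))].

(* An operator space with a fixed predual, on which its w*-topology depends. *)
Record dualOperatorSpace (R : realType) := DualOperatorSpace {
  dos_space :> operatorSpaceType R;
  predual : operatorSpaceType R;
  dos_iso : {linear dos_space -> 'B(predual, R[i]^o)};
  dos_iso_bij : bijective dos_iso;
  dos_iso_isometric : forall n (x : 'M[dos_space]_n),
    dual_mxnorm (map_mx dos_iso x) = mxnorm x }.

(* The coarsest topology making every element of F continuous: the topology
   induced by the evaluation map from V to the product space C^F. *)
Definition functional_topology (R : realType) (V : choiceType)
    (F : set (V -> R[i]^o)) : topologicalType :=
  initial_topology (fun (x : V) => (fun f => \val f x) : {ptws F -> R[i]^o}).

Section WeakStar.
Context {R : realType}.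

Definition predual_functionals (X : dualOperatorSpace R) : set (X -> R[i]^o) :=
  [set f | exists v : predual X, f = fun x => dos_iso X x v].

(* The elements of the predual of B(H, K), i.e. the trace class functionals
   T |-> \sum_k <T (xi k), eta k>, with xi and eta square summable. *)
Definition normal_functionals (H K : hilbertType R) :
    set ('B(H, K) -> R[i]^o) :=
  [set f | exists (xi : nat -> H) (eta : nat -> K),
    [/\ (\esum_(k in [set: nat]) (rnorm (xi k) ^+ 2)%:E < +oo)%E,
        (\esum_(k in [set: nat]) (rnorm (eta k) ^+ 2)%:E < +oo)%E
      & forall T : 'B(H, K),
          series (fun k => hdot (T (xi k)) (eta k) : R[i]^o) @ \oo --> f T]].

Definition wstar_dual (X : dualOperatorSpace R) : topologicalType :=
  functional_topology (@predual_functionals X).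

Definition wstar_op (H K : hilbertType R) : topologicalType :=
  functional_topology (@normal_functionals H K).

Definition wstar_closed (H K : hilbertType R) (X : set 'B(H, K)) : Prop :=
  closed (X : set (wstar_op H K)).

Definition lspan (V : lmodType R[i]) (S : set V) : set V :=
  [set x | exists n (a : 'I_n -> R[i]) (v : 'I_n -> V),
    (forall i, S (v i)) /\ x = \sum_i a i *: v i].

Definition wstar_span (H K : hilbertType R) (S : set 'B(H, K)) :
    set 'B(H, K) := closure (lspan S : set (wstar_op H K)).

End WeakStar.

Section InfiniteMatrices.
Context {R : realType} {I : choiceType} {H K : hilbertType R}.

Definition infmx := I -> I -> 'B(H, K).

Definition finite_submx_norm n (T : 'M[infmx]_n) (A B : {fset I}) : R :=
  opnorm (fun (a : 'I_n * A) (b : 'I_n * B) =>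
    T a.1 b.1 (val a.2) (val b.2) : H -> K).

Definition MI (X : set 'B(H, K)) : set infmx :=
  [set T | (forall i j, X (T i j)) /\
    exists C : R, forall A B : {fset I},
      finite_submx_norm (const_mx T : 'M[infmx]_1) A B <= C].

Definition MI_mxnorm n (T : 'M[infmx]_n) : R :=
  sup [set finite_submx_norm T A B | A in [set: {fset I}] & B in [set: {fset I}]].

(* M_I(B(H, K)) is the space of bounded operators from l2(I, H) to l2(I, K).
   [infmx_form T xi eta z] says that z = <T xi, eta> for xi in l2(I, H) and
   eta in l2(I, K), as the limit over the finite truncations of T. *)
Definition infmx_form (T : infmx) (xi : I -> H) (eta : I -> K) (z : R[i]^o) :=
  (fun A : {fset I} => \sum_(i : A) \sum_(j : A)
     hdot (T (val i) (val j) (xi (val j))) (eta (val i)) : R[i]^o)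
  @ totally --> z.

(* The trace class functionals of B(l2(I, H), l2(I, K)). Only their values on
   M_I(B(H, K)) are constrained. *)
Definition MI_normal_functionals : set (infmx -> R[i]^o) :=
  [set f | exists (xi : nat -> I -> H) (eta : nat -> I -> K),
    [/\ (\esum_(k in [set: nat * I]) (rnorm (xi k.1 k.2) ^+ 2)%:E < +oo)%E,
        (\esum_(k in [set: nat * I]) (rnorm (eta k.1 k.2) ^+ 2)%:E < +oo)%E
      & forall T, MI setT T -> exists z : nat -> R[i]^o,
          (forall k, infmx_form T (xi k) (eta k) (z k)) /\
          series z @ \oo --> f T]].

Definition wstar_MI : topologicalType :=
  functional_topology MI_normal_functionals.

End InfiniteMatrices.

Arguments infmx {R} I H K.
Arguments wstar_MI {R} I H K.
Arguments MI {R} I {H K} X.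

Section CompletelyBounded.
Context {R : realType}.

Definition completely_bounded_on (V W : Type) (D : set V)
    (NV : forall n, 'M[V]_n -> R) (NW : forall n, 'M[W]_n -> R)
    (f : V -> W) : Prop :=
  exists C : R, forall n (x : 'M[V]_n), (forall i j, D (x i j)) ->
    NW n (map_mx f x) <= C * NV n x.

Definition completely_isometric_on (V W : Type) (D : set V)
    (NV : forall n, 'M[V]_n -> R) (NW : forall n, 'M[W]_n -> R)
    (f : V -> W) : Prop :=
  forall n (x : 'M[V]_n), (forall i j, D (x i j)) ->
    NW n (map_mx f x) = NV n x.

Definition linear_on (V W : lmodType R[i]) (D : set V) (f : V -> W) : Prop :=
  forall a x y, D x -> D y -> f (a *: x + y) = a *: f x + f y.

Definition wstar_cb_iso (X : dualOperatorSpace R) (H K : hilbertType R)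
    (phi : {linear X -> 'B(H, K)}) : Prop :=
  [/\ wstar_closed (range phi),
      continuous (phi : wstar_dual X -> wstar_op H K),
      completely_bounded_on setT (@mxnorm R X) (@bop_mxnorm R H K) phi
    & exists2 psi : 'B(H, K) -> X, cancel phi psi &
        completely_bounded_on (range phi) (@bop_mxnorm R H K) (@mxnorm R X) psi].

(* Only the restriction of pi to M_I(X) is constrained. *)
Definition wstar_MI_iso (I : choiceType) (H1 H2 K1 K2 : hilbertType R)
    (X : set 'B(H1, H2)) (Y : set 'B(K1, K2))
    (pi : infmx I H1 H2 -> infmx I K1 K2) : Prop :=
  [/\ linear_on (MI I X) pi,
      pi @` MI I X = MI I Y,
      completely_isometric_on (MI I X)
        (@MI_mxnorm R I H1 H2) (@MI_mxnorm R I K1 K2) pi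
    & {within (MI I X : set (wstar_MI I H1 H2)),
        continuous (pi : wstar_MI I H1 H2 -> wstar_MI I K1 K2)}].

End CompletelyBounded.

Section TRO.
Context {R : realType}.

Definition is_TRO (H K : hilbertType R) (M : set 'B(H, K)) : Prop :=
  [/\ M 0, (forall a x y, M x -> M y -> M (a *: x + y))
    & op_mul (op_mul M (adjoints M)) M `<=` M].

Definition TRO_embeds (H1 H2 K1 K2 : hilbertType R)
    (Y : set 'B(K1, K2)) (X : set 'B(H1, H2)) : Prop :=
  exists (M1 : set 'B(H1, K1)) (M2 : set 'B(H2, K2)),
    [/\ is_TRO M1 /\ is_TRO M2,
        Y = wstar_span (op_mul (op_mul M2 X) (adjoints M1)),
        op_mul (op_mul (adjoints M2) Y) M1 `<=` X,
        op_mul (op_mul (adjoints M2) M2) X `<=` X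
      & op_mul (op_mul X (adjoints M1)) M1 `<=` X].

Definition cbDelta_embeds (Y X : dualOperatorSpace R) : Prop :=
  exists (H1 H2 K1 K2 : hilbertType R)
    (phi : {linear X -> 'B(H1, H2)}) (psi : {linear Y -> 'B(K1, K2)}),
    [/\ wstar_cb_iso phi, wstar_cb_iso psi
      & TRO_embeds (range psi) (range phi)].

Definition compress (H1 H2 : hilbertType R) (p : 'B(H2, H2))
    (X : set 'B(H1, H2)) (q : 'B(H1, H1)) : set 'B(H1, H2) :=
  [set bcomp (bcomp p x) q | x in X].

End TRO.

(* Main.v *)
(* (i) => (ii). The TROs may be replaced by their w*-closures. For a w*-closed
   TRO M, a family (v_d) in M that is maximal for sum_d v_d* v_d <= 1 sums to
   the right support p of M. Spreading it over l2(I) for a set I of words gives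
   A in M_I(M) with A* A = 1 (x) p; the same for M* gives B with
   B* B = 1 (x) p', and a Schroeder-Bernstein argument merges A and B* into a
   partial isometry U in M_I(M) from 1 (x) p to 1 (x) p'. With such U1, U2 for
   the two TROs, T |-> U2* T U1 maps M_I(psi(Y)) onto M_I(p phi(X) q).

   (ii) => (i). Let Z = M_I(p phi(X) q). Multiplication by reflections and by
   transpositions of the coordinates of l2(I) acts on Z, and so does, through
   pi, the analogous multiplication on M_I(psi(Y)). Such an involution of Z
   does not change the norm of a matrix over Z when it is applied to some of
   its rows (or columns). Therefore Z has a completely isometric and w*-continuous
   representation in which all these maps are multiplications by self-adjoint
   unitaries of one and the same Hilbert space: a minimal sublinear function of
   lists of vectors, invariant under the involutions, is quadratic, and the
   completion for this form is the space sought. In this representation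
   p phi(X) q and psi(Y) are both corners, cut out by projections that multiply
   the represented Z into itself, and the multipliers from one corner to the
   other form the two TROs. What remains of phi(X) is added as a direct
   summand. *)
From HB Require Import structures.
From mathcomp Require Import all_boot all_order all_algebra.
From mathcomp Require Import finmap all_classical all_reals all_analysis.
From mathcomp Require Import sesquilinear.
From mathcomp.analysis.showcase Require Import summability.
From mathcomp.real_closed Require Import complex.
From mathcomp Require Import ring lra zify.
Require Import Defs.

Set Implicit Arguments.
Unset Strict Implicit.
Unset Printing Implicit Defensive.

Import Order.TTheory GRing.Theory Num.Theory.
Import numFieldNormedType.Exports.

Local Open Scope classical_set_scope.
Local Open Scope ring_scope.
Local Open Scope complex_scope.

(* The obstacle from (ii) to (i) is that [pi] is only a map of operator spaces: the unitaries of
   l2(I) act on both sides, but transporting one action through [pi] gives abstract linear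
   involutions of Z, not multiplications by operators. What [pi] does carry over is that the norm of
   a matrix is stable when single rows or columns are changed, and this is the condition that
   characterizes one-sided multipliers. Involutions are used because each is its own inverse, which
   makes the moves of the minimization reversible; coordinate projections come back as (1 - u) / 2.
   Row moves are dilated first, column moves second, and the second dilation keeps the first because
   every row move commutes with every column move. The inverse of [pi] must be w*-continuous as
   well; this comes from the duality between operators and normal functionals. From (i) to (ii) the
   index set must contain disjoint copies of itself, one for each index of each maximal family, and
   words provide them. *)
#[global] Existing Instance totally_filter.

(** * Operators on Hilbert spaces *)

Section RealNorm.
Context {R : realType}.
Implicit Types V W : normedModType R[i].

Lemma normE V (x : V) : `|x| = (rnorm x)%:C.
Proof. by rewrite /rnorm RRe_real// ger0_real. Qed.

Lemma rnorm_ge0 V (x : V) : 0 <= rnorm x.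
Proof. by rewrite -ler0c -normE. Qed.

Lemma ler_rnormD V (x y : V) : rnorm (x + y) <= rnorm x + rnorm y.
Proof. by have := ler_normD x y; rewrite !normE -rmorphD/= lecR. Qed.

Lemma rnormZ V (a : R[i]) (x : V) :
  rnorm (a *: x) = rnorm (a : R[i]^o) * rnorm x.
Proof.
by apply: complexI; have := normrZ a x; rewrite rmorphM/= -!normE => ->.
Qed.

Lemma rnormN V (x : V) : rnorm (- x) = rnorm x.
Proof. by rewrite /rnorm normrN. Qed.

Lemma rnorm0 V : rnorm (0 : V) = 0.
Proof. by rewrite /rnorm normr0. Qed.

Lemma rnorm_eq0 V (x : V) : rnorm x = 0 -> x = 0.
Proof. by move=> h; apply/normr0_eq0; rewrite normE h. Qed.

Lemma rnormB V (x y : V) : rnorm (x - y) = rnorm (y - x).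
Proof. by rewrite -rnormN opprB. Qed.

Lemma ler_rnormB V (x y : V) : rnorm (x - y) <= rnorm x + rnorm y.
Proof. by rewrite (le_trans (ler_rnormD _ _))// rnormN. Qed.

Lemma ler_rnorm_sum V I (r : seq I) (P : pred I) (F : I -> V) :
  rnorm (\sum_(i <- r | P i) F i) <= \sum_(i <- r | P i) rnorm (F i).
Proof.
elim/big_ind2 : _ => [|x a y b xa yb|//]; first by rewrite rnorm0.
by rewrite (le_trans (ler_rnormD _ _))// lerD.
Qed.

Lemma rnormM (a b : R[i]) :
  rnorm (a * b : R[i]^o) = rnorm (a : R[i]^o) * rnorm (b : R[i]^o).
Proof. exact: (rnormZ a (b : R[i]^o)). Qed.

Lemma rnormC (r : R) : rnorm (r%:C : R[i]^o) = `|r|.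
Proof. by rewrite /rnorm normc_def /= expr0n /= addr0 sqrtr_sqr. Qed.

Lemma rnormi : rnorm ('i%C : R[i]^o) = 1.
Proof. by rewrite /rnorm normc_def /= expr0n /= add0r expr1n sqrtr1. Qed.

Lemma rnormJ (a : R[i]) : rnorm (Num.conj a : R[i]^o) = rnorm (a : R[i]^o).
Proof. by rewrite /rnorm norm_conjC. Qed.

Lemma sqr_rnorm (a : R[i]) : a * Num.conj a = (rnorm (a : R[i]^o) ^+ 2)%:C.
Proof. by rewrite -normCK rmorphXn /= -(normE (a : R[i]^o)). Qed.

Lemma ler_Re_rnorm (a : R[i]) : complex.Re a <= rnorm (a : R[i]^o).
Proof.
rewrite (le_trans (ler_norm _))// -lecR -normE.
exact: normc_ge_Re.
Qed.

Lemma rnormZr V (r : R) (x : V) : rnorm (r%:C *: x) = `|r| * rnorm x.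
Proof. by rewrite rnormZ rnormC. Qed.

Lemma cvg_rnormP V T (F : set_system T) {FF : Filter F} (f : T -> V) (l : V) :
  f @ F --> l <-> (forall e : R, 0 < e -> \forall t \near F, rnorm (l - f t) < e).
Proof.
split=> [/cvgrPdist_lt h e e0|h].
  have /h : 0 < e%:C by rewrite ltcR.
  by apply: filterS => t; rewrite normE ltcR.
apply/cvgrPdist_lt => e e0.
have eR : (complex.Re e)%:C = e by rewrite RRe_real// gtr0_real.
have /h : 0 < complex.Re e by rewrite -ltcR eR.
by apply: filterS => t; rewrite normE -{2}eR ltcR.
Qed.

Lemma cauchy_rnorm (V : completeNormedModType R[i]) T (F : set_system T)
    {FF : ProperFilter F} (f : T -> V) :
  (forall e : R, 0 < e -> exists2 t, True & \forall s \near F, rnorm (f t - f s) < e) ->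
  cvg (f @ F).
Proof.
move=> h; apply: cauchy_cvg; apply/cauchyP => e e0.
have eR : (complex.Re e)%:C = e by rewrite RRe_real// gtr0_real.
have /h[t _ ht] : 0 < complex.Re e by rewrite -ltcR eR.
exists (f t); rewrite /= /nbhs/=; apply: filterS ht => s.
by rewrite -ball_normE /ball_/= normE -{2}eR ltcR.
Qed.

End RealNorm.

Section BoundedOperators.
Context {R : realType}.
Implicit Types V W : normedModType R[i].

Lemma bopP V W (S T : 'B(V, W)) : S =1 T -> S = T.
Proof. by move=> h; apply: val_inj; apply/funext. Qed.

Lemma bopDE V W (S T : 'B(V, W)) x : (S + T) x = S x + T x.
Proof. by []. Qed.

Lemma bopBE V W (S T : 'B(V, W)) x : (S - T) x = S x - T x.
Proof. by []. Qed.

Lemma bopNE V W (S : 'B(V, W)) x : (- S) x = - S x.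
Proof. by []. Qed.

Lemma bopZE V W a (S : 'B(V, W)) x : (a *: S) x = a *: S x.
Proof. by []. Qed.

Lemma bop0E V W x : (0 : 'B(V, W)) x = 0.
Proof. by []. Qed.

Lemma bop_sumE V W I (r : seq I) (P : pred I) (F : I -> 'B(V, W)) x :
  (\sum_(i <- r | P i) F i) x = \sum_(i <- r | P i) F i x.
Proof. by elim/big_rec2 : _ => // i y z _ <-. Qed.

Section Linearity.
Context {V W : normedModType R[i]} (T : 'B(V, W)).

Lemma opD x y : T (x + y) = T x + T y. Proof. exact: linearD. Qed.
Lemma opB x y : T (x - y) = T x - T y. Proof. exact: linearB. Qed.
Lemma opZ a x : T (a *: x) = a *: T x. Proof. exact: linearZ. Qed.
Lemma op0 : T 0 = 0. Proof. exact: linear0. Qed.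
Lemma op_sum I (r : seq I) (P : pred I) (F : I -> V) :
  T (\sum_(i <- r | P i) F i) = \sum_(i <- r | P i) T (F i).
Proof. exact: linear_sum. Qed.

End Linearity.

Lemma bop_bounded V W (T : 'B(V, W)) :
  exists2 M : R, 0 < M & forall x, rnorm (T x) <= M * rnorm x.
Proof.
have /continuous_linear_bounded/linear_boundedP/pinfty_ex_gt0[M M0 h] :
  {for 0, continuous T} by exact: bop_continuous.
have MR : (complex.Re M)%:C = M by rewrite RRe_real// gtr0_real.
exists (complex.Re M) => [|x]; first by rewrite -ltcR MR.
by rewrite -lecR rmorphM/= MR -!normE; exact: h.
Qed.

Lemma mkbop_proof V W (f : V -> W) (M : R) :
  linear f -> (forall x, rnorm (f x) <= M * rnorm x) -> f \in bounded_linear.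
Proof.
move=> lf hM; apply/asboolP; split => //.
pose g : {linear V -> W} := HB.pack f (GRing.isLinear.Build _ _ _ _ f lf).
rewrite -[f]/(g : V -> W).
apply: bounded_linear_continuous; apply/linear_boundedP.
near=> N; move=> x; rewrite !normE.
have NR : N \is Num.real by near: N; exists 0; split => // x0; exact: gtr0_real.
rewrite -(RRe_real NR) -rmorphM lecR (le_trans (hM x))//.
rewrite ler_wpM2r ?rnorm_ge0// -lecR (RRe_real NR).
by near: N; apply: nbhs_pinfty_ge; rewrite complex_real.
Unshelve. all: by end_near. Qed.

Definition mkbop V W (f : V -> W) (M : R) (lf : linear f)
    (hM : forall x, rnorm (f x) <= M * rnorm x) : 'B(V, W) :=
  Bop (mkbop_proof lf hM).

Definition idop V : 'B(V, V).
Proof.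
apply: (@mkbop V V idfun 1); first by [].
by move=> x; rewrite mul1r.
Defined.

Lemma idopE V (x : V) : idop V x = x. Proof. by []. Qed.

Section Comp.
Context {U V W : normedModType R[i]}.
Implicit Types (S : 'B(V, W)) (T : 'B(U, V)).

Lemma bcompE S T x : bcomp S T x = S (T x). Proof. by []. Qed.

Lemma bcompDl S1 S2 T : bcomp (S1 + S2) T = bcomp S1 T + bcomp S2 T.
Proof. exact: bopP. Qed.

Lemma bcompDr S T1 T2 : bcomp S (T1 + T2) = bcomp S T1 + bcomp S T2.
Proof. by apply: bopP => x; rewrite !(bcompE, bopDE) linearD. Qed.

Lemma bcompZl a S T : bcomp (a *: S) T = a *: bcomp S T.
Proof. exact: bopP. Qed.

Lemma bcompZr a S T : bcomp S (a *: T) = a *: bcomp S T.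
Proof. by apply: bopP => x; rewrite !(bcompE, bopZE) linearZ. Qed.

Lemma bcompNl S T : bcomp (- S) T = - bcomp S T.
Proof. exact: bopP. Qed.

Lemma bcompNr S T : bcomp S (- T) = - bcomp S T.
Proof. by apply: bopP => x; rewrite !(bcompE, bopNE) linearN. Qed.

Lemma bcomp0l T : bcomp (0 : 'B(V, W)) T = 0.
Proof. exact: bopP. Qed.

Lemma bcomp0r S : bcomp S (0 : 'B(U, V)) = 0.
Proof. by apply: bopP => x; rewrite !(bcompE, bop0E) linear0. Qed.

Lemma bcomp_suml I (r : seq I) (P : pred I) (F : I -> 'B(V, W)) T :
  bcomp (\sum_(i <- r | P i) F i) T = \sum_(i <- r | P i) bcomp (F i) T.
Proof. by apply: bopP => x; rewrite !(bcompE, bop_sumE). Qed.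

Lemma bcomp_sumr I (r : seq I) (P : pred I) S (F : I -> 'B(U, V)) :
  bcomp S (\sum_(i <- r | P i) F i) = \sum_(i <- r | P i) bcomp S (F i).
Proof. by apply: bopP => x; rewrite !(bcompE, bop_sumE) linear_sum. Qed.

End Comp.

Lemma bcompA (V1 V2 V3 V4 : normedModType R[i]) (A : 'B(V3, V4))
    (B : 'B(V2, V3)) (C : 'B(V1, V2)) :
  bcomp A (bcomp B C) = bcomp (bcomp A B) C.
Proof. exact: bopP. Qed.

Lemma bcomp1l V W (T : 'B(V, W)) : bcomp (idop W) T = T.
Proof. exact: bopP. Qed.

Lemma bcomp1r V W (T : 'B(V, W)) : bcomp T (idop V) = T.
Proof. exact: bopP. Qed.

End BoundedOperators.

Section HilbertBasics.
Context {R : realType} {H : hilbertType R}.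
Implicit Types x y z : H.

Lemma hdotDl x y z : hdot (x + y) z = hdot x z + hdot y z.
Proof. exact: linearDl. Qed.
Lemma hdotDr x y z : hdot x (y + z) = hdot x y + hdot x z.
Proof. exact: linearDr. Qed.
Lemma hdotBl x y z : hdot (x - y) z = hdot x z - hdot y z.
Proof. exact: linearBl. Qed.
Lemma hdotBr x y z : hdot x (y - z) = hdot x y - hdot x z.
Proof. exact: linearBr. Qed.
Lemma hdotNr x z : hdot x (- z) = - hdot x z.
Proof. exact: linearNr. Qed.
Lemma hdot0l z : hdot 0 z = 0 :> R[i].
Proof. exact: linear0l. Qed.
Lemma hdot0r z : hdot z 0 = 0 :> R[i].
Proof. exact: linear0r. Qed.
Lemma hdotZl a x z : hdot (a *: x) z = a * hdot x z.
Proof. exact: linearZl_LR. Qed.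
Lemma hdotZr a x z : hdot x (a *: z) = Num.conj a * hdot x z.
Proof. exact: linearZr_LR. Qed.
Lemma hdotC x y : hdot x y = Num.conj (hdot y x).
Proof. by rewrite (hermitian_subproof x y) expr0 mul1r. Qed.

Lemma hdot_suml I (r : seq I) (P : pred I) (F : I -> H) z :
  hdot (\sum_(i <- r | P i) F i) z = \sum_(i <- r | P i) hdot (F i) z.
Proof. exact: linear_sumlz. Qed.

Lemma hdot_sumr I (r : seq I) (P : pred I) (F : I -> H) z :
  hdot z (\sum_(i <- r | P i) F i) = \sum_(i <- r | P i) hdot z (F i).
Proof. exact: linear_sumr. Qed.

Lemma hdotxx x : hdot x x = (rnorm x ^+ 2)%:C.
Proof. by rewrite -hdot_norm normE rmorphXn. Qed.

Lemma rnormDE x y :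
  rnorm (x + y) ^+ 2 = rnorm x ^+ 2 + rnorm y ^+ 2 + 2 * complex.Re (hdot x y).
Proof.
apply: complexI; rewrite -hdotxx hdotDl !hdotDr !hdotxx (hdotC y x).
have -> : Num.conj (hdot x y) = (2 * complex.Re (hdot x y))%:C - hdot x y.
  by case: (hdot x y) => a b; apply/eqP; rewrite eq_complex /=;
    apply/andP; split; apply/eqP; ring.
by rewrite [RHS]rmorphD [X in _ = X + _]rmorphD /=; ring.
Qed.

Lemma rnormBE x y :
  rnorm (x - y) ^+ 2 = rnorm x ^+ 2 + rnorm y ^+ 2 - 2 * complex.Re (hdot x y).
Proof. by rewrite rnormDE rnormN hdotNr raddfN mulrN. Qed.

Lemma parallelogram x y :
  rnorm (x + y) ^+ 2 + rnorm (x - y) ^+ 2 = 2 * rnorm x ^+ 2 + 2 * rnorm y ^+ 2.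
Proof. by rewrite rnormDE rnormBE; ring. Qed.

Lemma cauchy_schwarz x y : rnorm (hdot x y : R[i]^o) <= rnorm x * rnorm y.
Proof.
have [->|y0] := eqVneq y 0.
  by rewrite hdot0r !rnorm0 mulr0.
have ny : 0 < rnorm y.
  by rewrite lt_neqAle rnorm_ge0 andbT eq_sym; apply: contraNneq y0 => /rnorm_eq0 ->.
pose c := hdot x y / (rnorm y ^+ 2)%:C.
have : 0 <= rnorm (x - c *: y) ^+ 2 by rewrite exprn_ge0// rnorm_ge0.
rewrite rnormBE rnormZ hdotZr.
have -> : Num.conj c * hdot x y = (rnorm (hdot x y : R[i]^o) ^+ 2 / rnorm y ^+ 2)%:C.
  rewrite /c rmorphM /= mulrAC [Num.conj _ * _]mulrC sqr_rnorm.
  by rewrite -fmorphV [Num.conj _]conj_Creal ?complex_real// -rmorphM.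
have -> : rnorm (c : R[i]^o) = rnorm (hdot x y : R[i]^o) / rnorm y ^+ 2.
  rewrite /c rnormM -fmorphV rnormC ger0_norm// invr_ge0 exprn_ge0// rnorm_ge0 //.
rewrite /= => h.
rewrite -(@ler_pXn2r _ 2) ?nnegrE ?mulr_ge0 ?rnorm_ge0// exprMn.
have y2 : rnorm y ^+ 2 != 0 by rewrite expf_neq0// gt_eqF.
rewrite -ler_pdivrMr ?exprn_gt0//.
move: h; rewrite exprMn expr_div_n -exprM.
set a := rnorm (hdot x y : _) ^+ 2; set b := rnorm y in ny y2 *.
have -> : a / b ^+ (2 * 2) * b ^+ 2 = a / b ^+ 2 by field; rewrite gt_eqF.
by lra.
Qed.

Lemma hdot_ext x y : (forall z, hdot x z = hdot y z) -> x = y.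
Proof.
move=> h; apply/eqP; rewrite -subr_eq0; apply/eqP/rnorm_eq0.
have := hdotxx (x - y); rewrite hdotBl h subrr => /eqP.
by rewrite eq_sym => /eqP/complexI/eqP; rewrite sqrf_eq0 => /eqP.
Qed.

Lemma hdot_extr x y : (forall z, hdot z x = hdot z y) -> x = y.
Proof. by move=> h; apply: hdot_ext => z; rewrite hdotC h -hdotC. Qed.

Lemma hdot_cvg T (F : set_system T) {FF : Filter F} (f g : T -> H) (x y : H) :
  f @ F --> x -> g @ F --> y ->
  (fun t => hdot (f t) (g t) : R[i]^o) @ F --> (hdot x y : R[i]^o).
Proof.
move=> /cvg_rnormP fx /cvg_rnormP gy; apply/cvg_rnormP => e e0.
pose M := rnorm x + rnorm y + 1.
have M0 : 0 < M by rewrite ltr_wpDl// addr_ge0// rnorm_ge0.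
have d0 : 0 < Num.min 1 (e / (2 * M)).
  by rewrite lt_min ltr01 divr_gt0// mulr_gt0.
move: (fx _ d0) (gy _ d0); apply: filterS2 => t.
rewrite !lt_min => /andP[f1 f2] /andP[g1 g2].
have -> : hdot x y - hdot (f t) (g t) = hdot (x - f t) (g t) + hdot x (y - g t).
  by rewrite hdotBl hdotBr [RHS]addrC addrA subrK.
have ng : rnorm (g t) <= rnorm y + 1.
  have -> : g t = y - (y - g t) by rewrite subKr.
  by rewrite (le_trans (ler_rnormB _ _))// lerD// ltW.
apply: le_lt_trans (ler_rnormD _ _) _.
apply: le_lt_trans (lerD (cauchy_schwarz _ _) (cauchy_schwarz _ _)) _.
have : rnorm (x - f t) * rnorm (g t) <= e / (2 * M) * (rnorm y + 1).
  by apply: ler_pM; rewrite ?rnorm_ge0// ltW.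
have : rnorm x * rnorm (y - g t) <= rnorm x * (e / (2 * M)).
  by rewrite ler_wpM2l ?rnorm_ge0// ltW.
move=> a b; apply: le_lt_trans (lerD b a) _.
rewrite mulrC -mulrDl addrAC (addrC (rnorm y)) -/M.
have -> : M * (e / (2 * M)) = e / 2 by field; rewrite gt_eqF.
by rewrite ltr_pdivrMr// ltr_pMr// ltr1n.
Qed.

End HilbertBasics.

Section HilbertTheory.
Context {R : realType}.
Implicit Types H K : hilbertType R.

Lemma cauchy_seq_cvg (V : completeNormedModType R[i]) (u : nat -> V) :
  (forall e : R, 0 < e ->
     exists N, forall m n, (N <= m)%N -> (N <= n)%N -> rnorm (u m - u n) < e) ->
  exists l : V, u @ \oo --> l.
Proof.
move=> h; apply/cvg_ex; apply: cauchy_rnorm => e /h[N hN]; exists N => //.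
by exists N => // n /= Nn; exact: hN.
Qed.

Lemma real_quadratic0 (a b : R) : 0 <= a ->
  (forall t : R, 0 <= t ^+ 2 * a - 2 * t * b) -> b = 0.
Proof.
move=> a0 h; apply/eqP/negPn/negP => b0.
have a1 : 0 < a + 1 by rewrite ltr_wpDl.
(* The optimal [t] is [b / a]; adding 1 to the denominator covers [a = 0]. *)
have := h (b / (a + 1)); apply/negP; rewrite -ltNge.
have -> : (b / (a + 1)) ^+ 2 * a - 2 * (b / (a + 1)) * b =
  - (b / (a + 1)) ^+ 2 * (a + 2) by field; rewrite gt_eqF.
rewrite mulNr oppr_lt0 mulr_gt0 ?ltr_wpDl// exprn_even_gt0//.
by rewrite mulf_neq0// invr_neq0// gt_eqF.
Qed.

Definition subspace (V : lmodType R[i]) (M : set V) : Prop :=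
  M 0 /\ forall a x y, M x -> M y -> M (a *: x + y).

Section Subspace.
Context {V : lmodType R[i]} {M : set V} (sM : subspace M).

Lemma subspaceD x y : M x -> M y -> M (x + y).
Proof. by move=> Mx My; rewrite -[x]scale1r; exact: sM.2. Qed.

Lemma subspaceZ a x : M x -> M (a *: x).
Proof. by move=> Mx; rewrite -[_ *: _]addr0; apply: sM.2 => //; exact: sM.1. Qed.

Lemma subspaceN x : M x -> M (- x).
Proof. by rewrite -scaleN1r; exact: subspaceZ. Qed.

Lemma subspaceB x y : M x -> M y -> M (x - y).
Proof. by move=> Mx My; apply: subspaceD => //; exact: subspaceN. Qed.

Lemma subspace_sum I (r : seq I) (P : pred I) (F : I -> V) :
  (forall i, P i -> M (F i)) -> M (\sum_(i <- r | P i) F i).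
Proof.
by move=> h; elim/big_ind : _ => //; [exact: sM.1|exact: subspaceD].
Qed.

End Subspace.

(** Along [t c y] with real [t] the squared distance is a quadratic polynomial that is minimal at 0,
    so Re <u, c y> = 0. Taking 1 and the imaginary unit for [c] gives both parts of <u, y>. *)
Lemma orthogonal_of_min H (u y : H) :
  (forall c : R[i], rnorm u <= rnorm (u - c *: y)) -> hdot u y = 0.
Proof.
move=> h.
have key (c : R[i]) : complex.Re (hdot u (c *: y)) = 0.
  apply: (@real_quadratic0 (rnorm (c *: y) ^+ 2)); first by rewrite exprn_ge0// rnorm_ge0.
  move=> t; have : rnorm u ^+ 2 <= rnorm (u - (t%:C * c) *: y) ^+ 2.
    by rewrite ler_pXn2r ?nnegrE ?rnorm_ge0.
  rewrite -scalerA rnormBE rnormZr exprMn real_normK ?num_real// hdotZr conj_Creal ?complex_real//.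
  by case: (hdot u _) => a b /=; rewrite mul0r subr0; lra.
move: (key 1) (key 'i%C); rewrite scale1r hdotZr.
have -> : Num.conj 'i%C = - 'i%C :> R[i] by apply/eqP; rewrite eq_complex /= oppr0 !eqxx.
case: (hdot u y) => a b /= -> ; rewrite oppr0 mul0r sub0r mulN1r opprK => ->.
by [].
Qed.

Lemma projection_theorem H (M : set H) : subspace M -> closed M ->
  forall x, exists2 m, M m & forall y, M y -> hdot (x - m) y = 0.
Proof.
move=> sM cM x.
pose D := [set rnorm (x - y) | y in M].
have D0 : has_inf D.
  split; first by exists (rnorm (x - 0)), 0 => //; exact: sM.1.
  by exists 0 => _ [y _ <-]; exact: rnorm_ge0.
pose d := inf D.
have d0 : 0 <= d by apply: lb_le_inf; [exact: D0.1|move=> _ [y _ <-]; exact: rnorm_ge0].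
have dle y : M y -> d <= rnorm (x - y).
  by move=> My; apply: inf_lbound; [exact: D0.2|exists y].
have /choice[u hu] : forall n : nat, exists y, M y /\ rnorm (x - y) ^+ 2 < d ^+ 2 + n.+1%:R^-1.
  move=> n; have e0 : 0 < Num.sqrt (d ^+ 2 + n.+1%:R^-1) - d.
    rewrite subr_gt0 -{1}(ger0_norm d0) -sqrtr_sqr.
    by rewrite ltr_sqrt ?ltrDl ?invr_gt0// ltr_wpDl ?invr_gt0// exprn_ge0.
  have [_ [y My <-]] := inf_adherent e0 D0.
  rewrite -/d addrCA subrr addr0 => h; exists y; split => //.
  rewrite -[ltRHS]sqr_sqrtr; last by rewrite addr_ge0// exprn_ge0.
  by rewrite ltr_pXn2r// nnegrE ?rnorm_ge0 ?sqrtr_ge0.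
have half m n : M ((2^-1 : R[i]) *: (u m + u n)).
  by apply: subspaceZ => //; apply: subspaceD => //; [exact: (hu m).1|exact: (hu n).1].
(* Parallelogram law: the midpoint of [u m] and [u n] is in [M], hence at distance at least [d] from
   [x]. *)
have est m n : rnorm (u m - u n) ^+ 2 <= 2 * m.+1%:R^-1 + 2 * n.+1%:R^-1.
  have := parallelogram (x - u m) (x - u n).
  have -> : x - u m - (x - u n) = u n - u m by rewrite opprB addrC addrA subrK.
  rewrite [x - u m + _]addrACA -opprD => E.
  have -> : rnorm (u m - u n) = rnorm (u n - u m) by rewrite rnormB.
  have : 4 * d ^+ 2 <= rnorm (x + x - (u m + u n)) ^+ 2.
    have := dle _ (half m n); rewrite -(@ler_pXn2r _ 2) ?nnegrE ?rnorm_ge0// => h.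
    have -> : x + x - (u m + u n) = (2 : R)%:C *: (x - (2^-1 : R[i]) *: (u m + u n)).
      rewrite scalerBr scalerA -mulr2n -scaler_nat rmorph_nat mulfV ?scale1r//.

    by rewrite rnormZr exprMn ger0_norm// -natrX ler_wpM2l.
  have := (hu m).2; have := (hu n).2; move: E.
  set a := rnorm _ ^+ 2; set b := rnorm _ ^+ 2; set a' := rnorm _ ^+ 2; set b' := rnorm _ ^+ 2.
  set q := n.+1%:R^-1; set r := m.+1%:R^-1.
  by move: a b a' b' q r => a b a' b' q r E h1 h2 h3; lra.
have [m um] : exists m : H, u @ \oo --> m.
  apply: cauchy_seq_cvg => e e0.
  have e2 : 0 < e ^+ 2 / 4 by rewrite divr_gt0// exprn_gt0.
  have [N _ hN] := near_infty_natSinv_lt (PosNum e2).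
  exists N => i j Ni Nj.
  rewrite -(@ltr_pXn2r _ 2) ?nnegrE ?rnorm_ge0 ?ltW//.
  apply: le_lt_trans (est i j) _.
  have := hN _ Ni; have := hN _ Nj; rewrite /=.
  by move: (i.+1%:R^-1 : R) (j.+1%:R^-1 : R) => p q; lra.
have Mm : M m by apply: (closed_cvg M cM) um; apply: nearW => n; exact: (hu n).1.
exists m => // y My; apply: orthogonal_of_min => c.
have Mcy : M (m + c *: y) by apply: subspaceD => //; exact: subspaceZ.
rewrite -addrA -opprD; apply: le_trans (dle _ Mcy).
have dm : rnorm (x - m) ^+ 2 <= d ^+ 2.
  apply/ler_addgt0Pr => e e0.
  (* Replacing [u n] by its limit changes the distance by at most [q]; as this distance is at most
     [d + 1], its square then exceeds [d ^+ 2] by at most [q * (2 * d + 5)]. *)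
  have [q [e2 q1 qe]] : exists q : R, [/\ 0 < q, q <= 1 & q * (2 * d + 5) <= e].
    have d5 : 0 < 2 * d + 5 by rewrite ltr_wpDl// mulr_ge0.
    exists (Num.min 1 (e / (2 * d + 5))); rewrite ge_min lexx lt_min ltr01 divr_gt0//.
    by split => //; rewrite -ler_pdivlMr// ge_min lexx orbT.
  have [N1 _ hN1] := (cvg_rnormP _ _).1 um _ e2.
  have [N _ hN] := near_infty_natSinv_lt (PosNum e2).
  have := (hu (maxn N1 N)).2; have := hN1 (maxn N1 N) (leq_maxl _ _).
  have /= := hN (maxn N1 N) (leq_maxr _ _).
  set n := maxn _ _ => kq mq hq.
  have k0 : 0 < n.+1%:R^-1 :> R by rewrite invr_gt0.
  move: (n.+1%:R^-1) k0 kq hq => k k0 kq hq.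
  have A : rnorm (x - u n) <= d + 1.
    rewrite -(@ler_pXn2r _ 2) ?nnegrE ?rnorm_ge0 ?addr_ge0//.
    by apply: le_trans (ltW hq) _; rewrite sqrrD; nra.
  have B : rnorm (x - m) <= rnorm (x - u n) + q.
    have -> : x - m = (x - u n) + (u n - m) by rewrite addrA subrK.
    by rewrite (le_trans (ler_rnormD _ _))// lerD2l rnormB ltW.
  have : rnorm (x - m) ^+ 2 <= (rnorm (x - u n) + q) ^+ 2.
    by rewrite ler_pXn2r ?nnegrE ?rnorm_ge0// addr_ge0 ?rnorm_ge0 ?ltW.
  have := rnorm_ge0 (x - u n).
  by move: A hq; set a := rnorm (x - u n); move=> A hq a0 C; nra.
by rewrite -(@ler_pXn2r _ 2) ?nnegrE ?rnorm_ge0.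
Qed.

Lemma riesz H (f : H -> R[i]) (M : R) : linear_for *%R f ->
  (forall x, rnorm (f x : R[i]^o) <= M * rnorm x) ->
  exists y, forall x, f x = hdot x y.
Proof.
move=> lf hM.
pose F : 'B(H, R[i]^o) := @mkbop R H R[i]^o f M lf hM.
pose N : set H := [set x | f x = 0].
have fZ a x : f (a *: x) = a * f x.
  have f0 : f 0 = 0 by exact: (linear0 F).
  by rewrite -[_ *: _]addr0 lf f0 addr0.
have fB x y : f (x - y) = f x - f y by exact: (linearB F).
have sN : subspace N.
  split=> [|a x y]; first exact: (linear0 F).
  by rewrite /N /= => fx fy; rewrite lf fx fy mulr0 addr0.
have cN : closed N.
  apply: (@preimage_closed _ _ F [set 0]); first by move=> z _; exact: bop_continuous.
  exact: (accessible_closed_set1 (hausdorff_accessible (@norm_hausdorff _ _))).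
have [f0|/existsNP[x0 fx0]] := pselect (forall x, f x = 0).
  by exists 0 => x; rewrite hdot0r; exact: f0.
have [m Nm mo] := projection_theorem sN cN x0.
pose u := x0 - m.
have Fu : f u != 0 by rewrite fB Nm subr0; exact/eqP.
have u0 : hdot u u != 0.
  apply: contra_neq Fu; rewrite hdotxx => h.
  have -> : u = 0 by apply: rnorm_eq0; apply/eqP; rewrite -sqrf_eq0; apply/eqP/complexI.
  exact: (linear0 F).
exists (Num.conj (f u / hdot u u) *: u) => x.
rewrite hdotZr conjCK.
have : hdot u (x - (f x / f u) *: u) = 0.
  by apply: mo; rewrite /N /= fB fZ divfK// subrr.
rewrite hdotC => /(congr1 Num.conj); rewrite conjCK rmorph0.
rewrite hdotBl hdotZl => /eqP; rewrite subr_eq0 => /eqP ->.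
by field; rewrite u0 Fu.
Qed.

(** Riesz representation in the second variable, after a conjugation. Adjoints come from it, and
    later the operator that represents a functional on the normal functionals. *)
Lemma bounded_form_operator H K (B : H -> K -> R[i]) (M : R) : 0 <= M ->
  (forall y, linear_for *%R (B ^~ y)) ->
  (forall x a y z, B x (a *: y + z) = Num.conj a * B x y + B x z) ->
  (forall x y, rnorm (B x y : R[i]^o) <= M * rnorm x * rnorm y) ->
  exists2 T : 'B(H, K), (forall x y, hdot (T x) y = B x y) &
    forall x, rnorm (T x) <= M * rnorm x.
Proof.
move=> M0 Bl Br hB.
have /choice[t ht] : forall x, exists t, forall y, B x y = hdot t y.
  move=> x; have [| |t ht] := @riesz K (fun y => Num.conj (B x y)) (M * rnorm x).
  - by move=> a y z; rewrite Br rmorphD rmorphM /= conjCK.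
  - by move=> y; rewrite rnormJ.
  by exists t => y; rewrite hdotC -ht conjCK.
have lt : linear t.
  by move=> a x z; apply: hdot_ext => y; rewrite hdotDl hdotZl -!ht Bl.
have bt x : rnorm (t x) <= M * rnorm x.
  have [->|t0] := eqVneq (rnorm (t x)) 0; first by rewrite mulr_ge0// rnorm_ge0.
  have tp : 0 < rnorm (t x) by rewrite lt_neqAle eq_sym t0 rnorm_ge0.
  have := hB x (t x); rewrite ht hdotxx rnormC ger0_norm ?exprn_ge0 ?rnorm_ge0//.
  by rewrite expr2 ler_pM2r.
by exists (mkbop lt bt).
Qed.

Lemma adjoint_exists H K (T : 'B(H, K)) : exists S : 'B(K, H), is_adjoint T S.
Proof.
have [M M0 hM] := bop_bounded T.
have [||x a y z|y x|S hS _] := @bounded_form_operator K H (fun y x => hdot y (T x)) M.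
- exact: ltW.
- by move=> x a y z; rewrite hdotDl hdotZl.
- by rewrite linearP hdotDr hdotZr.
- rewrite (le_trans (cauchy_schwarz _ _))// mulrC -mulrA [rnorm y * _]mulrC mulrA.
  by rewrite ler_wpM2r ?rnorm_ge0.
by exists S => x y; rewrite hdotC -hS -hdotC.
Qed.

Definition adj H K (T : 'B(H, K)) : 'B(K, H) := projT1 (cid (adjoint_exists T)).

Lemma adjP H K (T : 'B(H, K)) x y : hdot (T x) y = hdot x (adj T y).
Proof. exact: (projT2 (cid (adjoint_exists T))). Qed.

Lemma adjPr H K (T : 'B(H, K)) x y : hdot x (T y) = hdot (adj T x) y.
Proof. by rewrite hdotC adjP -hdotC. Qed.

Lemma adjE H K (T : 'B(H, K)) (S : 'B(K, H)) : is_adjoint T S -> S = adj T.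
Proof. by move=> h; apply: bopP => y; apply: hdot_extr => x; rewrite -h adjP. Qed.

Lemma is_adjoint_adj H K (T : 'B(H, K)) : is_adjoint T (adj T).
Proof. by move=> x y; exact: adjP. Qed.

Lemma adjK H K (T : 'B(H, K)) : adj (adj T) = T.
Proof. by apply/esym/adjE => x y; rewrite -adjPr. Qed.

Lemma adj_comp H1 H2 H3 (S : 'B(H2, H3)) (T : 'B(H1, H2)) :
  adj (bcomp S T) = bcomp (adj T) (adj S).
Proof. by apply/esym/adjE => x y; rewrite !bcompE !adjP. Qed.

Lemma adjD H K (S T : 'B(H, K)) : adj (S + T) = adj S + adj T.
Proof. by apply/esym/adjE => x y; rewrite !bopDE hdotDl hdotDr !adjP. Qed.

Lemma adjZ H K a (T : 'B(H, K)) : adj (a *: T) = Num.conj a *: adj T.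
Proof. by apply/esym/adjE => x y; rewrite !bopZE hdotZl hdotZr adjP conjCK. Qed.

Lemma adjN H K (T : 'B(H, K)) : adj (- T) = - adj T.
Proof. by rewrite -scaleN1r adjZ rmorphN1 scaleN1r. Qed.

Lemma adjB H K (S T : 'B(H, K)) : adj (S - T) = adj S - adj T.
Proof. by rewrite adjD adjN. Qed.

Lemma adj0 H K : adj (0 : 'B(H, K)) = 0.
Proof. by rewrite -(scale0r (0 : 'B(H, K))) adjZ rmorph0 scale0r. Qed.

Lemma adj1 H : adj (idop H) = idop H.
Proof. by apply/esym/adjE. Qed.

Lemma adj_sum H K I (r : seq I) (P : pred I) (F : I -> 'B(H, K)) :
  adj (\sum_(i <- r | P i) F i) = \sum_(i <- r | P i) adj (F i).
Proof. by elim/big_rec2 : _ => [|i y z _ <-]; rewrite ?adj0 ?adjD. Qed.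

Lemma adj_bound H K (T : 'B(H, K)) (M : R) : 0 <= M ->
  (forall x, rnorm (T x) <= M * rnorm x) -> forall y, rnorm (adj T y) <= M * rnorm y.
Proof.
move=> M0 h y; have [->|t0] := eqVneq (rnorm (adj T y)) 0.
  by rewrite mulr_ge0// rnorm_ge0.
have tp : 0 < rnorm (adj T y) by rewrite lt_neqAle eq_sym t0 rnorm_ge0.
rewrite -(ler_pM2r tp) -expr2.
have -> : rnorm (adj T y) ^+ 2 = rnorm (hdot (T (adj T y)) y : R[i]^o).
  by rewrite adjP hdotxx rnormC ger0_norm// exprn_ge0// rnorm_ge0.
rewrite (le_trans (cauchy_schwarz _ _))// -mulrA [rnorm y * _]mulrC mulrA.
by rewrite ler_wpM2r ?rnorm_ge0.
Qed.

Lemma rnorm_adj_comp H K (T : 'B(H, K)) x :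
  (rnorm (T x) ^+ 2)%:C = hdot (bcomp (adj T) T x) x.
Proof. by rewrite -hdotxx bcompE -adjPr. Qed.

Definition opn (V W : normedModType R[i]) (T : 'B(V, W)) : R :=
  sup [set rnorm (T x) | x in [set x | rnorm x <= 1]].

Lemma opn_ubound (V W : normedModType R[i]) (T : 'B(V, W)) :
  has_sup [set rnorm (T x) | x in [set x | rnorm x <= 1]].
Proof.
split; first by exists (rnorm (T 0)), 0 => //=; rewrite rnorm0.
have [M M0 hM] := bop_bounded T; exists M => _ [x /= x1 <-].
by rewrite (le_trans (hM x))// ler_piMr// ltW.
Qed.

Lemma opn_ge0 (V W : normedModType R[i]) (T : 'B(V, W)) : 0 <= opn T.
Proof.
apply: (@le_trans _ _ (rnorm (T 0))); first exact: rnorm_ge0.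
apply: sup_upper_bound; first exact: opn_ubound.
by exists 0 => //=; rewrite rnorm0.
Qed.

Lemma opnP (V W : normedModType R[i]) (T : 'B(V, W)) x :
  rnorm (T x) <= opn T * rnorm x.
Proof.
have [/rnorm_eq0 ->|x0] := eqVneq (rnorm x) 0; first by rewrite linear0 !rnorm0 mulr0.
have xp : 0 < rnorm x by rewrite lt_neqAle eq_sym x0 rnorm_ge0.
rewrite -ler_pdivrMr//; apply: sup_upper_bound; first exact: opn_ubound.
exists ((rnorm x)^-1%:C *: x) => /=.
  by rewrite rnormZr ger0_norm ?invr_ge0 ?rnorm_ge0// mulVf.
by rewrite linearZ /= rnormZr ger0_norm ?invr_ge0 ?rnorm_ge0// mulrC.
Qed.

Lemma opn_le (V W : normedModType R[i]) (T : 'B(V, W)) (M : R) : 0 <= M ->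
  (forall x, rnorm (T x) <= M * rnorm x) -> opn T <= M.
Proof.
move=> M0 h; apply: ge_sup; first exact: (opn_ubound T).1.
by move=> _ [x /= x1 <-]; rewrite (le_trans (h x))// ler_piMr.
Qed.

Lemma opn_eq0 (V W : normedModType R[i]) (T : 'B(V, W)) : opn T <= 0 -> T = 0.
Proof.
move=> h; apply: bopP => x; apply: rnorm_eq0; apply/eqP.
rewrite eq_le rnorm_ge0 andbT (le_trans (opnP T x))//.
by rewrite mulr_le0_ge0// rnorm_ge0.
Qed.

End HilbertTheory.

Section Conj.
Context {R : realType}.
Implicit Types a b : R[i].

Lemma conjM a b : Num.conj (a * b) = Num.conj a * Num.conj b.
Proof. exact: rmorphM. Qed.
Lemma conjD a b : Num.conj (a + b) = Num.conj a + Num.conj b.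
Proof. exact: rmorphD. Qed.
Lemma conjN a : Num.conj (- a) = - Num.conj a.
Proof. exact: rmorphN. Qed.
Lemma conjB a b : Num.conj (a - b) = Num.conj a - Num.conj b.
Proof. exact: rmorphB. Qed.
Lemma conjR (r : R) : Num.conj (r%:C) = r%:C.
Proof. by rewrite conj_Creal// complex_real. Qed.
Lemma conj0 : Num.conj 0 = 0 :> R[i].
Proof. exact: rmorph0. Qed.
Lemma conj1 : Num.conj 1 = 1 :> R[i].
Proof. exact: rmorph1. Qed.

Lemma conj_sum I (r : seq I) (P : pred I) (F : I -> R[i]) :
  Num.conj (\sum_(i <- r | P i) F i) = \sum_(i <- r | P i) Num.conj (F i).
Proof. exact: rmorph_sum. Qed.

Lemma ler_eps (x y : R) : (forall e : R, 0 < e -> x <= y + e) -> x <= y.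
Proof. by move=> h; apply/ler_addgt0Pr. Qed.

(** [M] is arbitrary, so an approximation argument may lose any factor that does not depend on
    [e]. *)
Lemma eps_eq0 (x M : R) : 0 <= x -> (forall e : R, 0 < e -> x <= M * e) -> x = 0.
Proof.
move=> x0 h; apply/eqP; rewrite eq_le x0 andbT; apply: ler_eps => e e0.
rewrite add0r; have M1 : 0 < `|M| + 1 by rewrite ltr_wpDl.
rewrite (le_trans (h (e / (`|M| + 1)) _)) ?divr_gt0//.
rewrite mulrCA ler_piMr ?(ltW e0)// ler_pdivrMr// mul1r.
by rewrite (le_trans (ler_norm _))// lerDl.
Qed.

Lemma eps_eq (V : normedModType R[i]) (x y : V) (M : R) :
  (forall e : R, 0 < e -> rnorm (x - y) <= M * e) -> x = y.
Proof.
move=> h; apply/eqP; rewrite -subr_eq0; apply/eqP/rnorm_eq0.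
exact: (eps_eq0 (rnorm_ge0 _) h).
Qed.

Lemma cauchy_complex (u : nat -> R[i]^o) :
  (forall e : R, 0 < e ->
     exists N, forall m n, (N <= m)%N -> (N <= n)%N -> rnorm (u m - u n) < e) ->
  exists l : R[i]^o, u @ \oo --> l.
Proof.
move=> h.
have [a ha] : exists a : R, (fun n => complex.Re (u n)) @ \oo --> a.
  apply/cvg_ex; apply: cauchy_cvg; apply/cauchyP => e e0.
  have [N hN] := h e e0; exists (complex.Re (u N)); exists N => // n /= Nn.
  rewrite /ball/= -raddfB/=; apply: le_lt_trans (hN N n _ Nn) => //.
  by rewrite /rnorm normc_def /= -sqrtr_sqr ler_wsqrtr// lerDl sqr_ge0.
have [b hb] : exists a : R, (fun n => complex.Im (u n)) @ \oo --> a.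
  apply/cvg_ex; apply: cauchy_cvg; apply/cauchyP => e e0.
  have [N hN] := h e e0; exists (complex.Im (u N)); exists N => // n /= Nn.
  rewrite /ball/= -raddfB/=; apply: le_lt_trans (hN N n _ Nn) => //.
  by rewrite /rnorm normc_def /= -sqrtr_sqr ler_wsqrtr// lerDr sqr_ge0.
exists (a +i* b)%C; apply/cvg_rnormP => e e0.
have e2 : 0 < e / 2 by rewrite divr_gt0.
have /cvgrPdist_lt/(_ _ e2) A := ha; have /cvgrPdist_lt/(_ _ e2) B := hb.
apply: filterS2 A B => n A B; rewrite [(_ - _ : R[i]^o)]complexE.
apply: le_lt_trans (ler_rnormD _ _) _.
by rewrite rnormM rnormi mul1r !rnormC !raddfB /= [e]splitr ltrD.
Qed.

Lemma eps_split (a e : R) : 0 <= a -> 0 < e -> exists2 d, 0 < d & a * d <= e.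
Proof.
move=> a0 e0; exists (e / (a + 1)); first by rewrite divr_gt0// ltr_wpDl.
by rewrite mulrCA ler_piMr ?(ltW e0)// ler_pdivrMr ?ltr_wpDl// mul1r lerDl.
Qed.

End Conj.

(** * Completions, l2-sums and amplifications *)

Section Completion.
Context {R : realType} {V : lmodType R[i]}.

Record psdForm := PsdForm {
  psd_fun :> V -> V -> R[i];
  psd_linear : forall v, linear_for *%R (psd_fun ^~ v);
  psd_herm : forall u v, psd_fun v u = Num.conj (psd_fun u v);
  psd_ge0 : forall u, 0 <= complex.Re (psd_fun u u) }.

Variable N : psdForm.
Implicit Types u v w : V.

Definition seminorm u : R := Num.sqrt (complex.Re (N u u)).

Lemma psdDl u v w : N (u + v) w = N u w + N v w.
Proof. by have := psd_linear N w 1 u v; rewrite /= scale1r mul1r. Qed.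

Lemma psd0l w : N 0 w = 0.
Proof. by apply: (addrI (N 0 w)); rewrite -psdDl !addr0. Qed.

Lemma psdZl a u w : N (a *: u) w = a * N u w.
Proof. by have := psd_linear N w a u 0; rewrite /= psd0l !addr0. Qed.

Lemma psdNl u w : N (- u) w = - N u w.
Proof. by rewrite -scaleN1r psdZl mulN1r. Qed.

Lemma psdBl u v w : N (u - v) w = N u w - N v w.
Proof. by rewrite psdDl psdNl. Qed.

Lemma psdDr u v w : N w (u + v) = N w u + N w v.
Proof. by rewrite psd_herm psdDl conjD -!psd_herm. Qed.

Lemma psdZr a u w : N w (a *: u) = Num.conj a * N w u.
Proof. by rewrite psd_herm psdZl conjM -!psd_herm. Qed.

Lemma psdNr u w : N w (- u) = - N w u.
Proof. by rewrite psd_herm psdNl conjN -!psd_herm. Qed.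

Lemma psdBr u v w : N w (u - v) = N w u - N w v.
Proof. by rewrite psdDr psdNr. Qed.

Lemma seminorm_ge0 u : 0 <= seminorm u. Proof. exact: sqrtr_ge0. Qed.

Lemma seminormE u : N u u = (seminorm u ^+ 2)%:C.
Proof.
rewrite sqr_sqrtr ?psd_ge0//; have := psd_herm N u u.
case: (N u u) => a b /eqP; rewrite eq_complex /= => /andP[_ /eqP bE].
by congr (_ +i* _); lra.
Qed.

(** The form may be degenerate, so the minimizing multiple of [v] need not exist. If
    [seminorm v = 0], a large real factor contradicts positivity unless [N u v = 0]. *)
Lemma psd_cs u v : rnorm (N u v : R[i]^o) <= seminorm u * seminorm v.
Proof.
set z := N u v; set a := rnorm (z : R[i]^o).
have h (t : R) : 0 <= seminorm u ^+ 2 - 2 * t * a ^+ 2 + t ^+ 2 * a ^+ 2 * seminorm v ^+ 2.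
  have := psd_ge0 N (u - (t%:C * z) *: v).
  rewrite psdBl !psdBr !psdZl !psdZr !seminormE (psd_herm N u v) -/z.
  rewrite !conjM conjR.
  have -> : t%:C * Num.conj z * z = (t * a ^+ 2)%:C.
    by rewrite -mulrA [Num.conj z * z]mulrC sqr_rnorm -rmorphM.
  have -> : t%:C * z * Num.conj z = (t * a ^+ 2)%:C.
    by rewrite -mulrA sqr_rnorm -rmorphM.
  have -> : t%:C * z * (t%:C * Num.conj z * ((seminorm v) ^+ 2)%:C) =
     (t ^+ 2 * a ^+ 2 * seminorm v ^+ 2)%:C.
    have -> : t%:C * z * (t%:C * Num.conj z * ((seminorm v) ^+ 2)%:C) =
       t%:C * t%:C * (z * Num.conj z) * ((seminorm v) ^+ 2)%:C by ring.
    by rewrite sqr_rnorm -!rmorphM expr2.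
  by rewrite -!rmorphB /= => H; apply: le_trans H _; rewrite le_eqVlt; apply/orP; left; apply/eqP; ring.
have s0 := seminorm_ge0 u; have t0 := seminorm_ge0 v.
have a0 : 0 <= a by exact: rnorm_ge0.
rewrite -(@ler_pXn2r _ 2) ?nnegrE ?mulr_ge0// exprMn.
have [v0|v0] := eqVneq (seminorm v) 0.
  have [->|an0] := eqVneq a 0; first by rewrite expr0n /= mulr_ge0 ?exprn_ge0.
  have := h ((seminorm u ^+ 2 + 1) / a ^+ 2); rewrite v0 expr0n /= !mulr0 addr0 -mulrA divfK ?expf_neq0//.
  have := exprn_ge0 2 s0; move: (seminorm u ^+ 2) => q; lra.
have v2 : seminorm v ^+ 2 != 0 by rewrite expf_neq0.
have := h (seminorm v ^- 2).
set p := seminorm u ^+ 2; set q := seminorm v ^+ 2 in v2 *.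
have -> : p - 2 / q * a ^+ 2 + q^-1 ^+ 2 * a ^+ 2 * q = (p * q - a ^+ 2) / q by field.
rewrite pmulr_lge0 ?invr_gt0 ?lt_neqAle ?[0 == _]eq_sym ?v2 ?exprn_ge0//.
by rewrite subr_ge0.
Qed.

(* The completion consists of the functionals on [V] that are uniform limits,
   relatively to the seminorm, of the functionals [N u]. *)
Definition gns_pred : {pred V -> R[i]^o} := [pred l | `[< forall e : R, 0 < e ->
  exists u, forall v, rnorm (l v - N u v : R[i]^o) <= e * seminorm v >]].

Lemma gns_submod : submod_closed gns_pred.
Proof.
split=> [|a f g /asboolP hf /asboolP hg]; apply/asboolP => e e0.
  exists 0 => v; rewrite psd0l subr0 /= -[(0 : V -> R[i]^o) v]/0 rnorm0.
  by rewrite mulr_ge0 ?seminorm_ge0// ltW.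
have na := rnorm_ge0 (a : R[i]^o).
have e2 : 0 < e / 2 by rewrite divr_gt0.
have [d d0 hd] := eps_split na e2.
have [u hu] := hf _ d0; have [w hw] := hg _ e2.
exists (a *: u + w) => v; rewrite psdDl psdZl.
have -> : (a *: f + g) v - (a * N u v + N w v) = a *: (f v - N u v) + (g v - N w v).
  by rewrite !fctE scalerBr opprD addrACA.
rewrite (le_trans (ler_rnormD _ _))// rnormZ.
have H1 : rnorm (a : R[i]^o) * rnorm (f v - N u v : R[i]^o) <= e / 2 * seminorm v.
  by rewrite (le_trans (ler_wpM2l na (hu v)))// mulrA ler_wpM2r ?seminorm_ge0.
rewrite (le_trans (lerD H1 (hw v)))// -mulrDl ler_wpM2r ?seminorm_ge0//.
by rewrite -splitr.
Qed.

HB.instance Definition _ := GRing.isSubmodClosed.Build _ _ gns_pred gns_submod.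

Record gns := Gns { gns_fun :> V -> R[i]^o; gns_proof : gns_fun \in gns_pred }.

HB.instance Definition _ := [isSub for gns_fun].
HB.instance Definition _ := [Choice of gns by <:].
HB.instance Definition _ := [SubChoice_isSubLmodule of gns by <:].

Implicit Types l : gns.

Lemma gns_approx l (e : R) : 0 < e ->
  exists u, forall v, rnorm (l v - N u v : R[i]^o) <= e * seminorm v.
Proof. by case: l => f /= /asboolP; exact. Qed.

Lemma gns_ext l l' : l =1 l' -> l = l'.
Proof. by move=> h; apply: val_inj; apply/funext. Qed.

Lemma gns_embed_proof u : (N u : V -> R[i]^o) \in gns_pred.
Proof.
apply/asboolP => e e0; exists u => v.
by rewrite subrr rnorm0 mulr_ge0 ?seminorm_ge0// ltW.
Qed.

Definition gns_embed u : gns := Gns (gns_embed_proof u).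

Lemma gns_embed_linear : linear gns_embed.
Proof. by move=> a u w; apply: gns_ext => v /=; rewrite psdDl psdZl. Qed.

HB.instance Definition _ := GRing.isLinear.Build _ _ _ _ gns_embed gns_embed_linear.

Definition gns_bnd l : set R := [set c | 0 <= c /\ forall v, rnorm (l v) <= c * seminorm v].

Definition gns_nrm l : R := inf (gns_bnd l).

Lemma gns_bnd_has_inf l : has_inf (gns_bnd l).
Proof.
split; last by exists 0 => c [].
have [u hu] := gns_approx l (@ltr01 R).
exists (seminorm u + 1); split=> [|v]; first by rewrite addr_ge0 ?seminorm_ge0.
have -> : l v = N u v + (l v - N u v) by rewrite addrC subrK.
by rewrite (le_trans (ler_rnormD _ _))// mulrDl lerD ?psd_cs.
Qed.

Lemma gns_nrm_ge0 l : 0 <= gns_nrm l.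
Proof. by apply: lb_le_inf; [exact: (gns_bnd_has_inf l).1|move=> c []]. Qed.

Lemma gns_nrmP l v : rnorm (l v) <= gns_nrm l * seminorm v.
Proof.
apply: ler_eps => e e0.
have [d d0 hd] := eps_split (seminorm_ge0 v) e0.
have [c [c0 hc] cd] := inf_adherent d0 (gns_bnd_has_inf l).
move: cd; rewrite -[inf _]/(gns_nrm l) => cd.
rewrite (le_trans (hc v))// (le_trans (ler_wpM2r (seminorm_ge0 v) (ltW cd)))// mulrDl lerD2l.
by rewrite mulrC.
Qed.

Lemma gns_nrm_le l c : 0 <= c -> (forall v, rnorm (l v) <= c * seminorm v) -> gns_nrm l <= c.
Proof. by move=> c0 h; apply: inf_lbound; [exact: (gns_bnd_has_inf l).2|]. Qed.

Lemma gns_nrmD l l' : gns_nrm (l + l') <= gns_nrm l + gns_nrm l'.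
Proof.
apply: gns_nrm_le => [|v]; first by rewrite addr_ge0 ?gns_nrm_ge0.
by rewrite (le_trans (ler_rnormD _ _))// mulrDl lerD ?gns_nrmP.
Qed.

Lemma gns_nrm_eq0 l : gns_nrm l = 0 -> l = 0.
Proof.
move=> h; apply: gns_ext => v; apply: rnorm_eq0; apply/eqP.
by rewrite eq_le rnorm_ge0 andbT (le_trans (gns_nrmP l v))// h mul0r.
Qed.

Lemma gns_nrmZ_le a l : gns_nrm (a *: l) <= rnorm (a : R[i]^o) * gns_nrm l.
Proof.
apply: gns_nrm_le => [|v]; first by rewrite mulr_ge0 ?rnorm_ge0 ?gns_nrm_ge0.
by rewrite rnormZ -mulrA ler_wpM2l ?rnorm_ge0// gns_nrmP.
Qed.

Lemma gns_nrmZ a l : gns_nrm (a *: l) = rnorm (a : R[i]^o) * gns_nrm l.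
Proof.
have [->|a0] := eqVneq a 0.
  rewrite scale0r rnorm0 mul0r; apply/eqP; rewrite eq_le gns_nrm_ge0 andbT.
  by apply: gns_nrm_le => // v; rewrite mul0r rnorm0.
apply/eqP; rewrite eq_le gns_nrmZ_le /=.
have := gns_nrmZ_le a^-1 (a *: l); rewrite scalerA mulVf// scale1r.
have ap : 0 < rnorm (a : R[i]^o).
  by rewrite lt_neqAle rnorm_ge0 andbT eq_sym; apply: contraNneq a0 => /(@rnorm_eq0 _ R[i]^o) ->.
have -> : rnorm (a^-1 : R[i]^o) = (rnorm (a : R[i]^o))^-1.
  apply: (mulfI (lt0r_neq0 ap)); rewrite -rnormM mulfV// mulfV ?lt0r_neq0//.
  by rewrite -[1]/(1%:C) rnormC normr1.
by rewrite ler_pdivlMl.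
Qed.

Lemma gns_nrmN l : gns_nrm (- l) = gns_nrm l.
Proof. by rewrite -scaleN1r gns_nrmZ rnormN -[1]/(1%:C) rnormC normr1 mul1r. Qed.

Lemma gns_nrm_embed u : gns_nrm (gns_embed u) = seminorm u.
Proof.
apply/eqP; rewrite eq_le; apply/andP; split.
  by apply: gns_nrm_le => [|v]; [exact: seminorm_ge0|exact: psd_cs].
have [->|u0] := eqVneq (seminorm u) 0; first exact: gns_nrm_ge0.
have up : 0 < seminorm u by rewrite lt_neqAle eq_sym u0 seminorm_ge0.
have := gns_nrmP (gns_embed u) u; rewrite /= seminormE rnormC.
by rewrite ger0_norm ?exprn_ge0 ?seminorm_ge0// expr2 ler_pM2r.
Qed.

Lemma gns_dense l (e : R) : 0 < e -> exists u, gns_nrm (l - gns_embed u) <= e.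
Proof.
move=> e0; have [u hu] := gns_approx l e0; exists u.
by apply: gns_nrm_le; [exact: ltW|exact: hu].
Qed.

(** Since <l, u> should be [l u], the inner product <l, l'> is the limit of [l (u n)] along embedded
    vectors [u n] that converge to [l']. The inequality for all [u] determines the limit. *)
Lemma gns_ip_exists l l' : exists z : R[i]^o, forall u,
  rnorm (z - l u) <= gns_nrm l * gns_nrm (l' - gns_embed u).
Proof.
have /choice[u hu] : forall n : nat, exists u, gns_nrm (l' - gns_embed u) <= n.+1%:R^-1.
  by move=> n; apply: gns_dense; rewrite invr_gt0.
(* An element of the completion is a mere function; its additivity is inherited from the
   approximants [N x]. *)
have lB v w : l (v - w) = l v - l w.
  apply: (@eps_eq _ R[i]^o _ _ (seminorm (v - w) + seminorm v + seminorm w)) => e e0.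
  have [x hx] := gns_approx l e0.
  have -> : l (v - w) - (l v - l w) = (l (v - w) - N x (v - w)) - ((l v - N x v) - (l w - N x w)).
    have aux (a b c d f : R[i]) : a - (b - c) = a - (d - f) - (b - d - (c - f)) by ring.
    by rewrite psdBr; exact: aux.
  rewrite (le_trans (ler_rnormB _ _))// (le_trans (lerD (hx _) (ler_rnormB _ _)))//.
  rewrite !mulrDl -addrA lerD// ?[e * _]mulrC// lerD// [leRHS]mulrC; exact: hx.
have lest v w : rnorm (l v - l w) <= gns_nrm l * (gns_nrm (l' - gns_embed v) + gns_nrm (l' - gns_embed w)).
  rewrite -lB (le_trans (gns_nrmP _ _))// ler_wpM2l ?gns_nrm_ge0//.
  rewrite -gns_nrm_embed linearB /=.
  have -> : gns_embed v - gns_embed w = (l' - gns_embed w) - (l' - gns_embed v).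
    by rewrite opprB [RHS]addrC addrA subrK.
  by rewrite (le_trans (gns_nrmD _ _))// gns_nrmN addrC.
have [z hz] : exists z : R[i]^o, (fun n => l (u n) : R[i]^o) @ \oo --> z.
  apply: cauchy_complex => e e0.
  have e2 : 0 < e / 3 by rewrite divr_gt0.
  have [d d0 hd] := eps_split (gns_nrm_ge0 l) e2.
  have [n _ hn] := near_infty_natSinv_lt (PosNum d0).
  exists n => i j ni nj; apply: le_lt_trans (lest _ _) _.
  have a1 := le_trans (hu i) (ltW (hn _ ni)); have a2 := le_trans (hu j) (ltW (hn _ nj)).
  rewrite mulrDr; have := ler_wpM2l (gns_nrm_ge0 l) a1.
  have := ler_wpM2l (gns_nrm_ge0 l) a2; move: hd => /=; lra.
exists z => v; apply: ler_eps => e e0.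
have e2 : 0 < e / 2 by rewrite divr_gt0.
have [d d0 hd] := eps_split (gns_nrm_ge0 l) e2.
have [n _ hn] := near_infty_natSinv_lt (PosNum d0).
have [m _ hm] := (cvg_rnormP _ _).1 hz _ e2.
have := hm (maxn n m) (leq_maxr _ _); have /= := hn (maxn n m) (leq_maxl _ _).
set k := maxn n m => h1 h2.
have -> : z - l v = (z - l (u k)) + (l (u k) - l v) by rewrite addrA subrK.
rewrite (le_trans (ler_rnormD _ _))// (le_trans (lerD (ltW h2) (lest _ _)))//.
have := ler_wpM2l (gns_nrm_ge0 l) (le_trans (hu k) (ltW h1)).
by rewrite mulrDr; move: hd; lra.
Qed.

Definition gns_ip l l' : R[i] := projT1 (cid (gns_ip_exists l l')).

Lemma gns_ipP l l' u :
  rnorm (gns_ip l l' - l u : R[i]^o) <= gns_nrm l * gns_nrm (l' - gns_embed u).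
Proof. exact: (projT2 (cid (gns_ip_exists l l')) u). Qed.

Lemma gns_ip_linear l' : linear_for *%R (gns_ip ^~ l').
Proof.
move=> a l1 l2; apply: (@eps_eq _ R[i]^o _ _
  (gns_nrm (a *: l1 + l2) + rnorm (a : R[i]^o) * gns_nrm l1 + gns_nrm l2)) => e e0.
have [u hu] := gns_dense l' e0.
have h l : rnorm (gns_ip l l' - l u : R[i]^o) <= gns_nrm l * e.
  by rewrite (le_trans (gns_ipP l l' u))// ler_wpM2l ?gns_nrm_ge0.
have -> : gns_ip (a *: l1 + l2) l' - (a * gns_ip l1 l' + gns_ip l2 l') =
  (gns_ip (a *: l1 + l2) l' - (a *: l1 + l2) u) -
  (a * (gns_ip l1 l' - l1 u) + (gns_ip l2 l' - l2 u)).
  by rewrite -[(a *: l1 + l2) u]/(a * l1 u + l2 u); ring.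
rewrite (le_trans (ler_rnormB _ _))// !mulrDl -addrA lerD//.
rewrite (le_trans (ler_rnormD _ _))// lerD// rnormM -mulrA.
by rewrite ler_wpM2l ?rnorm_ge0.
Qed.

Lemma gns_ip_approx l l' u v : rnorm (gns_ip l l' - N u v : R[i]^o) <=
  gns_nrm l * gns_nrm (l' - gns_embed v) + gns_nrm (l - gns_embed u) * seminorm v.
Proof.
have -> : gns_ip l l' - N u v = (gns_ip l l' - l v) + (l v - N u v) by rewrite addrA subrK.
by rewrite (le_trans (ler_rnormD _ _))// lerD ?gns_ipP// (gns_nrmP (l - gns_embed u)).
Qed.

Lemma seminorm_le_gns l u (e : R) : gns_nrm (l - gns_embed u) <= e -> seminorm u <= gns_nrm l + e.
Proof.
move=> h; rewrite -gns_nrm_embed.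
have -> : gns_embed u = l - (l - gns_embed u) by rewrite subKr.
by rewrite (le_trans (gns_nrmD _ _))// gns_nrmN lerD2l.
Qed.

Lemma gns_ip_herm l l' : gns_ip l l' = Num.conj (gns_ip l' l).
Proof.
apply: (@eps_eq _ R[i]^o _ _ (2 * (gns_nrm l + gns_nrm l' + 1) + 2 * (gns_nrm l + gns_nrm l' + 1))) => e0 e00.
pose e := Num.min e0 1; have e0' : 0 < e by rewrite lt_min e00 ltr01.
have [ee e1] : e <= e0 /\ e <= 1 by rewrite !ge_min !lexx orbT.
have [u hu] := gns_dense l e0'; have [v hv] := gns_dense l' e0'.
have -> : gns_ip l l' - Num.conj (gns_ip l' l) =
  (gns_ip l l' - N u v) - Num.conj (gns_ip l' l - N v u).
  by rewrite conjB -(psd_herm N v u); ring.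
rewrite (le_trans (ler_rnormB _ _))// rnormJ.
have A k k' w x : gns_nrm (k - gns_embed w) <= e -> gns_nrm (k' - gns_embed x) <= e ->
   rnorm (gns_ip k k' - N w x : R[i]^o) <= 2 * (gns_nrm k + gns_nrm k' + 1) * e0.
  move=> kw kx; have kk := gns_nrm_ge0 k; have kk' := gns_nrm_ge0 k'.
  apply: le_trans (gns_ip_approx _ _ w x) _.
  have B := seminorm_le_gns kx.
  have : gns_nrm k * gns_nrm (k' - gns_embed x) <= gns_nrm k * e by rewrite ler_wpM2l.
  have : gns_nrm (k - gns_embed w) * seminorm x <= e * (gns_nrm k' + e).
    by rewrite ler_pM ?gns_nrm_ge0 ?seminorm_ge0.
  have : e * (gns_nrm k' + e) <= e0 * (gns_nrm k' + 1).
    by rewrite ler_pM ?addr_ge0 ?(ltW e0')// lerD2l.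
  have : gns_nrm k * e <= gns_nrm k * e0 by rewrite ler_wpM2l.
  have : 0 <= gns_nrm k * e0 by rewrite mulr_ge0// ltW.
  have : 0 <= gns_nrm k' * e0 by rewrite mulr_ge0// ltW.
  by rewrite !mulrDl !mulrDr; move: (ltW e00); lra.
rewrite mulrDl lerD ?A// [gns_nrm l + _]addrC; exact: A.
Qed.

Lemma gns_ip_bilinear : bilinear_for *%R (Num.conj \; *%R) gns_ip.
Proof.
split=> [l|l a x y /=]; first exact: gns_ip_linear.
by rewrite gns_ip_herm gns_ip_linear conjD conjM -!gns_ip_herm.
Qed.

Lemma gns_ip_hermitian l l' : gns_ip l l' = (-1) ^+ false * Num.conj (gns_ip l' l).
Proof. by rewrite expr0 mul1r -gns_ip_herm. Qed.

Lemma gns_ip_norm l : gns_ip l l = (gns_nrm l ^+ 2)%:C.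
Proof.
apply: (@eps_eq _ R[i]^o _ _ (4 * (gns_nrm l + 1))) => e0 e00.
pose e := Num.min e0 1; have e0' : 0 < e by rewrite lt_min e00 ltr01.
have [ee e1] : e <= e0 /\ e <= 1 by rewrite !ge_min !lexx orbT.
have [u hu] := gns_dense l e0'.
have -> : gns_ip l l - (gns_nrm l ^+ 2)%:C =
  (gns_ip l l - N u u) + (seminorm u ^+ 2 - gns_nrm l ^+ 2)%:C.
  by rewrite rmorphB seminormE /= addrA subrK.
rewrite (le_trans (ler_rnormD _ _))// rnormC.
have l0 := gns_nrm_ge0 l; have u0 := seminorm_ge0 u.
have B := seminorm_le_gns hu.
have C : gns_nrm l <= seminorm u + e.
  rewrite -gns_nrm_embed -[l in leLHS](subrK (gns_embed u)) addrC.
  by rewrite (le_trans (gns_nrmD _ _))// lerD2l.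
have D : `|seminorm u ^+ 2 - gns_nrm l ^+ 2| <= e * (2 * gns_nrm l + 1).
  rewrite subr_sqr normrM (ger0_norm (addr_ge0 u0 l0)) ler_pM ?addr_ge0//.
    by rewrite ler_norml; lra.
  by lra.
have := gns_ip_approx l l u u.
have E : gns_nrm l * gns_nrm (l - gns_embed u) <= gns_nrm l * e by rewrite ler_wpM2l.
have F : gns_nrm (l - gns_embed u) * seminorm u <= e * (gns_nrm l + 1).
  by rewrite ler_pM ?gns_nrm_ge0// (le_trans B)// lerD2l.
have G : gns_nrm l * e <= gns_nrm l * e0 by rewrite ler_wpM2l.
move: E F G D ee; set x := rnorm _; set y := `|_|; lra.
Qed.

Lemma gns_normD_subproof l l' : (gns_nrm (l + l'))%:C <= (gns_nrm l)%:C + (gns_nrm l')%:C.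
Proof. by rewrite -rmorphD/= lecR gns_nrmD. Qed.

Lemma gns_normZ_subproof (a : R[i]) l : (gns_nrm (a *: l))%:C = `|a| * (gns_nrm l)%:C.
Proof. by rewrite gns_nrmZ rmorphM /= -(normE (a : R[i]^o)). Qed.

Lemma gns_norm_eq0_subproof l : (gns_nrm l)%:C = 0 -> l = 0.
Proof. by move=> /complexI; exact: gns_nrm_eq0. Qed.

HB.instance Definition _ := Lmodule_isNormed.Build R[i] gns
  gns_normD_subproof gns_normZ_subproof gns_norm_eq0_subproof.

Lemma gns_rnormE l : rnorm l = gns_nrm l.
Proof. by apply: complexI; rewrite -normE. Qed.

Lemma gns_complete (F : set_system gns) : ProperFilter F -> cauchy F -> cvg F.
Proof.
move=> FF /(cauchyP F).1 cF.
have /choice[x hx] : forall n : nat, exists x : gns, \forall y \near F, gns_nrm (x - y) < n.+1%:R^-1.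
  move=> n; have e0 : 0 < (n.+1%:R^-1)%:C :> R[i] by rewrite ltcR invr_gt0.
  have [x hx] := cF _ e0; exists x; apply: filterS hx => y.
  by rewrite -ball_normE /ball_ /= normE ltcR gns_rnormE.
have xx i j : gns_nrm (x i - x j) <= i.+1%:R^-1 + j.+1%:R^-1.
  have [y [hi hj]] := filter_ex (filterI (hx i) (hx j)).
  have -> : x i - x j = (x i - y) - (x j - y) by rewrite opprB addrA subrK.
  by rewrite (le_trans (gns_nrmD _ _))// gns_nrmN lerD// ltW.
have /choice[f hf] : forall v, exists z : R[i]^o, (fun n => x n v : R[i]^o) @ \oo --> z.
  move=> v; apply: cauchy_complex => e e0.
  have e2 : 0 < e / 2 by rewrite divr_gt0.
  have [d d0 hd] := eps_split (seminorm_ge0 v) e2.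
  have d2 : 0 < d / 2 by rewrite divr_gt0.
  have [n _ hn] := near_infty_natSinv_lt (PosNum d2).
  exists n => i j ni nj; rewrite -[x i v - x j v]/((x i - x j) v).
  apply: le_lt_trans (gns_nrmP _ _) _.
  apply: le_lt_trans (ler_wpM2r (seminorm_ge0 v) (xx i j)) _.
  have := hn _ ni; have := hn _ nj; rewrite /= => a b.
  have : (i.+1%:R^-1 + j.+1%:R^-1) * seminorm v <= d * seminorm v.
    by rewrite ler_wpM2r ?seminorm_ge0// [d]splitr lerD// ltW.
  by move=> h; apply: le_lt_trans h _; rewrite mulrC (le_lt_trans hd)// ltr_pdivrMr// ltr_pMr// ltr1n.
have fx n v : rnorm (f v - x n v : R[i]^o) <= 2 * n.+1%:R^-1 * seminorm v.
  apply: ler_eps => e e0; have e2 : 0 < e / 2 by rewrite divr_gt0.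
  have [m _ hm] := (cvg_rnormP _ _).1 (hf v) _ e2.
  have := hm (maxn n m) (leq_maxr _ _); set k := maxn n m => h.
  have -> : f v - x n v = (f v - x k v) + (x k - x n) v.
    by rewrite [(x k - x n) v]/(x k v - x n v) addrA subrK.
  rewrite (le_trans (ler_rnormD _ _))// addrC lerD ?(le_trans (ltW h))//; last first.
    by rewrite ler_pdivrMr// ler_pMr// ler1n.
  rewrite (le_trans (gns_nrmP _ _))// ler_wpM2r ?seminorm_ge0// (le_trans (xx _ _))//.
  rewrite mulr_natl mulr2n lerD2r lef_pV2 ?posrE// ler_nat ltnS leq_maxl//.
have fP : (f : V -> R[i]^o) \in gns_pred.
  apply/asboolP => e e0; have e2 : 0 < e / 3 by rewrite divr_gt0.
  have [n _ hn] := near_infty_natSinv_lt (PosNum e2).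
  have [u hu] := gns_approx (x n) e2; exists u => v.
  have -> : f v - N u v = (f v - x n v) + (x n v - N u v) by rewrite addrA subrK.
  rewrite (le_trans (ler_rnormD _ _))// (le_trans (lerD (fx n v) (hu v)))// -mulrDl.
  rewrite ler_wpM2r ?seminorm_ge0//.
  by have := hn n (leqnn _); rewrite /=; move: (n.+1%:R^-1 : R) => q; lra.
apply/cvg_ex; exists (Gns fP); apply/(@cvg_rnormP R gns _ F FF idfun) => e e0.
have e2 : 0 < e / 4 by rewrite divr_gt0.
have [n _ hn] := near_infty_natSinv_lt (PosNum e2).
have := hn n (leqnn _) => /= hn'.
apply: filterS (hx n) => y hy; rewrite gns_rnormE.
have -> : Gns fP - y = (Gns fP - x n) + (x n - y) by rewrite addrA subrK.
apply: le_lt_trans (gns_nrmD _ _) _.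
have : gns_nrm (Gns fP - x n) <= 2 * n.+1%:R^-1.
  by apply: gns_nrm_le => [|v]; [rewrite mulr_ge0// invr_ge0|exact: fx].
by move: (n.+1%:R^-1 : R) hn' hy => q; lra.
Qed.

HB.instance Definition _ := Uniform_isComplete.Build gns gns_complete.

HB.instance Definition _ := bilinear_isBilinear.Build R[i] gns gns R[i] *%R
  (Num.conj \; *%R) gns_ip gns_ip_bilinear.

HB.instance Definition _ := isHermitianSesquilinear.Build R[i] gns false Num.conj gns_ip
  gns_ip_hermitian.

Lemma gns_ip_gt0 l : l != 0 -> 0 < gns_ip l l.
Proof.
rewrite gns_ip_norm ltcR exprn_even_gt0//= => l0.
by apply: contra_neq l0; exact: gns_nrm_eq0.
Qed.

HB.instance Definition _ := isDotProduct.Build R[i] gns gns_ip gns_ip_gt0.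

Lemma gns_hdot_norm l : `|l| ^+ 2 = gns_ip l l.
Proof. by rewrite gns_ip_norm normE gns_rnormE rmorphXn. Qed.

HB.instance Definition _ := isHilbert.Build R gns gns_hdot_norm.

Lemma hdot_gns u v : hdot (gns_embed u : gns) (gns_embed v : gns) = N u v.
Proof.
apply/eqP; rewrite -subr_eq0; apply/eqP/(@rnorm_eq0 _ R[i]^o)/eqP.
rewrite eq_le rnorm_ge0 andbT (le_trans (gns_ipP _ _ v))// subrr.
by rewrite -[gns_nrm 0]gns_rnormE rnorm0 mulr0.
Qed.

Lemma rnorm_gns u : rnorm (gns_embed u : gns) = seminorm u.
Proof. by rewrite gns_rnormE gns_nrm_embed. Qed.

Lemma gns_rdense (x : gns) (e : R) : 0 < e -> exists u, rnorm (x - gns_embed u) <= e.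
Proof. by move=> /(gns_dense x)[u hu]; exists u; rewrite gns_rnormE. Qed.

Lemma gns_extend (F : hilbertType R) (f : V -> F) (M : R) : linear f -> 0 <= M ->
  (forall u, rnorm (f u) <= M * seminorm u) ->
  exists2 T : 'B(gns, F), (forall u, T (gns_embed u) = f u) &
    forall x, rnorm (T x) <= M * rnorm x.
Proof.
move=> lf M0 hM.
pose fL : {linear V -> F} := HB.pack f (GRing.isLinear.Build _ _ _ _ f lf).
have fB u v : f (u - v) = f u - f v by exact: (linearB fL).
(* The estimate for all [u] at once determines [t x], so linearity and boundedness of [t] follow
   from it without returning to the chosen sequences. *)
have /choice[t ht] : forall x : gns, exists y : F, forall u,
    rnorm (y - f u) <= M * rnorm (x - gns_embed u).
  move=> x.
  have /choice[u hu] : forall n : nat, exists u, rnorm (x - gns_embed u) <= n.+1%:R^-1.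
    by move=> n; apply: gns_rdense; rewrite invr_gt0.
  have est v w : rnorm (f v - f w) <= M * (rnorm (x - gns_embed v) + rnorm (x - gns_embed w)).
    rewrite -fB (le_trans (hM _))// ler_wpM2l// -rnorm_gns linearB /=.
    have -> : gns_embed v - gns_embed w = (x - gns_embed w) - (x - gns_embed v).
      by rewrite opprB [RHS]addrC addrA subrK.
    by rewrite (le_trans (ler_rnormB _ _))// addrC.
  have [y hy] : exists y : F, (fun n => f (u n)) @ \oo --> y.
    apply: cauchy_seq_cvg => e e0.
    have e2 : 0 < e / 3 by rewrite divr_gt0.
    have [d d0 hd] := eps_split M0 e2.
    have [n _ hn] := near_infty_natSinv_lt (PosNum d0).
    exists n => i j ni nj; apply: le_lt_trans (est _ _) _.
    have := ler_wpM2l M0 (le_trans (hu i) (ltW (hn _ ni))).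
    have := ler_wpM2l M0 (le_trans (hu j) (ltW (hn _ nj))).
    by rewrite mulrDr; move: hd => /=; lra.
  exists y => v; apply: ler_eps => e e0.
  have e2 : 0 < e / 2 by rewrite divr_gt0.
  have [d d0 hd] := eps_split M0 e2.
  have [n _ hn] := near_infty_natSinv_lt (PosNum d0).
  have [m _ hm] := (cvg_rnormP _ _).1 hy _ e2.
  have := hm (maxn n m) (leq_maxr _ _); have /= := hn (maxn n m) (leq_maxl _ _).
  set k := maxn n m => h1 h2.
  have -> : y - f v = (y - f (u k)) + (f (u k) - f v) by rewrite addrA subrK.
  rewrite (le_trans (ler_rnormD _ _))// (le_trans (lerD (ltW h2) (est _ _)))//.
  have := ler_wpM2l M0 (le_trans (hu k) (ltW h1)).
  by rewrite mulrDr; move: hd; lra.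
have tE u : t (gns_embed u) = f u.
  apply: (@eps_eq _ _ _ _ 0) => e e0.
  by rewrite mul0r (le_trans (ht _ u))// subrr rnorm0 mulr0.
have tl : linear t.
  move=> a x y; apply: (@eps_eq _ _ _ _ (M * (rnorm (a : R[i]^o) + 1) + rnorm (a : R[i]^o) * M + M)) => e e0.
  have [u hu] := gns_rdense x e0; have [v hv] := gns_rdense y e0.
  have na := rnorm_ge0 (a : R[i]^o).
  have -> : t (a *: x + y) - (a *: t x + t y) = (t (a *: x + y) - f (a *: u + v)) -
     (a *: (t x - f u) + (t y - f v)).
    rewrite lf scalerBr [a *: t x - _ + _]addrACA -[in RHS]opprD opprB.
    by rewrite [RHS]addrA subrK.
  rewrite (le_trans (ler_rnormB _ _))// !mulrDl -[leRHS]addrA lerD//.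
    rewrite (le_trans (ht _ _))// -mulrA ler_wpM2l//.
    rewrite linearP /= opprD addrACA -scalerBr (le_trans (ler_rnormD _ _))//.
    by rewrite rnormZ mulrDl mul1r lerD// ler_wpM2l.
  rewrite (le_trans (ler_rnormD _ _))// rnormZ lerD//.
    by rewrite -mulrA ler_wpM2l// (le_trans (ht _ _))// ler_wpM2l.
  by rewrite (le_trans (ht _ _))// ler_wpM2l.
have tb x : rnorm (t x) <= M * rnorm x.
  by have := ht x 0; rewrite linear0 -[f 0]/(fL 0) linear0 !subr0.
by exists (mkbop tl tb).
Qed.

Lemma gns_bop_eq (F : hilbertType R) (S T : 'B(gns, F)) :
  (forall u, S (gns_embed u) = T (gns_embed u)) -> S = T.
Proof.
move=> h; apply: bopP => x.
apply: (@eps_eq _ _ _ _ (opn (S - T))) => e e0.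
have [u hu] := gns_rdense x e0.
rewrite -[S x - T x]/((S - T) x).
have -> : (S - T) x = (S - T) (x - gns_embed u).
  by rewrite opB !bopBE h subrr subr0.
by rewrite (le_trans (opnP _ _))// ler_wpM2l ?opn_ge0.
Qed.

Lemma gns_hdot_eq (x y : gns) :
  (forall u, hdot x (gns_embed u : gns) = hdot y (gns_embed u : gns)) -> x = y.
Proof.
move=> h; apply/eqP; rewrite -subr_eq0; apply/eqP; apply: rnorm_eq0.
have [//|x0] := eqVneq (rnorm (x - y)) 0.
have xp : 0 < rnorm (x - y) by rewrite lt_neqAle eq_sym x0 rnorm_ge0.
have e0 : 0 < rnorm (x - y) / 2 by rewrite divr_gt0.
have [u hu] := gns_rdense (x - y) e0.
have := cauchy_schwarz (x - y) (x - y - gns_embed u).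
rewrite hdotBr [X in _ - X]hdotBl h subrr subr0 hdotxx rnormC ger0_norm ?exprn_ge0 ?rnorm_ge0//.
move=> h2; have := le_trans h2 (ler_wpM2l (rnorm_ge0 _) hu).
by rewrite expr2 ler_pM2l// => h3; exfalso; move: xp h3; lra.
Qed.

End Completion.

(** * Sums over arbitrary index sets and the spaces l2(I, H) *)

Section OrthogonalSums.
Context {R : realType} {I : choiceType} {H : hilbertType R}.
Implicit Types (f : I -> H) (A B : {fset I}).

Lemma sum_fset_sub (V : zmodType) A B (F : I -> V) :
  (forall i, i \notin A -> F i = 0) -> (A `<=` B)%fset ->
  \sum_(i <- A) F i = \sum_(i <- B) F i.
Proof. by move=> F0 AB; apply: big_fset_incl => // i _; exact: F0. Qed.

Lemma sum_fset_eq (V : zmodType) A B (F : I -> V) :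
  (forall i, i \notin A -> F i = 0) -> (forall i, i \notin B -> F i = 0) ->
  \sum_(i <- A) F i = \sum_(i <- B) F i.
Proof.
move=> hA hB; rewrite (sum_fset_sub hA (fsubsetUl A B)).
by rewrite (sum_fset_sub hB (fsubsetUr A B)).
Qed.

Lemma sum_fset_delta (V : zmodType) A i (F : I -> V) : i \in A ->
  (forall j, j != i -> F j = 0) -> \sum_(j <- A) F j = F i.
Proof.
move=> iA h; rewrite (big_fsetD1 i)//= big_seq big1 ?addr0// => j.
by rewrite !inE => /andP[/h].
Qed.

Lemma pythagoras A f : (forall i j, i != j -> hdot (f i) (f j) = 0) ->
  rnorm (\sum_(i <- A) f i) ^+ 2 = \sum_(i <- A) rnorm (f i) ^+ 2.
Proof.
move=> o; apply: complexI; rewrite -hdotxx hdot_suml rmorph_sum /=.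
rewrite big_seq [RHS]big_seq; apply: eq_bigr => i iA.
by rewrite hdot_sumr (@sum_fset_delta _ A i)// ?hdotxx// => j ji; rewrite o// eq_sym.
Qed.

(** By orthogonality the squared distance of two nested finite sums is the difference of their
    squared norms, and these increase to a finite supremum. *)
Lemma orthogonal_sum_cvg f (M : R) : (forall i j, i != j -> hdot (f i) (f j) = 0) ->
  (forall A, \sum_(i <- A) rnorm (f i) ^+ 2 <= M) ->
  exists x : H, (fun A : {fset I} => \sum_(i <- A) f i) @ totally --> x.
Proof.
move=> o hM; apply/cvg_ex; apply: cauchy_rnorm => e e0.
pose D := [set \sum_(i <- A) rnorm (f i) ^+ 2 | A in [set: {fset I}]].
have Ds : has_sup D.
  by split; [exists (\sum_(i <- fset0) rnorm (f i) ^+ 2), fset0|exists M => _ [A _ <-]].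
have e2 : 0 < e ^+ 2 by rewrite exprn_gt0.
have [_ [A _ <-] hA] := sup_adherent e2 Ds.
exists A => //; exists A => // B /= AB.
rewrite -(@ltr_pXn2r _ 2) ?nnegrE ?rnorm_ge0 ?ltW// rnormB.
have S (V : zmodType) (F : I -> V) : \sum_(i <- B) F i =
    \sum_(i <- A) F i + \sum_(i <- (B `\` A)%fset) F i.
  rewrite (big_fsetID _ (mem A)) /=; congr (_ + _).
    by apply: eq_fbigl => i; rewrite !inE /= andb_idl// => /(fsubsetP AB).
  by apply: eq_fbigl => i; rewrite !inE /= andbC.
rewrite S addrC addKr pythagoras//.
have : \sum_(i <- B) rnorm (f i) ^+ 2 <= sup D.
  by apply: sup_upper_bound => //; exists B.
by rewrite S; move: hA; set a := \sum_(i <- A) _; set b := sup _; set c := \sum_(i <- _) _; lra.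
Qed.

Lemma totally_cvg_le (u : {fset I} -> H) (x : H) (M : R) :
  u @ totally --> x -> (forall A, rnorm (u A) <= M) -> rnorm x <= M.
Proof.
move=> /cvg_rnormP ux h; apply: ler_eps => e e0.
have [A hA] := filter_ex (ux _ e0).
have -> : x = u A + (x - u A) by rewrite addrC subrK.
by rewrite (le_trans (ler_rnormD _ _))// lerD// ltW.
Qed.

End OrthogonalSums.

Lemma bop_cvg (R : realType) (V W : normedModType R[i]) (T : 'B(V, W)) J
    (F : set_system J) {FF : Filter F} (f : J -> V) (x : V) :
  f @ F --> x -> (fun j => T (f j)) @ F --> T x.
Proof. by move=> fx; apply: (cvg_comp _ _ fx); exact: bop_continuous. Qed.

Arguments bop_cvg {R V W} T {J F FF f x}.

Section TotallyCvg.
Context {R : realType} {I : choiceType}.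

Lemma totally_cvg_unique (V : normedModType R[i]) (u : {fset I} -> V) (x y : V) :
  u @ totally --> x -> u @ totally --> y -> x = y.
Proof. by move=> ux uy; apply: (@cvg_unique V (@norm_hausdorff _ V) _ _ _ _ ux uy). Qed.

End TotallyCvg.

Section FiniteSupport.
Context {R : realType} {I : choiceType} {V : lmodType R[i]}.

Definition fs_pred : {pred I -> V} :=
  [pred f | `[< exists A : {fset I}, forall i, i \notin A -> f i = 0 >]].

Lemma fs_submod : submod_closed fs_pred.
Proof.
split=> [|a f g /asboolP[A hA] /asboolP[B hB]]; apply/asboolP; first by exists fset0.
exists (A `|` B)%fset => i; rewrite inE negb_or => /andP[iA iB].
by rewrite !fctE hA// hB// scaler0 addr0.
Qed.

HB.instance Definition _ := GRing.isSubmodClosed.Build _ _ fs_pred fs_submod.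

Record fsfn := FsFn { fs_fun :> I -> V; fs_proof : fs_fun \in fs_pred }.

HB.instance Definition _ := [isSub for fs_fun].
HB.instance Definition _ := [Choice of fsfn by <:].
HB.instance Definition _ := [SubChoice_isSubLmodule of fsfn by <:].

Lemma fs_ext (f g : fsfn) : f =1 g -> f = g.
Proof. by move=> h; apply: val_inj; apply/funext. Qed.

Lemma fs_linE a (f g : fsfn) i : (a *: f + g) i = a *: f i + g i.
Proof. by []. Qed.

Lemma fs_supp_exists (f : fsfn) : exists A : {fset I}, forall i, i \notin A -> f i = 0.
Proof. by case: f => f /= /asboolP. Qed.

(** Some finite set outside which [f] vanishes. It is not claimed to be the smallest one, so sums
    over it are compared through common supersets. *)
Definition supp (f : fsfn) := projT1 (cid (fs_supp_exists f)).

Lemma suppP f i : i \notin supp f -> f i = 0.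
Proof. exact: (projT2 (cid (fs_supp_exists f))). Qed.

Lemma single_proof i (x : V) : (fun j => if j == i then x else 0) \in fs_pred.
Proof. by apply/asboolP; exists [fset i]%fset => j; rewrite inE => /negbTE ->. Qed.

Definition single i x : fsfn := FsFn (single_proof i x).

Lemma single_linear i : linear (single i).
Proof.
move=> a x y; apply: fs_ext => j /=; rewrite !fctE /=.
by case: ifP; rewrite // scaler0 addr0.
Qed.

Lemma fs_sumE J (r : seq J) (P : pred J) (F : J -> fsfn) i :
  (\sum_(j <- r | P j) F j) i = \sum_(j <- r | P j) F j i.
Proof. by elim/big_rec2 : _ => // j y z _ <-. Qed.

Lemma fs_decomp f : f = \sum_(i <- supp f) single i (f i).
Proof.
apply: fs_ext => j; rewrite fs_sumE /=.
have [jf|jf] := boolP (j \in supp f).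
  by rewrite (@sum_fset_delta _ _ _ j) ?eqxx// => i; rewrite eq_sym => /negbTE ->.
rewrite suppP// big_seq big1// => i iS; case: eqP => // ji.
by rewrite ji iS in jf.
Qed.

End FiniteSupport.

Arguments fsfn {R} I V.

Section L2.
Context {R : realType} {I : choiceType} {H : hilbertType R}.
Implicit Types f g : fsfn I H.

Definition l2_fun f g : R[i] := \sum_(i <- supp f) hdot (f i) (g i).

Lemma l2_funE f g (A : {fset I}) : (forall i, i \notin A -> f i = 0) ->
  l2_fun f g = \sum_(i <- A) hdot (f i) (g i).
Proof.
move=> h; apply: sum_fset_eq => i iA; first by rewrite (suppP iA) hdot0l.
by rewrite h// hdot0l.
Qed.

Lemma l2_linear g : linear_for *%R (l2_fun ^~ g).
Proof.
move=> a f f'; pose A := (supp f `|` supp f')%fset.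
have hf i : i \notin A -> f i = 0 by rewrite inE negb_or => /andP[/suppP].
have hf' i : i \notin A -> f' i = 0 by rewrite inE negb_or => /andP[_ /suppP].
rewrite !(@l2_funE _ _ A)//; last by move=> i iA; rewrite fs_linE hf// hf'// scaler0 addr0.
rewrite mulr_sumr -big_split; apply: eq_bigr => i _.
by rewrite fs_linE hdotDl hdotZl.
Qed.

Lemma l2_herm f g : l2_fun g f = Num.conj (l2_fun f g).
Proof.
pose A := (supp f `|` supp g)%fset.
rewrite !(@l2_funE _ _ A); first by rewrite conj_sum; apply: eq_bigr => i _; rewrite -hdotC.
  by move=> i; rewrite inE negb_or => /andP[/suppP].
by move=> i; rewrite inE negb_or => /andP[_ /suppP].
Qed.

Lemma l2_normE f : l2_fun f f = (\sum_(i <- supp f) rnorm (f i) ^+ 2)%:C.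
Proof. by rewrite rmorph_sum; apply: eq_bigr => i _; exact: hdotxx. Qed.

Lemma l2_ge0 f : 0 <= complex.Re (l2_fun f f).
Proof. by rewrite l2_normE /=; apply: sumr_ge0 => i _; rewrite exprn_ge0// rnorm_ge0. Qed.

Definition l2_form := PsdForm l2_linear l2_herm l2_ge0.

Definition l2 : hilbertType R := gns l2_form.

Lemma l2_seminormE f : seminorm l2_form f ^+ 2 = \sum_(i <- supp f) rnorm (f i) ^+ 2.
Proof. by apply: complexI; rewrite -seminormE /= l2_normE. Qed.

Lemma l2_inj_proof i : exists T : 'B(H, l2), forall x, T x = gns_embed l2_form (single i x).
Proof.
have lin : linear (fun x => gns_embed l2_form (single i x) : l2).
  by move=> a x y; rewrite single_linear linearP.
have bnd x : rnorm (gns_embed l2_form (single i x) : l2) <= 1 * rnorm x.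
  rewrite mul1r rnorm_gns -(@ler_pXn2r _ 2) ?nnegrE ?rnorm_ge0 ?seminorm_ge0//.
  have -> : seminorm l2_form (single i x) ^+ 2 = rnorm x ^+ 2.
    apply: complexI; rewrite -seminormE /= (@l2_funE _ _ [fset i]%fset).
      by rewrite big_seq_fset1 /= eqxx hdotxx.
    by move=> j; rewrite inE /= => /negbTE ->.
  exact: lexx.
by exists (mkbop lin bnd).
Qed.

Definition l2i i : 'B(H, l2) := projT1 (cid (l2_inj_proof i)).

Lemma l2iE i x : l2i i x = gns_embed l2_form (single i x).
Proof. exact: (projT2 (cid (l2_inj_proof i))). Qed.

Lemma hdot_l2i i j x y : hdot (l2i i x) (l2i j y) = if i == j then hdot x y else 0.
Proof.
rewrite !l2iE hdot_gns /= (@l2_funE _ _ [fset i]%fset).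
  by rewrite big_seq_fset1 /= eqxx; case: eqP => // _; rewrite hdot0r.
by move=> k; rewrite inE /= => /negbTE ->.
Qed.

Lemma rnorm_l2i i x : rnorm (l2i i x) = rnorm x.
Proof.
apply/eqP; rewrite -(@eqrXn2 _ 2) ?rnorm_ge0//; apply/eqP/complexI.
by rewrite -!hdotxx hdot_l2i eqxx.
Qed.

Lemma gns_embed_l2 f : gns_embed l2_form f = \sum_(i <- supp f) l2i i (f i).
Proof.
rewrite [in LHS](fs_decomp f) linear_sum; apply: eq_bigr => i _.
by rewrite l2iE.
Qed.

Lemma l2_dense (x : l2) (e : R) : 0 < e ->
  exists (A : {fset I}) (h : I -> H), rnorm (x - \sum_(i <- A) l2i i (h i)) <= e.
Proof.
move=> /(gns_rdense x)[f hf]; exists (supp f), f.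
by rewrite -gns_embed_l2.
Qed.

Lemma rnorm_l2_sum (A : {fset I}) (h : I -> H) :
  rnorm (\sum_(i <- A) l2i i (h i)) ^+ 2 = \sum_(i <- A) rnorm (h i) ^+ 2.
Proof.
rewrite pythagoras => [|i j ij]; last by rewrite hdot_l2i (negbTE ij).
by apply: eq_bigr => i _; rewrite rnorm_l2i.
Qed.

Lemma l2_extend (F : hilbertType R) (T : I -> 'B(H, F)) (M : R) : 0 <= M ->
  (forall (A : {fset I}) (h : I -> H),
    rnorm (\sum_(i <- A) T i (h i)) ^+ 2 <= M ^+ 2 * \sum_(i <- A) rnorm (h i) ^+ 2) ->
  exists2 S : 'B(l2, F), (forall i x, S (l2i i x) = T i x) &
    forall x, rnorm (S x) <= M * rnorm x.
Proof.
move=> M0 hM; pose f (u : fsfn I H) := \sum_(i <- supp u) T i (u i).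
have fE (u : fsfn I H) (A : {fset I}) : (forall i, i \notin A -> u i = 0) -> f u = \sum_(i <- A) T i (u i).
  by move=> h; apply: sum_fset_eq => i iA; [rewrite (suppP iA) op0|rewrite h// op0].
have lf : linear f.
  move=> a u v; pose A := (supp u `|` supp v)%fset.
  have hu i : i \notin A -> u i = 0 by rewrite inE negb_or => /andP[/suppP].
  have hv i : i \notin A -> v i = 0 by rewrite inE negb_or => /andP[_ /suppP].
  rewrite !(fE _ A)//; last by move=> i iA; rewrite fs_linE hu// hv// scaler0 addr0.
  rewrite scaler_sumr -big_split; apply: eq_bigr => i _.
  by rewrite fs_linE opD opZ.
have [|S hS bS] := @gns_extend _ _ l2_form F f M lf M0.
  move=> u; rewrite -(@ler_pXn2r _ 2) ?nnegrE ?mulr_ge0 ?rnorm_ge0 ?seminorm_ge0//.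
  by rewrite exprMn l2_seminormE hM.
exists S => // i x; rewrite l2iE hS (fE _ [fset i]%fset).
  by rewrite big_seq_fset1 /= eqxx.
by move=> k; rewrite inE /= => /negbTE ->.
Qed.

Lemma l2_bop_eq (F : hilbertType R) (S T : 'B(l2, F)) :
  (forall i x, S (l2i i x) = T (l2i i x)) -> S = T.
Proof.
move=> h; apply: gns_bop_eq => f; rewrite gns_embed_l2 !op_sum.
by apply: eq_bigr => i _; exact: h.
Qed.

Lemma l2_hdot_eq (x y : l2) : (forall i h, hdot x (l2i i h) = hdot y (l2i i h)) -> x = y.
Proof.
move=> h; apply: gns_hdot_eq => f; rewrite gns_embed_l2 !hdot_sumr.
by apply: eq_bigr => i _; exact: h.
Qed.

Definition l2p i : 'B(l2, H) := adj (l2i i).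

Lemma l2pi i j x : l2p i (l2i j x) = if i == j then x else 0.
Proof.
apply: hdot_extr => y; rewrite -adjP hdot_l2i eq_sym.
by case: eqP => // _; rewrite hdot0r.
Qed.

Lemma l2_ext (x y : l2) : (forall i, l2p i x = l2p i y) -> x = y.
Proof. by move=> h; apply: l2_hdot_eq => i z; rewrite !adjPr -!/(l2p i) h. Qed.

Definition l2t (A : {fset I}) : 'B(l2, l2) := \sum_(i <- A) bcomp (l2i i) (l2p i).

Lemma l2tE A x : l2t A x = \sum_(i <- A) l2i i (l2p i x).
Proof. by rewrite bop_sumE. Qed.

Lemma l2t_normE A x : rnorm (l2t A x) ^+ 2 = \sum_(i <- A) rnorm (l2p i x) ^+ 2.
Proof. by rewrite l2tE rnorm_l2_sum. Qed.

Lemma hdot_l2t A x y : hdot (l2t A x) y = \sum_(i <- A) hdot (l2p i x) (l2p i y).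
Proof. by rewrite l2tE hdot_suml; apply: eq_bigr => i _; rewrite adjP. Qed.

Lemma adj_l2t A : adj (l2t A) = l2t A.
Proof. by rewrite adj_sum; apply: eq_bigr => i _; rewrite adj_comp adjK. Qed.

Lemma l2t_l2i (A : {fset I}) i x : i \in A -> l2t A (l2i i x) = l2i i x.
Proof.
move=> iA; rewrite l2tE (@sum_fset_delta _ _ _ i)// ?l2pi ?eqxx// => j ji.
by rewrite l2pi (negbTE ji) op0.
Qed.

Lemma l2t_idem A x : l2t A (l2t A x) = l2t A x.
Proof.
rewrite [X in l2t A X = _]l2tE op_sum [RHS]l2tE big_seq [RHS]big_seq; apply: eq_bigr => i iA.
exact: l2t_l2i.
Qed.

Lemma l2t_le A x : rnorm (l2t A x) <= rnorm x.
Proof.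
have [->|t0] := eqVneq (rnorm (l2t A x)) 0; first exact: rnorm_ge0.
have tp : 0 < rnorm (l2t A x) by rewrite lt_neqAle eq_sym t0 rnorm_ge0.
rewrite -(ler_pM2l tp) -expr2; apply: le_trans (cauchy_schwarz (l2t A x) x).
have -> : hdot (l2t A x) x = (rnorm (l2t A x) ^+ 2)%:C.
  by rewrite -hdotxx -{2}[l2t A in RHS]adj_l2t -adjP l2t_idem.
by rewrite rnormC ger0_norm// exprn_ge0// rnorm_ge0.
Qed.

Lemma l2t_cvg x : (fun A : {fset I} => l2t A x) @ totally --> x.
Proof.
apply/cvg_rnormP => e e0; have e2 : 0 < e / 3 by rewrite divr_gt0.
have [A [h hA]] := l2_dense x e2.
set y := \sum_(i <- A) _ in hA; exists A => // B /= AB.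
have yB : l2t B y = y.
  rewrite /y op_sum big_seq [RHS]big_seq; apply: eq_bigr => i iA.
  by rewrite l2t_l2i//; exact: (fsubsetP AB).
have -> : x - l2t B x = (x - y) - l2t B (x - y).
  by rewrite opB yB opprB addrA subrK.
apply: le_lt_trans (ler_rnormB _ _) _.
by have := l2t_le B (x - y); move: hA e0; lra.
Qed.

Lemma l2_vec (h : I -> H) (M : R) : (forall A : {fset I}, \sum_(i <- A) rnorm (h i) ^+ 2 <= M) ->
  exists2 x : l2, (forall i, l2p i x = h i) & rnorm x ^+ 2 <= M.
Proof.
move=> hM; have M0 : 0 <= M by have := hM fset0; rewrite big_seq_fset0.
have [||x hx] := @orthogonal_sum_cvg R I l2 (fun i => l2i i (h i)) M.
- by move=> i j ij; rewrite hdot_l2i (negbTE ij).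
- by move=> A; under eq_bigr do rewrite rnorm_l2i; exact: hM.
exists x => [i|].
  have : (fun A : {fset I} => l2p i (\sum_(j <- A) l2i j (h j))) @ totally --> l2p i x.
    exact: (bop_cvg (l2p i) hx).
  move=> /totally_cvg_unique; apply.
  apply/cvg_rnormP => e e0; exists [fset i]%fset => // B /=.
  rewrite fsub1set => iB; rewrite op_sum (@sum_fset_delta _ _ _ i)//.
    by rewrite l2pi eqxx subrr rnorm0.
  by move=> j ji; rewrite l2pi eq_sym (negbTE ji).
rewrite -[leRHS]sqr_sqrtr// ler_pXn2r ?nnegrE ?rnorm_ge0 ?sqrtr_ge0//.
apply: (totally_cvg_le hx) => A.
rewrite -(@ler_pXn2r _ 2) ?nnegrE ?rnorm_ge0 ?sqrtr_ge0// sqr_sqrtr//.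
by rewrite rnorm_l2_sum.
Qed.

Lemma l2_norm_le x (A : {fset I}) : \sum_(i <- A) rnorm (l2p i x) ^+ 2 <= rnorm x ^+ 2.
Proof. by rewrite -l2t_normE ler_pXn2r ?nnegrE ?rnorm_ge0// l2t_le. Qed.

Lemma l2_hdot_cvg x y :
  (fun A : {fset I} => \sum_(i <- A) hdot (l2p i x) (l2p i y) : R[i]^o) @ totally --> (hdot x y : R[i]^o).
Proof.
under eq_fun do rewrite -hdot_l2t.
by apply: hdot_cvg; [exact: l2t_cvg|exact: cvg_cst].
Qed.

End L2.

Arguments l2 {R} I H.
Arguments l2t_cvg {R I H} x.
Arguments l2_hdot_cvg {R I H} x y.

Section Amplification.
Context {R : realType} {I J : choiceType} {H K : hilbertType R}.

Lemma ampl_exists (T : 'B(H, K)) :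
  exists2 S : 'B(l2 I H, l2 I K), (forall i x, S (l2i i x) = l2i i (T x)) &
    forall x, rnorm (S x) <= opn T * rnorm x.
Proof.
apply: (@l2_extend _ _ _ _ (fun i => bcomp (l2i i) T)); first exact: opn_ge0.
move=> A h; rewrite (rnorm_l2_sum A (fun i => T (h i))) mulr_sumr.
apply: ler_sum => i _; rewrite -exprMn ler_pXn2r ?nnegrE ?mulr_ge0 ?rnorm_ge0 ?opn_ge0//.
exact: opnP.
Qed.

(** This is 1 (x) T, the diagonal matrix all of whose diagonal entries are [T]. *)
Definition ampl (T : 'B(H, K)) := s2val (cid2 (ampl_exists T)).

Lemma ampl_l2i T i x : ampl T (l2i i x) = l2i i (T x).
Proof. exact: (s2valP (cid2 (ampl_exists T))). Qed.

Lemma ampl_le T x : rnorm (ampl T x) <= opn T * rnorm x.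
Proof. exact: (s2valP' (cid2 (ampl_exists T))). Qed.

Lemma l2p_ampl T i x : l2p i (ampl T x) = T (l2p i x).
Proof.
have : bcomp (l2p i) (ampl T) = bcomp T (l2p i).
  apply: l2_bop_eq => j y; rewrite !bcompE ampl_l2i !l2pi.
  by case: eqP => // _; rewrite op0.
by move=> /(congr1 (fun S => bop_fun S x)).
Qed.

Lemma ampl_linear : linear ampl.
Proof.
move=> a S T; apply: l2_bop_eq => i x.
by rewrite bopDE bopZE !ampl_l2i bopDE bopZE opD opZ.
Qed.

Lemma reindex_exists (g : I -> J) : injective g ->
  exists2 S : 'B(l2 I H, l2 J H), (forall i x, S (l2i i x) = l2i (g i) x) &
    forall x, rnorm (S x) <= 1 * rnorm x.
Proof.
move=> gi; apply: (@l2_extend _ _ _ _ (fun i => l2i (g i))) => // A h.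
rewrite expr1n mul1r pythagoras => [|i j ij].
  by under eq_bigr do rewrite rnorm_l2i.
by rewrite hdot_l2i (inj_eq gi) (negbTE ij).
Qed.

End Amplification.

Section DirectSum.
Context {R : realType} {H K : hilbertType R}.

Definition dsum_fun (u v : (H * K)%type) : R[i] := hdot u.1 v.1 + hdot u.2 v.2.

Lemma dsum_linear v : linear_for *%R (dsum_fun ^~ v).
Proof. by move=> a u u'; rewrite /dsum_fun !hdotDl !hdotZl; ring. Qed.

Lemma dsum_herm u v : dsum_fun v u = Num.conj (dsum_fun u v).
Proof. by rewrite /dsum_fun conjD -!hdotC. Qed.

Lemma dsum_ge0 u : 0 <= complex.Re (dsum_fun u u).
Proof. by rewrite /dsum_fun !hdotxx /= addr_ge0// exprn_ge0// rnorm_ge0. Qed.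

Definition dsum_form := PsdForm dsum_linear dsum_herm dsum_ge0.

Definition dsum : hilbertType R := gns dsum_form.

Lemma dsum_seminorm u : seminorm dsum_form u ^+ 2 = rnorm u.1 ^+ 2 + rnorm u.2 ^+ 2.
Proof. by apply: complexI; rewrite -seminormE /= /dsum_fun !hdotxx rmorphD. Qed.

Lemma dsum_inj_exists (L : hilbertType R) (f : L -> H * K) : linear f ->
  (forall x, rnorm (f x).1 ^+ 2 + rnorm (f x).2 ^+ 2 = rnorm x ^+ 2) ->
  exists T : 'B(L, dsum), forall x, T x = gns_embed dsum_form (f x).
Proof.
move=> lf nf.
have lin : linear (fun x => gns_embed dsum_form (f x) : dsum).
  by move=> a x y; rewrite lf linearP.
have bnd x : rnorm (gns_embed dsum_form (f x) : dsum) <= 1 * rnorm x.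
  rewrite mul1r rnorm_gns -(@ler_pXn2r _ 2) ?nnegrE ?rnorm_ge0 ?seminorm_ge0//.
  by rewrite dsum_seminorm nf.
by exists (mkbop lin bnd).
Qed.

(** These four relations say that [i1] and [i2] are isometries with complementary ranges; the direct
    sum is used through them alone. *)
Lemma dsum_structure : exists (i1 : 'B(H, dsum)) (i2 : 'B(K, dsum)),
  [/\ bcomp (adj i1) i1 = idop H, bcomp (adj i2) i2 = idop K,
      bcomp (adj i2) i1 = 0
    & bcomp i1 (adj i1) + bcomp i2 (adj i2) = idop dsum].
Proof.
have [||i1 h1] := @dsum_inj_exists H (fun x => (x, 0)).
- by move=> a x y; congr pair => /=; rewrite scaler0 addr0.
- by move=> x /=; rewrite rnorm0 expr0n addr0.
have [||i2 h2] := @dsum_inj_exists K (fun x => (0, x)).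
- by move=> a x y; congr pair => /=; rewrite scaler0 addr0.
- by move=> x /=; rewrite rnorm0 expr0n add0r.
have e11 x : adj i1 (i1 x) = x.
  apply: hdot_ext => y.
  by rewrite -adjPr !h1 hdot_gns /= /dsum_fun /= hdot0l addr0.
have e22 x : adj i2 (i2 x) = x.
  apply: hdot_ext => y.
  by rewrite -adjPr !h2 hdot_gns /= /dsum_fun /= hdot0l add0r.
have e21 x : adj i2 (i1 x) = 0.
  apply: hdot_ext => y.
  by rewrite -adjPr h1 h2 hdot_gns /= /dsum_fun /= !hdot0l hdot0r addr0.
have e12 x : adj i1 (i2 x) = 0.
  apply: hdot_ext => y.
  by rewrite -adjPr h1 h2 hdot_gns /= /dsum_fun /= !hdot0l hdot0r addr0.
exists i1, i2; split; try exact: bopP.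
apply: gns_bop_eq => -[x y].
have -> : gns_embed dsum_form (x, y) = i1 x + i2 y.
  by rewrite h1 h2 -linearD; congr gns_embed; congr pair => /=; rewrite ?addr0 ?add0r.
rewrite bopDE !bcompE !opD e11 e12 e21 e22 !op0 addr0 add0r.
by [].
Qed.

End DirectSum.

Section Sums.
Context {R : realType}.

Lemma esum_bounded (I : choiceType) (a : I -> R) : (forall i, 0 <= a i) ->
  (\esum_(i in [set: I]) (a i)%:E < +oo)%E <->
  exists M : R, forall A : {fset I}, \sum_(i <- A) a i <= M.
Proof.
move=> a0; have fsE (A : {fset I}) : (\sum_(i \in [set` A]) (a i)%:E)%E = (\sum_(i <- A) a i)%:E.
  by rewrite fsbig_finite ?finite_fset//= set_fsetK sumEFin.
split=> [h|[M hM]].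
  have h0 : (0 <= \esum_(i in [set: I]) (a i)%:E)%E by apply: esum_ge0 => i _; rewrite lee_fin.
  exists (fine (\esum_(i in [set: I]) (a i)%:E)%E) => A.
  rewrite -lee_fin fineK ?ge0_fin_numE// -fsE; apply: esum_ge.
  by exists [set` A] => //; split => //; exact: finite_fset.
apply: (@le_lt_trans _ _ M%:E); last exact: ltry.
apply: ge_ereal_sup => _ [X [fX _] <-].
by rewrite -(fset_setK fX) fsE lee_fin.
Qed.

Lemma rnorm_cvg (V : normedModType R[i]) T (F : set_system T) {FF : ProperFilter F}
  (f : T -> V) (x : V) : f @ F --> x -> (fun t => rnorm (f t)) @ F --> rnorm x.
Proof.
move=> /cvg_rnormP fx; apply/cvgrPdist_lt => e e0; apply: filterS (fx _ e0) => t.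
apply: le_lt_trans; rewrite ler_norml lerBrDr addrC lerBlDr.
have := ler_rnormD (f t - x) x; have := ler_rnormD (x - f t) (f t).
rewrite !subrK (rnormB (f t) x) => a b; apply/andP; split; last by lra.
by rewrite addrC; lra.
Qed.

Lemma sum_rnorm2_cvg (V : normedModType R[i]) T (F : set_system T) {FF : ProperFilter F}
  J (r : seq J) (f : J -> T -> V) (x : J -> V) (M : R) :
  (forall j, f j @ F --> x j) -> (\forall t \near F, \sum_(j <- r) rnorm (f j t) ^+ 2 <= M) ->
  \sum_(j <- r) rnorm (x j) ^+ 2 <= M.
Proof.
move=> h; apply: cvgr_to_le.
elim: r => [|j r IHr]; first by rewrite big_nil; under eq_fun do rewrite big_nil; exact: cvg_cst.
rewrite big_cons; under eq_fun do rewrite big_cons.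
apply: cvgD; last exact: IHr.
by under eq_fun do rewrite expr2; rewrite expr2; apply: cvgM; exact: rnorm_cvg.
Qed.

Lemma cvg_bigsum (V : normedModType R[i]) T (F : set_system T) {FF : Filter F}
  J (r : seq J) (f : J -> T -> V) (x : J -> V) :
  (forall j, f j @ F --> x j) -> (fun t => \sum_(j <- r) f j t) @ F --> \sum_(j <- r) x j.
Proof.
move=> h; elim: r => [|j r IHr].
  by rewrite big_nil; under eq_fun do rewrite big_nil; exact: cvg_cst.
rewrite big_cons; under eq_fun do rewrite big_cons.
by apply: cvgD; [exact: h|exact: IHr].
Qed.

Lemma sum_fsetE (V : zmodType) (J : choiceType) (B : {fset J}) (F : J -> V) :
  \sum_(j : B) F (val j) = \sum_(j <- B) F j.
Proof. by rewrite big_seq_fsetE. Qed.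

Lemma sum_pair (V : nmodType) (A B : finType) (F : A * B -> V) :
  \sum_p F p = \sum_a \sum_b F (a, b).
Proof. by rewrite pair_bigA; apply: eq_bigr => -[]. Qed.

(** Initial segments are cofinal among the finite sets, so unordered summability implies convergence
    of the series. *)
Lemma totally_nat : (fun n : nat => [fset k | k in iota 0 n]%fset) @ \oo --> @totally nat.
Proof.
move=> P [A _ hA]; exists (\max_(k <- A) k.+1)%N => // n /= hn; apply: hA => /=.
apply/fsubsetP => k kA; rewrite in_fset/= mem_iota/= add0n.
by apply: leq_trans hn; rewrite (big_fsetD1 k)//= leq_maxl.
Qed.

Lemma totally_series (V : normedModType R[i]) (z : nat -> V) (l : V) :
  (fun A : {fset nat} => \sum_(k <- A) z k) @ totally --> l -> series z @ \oo --> l.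
Proof.
move=> h; have := cvg_comp _ _ totally_nat h.
suff -> : (fun A : {fset nat} => \sum_(k <- A) z k) \o (fun n : nat => [fset k | k in iota 0 n]%fset) = series z by [].
apply/funext => n /=; rewrite /series /= /index_iota subn0.
by rewrite big_imfset //= undup_id ?iota_uniq.
Qed.

End Sums.

(** * Operator matrices and normal functionals *)

Section MatrixBounds.
Context {R : realType}.

(** The matrix has norm at most [|M|]. With squared norms such bounds are handled by finite sums
    alone, without the supremum and the square roots of [opnorm]. *)
Definition opb (A B : finType) (V W : normedModType R[i]) (T : A -> B -> 'B(V, W)) (M : R) :=
  forall h : B -> V, \sum_a rnorm (\sum_b T a b (h b)) ^+ 2 <= M ^+ 2 * \sum_b rnorm (h b) ^+ 2.

Context {A B : finType} {V W : normedModType R[i]}.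
Implicit Type T : A -> B -> 'B(V, W).

Lemma l2norm_ge0 (C : finType) (h : C -> V) : 0 <= l2norm h.
Proof. exact: sqrtr_ge0. Qed.

Lemma l2normE (C : finType) (U : normedModType R[i]) (h : C -> U) :
  l2norm h ^+ 2 = \sum_a rnorm (h a) ^+ 2.
Proof. by rewrite sqr_sqrtr// sumr_ge0// => i _; rewrite exprn_ge0// rnorm_ge0. Qed.

Lemma opb_l2norm T (M : R) : 0 <= M -> opb T M <->
  forall h, l2norm (fun a => \sum_b T a b (h b)) <= M * l2norm h.
Proof.
move=> M0; split=> hM h.
  by rewrite -(@ler_pXn2r _ 2) ?nnegrE ?mulr_ge0 ?sqrtr_ge0// exprMn !l2normE.
by rewrite -!l2normE -exprMn ler_pXn2r ?nnegrE ?mulr_ge0 ?sqrtr_ge0.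
Qed.

Lemma opb_exists T : exists2 M : R, 0 <= M & opb T M.
Proof.
pose M := \sum_a \sum_b opn (T a b).
have M0 : 0 <= M by apply: sumr_ge0 => a _; apply: sumr_ge0 => b _; exact: opn_ge0.
exists (#|A|%:R * M); first by rewrite mulr_ge0.
apply/opb_l2norm; first by rewrite mulr_ge0.
move=> h; have h0 := l2norm_ge0 h.
have hb b : rnorm (h b) <= l2norm h.
  rewrite -(@ler_pXn2r _ 2) ?nnegrE ?rnorm_ge0// l2normE (bigD1 b)//= lerDl.
  by apply: sumr_ge0 => i _; rewrite exprn_ge0// rnorm_ge0.
have ha a : rnorm (\sum_b T a b (h b)) <= M * l2norm h.
  rewrite (le_trans (ler_rnorm_sum _ _ _))//.
  apply: (@le_trans _ _ ((\sum_b opn (T a b)) * l2norm h)).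
    rewrite mulr_suml; apply: ler_sum => b _; rewrite (le_trans (opnP _ _))//.
    by rewrite ler_wpM2l ?opn_ge0.
  rewrite ler_wpM2r// /M (bigD1 a)//= lerDl; apply: sumr_ge0 => i _.
  by apply: sumr_ge0 => b _; exact: opn_ge0.
rewrite -mulrA -(@ler_pXn2r _ 2) ?nnegrE ?mulr_ge0// ?sqrtr_ge0// l2normE.
apply: (@le_trans _ _ (\sum_(a : A) (M * l2norm h) ^+ 2)).
  by apply: ler_sum => a _; rewrite ler_pXn2r ?nnegrE ?mulr_ge0 ?rnorm_ge0.
have -> : \sum_(a : A) (M * l2norm h) ^+ 2 = #|A|%:R * (M * l2norm h) ^+ 2.
  by rewrite sumr_const mulr_natl.
rewrite [leRHS]exprMn; apply: ler_wpM2r; first by rewrite exprn_ge0 ?mulr_ge0.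
by rewrite -natrX ler_nat; case: #|_| => // n; rewrite leq_pmulr.
Qed.

Lemma opb_opnorm T : opb T (opnorm (fun a b => T a b : V -> W)).
Proof.
set N := opnorm _.
have [M M0 hM] := opb_exists T.
pose S := [set l2norm (fun a => \sum_b T a b (h b)) | h in [set h : B -> V | l2norm h <= 1]].
have S0 : S 0.
  exists (fun _ => 0) => /=; rewrite /l2norm big1 ?sqrtr0// => b _; first by rewrite rnorm0 expr0n.
  by rewrite big1 ?rnorm0 ?expr0n// => c _; rewrite op0.
have hS : has_sup S.
  split; first by exists 0.
  exists M => _ [h /= h1 <-]; rewrite (le_trans ((opb_l2norm T M0).1 hM h))//.
  by rewrite ler_piMr.
have N0 : 0 <= N by exact: sup_upper_bound.
apply/opb_l2norm => // h.
have [h0|h0] := eqVneq (l2norm h) 0.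
  rewrite h0 mulr0; have := (opb_l2norm T M0).1 hM h; rewrite h0 mulr0.
  by apply: le_trans.
have hp : 0 < l2norm h by rewrite lt_neqAle eq_sym h0 sqrtr_ge0.
have sc (C : finType) (U : normedModType R[i]) (k : C -> U) (c : R) : 0 <= c ->
    l2norm (fun a => c%:C *: k a) = c * l2norm k.
  move=> c0; apply/eqP; rewrite -(@eqrXn2 _ 2) ?mulr_ge0 ?sqrtr_ge0// exprMn !l2normE mulr_sumr.
  by apply/eqP/eq_bigr => a _; rewrite rnormZr exprMn real_normK ?num_real.
rewrite -ler_pdivrMr//; apply: sup_upper_bound => //.
exists (fun b => (l2norm h)^-1%:C *: h b) => /=.
  by rewrite sc ?invr_ge0 ?(ltW hp)// mulVf.
rewrite mulrC -sc ?invr_ge0 ?(ltW hp)//; congr l2norm; apply/funext => a.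
by rewrite scaler_sumr; apply: eq_bigr => b _; rewrite opZ.
Qed.

Lemma opnorm_ge0 T : 0 <= opnorm (fun a b => T a b : V -> W).
Proof.
have [M M0 hM] := opb_exists T.
apply: sup_upper_bound; last first.
  exists (fun _ => 0) => /=; rewrite /l2norm big1 ?sqrtr0// => b _; first by rewrite rnorm0 expr0n.
  by rewrite big1 ?rnorm0 ?expr0n// => c _; rewrite op0.
split.
  exists 0, (fun _ => 0) => /=; rewrite /l2norm big1 ?sqrtr0// => b _; first by rewrite rnorm0 expr0n.
  by rewrite big1 ?rnorm0 ?expr0n// => c _; rewrite op0.
exists M => _ [h /= h1 <-]; rewrite (le_trans ((opb_l2norm T M0).1 hM h))//.
by rewrite ler_piMr.
Qed.

Lemma opnorm_le T (M : R) : 0 <= M -> opnorm (fun a b => T a b : V -> W) <= M <-> opb T M.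
Proof.
move=> M0; split=> h; last first.
  apply: ge_sup.
    exists 0, (fun _ => 0) => /=; rewrite /l2norm big1 ?sqrtr0// => b _; first by rewrite rnorm0 expr0n.
    by rewrite big1 ?rnorm0 ?expr0n// => c _; rewrite op0.
  move=> _ [k /= k1 <-]; rewrite (le_trans ((opb_l2norm T M0).1 h k))//.
  by rewrite ler_piMr.
move=> k; rewrite (le_trans (opb_opnorm T k))// ler_wpM2r//.
  by rewrite sumr_ge0// => i _; rewrite exprn_ge0// rnorm_ge0.
by rewrite ler_pXn2r ?nnegrE ?opnorm_ge0.
Qed.

End MatrixBounds.

Section L2Families.
Context {R : realType} {H : hilbertType R}.

Lemma l2_norm_lim (I : choiceType) (x : l2 I H) (M : R) :
  (forall A : {fset I}, \sum_(i <- A) rnorm (l2p i x) ^+ 2 <= M) -> rnorm x ^+ 2 <= M.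
Proof.
move=> h; have M0 : 0 <= M by have := h fset0; rewrite big_seq_fset0.
rewrite -[leRHS]sqr_sqrtr// ler_pXn2r ?nnegrE ?rnorm_ge0 ?sqrtr_ge0//.
apply: (totally_cvg_le (l2t_cvg x)) => A.
by rewrite -(@ler_pXn2r _ 2) ?nnegrE ?rnorm_ge0 ?sqrtr_ge0// sqr_sqrtr// l2t_normE.
Qed.

Lemma esum_l2 (I : choiceType) (x : l2 I H) :
  (\esum_(k in [set: I]) (rnorm (l2p k x) ^+ 2)%:E < +oo)%E.
Proof.
apply/esum_bounded => [i|]; first by rewrite exprn_ge0// rnorm_ge0.
by exists (rnorm x ^+ 2) => A; exact: l2_norm_le.
Qed.

Lemma esum_vec (I : choiceType) (xi : I -> H) :
  (\esum_(k in [set: I]) (rnorm (xi k) ^+ 2)%:E < +oo)%E ->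
  exists x : l2 I H, forall k, l2p k x = xi k.
Proof.
move=> /esum_bounded[i|M hM]; first by rewrite exprn_ge0// rnorm_ge0.
by have [x hx _] := l2_vec hM; exists x.
Qed.

Lemma esum_l2E (I : choiceType) (x : l2 I H) :
  (\esum_(k in [set: I]) (rnorm (l2p k x) ^+ 2)%:E = (rnorm x ^+ 2)%:E)%E.
Proof.
have p k : 0 <= rnorm (l2p k x) ^+ 2 by rewrite exprn_ge0// rnorm_ge0.
have fsE (A : {fset I}) : (\sum_(i \in [set` A]) (rnorm (l2p i x) ^+ 2)%:E)%E =
    (\sum_(i <- A) rnorm (l2p i x) ^+ 2)%:E.
  by rewrite fsbig_finite ?finite_fset//= set_fsetK sumEFin.
apply/eqP; rewrite eq_le; apply/andP; split.
  apply: ge_ereal_sup => _ [X [fX _] <-].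
  by rewrite -(fset_setK fX) fsE lee_fin l2_norm_le.
have h0 : (0 <= \esum_(i in [set: I]) (rnorm (l2p i x) ^+ 2)%:E)%E.
  by apply: esum_ge0 => i _; rewrite lee_fin.
have fin : (\esum_(i in [set: I]) (rnorm (l2p i x) ^+ 2)%:E \is a fin_num)%E.
  by rewrite ge0_fin_numE// esum_l2.
rewrite -(fineK fin) lee_fin; apply: l2_norm_lim => A.
rewrite -lee_fin fineK// -fsE; apply: esum_ge.
by exists [set` A] => //; split => //; exact: finite_fset.
Qed.

End L2Families.

Section NormalFunctionals.
Context {R : realType} {H K : hilbertType R}.

(** The trace class functional sum_k <T x_k, y_k> as one vector functional of 1 (x) T; in this form
    no series has to be handled. *)
Definition nform (x : l2 nat H) (y : l2 nat K) : 'B(H, K) -> R[i]^o :=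
  fun T => hdot (ampl T x) y.

Lemma nform_series (x : l2 nat H) (y : l2 nat K) (T : 'B(H, K)) :
  series (fun k => hdot (T (l2p k x)) (l2p k y) : R[i]^o) @ \oo --> nform x y T.
Proof.
apply: (@totally_series _ R[i]^o).
have := l2_hdot_cvg (ampl T x) y.
by under eq_fun do under eq_bigr do rewrite l2p_ampl.
Qed.

Lemma normal_nform (f : 'B(H, K) -> R[i]^o) :
  normal_functionals f <-> exists x y, f = nform x y.
Proof.
split=> [[xi [eta [h1 h2 h]]]|[x [y ->]]].
  have [x hx] := esum_vec h1; have [y hy] := esum_vec h2.
  exists x, y; apply/funext => T.
  have := @nform_series x y T.
  have -> : (fun k => hdot (T (l2p k x)) (l2p k y) : R[i]^o) = (fun k => hdot (T (xi k)) (eta k)).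
    by apply/funext => k; rewrite hx hy.
  exact: (@cvg_unique R[i]^o (@norm_hausdorff _ R[i]^o) _ _ _ _ (h T)).
exists (fun k => l2p k x), (fun k => l2p k y); split; last exact: nform_series.
- exact: esum_l2.
- exact: esum_l2.
Qed.

End NormalFunctionals.

Section MatrixOperators.
Context {R : realType} {I : choiceType} {H K : hilbertType R}.
Implicit Types S : 'B(l2 I H, l2 I K).

Definition ent S : infmx I H K := fun i j => bcomp (l2p i) (bcomp S (l2i j)).

Lemma ent_linear a S T : ent (a *: S + T) = a *: ent S + ent T.
Proof.
by apply/funext => i; apply/funext => j; rewrite /ent bcompDl bcompZl bcompDr bcompZr.
Qed.

Lemma ent_inj : injective ent.
Proof.
move=> S T h; apply: l2_bop_eq => j x; apply: l2_ext => i.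
by have /(congr1 (fun F => bop_fun F x)) := congr1 (fun F : infmx I H K => F i j) h.
Qed.

(** Finite submatrices are the compressions of [S] by the truncations [l2t]. These tend strongly to
    the identity and are removed by two limits, first on the left and then on the right. *)
Lemma ent_bound n (S : 'I_n -> 'I_n -> 'B(l2 I H, l2 I K)) (M : R) : 0 <= M ->
  (opb S M <-> forall A B : {fset I},
    finite_submx_norm (\matrix_(i, j) ent (S i j)) A B <= M).
Proof.
move=> M0; split=> [hM A B|hM x].
  apply/(opnorm_le _ M0) => h.
  pose y (b : 'I_n) : l2 I H := \sum_(j : B) l2i (val j) (h (b, j)).
  have yn b : rnorm (y b) ^+ 2 = \sum_(j : B) rnorm (h (b, j)) ^+ 2.
    pose g (k : I) := if insub k is Some j then h (b, j) else 0.
    have gE (j : B) : h (b, j) = g (val j) by rewrite /g valK.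
    rewrite /y; under eq_bigr do rewrite gE.
    rewrite (sum_fsetE B (fun k => l2i k (g k))) rnorm_l2_sum -sum_fsetE.
    by apply: eq_bigr => j _; rewrite gE.
  have -> : \sum_(a : 'I_n * A) rnorm (\sum_(b : 'I_n * B)
      (\matrix_(i, j) ent (S i j)) a.1 b.1 (val a.2) (val b.2) (h b)) ^+ 2
    = \sum_(a : 'I_n) \sum_(i : A) rnorm (l2p (val i) (\sum_b S a b (y b))) ^+ 2.
    rewrite sum_pair; apply: eq_bigr => a _; apply: eq_bigr => i _; congr (rnorm _ ^+ 2).
    rewrite op_sum sum_pair /=.
    apply: eq_bigr => b _; rewrite /y op_sum op_sum; apply: eq_bigr => j _.
    by rewrite mxE.
  have -> : \sum_b rnorm (h b) ^+ 2 = \sum_b rnorm (y b) ^+ 2.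
    rewrite sum_pair.
    by apply: eq_bigr => b _; rewrite yn.
  apply: le_trans (hM y); apply: ler_sum => a _.
  by rewrite (sum_fsetE A (fun k => rnorm (l2p k (\sum_b S a b (y b))) ^+ 2)) l2_norm_le.
have fin (A B : {fset I}) : \sum_a rnorm (l2t A (\sum_b S a b (l2t B (x b)))) ^+ 2 <=
    M ^+ 2 * \sum_b rnorm (x b) ^+ 2.
  have /(opnorm_le _ M0)/(_ (fun b => l2p (val b.2) (x b.1))) := hM A B.
  rewrite (eq_bigr (fun a => rnorm (l2p (val a.2) (\sum_b S a.1 b (l2t B (x b)))) ^+ 2)); last first.
    move=> [a i] _ /=; congr (rnorm _ ^+ 2).
    rewrite op_sum sum_pair /=.
    apply: eq_bigr => b _; rewrite l2tE op_sum op_sum -sum_fsetE; apply: eq_bigr => j _.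
    by rewrite mxE.
  rewrite !sum_pair /= => h.
  have E a : rnorm (l2t A (\sum_b S a b (l2t B (x b)))) ^+ 2 =
     \sum_(i : A) rnorm (l2p (val i) (\sum_b S a b (l2t B (x b)))) ^+ 2.
    by rewrite l2t_normE -sum_fsetE.
  under eq_bigr do rewrite E.
  apply: le_trans h _; rewrite ler_wpM2l ?exprn_ge0//; apply: ler_sum => b _.
  by rewrite (sum_fsetE B (fun k => rnorm (l2p k (x b)) ^+ 2)) l2_norm_le.
have finB (B : {fset I}) : \sum_a rnorm (\sum_b S a b (l2t B (x b))) ^+ 2 <=
    M ^+ 2 * \sum_b rnorm (x b) ^+ 2.
  apply: (@sum_rnorm2_cvg _ _ _ totally _ _ _
    (fun a (A : {fset I}) => l2t A (\sum_b S a b (l2t B (x b))))).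
    by move=> a; exact: l2t_cvg.
  by apply: nearW => A; exact: fin.
apply: (@sum_rnorm2_cvg _ _ _ totally _ _ _
    (fun a (B : {fset I}) => \sum_b S a b (l2t B (x b)))); last first.
  by apply: nearW => A; exact: finB.
move=> a; apply: cvg_bigsum => b; apply: bop_cvg; exact: l2t_cvg.
Qed.

Lemma finite_submx_norm_ge0 n (T : 'M[infmx I H K]_n) A B : 0 <= finite_submx_norm T A B.
Proof. exact: opnorm_ge0. Qed.

Lemma ent_MI S : MI I setT (ent S).
Proof.
split=> //; have [M M0 hM] := opb_exists (fun _ _ : 'I_1 => S).
have := (ent_bound _ M0).1 hM; set U := \matrix_(_, _) _ => hU.
suff -> : const_mx (ent S) = U :> 'M[infmx I H K]_1 by exists M.
by apply/matrixP => i j; rewrite !mxE.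
Qed.

Lemma MI_mxnorm_ent n (S : 'M['B(l2 I H, l2 I K)]_n) :
  MI_mxnorm (map_mx ent S) = bop_mxnorm S.
Proof.
have mE : map_mx ent S = \matrix_(i, j) ent (S i j).
  by apply/matrixP => i j; rewrite !mxE.
have ub (A B : {fset I}) : finite_submx_norm (map_mx ent S) A B <= bop_mxnorm S.
  rewrite mE; apply: (ent_bound _ (opnorm_ge0 _)).1.
  exact: opb_opnorm.
have hs : has_sup [set finite_submx_norm (map_mx ent S) A B | A in [set: {fset I}] & B in [set: {fset I}]].
  split; last by exists (bop_mxnorm S) => _ [A _ [B _ <-]].
  by exists (finite_submx_norm (map_mx ent S) fset0 fset0), fset0 => //; exists fset0.
apply/eqP; rewrite eq_le; apply/andP; split.
  by apply: ge_sup => [|_ [A _ [B _ <-]]]; [exact: hs.1|exact: ub].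
have s0 : 0 <= MI_mxnorm (map_mx ent S).
  apply: le_trans (finite_submx_norm_ge0 (map_mx ent S) fset0 fset0) _.
  by apply: sup_upper_bound => //; exists fset0 => //; exists fset0.
apply/(opnorm_le _ s0)/(ent_bound _ s0) => A B.
by rewrite -mE; apply: sup_upper_bound => //; exists A => //; exists B.
Qed.

Lemma MI_ent (T : infmx I H K) : MI I setT T -> exists S, ent S = T.
Proof.
move=> [_ [C hC]].
have C0 : 0 <= C by exact: le_trans (finite_submx_norm_ge0 _ fset0 fset0) (hC fset0 fset0).
have key (A B : {fset I}) (h : I -> H) :
    \sum_(i <- A) rnorm (\sum_(j <- B) T i j (h j)) ^+ 2 <= C ^+ 2 * \sum_(j <- B) rnorm (h j) ^+ 2.
  have /(opnorm_le _ C0)/(_ (fun b => h (val b.2))) := hC A B.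
  rewrite !sum_pair !big_ord1 /= => H0.
  rewrite -(sum_fsetE B (fun j => rnorm (h j) ^+ 2)); apply: le_trans H0.
  rewrite le_eqVlt; apply/orP; left; apply/eqP; rewrite -sum_fsetE.
  apply: eq_bigr => i _; congr (rnorm _ ^+ 2).
  by rewrite sum_pair big_ord1 /= -sum_fsetE; apply: eq_bigr => j _; rewrite mxE.
have col1 j x (A : {fset I}) : \sum_(i <- A) rnorm (T i j x) ^+ 2 <= C ^+ 2 * rnorm x ^+ 2.
  by have := key A [fset j]%fset (fun _ => x); rewrite big_seq_fset1; under eq_bigr do rewrite big_seq_fset1.
(* Column [j] applied to [x] is a vector of l2(I, K); the operator is assembled from its columns. *)
have /choice[c hc] : forall jx : I * H, exists y : l2 I K,
    (forall i, l2p i y = T i jx.1 jx.2) /\ rnorm y ^+ 2 <= C ^+ 2 * rnorm jx.2 ^+ 2.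
  by move=> [j x]; have [y h1 h2] := l2_vec (col1 j x); exists y.
have cl j : linear (fun x => c (j, x)).
  move=> a x y; apply: l2_ext => i.
  have hc1 z k l : l2p l (c (k, z)) = T l k z by exact: (hc (k, z)).1.
  apply: etrans (hc1 _ _ _) _; rewrite !opD !opZ.
  by congr (_ *: _ + _); apply/esym; exact: hc1.
have cb j x : rnorm (c (j, x)) <= C * rnorm x.
  rewrite -(@ler_pXn2r _ 2) ?nnegrE ?mulr_ge0 ?rnorm_ge0// exprMn.
  exact: (hc (j, x)).2.
have [|S hS _] := @l2_extend R I H (l2 I K) (fun j => mkbop (cl j) (cb j)) C C0.
  move=> B h; apply: l2_norm_lim => A.
  under eq_bigr do rewrite op_sum; apply: le_trans (key A B h).
  rewrite le_eqVlt; apply/orP; left; apply/eqP/eq_bigr => i _; congr (rnorm _ ^+ 2).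
  by apply: eq_bigr => j _; rewrite (hc (j, h j)).1.
exists S; apply/funext => i; apply/funext => j; apply: bopP => x.
by rewrite /ent !bcompE hS (hc (j, x)).1.
Qed.

Definition MIop (X : set 'B(H, K)) : set 'B(l2 I H, l2 I K) :=
  [set S | forall i j, X (ent S i j)].

Lemma MIE X : MI I X = ent @` MIop X.
Proof.
apply/seteqP; split=> [T [hX [C hC]]|_ [S hS <-]]; last first.
  by have [_ hC] := ent_MI S; split.
have [S hS] : exists S, ent S = T by apply: MI_ent; split => //; exists C.
by exists S => // i j; rewrite hS.
Qed.

Lemma ent_form S (x : l2 I H) (y : l2 I K) :
  infmx_form (ent S) (fun i => l2p i x) (fun i => l2p i y) (hdot (S x) y).
Proof.
rewrite /infmx_form; have -> : (fun A : {fset I} => \sum_(i : A) \sum_(j : A)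
   hdot (ent S (val i) (val j) (l2p (val j) x)) (l2p (val i) y) : R[i]^o) =
   (fun A : {fset I} => hdot (S (l2t A x)) (l2t A y) : R[i]^o).
  apply/funext => A; rewrite !l2tE op_sum hdot_sumr -sum_fsetE; apply: eq_bigr => i _.
  rewrite hdot_suml -sum_fsetE; apply: eq_bigr => j _.
  by rewrite /ent !bcompE -adjPr.
apply: hdot_cvg; last exact: l2t_cvg.
by apply: bop_cvg; exact: l2t_cvg.
Qed.

Lemma MI_normal_pullback (f : infmx I H K -> R[i]^o) : MI_normal_functionals f ->
  exists x y, forall S, f (ent S) = nform x y S.
Proof.
move=> [xi [eta [h1 h2 h]]].
have vec (L : hilbertType R) (u : nat -> I -> L) :
    (\esum_(k in [set: nat * I]) (rnorm (u k.1 k.2) ^+ 2)%:E < +oo)%E ->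
    exists x : l2 nat (l2 I L), forall k i, l2p i (l2p k x) = u k i.
  move=> hu; have p k i : (0 <= (rnorm (u k i) ^+ 2)%:E)%E by rewrite lee_fin exprn_ge0// rnorm_ge0.
  have E : (\esum_(k in [set: nat]) \esum_(i in [set: I]) (rnorm (u k i) ^+ 2)%:E < +oo)%E.
    rewrite (esum_esum (J := fun=> setT)) => [|k i _ _]; last exact: p.
    apply: le_lt_trans hu; rewrite le_eqVlt; apply/orP; left; apply/eqP.
    by congr (esum _ _); apply/seteqP; split=> // -[].
  have /choice[v hv] : forall k, exists v : l2 I L, forall i, l2p i v = u k i.
    move=> k; apply: esum_vec; apply/esum_bounded => [i|].
      by rewrite exprn_ge0// rnorm_ge0.
    have /esum_bounded[i|M hM] := hu; first by rewrite exprn_ge0// rnorm_ge0.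
    exists M => A; have := hM [fset (k, i) | i in A]%fset.
    by rewrite big_imfset //= => i j _ _ [].
  have [x hx] : exists x : l2 nat (l2 I L), forall k, l2p k x = v k.
    apply: esum_vec; apply: le_lt_trans E; rewrite le_eqVlt; apply/orP; left; apply/eqP.
    apply: eq_esum => k _; rewrite -esum_l2E; apply: eq_esum => i _.
    by rewrite hv.
  by exists x => k i; rewrite hx hv.
have [x hx] := vec _ _ h1; have [y hy] := vec _ _ h2.
exists x, y => S; have [z [hz fz]] := h _ (ent_MI S).
have zE k : z k = hdot (S (l2p k x)) (l2p k y).
  have := @ent_form S (l2p k x) (l2p k y).
  have -> : (fun i => l2p i (l2p k x)) = xi k by apply/funext => i; rewrite hx.
  have -> : (fun i => l2p i (l2p k y)) = eta k by apply/funext => i; rewrite hy.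
  by move=> /(totally_cvg_unique (hz k)).
apply: (@cvg_unique R[i]^o (@norm_hausdorff _ R[i]^o) _ _ _ _ fz).
have := @nform_series _ _ _ x y S.
have -> // : (fun k => hdot (S (l2p k x)) (l2p k y) : R[i]^o) = z.
by apply/funext => k; rewrite zE.
Qed.

Lemma MI_normal_extend (x : l2 nat (l2 I H)) (y : l2 nat (l2 I K)) :
  exists2 f : infmx I H K -> R[i]^o, MI_normal_functionals f &
    forall S, f (ent S) = nform x y S.
Proof.
have /choice[g hg] : forall T : infmx I H K, exists w : R[i]^o, forall S, ent S = T -> w = nform x y S.
  move=> T; have [[S hS]|nS] := pselect (exists S, ent S = T).
    by exists (nform x y S) => S' hS'; congr nform; apply: ent_inj; rewrite hS hS'.
  (* Off the bounded matrices the value is free; it is set to 0. *)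
  by exists 0 => S hS; exfalso; apply: nS; exists S.
exists g => [|S]; last exact: hg.
exists (fun k i => l2p i (l2p k x)), (fun k i => l2p i (l2p k y)).
have fin (L : hilbertType R) (u : l2 nat (l2 I L)) :
    (\esum_(k in [set: nat * I]) (rnorm (l2p k.2 (l2p k.1 u)) ^+ 2)%:E < +oo)%E.
  have := @esum_esum R nat I setT (fun=> setT) (fun k i => (rnorm (l2p i (l2p k u)) ^+ 2)%:E).
  move=> /(_ _)/esym h; apply: le_lt_trans (esum_l2 u).
  have -> : [set: nat * I] = setT `*`` (fun=> setT) by apply/seteqP; split=> // -[].
  rewrite h => [|i j _ _]; last by rewrite lee_fin exprn_ge0// rnorm_ge0.
  rewrite le_eqVlt; apply/orP; left; apply/eqP; apply: eq_esum => k _.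
  exact: esum_l2E.
split; [exact: fin|exact: fin|move=> T hT].
have [S hS] := MI_ent hT; exists (fun k => hdot (S (l2p k x)) (l2p k y)); split.
  by move=> k; rewrite -hS; exact: ent_form.
rewrite (hg _ _ hS); exact: nform_series.
Qed.

End MatrixOperators.

(** * The w*-topology *)

Section FunctionalTopology.
Context {R : realType}.

Section Convergence.
Context {V : choiceType} (F : set (V -> R[i]^o)).
Local Notation W := (functional_topology F).

Lemma ft_cvg (G : set_system V) (x : V) : Filter G ->
  G --> (x : W) <-> forall f, F f -> f @ G --> f x.
Proof.
move=> FG; pose ev (x : V) := (fun f => \val f x) : {ptws F -> R[i]^o}.
split=> [Gx f Ff|h].
  pose f' : F := SigSub (mem_set Ff).
  have evG : ev @ G --> (ev x : {ptws F -> R[i]^o}).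
    by apply: cvg_trans (@initial_continuous V _ ev x); exact: cvg_app.
  have pc := @proj_continuous F (fun=> R[i]^o) f'.
  by apply: cvg_trans (pc (ev x)); apply: (cvg_app (@proj F (fun=> R[i]^o) f')) evG.
move=> A [B [[C oC <-] Cx]] BA; apply: (filterS BA).
have /(_ C) : ev @ G --> (ev x : {ptws F -> R[i]^o}).
  apply/cvg_sup => f; apply/cvg_image.
    rewrite eqEsubset; split => y //; exists (dfwith (fun=> 0) f y) => //.
  move=> D /(h _ (set_valP f)) fD; exists (@proj F (fun=> R[i]^o) f @^-1` D) => //.
  rewrite eqEsubset; split => [_ [y Dy <-]//|y Dy].
  by exists (dfwith (fun=> 0) f y); rewrite /proj /= dfwithin.
by apply; exact: open_nbhs_nbhs.
Qed.

Lemma ft_ev_continuous f : F f -> continuous (f : W -> R[i]^o).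
Proof. by move=> Ff x; have /ft_cvg : nbhs (x : W) --> (x : W) by []; apply. Qed.

Lemma ft_continuous (T : topologicalType) (g : T -> V) :
  (forall f, F f -> continuous (f \o g)) -> continuous (g : T -> W).
Proof.
by move=> h x; apply/ft_cvg => f Ff; apply: cvg_trans (h f Ff x).
Qed.

Definition ft_base (x : V) : set_system V := [set U |
  exists (s : seq (V -> R[i]^o)) (e : R), [/\ forall f, f \in s -> F f, 0 < e &
  forall y, (forall f, f \in s -> rnorm (f x - f y) < e) -> U y]].

Lemma ft_base_filter x : Filter (ft_base x).
Proof.
split; first by exists [::], 1; split.
- move=> A B [s [e [hs e0 hA]]] [t [d [ht d0 hB]]].
  exists (s ++ t), (Num.min e d); split=> [f||y hy].
  + by rewrite mem_cat => /orP[/hs|/ht].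
  + by rewrite lt_min e0 d0.
  split; [apply: hA|apply: hB] => f fs; have : f \in s ++ t by rewrite mem_cat fs ?orbT.
    by move=> /hy; rewrite lt_min => /andP[].
  by move=> /hy; rewrite lt_min => /andP[].
move=> A B AB [s [e [hs e0 hA]]]; exists s, e; split => // y /hA; exact: AB.
Qed.

Lemma ft_nbhs (x : V) (U : set V) : nbhs (x : W) U -> ft_base x U.
Proof.
have FB := ft_base_filter x.
have : ft_base x --> (x : W); last by apply.
apply/ft_cvg => f Ff; apply/cvg_rnormP => e e0.
exists [:: f], e; split => // [g|y]; first by rewrite inE => /eqP ->.
by apply; rewrite inE.
Qed.

End Convergence.

Section LinearAlgebra.
Context {V : lmodType R[i]}.
Implicit Types (D : set V) (P : set (V -> R[i]^o)).

Definition lin_on D (f : V -> R[i]^o) :=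
  forall a x y, D x -> D y -> f (a *: x + y) = a * f x + f y.

Section Lin.
Context {D : set V} (sD : subspace D) {f : V -> R[i]^o} (lf : lin_on D f).

Lemma lin_on0 : f 0 = 0.
Proof.
have := lf 1 sD.1 sD.1; rewrite scale1r mul1r addr0 => /eqP.
by rewrite -subr_eq subrr eq_sym => /eqP.
Qed.

Lemma lin_onZ a x : D x -> f (a *: x) = a * f x.
Proof. by move=> Dx; rewrite -[_ *: _]addr0 lf// ?lin_on0 ?addr0//; exact: sD.1. Qed.

Lemma lin_onD x y : D x -> D y -> f (x + y) = f x + f y.
Proof. by move=> Dx Dy; have := lf 1 Dx Dy; rewrite scale1r mul1r. Qed.

Lemma lin_onB x y : D x -> D y -> f (x - y) = f x - f y.
Proof.
move=> Dx Dy; rewrite lin_onD//; last exact: subspaceN.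
by rewrite -scaleN1r lin_onZ// mulN1r.
Qed.

End Lin.

(** A functional that vanishes on the common kernel of finitely many others is a combination of
    them. The induction removes one functional and shrinks [D] to its kernel; its coefficient is
    then read off at a single point [x0] of [D] where it does not vanish. *)
Lemma functional_span P D (s : seq (V -> R[i]^o)) (g : V -> R[i]^o) :
  subspace P -> subspace D -> (forall f, P f -> lin_on D f) ->
  (forall f, f \in s -> P f) -> lin_on D g ->
  (forall x, D x -> (forall f, f \in s -> f x = 0) -> g x = 0) ->
  exists2 t, P t & forall x, D x -> g x = t x.
Proof.
move=> sP; elim: s D => [|f s IHs] D sD lP hs lg h.
  by exists 0; [exact: sP.1|move=> x Dx; rewrite h].
have Pf : P f by apply: hs; rewrite inE eqxx.
have hs' k : k \in s -> P k by move=> ks; apply: hs; rewrite inE ks orbT.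
pose D' := [set x | D x /\ f x = 0].
have sD' : subspace D'.
  split; first by split; [exact: sD.1|exact: (lin_on0 sD (lP _ Pf))].
  move=> a x y [Dx fx] [Dy fy]; split; first exact: sD.2.
  by rewrite (lP _ Pf)// fx fy mulr0 addr0.
have [||||t Pt ht] := IHs D' sD'.
- by move=> k Pk a x y [Dx _] [Dy _]; exact: (lP _ Pk).
- by [].
- by move=> a x y [Dx _] [Dy _]; exact: lg.
- move=> x [Dx fx] hx; apply: h => // k; rewrite inE => /orP[/eqP ->//|].
  exact: hx.
have [f0|/existsNP[x0 /not_implyP[Dx0 fx0]]] := pselect (forall x, D x -> f x = 0).
  by exists t => // x Dx; apply: ht; split => //; exact: f0.
have fx0' : f x0 != 0 by exact/eqP.
exists (((g x0 - t x0) / f x0) *: f + t); first exact: sP.2.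
move=> x Dx; pose y := x - (f x / f x0) *: x0.
have D0 : D ((f x / f x0) *: x0) by exact: subspaceZ.
have D'y : D' y.
  split; first exact: subspaceB.
  by rewrite (lin_onB sD (lP _ Pf))// (lin_onZ sD (lP _ Pf))// divfK// subrr.
have := ht y D'y.
rewrite (lin_onB sD lg)// (lin_onZ sD lg)// (lin_onB sD (lP _ Pt))// (lin_onZ sD (lP _ Pt))//.
rewrite !fctE => /eqP; rewrite subr_eq => /eqP ->.
rewrite -[_ *: f x]/(_ * f x).
have aux (a b c d e : R[i]) : e != 0 -> a - c / e * b + c / e * d = (d - b) / e * c + a.
  by move=> e0; field.
exact: aux.
Qed.

(** Continuity at 0 bounds [g] on a neighbourhood given by finitely many functionals. On their
    common kernel [g] is then bounded on all multiples of a vector, hence 0. The subspace [P] may be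
    larger than [F], which is not assumed to be closed under combinations. *)
Lemma continuous_span (F P : set (V -> R[i]^o)) D (g : V -> R[i]^o) :
  F `<=` P -> subspace P -> subspace D -> (forall f, P f -> lin_on D f) -> lin_on D g ->
  {within (D : set (functional_topology F)),
    continuous (g : functional_topology F -> R[i]^o)} ->
  exists2 t, P t & forall x, D x -> g x = t x.
Proof.
move=> FP sP sD lP lg; rewrite subspace_continuousP => /(_ 0 sD.1)/(@cvg_rnormP R R[i]^o)/(_ 1 ltr01).
move=> /ft_nbhs[s [e [hs e0 he]]].
apply: (functional_span sP sD lP _ lg) => [f /hs/FP//|x Dx hx].
have {}he y : (forall f, f \in s -> rnorm (f 0 - f y) < e) -> D y -> rnorm (g 0 - g y) < 1 := he y.
have small (n : nat) : n%:R * rnorm (g x) < 1.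
  have Dn : D (n%:R *: x) by exact: subspaceZ.
  have := he (n%:R *: x); rewrite (lin_on0 sD lg) (lin_onZ sD lg)// sub0r rnormN rnormM.
  have -> : rnorm (n%:R : R[i]^o) = n%:R.
    by rewrite -(rmorph_nat (real_complex R) n) rnormC ger0_norm.
  apply => // f fs; rewrite (lin_on0 sD (lP _ (FP _ (hs _ fs)))) (lin_onZ sD (lP _ (FP _ (hs _ fs))))//.
  by rewrite hx// mulr0 subr0 rnorm0.
apply: rnorm_eq0; apply/eqP/negPn/negP => gx.
have gp : 0 < rnorm (g x) by rewrite lt_neqAle eq_sym gx rnorm_ge0.
have := small (Num.truncn (rnorm (g x))^-1).+1.
rewrite -ltr_pdivlMr// div1r => h2.
have := Num.Theory.truncnS_gt (rnorm (g x))^-1.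
by rewrite ltNge (ltW h2).
Qed.

(** On the sum of [D] and the line through [x], the coefficient of [x] is a functional that vanishes
    on [D]. It is a combination of the finitely many functionals defining a neighbourhood of [x]
    disjoint from [D], and this combination extends it to the whole space. *)
Lemma closed_separation (F : set (V -> R[i]^o)) D (x : V) :
  subspace F -> subspace D -> (forall f, F f -> lin_on setT f) ->
  ~ closure (D : set (functional_topology F)) x ->
  exists2 t, F t & (forall y, D y -> t y = 0) /\ t x != 0.
Proof.
move=> sF sD lF ncx; have nDx : ~ D x by move=> /(@subset_closure (functional_topology F)).
have : nbhs (x : functional_topology F) (~` D).
  have /existsNP[U /not_implyP[xU /set0P/negP/negPn/eqP UD]] := ncx.
  by apply: filterS xU => y Uy Dy; rewrite -[False]/(set0 y) -UD.
move=> /ft_nbhs[s [e [hs e0 he]]].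
pose E := [set y | exists l, D (y - l *: x)].
have sE : subspace E.
  split; first by exists 0; rewrite scale0r subr0; exact: sD.1.
  move=> a y z [l Dl] [m Dm]; exists (a * l + m).
  have -> : a *: y + z - (a * l + m) *: x = a *: (y - l *: x) + (z - m *: x).
    by rewrite scalerBr scalerDl scalerA opprD addrACA.
  exact: sD.2.
have uniq l m y : D (y - l *: x) -> D (y - m *: x) -> l = m.
  move=> Dl Dm; apply/eqP/negPn/negP => lm; apply: nDx.
  have := subspaceB sD Dl Dm.
  have -> : y - l *: x - (y - m *: x) = (m - l) *: x.
    by rewrite scalerBl opprB addrC addrA subrK.
  move=> /(subspaceZ sD (m - l)^-1); rewrite scalerA mulVf ?scale1r//.
  by rewrite subr_eq0 eq_sym.
have /choice[g hg] : forall y, exists l : R[i]^o, E y -> D (y - (l : R[i]) *: x).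
  by move=> y; have [[l hl]|nE] := pselect (E y); [exists l|exists 0].
have gE l y : D (y - l *: x) -> g y = l.
  by move=> Dl; apply: (uniq _ _ y) => //; apply: hg; exists l.
have [||t Ft ht] := @functional_span F E s g sF sE (fun f Ff a y z _ _ => lF f Ff a y z I I) hs.
- move=> a y z [l Dl] [m Dm]; rewrite (gE _ _ Dl) (gE _ _ Dm); apply: gE.
  have -> : a *: y + z - (a * l + m) *: x = a *: (y - l *: x) + (z - m *: x).
    by rewrite scalerBr scalerDl scalerA opprD addrACA.
  exact: sD.2.
- move=> y [l Dl] hy; rewrite (gE _ _ Dl); apply/eqP/negPn/negP => l0.
  have l0' : l != 0 by [].
  (* This is [x - l^-1 y]: a point of [D] at which every functional of [s] has the same value as at
     [x], so it would lie in the neighbourhood that avoids [D]. *)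
  pose a := (- l^-1) *: (y - l *: x).
  have Da : D a by exact: subspaceZ.
  apply: (he a) Da => f fs; have lf := lF f (hs f fs).
  have sT : subspace [set: V] by [].
  rewrite /a (lin_onZ sT lf)// (lin_onB sT lf)// (lin_onZ sT lf)// hy//.
  have -> : f x - - l^-1 * (0 - l * f x) = 0 :> R[i].
    have aux (b c : R[i]) : c != 0 -> b - - c^-1 * (0 - c * b) = 0 by move=> c0; field.
    exact: aux.
  by rewrite rnorm0.
exists t => //; split=> [y Dy|].
  by rewrite -ht ?(gE 0 y) ?scale0r ?subr0//; exists 0; rewrite scale0r subr0.
rewrite -ht; last by exists 1; rewrite scale1r subrr; exact: sD.1.
rewrite (gE 1 x) ?scale1r ?subrr ?oner_eq0//; exact: sD.1.
Qed.

End LinearAlgebra.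
End FunctionalTopology.

Section NormalSpace.
Context {R : realType} {H K : hilbertType R}.
Implicit Types (x : l2 nat H) (y : l2 nat K).

Lemma nform_linear x y : lin_on setT (nform x y).
Proof.
by move=> a S T _ _; rewrite /nform ampl_linear bopDE bopZE hdotDl hdotZl.
Qed.

Lemma nform_le x y T : rnorm (nform x y T) <= opn T * (rnorm x * rnorm y).
Proof.
rewrite (le_trans (cauchy_schwarz _ _))// mulrA ler_wpM2r ?rnorm_ge0//.
exact: ampl_le.
Qed.

Lemma nform_Dl x x' y : nform (x + x') y = nform x y + nform x' y.
Proof. by apply/funext => T; rewrite /nform opD hdotDl. Qed.

Lemma nform_Bl x x' y : nform (x - x') y = nform x y - nform x' y.
Proof. by apply/funext => T; rewrite /nform opB hdotBl. Qed.

Lemma nform_Zl a x y : nform (a *: x) y = a *: nform x y.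
Proof. by apply/funext => T; rewrite /nform opZ hdotZl. Qed.

Lemma nform_Zr a x y : nform x (a *: y) = Num.conj a *: nform x y.
Proof. by apply/funext => T; rewrite /nform hdotZr. Qed.

Lemma nform_Dr x y y' : nform x (y + y') = nform x y + nform x y'.
Proof. by apply/funext => T; rewrite /nform hdotDr. Qed.

Lemma nform0l y : nform (0 : l2 nat H) y = 0.
Proof. by apply/funext => T; rewrite /nform op0 hdot0l. Qed.

Lemma nform_l2i i j (h : H) (k : K) T :
  nform (l2i i h) (l2i j k) T = if i == j then hdot (T h) k else 0.
Proof. by rewrite /nform ampl_l2i hdot_l2i. Qed.

End NormalSpace.

Section NormalSums.
Context {R : realType}.

(** The numbers contain infinitely many disjoint copies of themselves, and [n] selects one of
    them. *)
Definition shift_idx (n k : nat) : nat := @choice.pickle (nat * nat)%type (n, k).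

Lemma shift_idx_inj n : injective (shift_idx n).
Proof. by move=> k l /(pcan_inj choice.pickleK) []. Qed.

Lemma shift_idx_neq n m k l : n != m -> shift_idx n k != shift_idx m l.
Proof. by apply: contra => /eqP/(pcan_inj choice.pickleK)[-> _]. Qed.

Section Shift.
Context {H : hilbertType R}.

Definition l2sh (n : nat) : 'B(l2 nat H, l2 nat H) :=
  s2val (cid2 (@reindex_exists R nat nat H _ (shift_idx_inj (n := n)))).

Lemma l2sh_l2i n i x : l2sh n (l2i i x) = l2i (shift_idx n i) x.
Proof. exact: (s2valP (cid2 (@reindex_exists R nat nat H _ (shift_idx_inj (n := n))))). Qed.

Lemma adj_l2sh n m x : adj (l2sh n) (l2sh m x) = if n == m then x else 0.
Proof.
suff E : bcomp (adj (l2sh n)) (l2sh m) = if n == m then idop _ else 0.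
  by have := congr1 (fun S => bop_fun S x) E; rewrite bcompE => ->; case: eqP.
apply: l2_bop_eq => i y; apply: l2_hdot_eq => j z.
rewrite bcompE -adjPr !l2sh_l2i hdot_l2i.
have [->|nm] := eqVneq n m.
  by rewrite (inj_eq (shift_idx_inj (n := m))) idopE hdot_l2i.
by rewrite (negbTE (shift_idx_neq _ _ _)) ?[m == n]eq_sym// bop0E hdot0l.
Qed.

Lemma hdot_l2sh n m x y : hdot (l2sh n x) (l2sh m y) = if n == m then hdot x y else 0.
Proof. by rewrite adjP adj_l2sh; case: eqP => // _; rewrite hdot0r. Qed.

Lemma rnorm_l2sh n x : rnorm (l2sh n x) = rnorm x.
Proof.
apply/eqP; rewrite -(@eqrXn2 _ 2) ?rnorm_ge0//; apply/eqP/complexI.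
by rewrite -!hdotxx hdot_l2sh eqxx.
Qed.

End Shift.

Context {H K : hilbertType R}.

Lemma ampl_l2sh (T : 'B(H, K)) n x : ampl T (l2sh n x) = l2sh n (ampl T x).
Proof.
suff : bcomp (ampl T) (l2sh n) = bcomp (l2sh n) (ampl T) by move=> /(congr1 (fun S => bop_fun S x)).
by apply: l2_bop_eq => i y; rewrite !bcompE l2sh_l2i !ampl_l2i l2sh_l2i.
Qed.

(** The shifts have orthogonal ranges and commute with amplifications, so two functionals can be
    placed side by side in one pair of vectors. This is why normal functionals form a subspace. *)
Lemma nform_sum2 (x x' : l2 nat H) (y y' : l2 nat K) :
  nform x y + nform x' y' =
  nform (l2sh 0 x + l2sh 1 x') (l2sh 0 y + l2sh 1 y').
Proof.
apply/funext => T; rewrite !fctE /nform opD !ampl_l2sh hdotDl !hdotDr !hdot_l2sh /=.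
by rewrite addr0 add0r.
Qed.

Lemma rnorm_l2sh2 (L : hilbertType R) (x x' : l2 nat L) :
  rnorm (l2sh 0 x + l2sh 1 x') ^+ 2 = rnorm x ^+ 2 + rnorm x' ^+ 2.
Proof. by rewrite rnormDE hdot_l2sh /= mulr0 addr0 !rnorm_l2sh. Qed.

Lemma normal_subspace : subspace (@normal_functionals R H K).
Proof.
split; first by apply/normal_nform; exists 0, 0; rewrite nform0l.
move=> a f g /normal_nform[x [y ->]] /normal_nform[x' [y' ->]].
apply/normal_nform; rewrite -nform_Zl nform_sum2.
by exists (l2sh 0 (a *: x) + l2sh 1 x'), (l2sh 0 y + l2sh 1 y').
Qed.

Lemma normal_linear (f : 'B(H, K) -> R[i]^o) : normal_functionals f -> lin_on setT f.
Proof. by move=> /normal_nform[x [y ->]]; exact: nform_linear. Qed.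

Lemma nform_series_sum (x : nat -> l2 nat H) (y : nat -> l2 nat K) (M : R) :
  (forall A : {fset nat}, \sum_(n <- A) rnorm (x n) ^+ 2 <= M) ->
  (forall A : {fset nat}, \sum_(n <- A) rnorm (y n) ^+ 2 <= M) ->
  exists X Y, forall T, series (fun n => nform (x n) (y n) T) @ \oo --> nform X Y T.
Proof.
have vec (L : hilbertType R) (u : nat -> l2 nat L) :
    (forall A : {fset nat}, \sum_(n <- A) rnorm (u n) ^+ 2 <= M) ->
    exists X : l2 nat L, (fun A : {fset nat} => \sum_(n <- A) l2sh n (u n)) @ totally --> X.
  move=> hM; apply: (orthogonal_sum_cvg (M := M)) => [i j ij|A].
    by rewrite hdot_l2sh (negbTE ij).
  by under eq_bigr do rewrite rnorm_l2sh.
move=> /vec[X hX] /vec[Y hY]; exists X, Y => T.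
apply: (@totally_series _ R[i]^o).
have -> : (fun A : {fset nat} => \sum_(n <- A) nform (x n) (y n) T) =
  (fun A : {fset nat} => hdot (ampl T (\sum_(n <- A) l2sh n (x n))) (\sum_(n <- A) l2sh n (y n)) : R[i]^o).
  apply/funext => A; rewrite (op_sum (ampl T)).
  rewrite hdot_suml; apply: eq_big_seq => i iA.
  rewrite hdot_sumr ampl_l2sh (@sum_fset_delta _ _ _ i) ?hdot_l2sh ?eqxx// => j ji.
  by rewrite hdot_l2sh eq_sym (negbTE ji).
by apply: hdot_cvg => //; exact: bop_cvg.
Qed.

End NormalSums.

Section Polars.
Context {R : realType}.

Section Polar.
Context {H K : hilbertType R}.
Implicit Types (D : set 'B(H, K)) (T : 'B(H, K)).

Section NormalLinear.
Context {f : 'B(H, K) -> R[i]^o} (nf : normal_functionals f).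

Lemma normal0 : f 0 = 0.
Proof. exact: lin_on0 (normal_linear nf). Qed.

Lemma normalD x y : f (x + y) = f x + f y.
Proof. exact: (@lin_onD _ _ setT _ (normal_linear nf)). Qed.

Lemma normalZ a x : f (a *: x) = a * f x.
Proof. by apply: (@lin_onZ _ _ setT _ _ (normal_linear nf)). Qed.

Lemma normalB x y : f (x - y) = f x - f y.
Proof. by apply: (@lin_onB _ _ setT _ _ (normal_linear nf)). Qed.

End NormalLinear.

(** The bipolar theorem for subspaces. It turns w*-closedness into vanishing conditions for normal
    functionals, the form in which it is mostly used below. *)
Lemma closure_polar D T : subspace D ->
  closure (D : set (wstar_op H K)) T <->
  forall f : 'B(H, K) -> R[i]^o, normal_functionals f -> (forall S, D S -> f S = 0) -> f T = 0.
Proof.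
move=> sD; split=> [cT f nf fD|h].
  apply: (@eps_eq R R[i]^o _ _ 1) => e e0.
  have := @ft_ev_continuous R _ _ f nf T.
  move=> /(@cvg_rnormP R R[i]^o _ _ (nbhs_filter _))/(_ _ e0)/cT[S [DS]].
  by rewrite (fD S)// mul1r => /ltW.
apply: contrapT => nc.
have [t nt [tD /eqP]] := closed_separation (@normal_subspace R H K) sD (@normal_linear R H K) nc.
by apply; exact: h.
Qed.

Lemma closed_polar D : subspace D -> wstar_closed D <->
  forall T, (forall f : 'B(H, K) -> R[i]^o, normal_functionals f -> (forall S, D S -> f S = 0) -> f T = 0) -> D T.
Proof.
move=> sD; split=> [cD T h|h T cT]; first by apply: cD; exact/(closure_polar _ sD).
by apply: h; exact/(closure_polar _ sD).
Qed.

Lemma lspan_subspace (V : lmodType R[i]) (S : set V) : subspace (lspan S).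
Proof.
split; first by exists 0%N, (fun=> 0), (fun=> 0); split; [case|rewrite big_ord0].
move=> a _ _ [m [b [u [hu ->]]]] [n [c [v [hv ->]]]].
exists (m + n)%N, (fun i => match fintype.split i with inl j => a * b j | inr j => c j end),
  (fun i => match fintype.split i with inl j => u j | inr j => v j end).
split=> [i|]; first by case: (fintype.split i).
rewrite big_split_ord /= scaler_sumr; congr (_ + _); apply: eq_bigr => i _.
  by rewrite (unsplitK (inl i)) scalerA.
by rewrite (unsplitK (inr i)).
Qed.

Lemma lspan_sub (V : lmodType R[i]) (S : set V) : S `<=` lspan S.
Proof.
move=> x Sx; exists 1%N, (fun=> 1), (fun=> x).
by split=> //; rewrite big_ord1 scale1r.
Qed.

Lemma wstar_span_polar (S : set 'B(H, K)) T : wstar_span S T <->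
  forall f : 'B(H, K) -> R[i]^o, normal_functionals f -> (forall s, S s -> f s = 0) -> f T = 0.
Proof.
rewrite /wstar_span closure_polar; last exact: lspan_subspace.
split=> h f nf fS; apply: h => //.
  move=> _ [n [a [v [hv ->]]]].
  elim/big_ind : _ => [|x y fx fy|i _].
  - exact: normal0.
  - by rewrite normalD// fx fy addr0.
  - by rewrite normalZ// fS// mulr0.
by move=> s Ss; apply: fS; exact: lspan_sub.
Qed.

(** On finitely supported vectors this is convergence of finitely many coordinates; the uniform
    bound [M] extends it to all of l2(I, H). *)
Lemma ampl_sot (I : choiceType) J (F : set_system J) {FF : Filter F}
    (T : J -> 'B(H, K)) T0 (M : R) x :
  (forall j x, rnorm (T j x) <= M * rnorm x) ->
  (forall x, (fun j => T j x) @ F --> T0 x) ->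
  (fun j => ampl (I := I) (T j) x) @ F --> ampl T0 x.
Proof.
move=> TM cT; apply/cvg_rnormP => e e0.
pose N := Num.max M 0 + opn T0.
have N0 : 0 <= N by rewrite addr_ge0 ?opn_ge0// le_max lexx orbT.
have e2 : 0 < e / 2 by rewrite divr_gt0.
have [d d0 hd] := eps_split N0 e2.
have [A [h hx]] := l2_dense x d0.
pose s := \sum_(i <- A) l2i i (h i).
have TE S : ampl S s = \sum_(i <- A) l2i i (S (h i)).
  by rewrite /s op_sum; apply: eq_bigr => i _; rewrite ampl_l2i.
have cs : (fun j => ampl (T j) s) @ F --> ampl T0 s.
  rewrite TE (_ : (fun j => _) = (fun j => \sum_(i <- A) l2i i (T j (h i)))); last first.
    by apply/funext => j; rewrite TE.
  by apply: (cvg_bigsum (f := fun i j => l2i i (T j (h i)))) => i; exact: bop_cvg.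
move/cvg_rnormP : cs => /(_ _ e2); apply: filterS => j hj.
have b1 : rnorm (ampl (T j) (x - s)) <= Num.max M 0 * d.
  rewrite (le_trans (ampl_le _ _))// ler_pM ?opn_ge0 ?rnorm_ge0//.
  apply: opn_le => [|y]; first by rewrite le_max lexx orbT.
  by rewrite (le_trans (TM j y))// ler_wpM2r ?rnorm_ge0// le_max lexx.
have b2 : rnorm (ampl T0 (x - s)) <= opn T0 * d.
  by rewrite (le_trans (ampl_le _ _))// ler_wpM2l ?opn_ge0.
have -> : ampl T0 x - ampl (T j) x =
    (ampl T0 s - ampl (T j) s) + (ampl T0 (x - s) - ampl (T j) (x - s)).
  by rewrite !opB [RHS]addrACA -opprD ![_ + (_ - _)]addrC !subrK.
apply: le_lt_trans (ler_rnormD _ _) _.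
have := ler_rnormB (ampl T0 (x - s)) (ampl (T j) (x - s)).
move: hd b1 b2 hj; rewrite /N mulrDl; lra.
Qed.

(** A normal functional is a vector functional of an amplification, so bounded strong limits are
    w*-limits. *)
Lemma sot_closed (D : set 'B(H, K)) J (F : set_system J) {FF : ProperFilter F}
    (T : J -> 'B(H, K)) T0 (M : R) :
  subspace D -> wstar_closed D -> (forall j, D (T j)) ->
  (forall j x, rnorm (T j x) <= M * rnorm x) ->
  (forall x, (fun j => T j x) @ F --> T0 x) -> D T0.
Proof.
move=> sD /(closed_polar sD) h DT TM cT; apply: h => f /normal_nform[x [y ->]] fD.
have h1 : (fun j => hdot (ampl (T j) x) y : R[i]^o) @ F --> (hdot (ampl T0 x) y : R[i]^o).
  by apply: hdot_cvg => //; [exact: ampl_sot cT|exact: cvg_cst].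
have h2 : (fun j => hdot (ampl (T j) x) y : R[i]^o) @ F --> (0 : R[i]^o).
  rewrite (_ : (fun j => _) = cst 0); first exact: cvg_cst.
  by apply/funext => j; rewrite -[LHS]/(nform x y (T j)) fD.
exact: (cvg_unique (@norm_hausdorff _ R[i]^o) h1 h2).
Qed.

Lemma nformE x y (T : 'B(H, K)) : nform x y T = hdot (ampl T x) y.
Proof. by []. Qed.

Lemma nform_single h k (T : 'B(H, K)) :
  nform (l2i 0%N h) (l2i 0%N k) T = hdot (T h) k.
Proof. by rewrite nform_l2i eqxx. Qed.

Lemma vector_normal h k : normal_functionals (fun T : 'B(H, K) => hdot (T h) k : R[i]^o).
Proof.
apply/normal_nform; exists (l2i 0%N h), (l2i 0%N k).
by apply/funext => T; rewrite nform_single.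
Qed.

End Polar.

Lemma ampl_comp (I : choiceType) (H1 H2 H3 : hilbertType R) (S : 'B(H2, H3)) (T : 'B(H1, H2)) x :
  ampl (bcomp S T) x = ampl S (ampl (I := I) T x).
Proof.
suff E : ampl (bcomp S T) = bcomp (ampl S) (ampl (I := I) T) by rewrite E.
by apply: l2_bop_eq => i y; rewrite bcompE !ampl_l2i.
Qed.

Lemma adj_ampl (I : choiceType) (H1 H2 : hilbertType R) (T : 'B(H1, H2)) : adj (ampl T) = ampl (I := I) (adj T).
Proof.
apply: l2_bop_eq => i y; apply: l2_hdot_eq => j h.
rewrite -adjPr !ampl_l2i !hdot_l2i; case: eqP => // _; exact: adjPr.
Qed.

Section Composition.
Context {H1 H2 K1 K2 : hilbertType R}.

Lemma normal_comp (f : 'B(K1, K2) -> R[i]^o) (a : 'B(H2, K2)) (b : 'B(K1, H1)) :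
  normal_functionals f ->
  normal_functionals (fun T : 'B(H1, H2) => f (bcomp (bcomp a T) b)).
Proof.
move=> /normal_nform[x [y ->]]; apply/normal_nform; exists (ampl b x), (ampl (adj a) y).
by apply/funext => T; rewrite !nformE !ampl_comp -adj_ampl adjP.
Qed.

Lemma normal_adj (f : 'B(H1, H2) -> R[i]^o) : normal_functionals f ->
  normal_functionals (fun T : 'B(H2, H1) => Num.conj (f (adj T)) : R[i]^o).
Proof.
move=> /normal_nform[x [y ->]]; apply/normal_nform; exists y, x.
by apply/funext => T; rewrite !nformE -adj_ampl -adjPr -hdotC.
Qed.

End Composition.
End Polars.

(** * Zorn's lemma for families of functions and the Hahn-Banach theorem *)

Section MinimalFunctions.
Context {R : realType}.

Lemma minimal_function T (C : set (T -> R)) (q0 : T -> R) : C q0 ->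
  (forall A : set (T -> R), A `<=` C -> A !=set0 ->
     total_on A (fun f g => forall t, f t <= g t) ->
     exists2 g, C g & forall f, A f -> forall t, g t <= f t) ->
  exists q, [/\ C q, (forall t, q t <= q0 t) &
    forall q', C q' -> (forall t, q' t <= q t) -> q' = q].
Proof.
move=> Cq0 hC; pose S := {q : T -> R | C q /\ forall t, q t <= q0 t}.
pose r (a b : S) := `[< forall t, sval b t <= sval a t >].
have [||||[q [Cq qq0]] hq] := @Zorn S r.
- by move=> a; apply/asboolP.
- by move=> a b c /asboolP ab /asboolP bc; apply/asboolP => t; rewrite (le_trans (bc t)).
- move=> [a pa] [b pb] /asboolP/= ab /asboolP/= ba.
  have eab : a = b by apply/funext => t; apply/eqP; rewrite eq_le ab ba.
  by move: pb; rewrite -eab => pb; congr exist; exact: Prop_irrelevance.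
- move=> A tA; have [[a Aa]|nA] := pselect (A !=set0); last first.
    by exists (exist _ q0 (conj Cq0 (fun t => lexx (q0 t)))) => s As; case: nA; exists s.
  have [|||g Cg hg] := hC [set sval a | a in A].
  - by move=> _ [b _ <-]; exact: (svalP b).1.
  - by exists (sval a), a.
  - move=> _ _ [b Ab <-] [c Ac <-].
    by have [/asboolP|/asboolP] := tA _ _ Ab Ac; [right|left].
  have gq0 t : g t <= q0 t.
    apply: (le_trans (hg (sval a) _ t)); [by exists a|exact: (svalP a).2].
  by exists (exist _ g (conj Cg gq0)) => s As; apply/asboolP => t; apply: hg; exists s.
exists q; split => // q' Cq' q'q.
have pq' : C q' /\ forall t, q' t <= q0 t by split=> // t; rewrite (le_trans (q'q t)).
have e : exist _ q' pq' = exist _ q (conj Cq qq0) :> S by apply: hq; apply/asboolP.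
by have := congr1 sval e.
Qed.

(** The nearly minimal member of [A] depends on the point; in a chain, the smaller of two such
    members serves at both points. *)
Lemma chain_inf T (A : set (T -> R)) (b : T -> R) : A !=set0 ->
  (forall f, A f -> forall t, b t <= f t) ->
  exists g : T -> R, (forall f, A f -> forall t, g t <= f t) /\
    forall t (e : R), 0 < e -> exists2 f, A f & f t < g t + e.
Proof.
move=> [a Aa] hb; exists (fun t => inf [set f t | f in A]).
have hi t : has_inf [set f t | f in A].
  by split; [exists (a t), a|exists (b t) => _ [f Af <-]; exact: hb].
split=> [f Af t|t e e0]; first by apply: (inf_lbound (hi t).2); exists f.
by have [_ [f Af <-] hf] := inf_adherent e0 (hi t); exists f.
Qed.

End MinimalFunctions.

Section HahnBanach.
Context {R : realType} {V : lmodType R[i]} (p : V -> R).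
Hypothesis pD : forall x y, p (x + y) <= p x + p y.
Hypothesis pZ : forall a x, p (a *: x) = rnorm (a : R[i]^o) * p x.

Let p0 : p 0 = 0.
Proof. by rewrite -(scale0r 0) pZ rnorm0 mul0r. Qed.

Let pge0 x : 0 <= p x.
Proof.
have := pD x (- x); rewrite subrr p0 -scaleN1r pZ rnormN.
have -> : rnorm (1 : R[i]^o) = 1 by rewrite (rnormC (1 : R)) normr1.
by rewrite mul1r -mulr2n pmulrn_lge0.
Qed.

Let sublin : set (V -> R) := [set q | [/\ forall x y, q (x + y) <= q x + q y,
  forall (t : R) x, 0 <= t -> q (t%:C *: x) = t * q x & forall x, q x <= p x]].

Let sublin0 q : sublin q -> q 0 = 0.
Proof. by move=> [_ qZ _]; rewrite -(scaler0 _ 0) qZ// mul0r. Qed.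

Let sublin_ge q x : sublin q -> - p x <= q x.
Proof.
move=> sq; have [qD _ qp] := sq.
have := qD x (- x); rewrite subrr sublin0// => h.
have := qp (- x); rewrite -scaleN1r pZ rnormN.
have -> : rnorm (1 : R[i]^o) = 1 by rewrite (rnormC (1 : R)) normr1.
by rewrite scaleN1r; lra.
Qed.

(* The largest sublinear [q' <= q] with [q' (- a) <= - q a]. *)
Let sublin_tilt q a : sublin q -> exists q', [/\ sublin q', forall x, q' x <= q x &
  forall x, q' x <= q (x + a) - q a].
Proof.
move=> sq; have [qD qZ qp] := sq.
pose S x := [set q (x + t%:C *: a) - t * q a | t in [set t : R | 0 <= t]].
have Sn x : S x !=set0 by exists (q (x + (0 : R)%:C *: a) - 0 * q a), 0 => /=.
have Slb x : lbound (S x) (- q (- x)).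
  move=> _ [t /= t0 <-]; have := qD (x + t%:C *: a) (- x).
  by rewrite addrAC subrr add0r qZ//; lra.
have Si x : has_inf (S x) by split; [exact: Sn|exists (- q (- x))].
have leS x t : 0 <= t -> inf (S x) <= q (x + t%:C *: a) - t * q a.
  by move=> t0; apply: (inf_lbound (Si x).2); exists t.
have adh x (e : R) : 0 < e -> exists2 t, 0 <= t & q (x + t%:C *: a) - t * q a < inf (S x) + e.
  by move=> e0; have [_ [t t0 <-] h] := inf_adherent e0 (Si x); exists t.
exists (fun x => inf (S x)); split.
- split=> [x y|t x t0|x].
  + apply: ler_eps => e e0; have e2 : 0 < e / 2 by rewrite divr_gt0.
    have [s s0 hs] := adh x _ e2; have [t t0 ht] := adh y _ e2.
    rewrite (le_trans (leS _ (s + t) _)) ?addr_ge0//.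
    have -> : x + y + (s + t)%:C *: a = (x + s%:C *: a) + (y + t%:C *: a).
      by rewrite rmorphD /= scalerDl addrACA.
    have := qD (x + s%:C *: a) (y + t%:C *: a); lra.
  + have [->|tn0] := eqVneq t 0.
      rewrite scale0r mul0r; apply/eqP; rewrite eq_le; apply/andP; split.
        by rewrite (le_trans (leS _ 0 _))// scale0r addr0 sublin0// mul0r subr0.
      apply: lb_le_inf (Sn 0) _ => _ [s s0 <-].
      by rewrite add0r qZ// subrr.
    have tp : 0 < t by rewrite lt_neqAle eq_sym tn0.
    have key u y : 0 < u -> inf (S (u%:C *: y)) <= u * inf (S y).
      move=> u0; apply: ler_eps => e e0.
      have eu : 0 < e / u by rewrite divr_gt0.
      have [s s0 hs] := adh y _ eu.
      rewrite (le_trans (leS _ (u * s) _)) ?mulr_ge0 ?(ltW u0)//.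
      rewrite rmorphM /= -scalerA -scalerDr qZ; last exact: ltW.
      rewrite -mulrA -mulrBr.
      have -> : e = u * (e / u) by rewrite mulrCA divff ?mulr1// gt_eqF.
      by rewrite -mulrDr; apply: ler_wpM2l; exact: ltW.
    apply/eqP; rewrite eq_le key//=.
    have := key t^-1 (t%:C *: x); rewrite invr_gt0 => /(_ tp).
    rewrite scalerA -rmorphM /= mulVf// scale1r.
    by rewrite ler_pdivlMl.
  + by rewrite (le_trans (leS _ 0 _))// scale0r addr0 mul0r subr0.
- by move=> x; rewrite (le_trans (leS _ 0 _))// scale0r addr0 mul0r subr0.
- by move=> x; rewrite (le_trans (leS _ 1 _))// scale1r mul1r.
Qed.

Lemma hahn_banach u : exists l : V -> R[i]^o, [/\ lin_on setT l,
  forall x, rnorm (l x) <= p x & l u = (p u)%:C].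
Proof.
have sp : sublin p by split=> // t x t0; rewrite pZ rnormC ger0_norm.
(* The tilt at [u] gives [q0 (- u) <= - p u], which forces a linear functional below [q0] to take
   the value [p u] at [u]. *)
have [q0 [sq0 q0p q0u]] := sublin_tilt u sp.
have [|q [sq qq0 qmin]] := @minimal_function R V sublin q0 sq0.
  move=> A AC A0 tA.
  have [|g [gA hg]] := @chain_inf R V A (fun x => - p x) A0.
    by move=> f /AC sf t; exact: sublin_ge.
  exists g => //; split=> [x y|t x t0|x].
  - apply: ler_eps => e e0; have e2 : 0 < e / 2 by rewrite divr_gt0.
    have [f1 Af1 h1] := hg x _ e2; have [f2 Af2 h2] := hg y _ e2.
    have [f [Af f1' f2']] : exists f, [/\ A f, f x <= f1 x & f y <= f2 y].
      by have [h|h] := tA _ _ Af1 Af2; [exists f1|exists f2].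
    have [fD _ _] := AC _ Af.
    by rewrite (le_trans (gA _ Af _))// (le_trans (fD _ _))//; lra.
  - have key s y : 0 <= s -> g (s%:C *: y) <= s * g y.
      move=> s0; apply: ler_eps => e e0.
      have [d d0 hd] := eps_split s0 e0.
      have [f Af hf] := hg y _ d0; have [_ fZ _] := AC _ Af.
      rewrite (le_trans (gA _ Af _))// fZ//.
      rewrite (le_trans (ler_wpM2l s0 (ltW hf)))// mulrDr; lra.
    apply/eqP; rewrite eq_le key//=.
    have [->|tn0] := eqVneq t 0.
      rewrite mul0r scale0r; apply: ler_eps => e e0.
      have [f Af hf] := hg 0 _ e0.
      by rewrite -(sublin0 (AC _ Af)) ltW.
    have tp : 0 < t by rewrite lt_neqAle eq_sym tn0.
    have := key t^-1 (t%:C *: x); rewrite invr_ge0 => /(_ t0).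
    rewrite scalerA -rmorphM /= mulVf// scale1r.
    by rewrite ler_pdivlMl.
  - by have [f Af] := A0; have [_ _ fp] := AC _ Af; rewrite (le_trans (gA _ Af _)).
have [qD qZ qp] := sq.
have qadd x a : q (x + a) = q x + q a.
  apply/eqP; rewrite eq_le qD/=.
  have [q' [sq' q'q q'a]] := sublin_tilt a sq.
  have := q'a x; rewrite (qmin q')//; lra.
have q00 := sublin0 sq.
have qN x : q (- x) = - q x.
  by apply/eqP; rewrite -addr_eq0 addrC -qadd subrr q00.
have qR (t : R) x : q (t%:C *: x) = t * q x.
  have [t0|/ltW t0] := leP 0 t; first exact: qZ.
  rewrite -[t]opprK rmorphN /= scaleNr qN qZ ?oppr_ge0//; ring.
have quE : q u = p u.
  apply/eqP; rewrite eq_le qp /=.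
  have := q0u (- u); rewrite addNr p0 => h.
  have := qq0 (- u); rewrite qN; lra.
(* The complex functional whose real part is [q]. *)
pose l x : R[i]^o := (q x +i* - q ('i%C *: x))%C.
have lC (a b : R) x : ((a +i* b)%C : R[i]) *: x = a%:C *: x + b%:C *: ('i%C *: x).
  by rewrite scalerA -scalerDl; congr (_ *: _); simpc.
have ll : lin_on setT l.
  move=> [a b] x y _ _; rewrite /l lC.
  have iE : 'i%C *: (a%:C *: x + b%:C *: ('i%C *: x) + y) =
    a%:C *: ('i%C *: x) + (- b)%:C *: x + 'i%C *: y :> V.
    rewrite !scalerDr !scalerA; congr (_ *: _ + _ *: _ + _); simpc => //.
  rewrite iE !qadd !qR.
  by apply/eqP; rewrite eq_complex /=; apply/andP; split; apply/eqP; ring.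
have lp x : rnorm (l x) <= p x.
  have [l0|l0] := eqVneq (l x) 0; first by rewrite l0 rnorm0.
  have r0 : rnorm (l x) != 0 by apply: contra l0 => /eqP/rnorm_eq0 ->.
  pose a : R[i] := Num.conj (l x) / (rnorm (l x))%:C.
  have ra : rnorm (a : R[i]^o) = 1.
    by rewrite /a rnormM rnormJ -fmorphV rnormC ger0_norm ?invr_ge0 ?rnorm_ge0// divff.
  have : l (a *: x) = (rnorm (l x))%:C.
    rewrite (lin_onZ _ ll)// /a mulrAC [_ * l x]mulrC sqr_rnorm.
    by rewrite expr2 rmorphM /= mulfK// fmorph_eq0.
  move=> /(congr1 (@complex.Re R)) /= <-.
  by rewrite (le_trans (qp _))// pZ ra mul1r.
exists l; split=> //.
(* The modulus of [l u] is at most [p u], which is already its real part, so the imaginary part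
   vanishes. *)
have := lp u; rewrite /l quE.
move=> h; apply/eqP; rewrite eq_complex /= eqxx /=.
have : rnorm (l u) ^+ 2 <= p u ^+ 2 by rewrite lerXn2r ?nnegrE ?rnorm_ge0.
have -> : rnorm (l u) ^+ 2 = p u ^+ 2 + q ('i%C *: u) ^+ 2.
  apply/complexI; rewrite -sqr_rnorm /l quE.
  by apply/eqP; rewrite eq_complex /=; apply/andP; split; apply/eqP; ring.
rewrite -lerBrDl subrr => h2.
have := sqr_ge0 (q ('i%C *: u)) => h3.
by rewrite oppr_eq0 -sqrf_eq0 eq_le h2 h3.
Qed.

End HahnBanach.

(** * Duality between operators and normal functionals *)

Section NormalLmodule.
Context {R : realType} {H K : hilbertType R}.

Definition nf_pred : {pred 'B(H, K) -> R[i]^o} := [pred f | `[< normal_functionals f >]].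

Lemma nf_submod : submod_closed nf_pred.
Proof.
split; first by apply/asboolP; exact: (@normal_subspace R H K).1.
move=> a f g /asboolP nf /asboolP ng; apply/asboolP.
exact: (@normal_subspace R H K).2.
Qed.

HB.instance Definition _ := GRing.isSubmodClosed.Build _ _ nf_pred nf_submod.

Record nfun := NFun { nf_fun :> 'B(H, K) -> R[i]^o; nf_proof : nf_fun \in nf_pred }.

HB.instance Definition _ := [isSub for @nf_fun].
HB.instance Definition _ := [Choice of nfun by <:].
HB.instance Definition _ := [SubChoice_isSubLmodule of nfun by <:].

Lemma nfun_normal (f : nfun) : normal_functionals (nf_fun f).
Proof. by case: f => f /= /asboolP. Qed.

Lemma nform_proof x y : nform x y \in nf_pred.
Proof. by apply/asboolP/normal_nform; exists x, y. Qed.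

Definition nff x y : nfun := NFun (nform_proof x y).

End NormalLmodule.

Section Cost.
Context {R : realType} {H K : hilbertType R}.
Implicit Types (x : l2 nat H) (y : l2 nat K) (u v : @nfun R H K).
Context (D : set ('B(H, K) -> R[i]^o)) (sD : subspace D).

(** Its infimum over the representations of a functional modulo [D] is the norm in the quotient of
    the trace class by [D]. The product of the two norms would give the same infimum, by rescaling,
    but [cost] is additive for orthogonal sums, and this yields the triangle inequality. *)
Definition cost x y : R := (rnorm x ^+ 2 + rnorm y ^+ 2) / 2.

Lemma cost_ge0 x y : 0 <= cost x y.
Proof. by rewrite divr_ge0// addr_ge0// sqr_ge0. Qed.

Lemma cost_prod x y : rnorm x * rnorm y <= cost x y.
Proof. by rewrite /cost; have := sqr_ge0 (rnorm x - rnorm y); nra. Qed.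

Definition costs u : set R := [set c | exists x y, D (nf_fun u - nform x y) /\ c = cost x y].

Definition quotient_cost u : R := inf (costs u).

Lemma costs_inf u : has_inf (costs u).
Proof.
split; last by exists 0 => _ [x [y [_ ->]]]; exact: cost_ge0.
have /normal_nform[x [y E]] := nfun_normal u.
by exists (cost x y), x, y; split => //; rewrite E subrr; exact: sD.1.
Qed.

Lemma quotient_cost_ge0 u : 0 <= quotient_cost u.
Proof.
by apply: lb_le_inf (costs_inf u).1 _ => _ [x [y [_ ->]]]; exact: cost_ge0.
Qed.

Lemma quotient_cost_le u x y : D (nf_fun u - nform x y) -> quotient_cost u <= cost x y.
Proof. by move=> h; apply: inf_lbound (costs_inf u).2 _ _; exists x, y. Qed.

Lemma quotient_cost_lt u (e : R) : 0 < e ->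
  exists x y, D (nf_fun u - nform x y) /\ cost x y < quotient_cost u + e.
Proof.
by move=> e0; have [_ [x [y [h ->]]] hc] := inf_adherent e0 (costs_inf u); exists x, y.
Qed.

Lemma quotient_costD u v : quotient_cost (u + v) <= quotient_cost u + quotient_cost v.
Proof.
apply: ler_eps => e e0; have e2 : 0 < e / 2 by rewrite divr_gt0.
have [x [y [h hc]]] := quotient_cost_lt u e2.
have [x' [y' [h' hc']]] := quotient_cost_lt v e2.
have : quotient_cost (u + v) <= cost (l2sh 0 x + l2sh 1 x') (l2sh 0 y + l2sh 1 y').
  apply: quotient_cost_le; rewrite -nform_sum2.
  have -> : nf_fun (u + v) - (nform x y + nform x' y') =
    (nf_fun u - nform x y) + (nf_fun v - nform x' y') by rewrite opprD addrACA.
  exact: subspaceD.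
have -> : cost (l2sh 0 x + l2sh 1 x') (l2sh 0 y + l2sh 1 y') = cost x y + cost x' y'.
  rewrite /cost (rnorm_l2sh2 x x') (rnorm_l2sh2 y y') -mulrDl; congr (_ / _).
  exact: addrACA.
move=> /le_trans; apply; rewrite [in leRHS](splitr e) addrACA ltW//; exact: ltrD.
Qed.

Lemma quotient_cost0 u : D (nf_fun u) -> quotient_cost u = 0.
Proof.
move=> Du; apply/eqP; rewrite eq_le quotient_cost_ge0 andbT.
rewrite (le_trans (quotient_cost_le (x := 0) (y := 0) _))//; first by rewrite nform0l subr0.
by rewrite /cost !rnorm0 expr0n /= addr0 mul0r.
Qed.

Lemma nform_scale (t : R) (a : R[i]) x y :
  nform (t%:C *: (a *: x)) (t%:C *: y) = (t ^+ 2)%:C *: (a *: nform x y).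
Proof.
by rewrite nform_Zr !nform_Zl conjR !scalerA expr2 rmorphM /= mulrA.
Qed.

Lemma quotient_costZ_le a u : quotient_cost (a *: u) <= rnorm (a : R[i]^o) * quotient_cost u.
Proof.
have [->|a0] := eqVneq a 0.
  by rewrite scale0r rnorm0 mul0r quotient_cost0//; exact: sD.1.
have n0 : 0 < rnorm (a : R[i]^o).
  rewrite lt_neqAle rnorm_ge0 andbT eq_sym; apply: contra a0 => /eqP/rnorm_eq0 ->//.
apply: ler_eps => e e0; have e1 : 0 < e / rnorm (a : R[i]^o) by rewrite divr_gt0.
have [x [y [h hc]]] := quotient_cost_lt u e1.
(* The modulus of [a] is shared by [x] and [y], each scaled by its square root; the phase [b] goes
   to [x]. *)
pose s := Num.sqrt (rnorm (a : R[i]^o)).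
have s2 : s ^+ 2 = rnorm (a : R[i]^o) by rewrite sqr_sqrtr// ltW.
pose b := a / (rnorm (a : R[i]^o))%:C.
have rb : rnorm (b : R[i]^o) = 1.
  by rewrite rnormM -fmorphV rnormC ger0_norm ?invr_ge0 ?rnorm_ge0// divff// gt_eqF.
have : quotient_cost (a *: u) <= cost (s%:C *: (b *: x)) (s%:C *: y).
  apply: quotient_cost_le; rewrite nform_scale scalerA s2 mulrCA divff ?mulr1; last first.
    by rewrite fmorph_eq0 gt_eqF.
  by rewrite -scalerBr; exact: subspaceZ.
rewrite /cost !rnormZr rnormZ rb mul1r !exprMn real_normK ?num_real// s2 -mulrDr.
have : rnorm (a : R[i]^o) * cost x y < rnorm (a : R[i]^o) * (quotient_cost u + e / rnorm (a : R[i]^o)).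
  by rewrite ltr_pM2l.
have -> : rnorm (a : R[i]^o) * (quotient_cost u + e / rnorm (a : R[i]^o)) =
    rnorm (a : R[i]^o) * quotient_cost u + e by field; rewrite lt0r_neq0.
rewrite /cost mulrA => h1 /le_trans; apply.
exact: ltW.
Qed.

Lemma quotient_costZ a u : quotient_cost (a *: u) = rnorm (a : R[i]^o) * quotient_cost u.
Proof.
apply/eqP; rewrite eq_le quotient_costZ_le/=.
have [->|a0] := eqVneq a 0; first by rewrite rnorm0 mul0r quotient_cost_ge0.
have n0 : 0 < rnorm (a : R[i]^o).
  rewrite lt_neqAle rnorm_ge0 andbT eq_sym; apply: contra a0 => /eqP/rnorm_eq0 ->//.
have := quotient_costZ_le a^-1 (a *: u); rewrite scalerA mulVf// scale1r.
have -> : rnorm (a^-1 : R[i]^o) = (rnorm (a : R[i]^o))^-1.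
  apply: (mulfI (lt0r_neq0 n0)).
  by rewrite divff ?lt0r_neq0// -rnormM divff// (rnormC 1) normr1.
by rewrite ler_pdivlMl.
Qed.

Lemma quotient_cost_nform x y : quotient_cost (nff x y) <= rnorm x * rnorm y.
Proof.
have h0 : nff x y = 0 -> quotient_cost (nff x y) <= rnorm x * rnorm y.
  move=> ->; rewrite quotient_cost0 ?mulr_ge0 ?rnorm_ge0//; exact: sD.1.
have [x0|x0] := eqVneq (rnorm x) 0.
  by apply: h0; apply/val_inj; rewrite /= (rnorm_eq0 x0) nform0l.
have [y0|y0] := eqVneq (rnorm y) 0.
  apply: h0; apply/val_inj; rewrite /= (rnorm_eq0 y0).
  by have := nform_Zr 0 x (0 : l2 nat K); rewrite scale0r conj0 scale0r.
have xp : 0 < rnorm x by rewrite lt_neqAle eq_sym x0 rnorm_ge0.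
have yp : 0 < rnorm y by rewrite lt_neqAle eq_sym y0 rnorm_ge0.
(* Scaling [x] by [t] and [y] by its inverse keeps the functional and gives both vectors the squared
   norm [rnorm x * rnorm y]. *)
pose t := Num.sqrt (rnorm y / rnorm x).
have t0 : 0 < t by rewrite sqrtr_gt0 divr_gt0.
have t2 : t ^+ 2 = rnorm y / rnorm x by rewrite sqr_sqrtr// ltW// divr_gt0.
rewrite (le_trans (quotient_cost_le (x := t%:C *: x) (y := (t^-1)%:C *: y) _))//.
  rewrite nform_Zr nform_Zl conjR scalerA -rmorphM /= mulVf ?gt_eqF// scale1r subrr.
  exact: sD.1.
rewrite /cost !rnormZr !exprMn !real_normK ?num_real// exprVn t2.
rewrite le_eqVlt; apply/orP; left; apply/eqP; field.
by rewrite x0 y0.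
Qed.

Hypothesis DN : D `<=` @normal_functionals R H K.

(** Hahn-Banach for the quotient norm, combined with the fact that a bounded functional on the trace
    class is evaluation at an operator. So [a] is a contraction annihilated by [D] at which [f]
    attains its quotient norm. *)
Lemma normal_duality f : normal_functionals f -> exists a : 'B(H, K),
  [/\ forall h, rnorm (a h) <= rnorm h, forall g, D g -> g a = 0 &
  forall e : R, 0 < e -> exists x y, D (f - nform x y) /\
    cost x y < complex.Re (f a) + e].
Proof.
move=> nf; pose u : nfun := NFun (asboolT nf : f \in nf_pred).
have [l [ll lp lu]] := hahn_banach quotient_costD quotient_costZ u.
have nffD x x' y c : nff (c *: x + x') y = c *: nff x y + nff x' y.
  by apply/val_inj; rewrite /= nform_Dl nform_Zl.
have nffDr x y y' c : nff x (c *: y + y') = Num.conj c *: nff x y + nff x y'.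
  by apply/val_inj; rewrite /= nform_Dr nform_Zr.
have [|y c x x'|x c y y'|x y|A hA Ale] :=
  @bounded_form_operator R (l2 nat H) (l2 nat K) (fun x y => l (nff x y)) 1.
- exact: ler01.
- by rewrite /= nffD ll.
- by rewrite nffDr ll.
- by rewrite mul1r (le_trans (lp _))// quotient_cost_nform.
pose a : 'B(H, K) := bcomp (l2p 0%N) (bcomp A (l2i 0%N)).
(* On [l2i i h] and [l2i j k] the functional is 0 for [i] different from [j], and otherwise does not
   depend on [i]; hence [A] is the amplification of one of its diagonal entries. *)
have aE : A = ampl a.
  apply: l2_bop_eq => i h; apply: l2_hdot_eq => j k.
  rewrite ampl_l2i hdot_l2i hA /a !bcompE -adjPr hA.
  have [->|ij] := eqVneq i j.
    by congr l; apply/val_inj/funext => T /=; rewrite !nform_l2i !eqxx.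
  have l0 : l 0 = 0 by apply: lin_on0 ll.
  rewrite -[RHS]l0; congr l; apply/val_inj/funext => T /=.
  by rewrite nform_l2i (negbTE ij).
have la v : l v = v a.
  have /normal_nform[x [y E]] := nfun_normal v.
  have -> : v = nff x y by apply/val_inj.
  by rewrite -hA aE.
exists a; split=> [h|g Dg|e e0].
- have := Ale (l2i 0%N h); rewrite aE ampl_l2i !rnorm_l2i mul1r; apply.
- pose v : nfun := NFun (asboolT (DN Dg) : g \in nf_pred).
  apply: rnorm_eq0; apply/eqP; rewrite eq_le rnorm_ge0 andbT.
  by rewrite -[g a]/(v a) -la (le_trans (lp v))// quotient_cost0.
- have [x [y [h hc]]] := quotient_cost_lt u e0; exists x, y; split => //.
  by rewrite -[f a]/(u a) -la lu.
Qed.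

End Cost.

Section NormalRestriction.
Context {R : realType}.

Lemma sum_geometric (A : {fset nat}) : \sum_(n <- A) (2^-1 : R) ^+ n <= 2.
Proof.
have key N (B : {fset nat}) : (forall n, n \in B -> (n < N)%N) ->
    \sum_(n <- B) (2^-1 : R) ^+ n <= 2 - 2 * 2^-1 ^+ N.
  elim: N B => [|N IHN] B hB.
    by rewrite big_seq big1 ?expr0 ?mulr1 ?subrr// => n /hB.
  have h : 2 - 2 * 2^-1 ^+ N <= 2 - 2 * 2^-1 ^+ N.+1 - 2^-1 ^+ N :> R.
    by rewrite exprS; lra.
  have e0 : 0 <= (2^-1 : R) ^+ N by rewrite exprn_ge0.
  have [NB|NB] := boolP (N \in B).
    rewrite (big_fsetD1 N)//= -lerBrDl (le_trans (IHN _ _))// => n.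
    by rewrite in_fsetD1 => /andP[nN /hB]; rewrite ltnS leq_eqVlt (negbTE nN).
  rewrite (le_trans (IHN _ _)); [lra|move=> n nB|].
    move: (hB _ nB); rewrite ltnS leq_eqVlt => /orP[/eqP nN|//].
    by rewrite -nN nB in NB.
  by rewrite (le_trans h)// gerBl.
apply: (le_trans (key (\max_(n <- A) n).+1 A _)) => [n nA|]; last first.
  by rewrite gerBl mulr_ge0// exprn_ge0.
by rewrite ltnS; apply: (leq_bigmax_seq (F := id)) nA _.
Qed.

Lemma opn_le1 (H K : hilbertType R) (a : 'B(H, K)) : (forall h, rnorm (a h) <= rnorm h) -> opn a <= 1.
Proof. by move=> h; apply: opn_le => // x; rewrite mul1r. Qed.

(** Duality with [D] the normal functionals that vanish on [Z]. The contraction [a] lies in [Z] by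
    w*-closedness, so the quotient norm of [u] is at most [c]. *)
Lemma normal_norm_lift (H K : hilbertType R) (Z : set 'B(H, K)) u (c : R) :
  subspace Z -> wstar_closed Z -> 0 <= c -> normal_functionals u ->
  (forall z, Z z -> rnorm (u z) <= c * opn z) ->
  forall e, 0 < e -> exists x y, (forall z, Z z -> u z = nform x y z) /\ cost x y < c + e.
Proof.
move=> sZ /(closed_polar sZ) cZ c0 nu uc e e0.
pose D := [set f : 'B(H, K) -> R[i]^o | normal_functionals f /\ forall z, Z z -> f z = 0].
have sD : subspace D.
  split; first by split; [exact: (@normal_subspace R H K).1|by []].
  move=> a f g [nf f0] [ng g0]; split; first exact: (@normal_subspace R H K).2.
  by move=> z Zz; rewrite -[LHS]/(a * f z + g z) f0// g0// addr0 mulr0.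
have [|a [a1 aD hc]] := @normal_duality R H K D sD _ u nu; first by move=> f [].
have Za : Z a by apply: cZ => f nf f0; exact: aD.
have [x [y [[_ h] hxy]]] := hc e e0; exists x, y; split.
  by move=> z Zz; apply/eqP; rewrite -subr_eq0; apply/eqP; exact: h.
apply: (lt_le_trans hxy); rewrite lerD2r (le_trans (ler_Re_rnorm _))//.
by rewrite (le_trans (uc _ Za))// -[leRHS]mulr1 ler_wpM2l// opn_le1.
Qed.

(** Completeness of the predual of [Z]: successive differences of approximants are small on [Z], so
    they lift to pairs of vectors with geometrically decreasing cost, and the telescoping series is
    summed into one [nform]. *)
Lemma normal_limit (H K : hilbertType R) (Z : set 'B(H, K)) (g : 'B(H, K) -> R[i]^o) :
  subspace Z -> wstar_closed Z ->
  (forall e : R, 0 < e -> exists2 v, normal_functionals v &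
     forall z, Z z -> rnorm (g z - v z) <= e * opn z) ->
  exists2 v, normal_functionals v & forall z, Z z -> g z = v z.
Proof.
move=> sZ cZ hg.
pose d n : R := 2^-1 ^+ n.
have d0 n : 0 < d n by rewrite exprn_gt0.
have /choice[v hv] : forall n, exists v : 'B(H, K) -> R[i]^o, normal_functionals v /\
    forall z, Z z -> rnorm (g z - v z) <= d n * opn z.
  by move=> n; have [v nv hv] := hg _ (d0 n); exists v.
have /choice[xy hxy] : forall n, exists xy : l2 nat H * l2 nat K,
    (forall z, Z z -> v n.+1 z - v n z = nform xy.1 xy.2 z) /\ cost xy.1 xy.2 < 4 * d n.
  move=> n.
  (* On [Z] the difference is at most [d n + d n.+1] times the norm, which is below [3 * d n]; the
     lift loses one more [d n]. *)
  have [||z Zz|x [y [h1 h2]]] := @normal_norm_lift H K Z (v n.+1 - v n) (3 * d n) sZ cZ _ _ _ (d n) (d0 n).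
  - by rewrite mulr_ge0// ltW.
  - by apply: subspaceB; [exact: normal_subspace|exact: (hv _).1|exact: (hv _).1].
  - have h1 := (hv n.+1).2 z Zz; have h2 := (hv n).2 z Zz.
    have -> : (v n.+1 - v n) z = (g z - v n z) - (g z - v n.+1 z).
      by rewrite -[LHS]/(v n.+1 z - v n z) opprB [RHS]addrC addrA subrK.
    rewrite (le_trans (ler_rnormB _ _))//.
    have : d n.+1 = d n / 2 by rewrite /d exprSr.
    move: (opn_ge0 z) (d0 n) h1 h2 => o0 dn h1 h2 e; rewrite e in h1; nra.
  - by exists (x, y); split => //; move: h2; lra.
have [X [Y hXY]] : exists X Y, forall T, series (fun n => nform (xy n).1 (xy n).2 T) @ \oo --> nform X Y T.
  have b n : rnorm (xy n).1 ^+ 2 <= 8 * d n /\ rnorm (xy n).2 ^+ 2 <= 8 * d n.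
    have := (hxy n).2; rewrite /cost.
    move: (sqr_ge0 (rnorm (xy n).1)) (sqr_ge0 (rnorm (xy n).2)).
    move: (_ ^+ 2) (_ ^+ 2) => p q p0 q0; split; lra.
  apply: (@nform_series_sum R H K _ _ (8 * 2)) => A;
    apply: (@le_trans _ _ (\sum_(n <- A) 8 * d n)).
  - by apply: ler_sum => n _; exact: (b n).1.
  - by rewrite -mulr_sumr ler_wpM2l// sum_geometric.
  - by apply: ler_sum => n _; exact: (b n).2.
  - by rewrite -mulr_sumr ler_wpM2l// sum_geometric.
exists (v 0%N + nform X Y) => [|z Zz].
  apply: subspaceD; [exact: normal_subspace|exact: (hv _).1|].
  by apply/normal_nform; exists X, Y.
have c1 : (fun n => v n z) @ \oo --> v 0%N z + nform X Y z.
  have -> : (fun n => v n z) = (fun n => v 0%N z + series (fun n => nform (xy n).1 (xy n).2 z) n).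
    apply/funext; elim=> [|n IHn]; first by rewrite /series /= big_geq// addr0.
    rewrite seriesS addrCA -IHn -(hxy n).1// subrK//.
  by apply: cvgD; [exact: cvg_cst|exact: hXY].
have c2 : (fun n => v n z) @ \oo --> g z.
  apply/(@cvg_rnormP R R[i]^o) => e e0.
  have h0 : (fun n => d n * opn z) @ \oo --> (0 * opn z).
    apply: cvgMl; rewrite /d.
    by apply: cvg_expr; rewrite ger0_norm// invf_lt1// ltr1n.
  rewrite mul0r in h0; move/cvgrPdist_lt : h0 => /(_ _ e0); apply: filterS => n.
  rewrite sub0r normrN ger0_norm ?mulr_ge0 ?opn_ge0 ?(ltW (d0 _))//.
  by apply: le_lt_trans; exact: (hv n).2.
exact: (cvg_unique (@norm_hausdorff _ R[i]^o) c2 c1).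
Qed.

(** Let [D] be the normal functionals that on [A] are pullbacks along [Pi]; it contains those
    vanishing on [A]. An operator [a] annihilated by [D] lies in [A] and has [Pi a = 0], hence is 0.
    So on [A] every normal [u] is a norm limit of pullbacks, and since [Pi] is isometric its
    transport to [B] is a norm limit of normal functionals. *)
Lemma normal_inverse (H1 H2 K1 K2 : hilbertType R) (A : set 'B(H1, H2))
    (B : set 'B(K1, K2)) (Pi : 'B(H1, H2) -> 'B(K1, K2)) :
  subspace A -> wstar_closed A -> subspace B -> wstar_closed B ->
  linear_on A Pi -> Pi @` A = B -> (forall T, A T -> opn (Pi T) = opn T) ->
  (forall f, normal_functionals f ->
    exists2 g, normal_functionals g & forall T, A T -> f (Pi T) = g T) ->
  forall g, normal_functionals g ->
    exists2 f, normal_functionals f & forall T, A T -> f (Pi T) = g T.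
Proof.
move=> sA cA sB cB lP PAB iP nP u nu.
have PB T : A T -> B (Pi T) by move=> AT; rewrite -PAB; exists T.
pose D := [set f : 'B(H1, H2) -> R[i]^o | normal_functionals f /\
  exists2 v : 'B(K1, K2) -> R[i]^o, normal_functionals v & forall T, A T -> f T = v (Pi T)].
have sD : subspace D.
  split.
    split; first exact: (@normal_subspace R H1 H2).1.
    by exists 0; [exact: (@normal_subspace R K1 K2).1|].
  move=> a f g [nf [v nv fv]] [ng [w nw gw]]; split.
    exact: (@normal_subspace R H1 H2).2.
  exists (a *: v + w); first exact: (@normal_subspace R K1 K2).2.
  by move=> T AT; rewrite !fctE fv// gw.
have [|a [a1 aD hc]] := @normal_duality R H1 H2 D sD _ u nu; first by move=> f [].
have Aa : A a.
  apply/(closed_polar sA).1 => // f nf f0; apply: aD; split=> //.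
  by exists 0; [exact: (@normal_subspace R K1 K2).1|].
have Pa : Pi a = 0.
  apply: bopP => h; apply: hdot_ext => k; rewrite bop0E hdot0l.
  have [g ng gE] := nP _ (vector_normal h k).
  rewrite gE//; apply: aD; split=> //.
  by exists (fun T : 'B(K1, K2) => hdot (T h) k); [exact: vector_normal|move=> T AT; rewrite -gE].
have a0 : a = 0.
  apply: opn_eq0; rewrite -iP// Pa; apply: opn_le => // x.
  by rewrite bop0E rnorm0 mul0r.
have /choice[inv hinv] : forall S : 'B(K1, K2), exists T, B S -> A T /\ Pi T = S.
  move=> S; have [|nB] := pselect (B S); last by exists 0.
  by rewrite -PAB => -[T AT <-]; exists T.
have PiB x y : A x -> A y -> Pi (x - y) = Pi x - Pi y.
  move=> Ax Ay; have := lP (-1) _ _ Ay Ax; rewrite !scaleN1r => h.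
  by rewrite addrC h addrC.
have inj x y : A x -> A y -> Pi x = Pi y -> x = y.
  move=> Ax Ay e; apply/eqP; rewrite -subr_eq0; apply/eqP; apply: opn_eq0.
  rewrite -iP; last exact: subspaceB.
  rewrite PiB// e subrr; apply: opn_le => // z; by rewrite bop0E rnorm0 mul0r.
have invP T : A T -> inv (Pi T) = T.
  by move=> AT; have [A1 e] := hinv _ (PB _ AT); exact: inj.
have [|v nv hv] := @normal_limit _ _ B (fun S => u (inv S)) sB cB.
  move=> e e0; have [x [y [[_ [v nv hv]] hxy]]] := hc e e0.
  exists v => // S BS; have [A1 <-] := hinv _ BS.
  rewrite -hv// invP// iP//.
  have -> : u (inv S) - (u - nform x y) (inv S) = nform x y (inv S).
    by rewrite -[(u - _) _]/(u (inv S) - nform x y (inv S)) opprB addrC subrK.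
  rewrite (le_trans (nform_le _ _ _))// mulrC ler_wpM2r ?opn_ge0//.
  rewrite (le_trans (cost_prod _ _))// ltW//.
  by move: hxy; rewrite a0 (normal0 nu) /= add0r.
by exists v => // T AT; rewrite -hv ?invP//; exact: PB.
Qed.

End NormalRestriction.

(** * Invariant quadratic forms and dilations *)

Section JordanVonNeumann.
Context {R : realType}.

(** With m the integer part of n t, additivity gives n (f t - t f 1) = f (n t - m) - (n t - m) f 1,
    where n t - m is in [0, 1]. So n |f t - t f 1| is bounded in n. *)
Lemma additive_bounded_linear (f : R -> R) (C : R) :
  (forall s t, f (s + t) = f s + f t) -> (forall t, 0 <= t <= 1 -> `|f t| <= C) ->
  forall t, f t = t * f 1.
Proof.
move=> fD fC t.
have f0 : f 0 = 0 by have := fD 0 0; rewrite addr0; lra.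
have fN s : f (- s) = - f s by have := fD s (- s); rewrite subrr f0; lra.
have fn (n : nat) s : f (n%:R * s) = n%:R * f s.
  elim: n => [|n IHn]; first by rewrite !mul0r f0.
  by rewrite -natr1 !mulrDl fD IHn !mul1r.
have fz (m : int) s : f (m%:~R * s) = m%:~R * f s.
  case: m => n; first exact: fn.
  by rewrite NegzE mulrNz !mulNr fN fn.
pose M := C + `|f 1|.
have key (n : nat) : n%:R * `|f t - t * f 1| <= M.
  pose m := Num.floor (n%:R * t).
  have /andP[h1 h2] : 0 <= n%:R * t - m%:~R <= 1.
    by rewrite subr_ge0 floor_le /= lerBlDr ltW// addrC -intrD1 lt_succ_floor.
  have e : n%:R * (f t - t * f 1) = f (n%:R * t - m%:~R) - (n%:R * t - m%:~R) * f 1.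
    rewrite fD fN -[in f m%:~R](mulr1 m%:~R) fz fn; ring.
  rewrite -[n%:R]ger0_norm// -normrM e (le_trans (ler_normB _ _))//.
  rewrite lerD ?fC ?h1//; rewrite normrM ler_piMl// ger0_norm//.
apply/eqP; rewrite -subr_eq0 -normr_eq0; apply/eqP/le_anti; rewrite normr_ge0 andbT.
rewrite leNgt; apply/negP => p.
have := key (Num.truncn (M / `|f t - t * f 1|)).+1.
rewrite -ler_pdivlMr// leNgt => /negP; apply.
exact: truncnS_gt.
Qed.

Context {V : lmodType R[i]} (N : V -> R).
Hypothesis N_ge0 : forall x, 0 <= N x.
Hypothesis N_par : forall x y, N (x + y) + N (x - y) = 2 * N x + 2 * N y.
Hypothesis N_i : forall x, N ('i%C *: x) = N x.
Hypothesis N_c : forall (c : R) x, 0 <= c <= 1 -> N (c%:C *: x) <= N x.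

Let b x y : R := (N (x + y) - N (x - y)) / 4.

Let iiN x : 'i%C *: ('i%C *: x) = - x :> V.
Proof. by rewrite scalerA -expr2 sqr_i scaleN1r. Qed.

Let N0 : N 0 = 0.
Proof. have := N_par 0 0; rewrite subrr addr0; lra. Qed.

Let NN x : N (- x) = N x.
Proof. by rewrite -iiN !N_i. Qed.

Let bC x y : b x y = b y x.
Proof. by rewrite /b [x + y]addrC -[N (x - y)]NN opprB. Qed.

Let b0 y : b 0 y = 0.
Proof. by rewrite /b add0r sub0r NN subrr mul0r. Qed.

Let bDB x z y : b (x + z) y + b (x - z) y = 2 * b x y.
Proof.
rewrite /b.
have := N_par (x + y) z; have := N_par (x - y) z.
rewrite [x + y + z]addrAC [x - y + z]addrAC [x + y - z]addrAC [x - y - z]addrAC; lra.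
Qed.

Let bD x z y : b (x + z) y = b x y + b z y.
Proof.
have b2 u : b (u + u) y = 2 * b u y.
  by have := bDB u u y; rewrite subrr b0 addr0.
have h (c : R[i]) : 2^-1 *: c%:A = (c / 2)%:A :> R[i]^o by rewrite scalerA mulrC.
pose p := 2^-1 *: x; pose q := 2^-1 *: z.
have hx : x = p + p by rewrite -scalerDl -mulr2n -[_ *+ 2]mulr_natr mulVf ?scale1r// pnatr_eq0.
have hz : z = q + q by rewrite -scalerDl -mulr2n -[_ *+ 2]mulr_natr mulVf ?scale1r// pnatr_eq0.
have := bDB (p + q) (p - q) y.
have -> : p + q + (p - q) = x by rewrite addrACA subrr addr0 -hx.
have -> : p + q - (p - q) = z by rewrite opprB [q - p]addrC addrACA subrr add0r -hz.
by rewrite -b2 addrACA -hx -hz.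
Qed.

Let bR (t : R) x y : b (t%:C *: x) y = t * b x y.
Proof.
have -> : b x y = b ((1 : R)%:C *: x) y by rewrite scale1r.
apply: (@additive_bounded_linear (fun t => b (t%:C *: x) y) (N x + N y)) => [u v|u u01].
  by rewrite rmorphD /= scalerDl bD.
have h1 := N_c x u01; have h2 := N_par (u%:C *: x) y.
have := N_ge0 (u%:C *: x + y); have := N_ge0 (u%:C *: x - y).
have := N_ge0 x; have := N_ge0 y.
by rewrite /b ler_norml => *; apply/andP; split; lra.
Qed.

Let bi x y : b ('i%C *: x) y = - b x ('i%C *: y).
Proof.
have bii u v : b ('i%C *: u) ('i%C *: v) = b u v.
  by rewrite /b -scalerDr -scalerBr !N_i.
by rewrite -bii iiN -scaleN1r -[-1 : R[i]](rmorphN1 (real_complex R)) bR mulN1r.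
Qed.

Let f x y : R[i] := (b x y +i* b x ('i%C *: y))%C.

Let f_linear v : linear_for *%R (f ^~ v).
Proof.
move=> [a1 a2] x y /=; rewrite /f.
have lC : ((a1 +i* a2)%C : R[i]) *: x = a1%:C *: x + a2%:C *: ('i%C *: x).
  by rewrite scalerA -scalerDl; congr (_ *: _); simpc.
rewrite lC !bD !bR !bi iiN.
have -> : b x (- v) = - b x v.
  by rewrite bC -scaleN1r -[-1 : R[i]](rmorphN1 (real_complex R)) bR mulN1r bC.
by apply/eqP; rewrite eq_complex /=; apply/andP; split; apply/eqP; ring.
Qed.

Let f_herm u v : f v u = Num.conj (f u v).
Proof.
apply/eqP; rewrite /f eq_complex /= bC eqxx /=.
by rewrite bC bi.
Qed.

Let f_diag x : complex.Re (f x x) = N x.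
Proof.
rewrite /f /= /b subrr N0 subr0.
have := N_par x x; rewrite subrr N0; lra.
Qed.

(** [N_c] takes the place of continuity: it bounds the polarization on the unit interval of scalars,
    which gives real homogeneity. A linear map that preserves [N] preserves the form because the
    form is an expression in values of [N]. *)
Lemma jordan_von_neumann : exists F : @psdForm R V,
  (forall x, complex.Re (F x x) = N x) /\
  forall A : V -> V, linear A -> (forall x, N (A x) = N x) ->
    forall x y, F (A x) (A y) = F x y.
Proof.
have f_ge0 u : 0 <= complex.Re (f u u) by rewrite f_diag.
exists (PsdForm f_linear f_herm f_ge0); split=> // A lA NA x y /=.
have AD u v : A (u + v) = A u + A v by have := lA 1 u v; rewrite !scale1r.
have A0 : A 0 = 0.
  by apply: (addrI (A 0)); rewrite -AD !addr0.
have AZ a u : A (a *: u) = a *: A u by have := lA a u 0; rewrite A0 !addr0.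
have AB u v : A (u - v) = A u - A v by rewrite AD -scaleN1r AZ scaleN1r.
by rewrite /f /b -!AZ -!AD -!AB !NA.
Qed.

End JordanVonNeumann.

Section InvariantForm.
Context {R : realType} {V : lmodType R[i]} {G : Type} (A : G -> V -> V).

(* On a list u, seen as a column vector, an additive functional q that is
   invariant under [move] has the form u |-> sum_i F(u_i, u_i). *)
Inductive move : seq V -> seq V -> Prop :=
| move_perm u v of perm_eq u v : move u v
| move_rot (c s : R) x y u of c ^+ 2 + s ^+ 2 = 1 :
    move [:: x, y & u] [:: c%:C *: x + s%:C *: y, c%:C *: y - s%:C *: x & u]
| move_zero u : move (0 :: u) u
| move_phase x u : move (x :: u) ('i%C *: x :: u)
| move_map g x u : move (x :: u) (A g x :: u).

Lemma move_cat u v w : move u v -> move (u ++ w) (v ++ w).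
Proof.
by case=> *; [apply: move_perm; rewrite perm_cat2r|exact: move_rot|exact: move_zero
             |exact: move_phase|exact: move_map].
Qed.

Let sc (t : R) (u : seq V) := [seq t%:C *: x | x <- u].

(** A rotation takes the pair [s x, t x] to [r x, 0]. So two scaled copies of a list count as one,
    and this makes the functional constructed in [tilt] subadditive. *)
Lemma move_combine (T : Type) (q : seq V -> T) (a : seq V) :
  (forall u v, move u v -> q u = q v) ->
  forall (s t : R) u, 0 < s -> 0 < t ->
  q (u ++ sc s a ++ sc t a) = q (u ++ sc (Num.sqrt (s ^+ 2 + t ^+ 2)) a).
Proof.
move=> qm s t u s0 t0; set r := Num.sqrt _.
have r2 : r ^+ 2 = s ^+ 2 + t ^+ 2 by rewrite sqr_sqrtr// addr_ge0// sqr_ge0.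
have r0 : r != 0 by rewrite -sqrf_eq0 r2 lt0r_neq0// addr_gt0// exprn_gt0.
have rotE x (c d : R) : c%:C *: (s%:C *: x) + d%:C *: (t%:C *: x) = (c * s + d * t)%:C *: x.
  by rewrite !scalerA -scalerDl rmorphD !rmorphM.
have rotE' x (c d : R) : c%:C *: (t%:C *: x) - d%:C *: (s%:C *: x) = (c * t - d * s)%:C *: x.
  by rewrite !scalerA -scalerBl rmorphB !rmorphM.
elim: a u => [|x a IHa] u //=.
have p1 : perm_eq (u ++ s%:C *: x :: sc s a ++ t%:C *: x :: sc t a)
    [:: s%:C *: x, t%:C *: x & u ++ sc s a ++ sc t a].
  apply/permP => P; rewrite /= !count_cat /= !count_cat /=; lia.
rewrite (qm _ _ (move_perm p1)).
have cs : (s / r) ^+ 2 + (t / r) ^+ 2 = 1.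
  by rewrite !exprMn exprVn -mulrDl -r2 divff// expf_neq0.
rewrite (qm _ _ (move_rot _ _ _ cs)) rotE rotE'.
have -> : s / r * s + t / r * t = r by rewrite mulrAC [t / r * t]mulrAC -mulrDl -!expr2 -r2 expr2 mulfK.
have -> : s / r * t - t / r * s = 0 by ring.
rewrite scale0r.
have p2 : perm_eq [:: r%:C *: x, 0 & u ++ sc s a ++ sc t a]
   (0 :: (r%:C *: x :: u) ++ sc s a ++ sc t a).
  exact: (permEl (perm_catCA [:: _] [:: _] _)).
rewrite (qm _ _ (move_perm p2)) (qm _ _ (move_zero _)) IHa.
apply/qm/move_perm; exact: (permEl (perm_catCA [:: _] u _)).
Qed.

Context (D : seq V -> R -> Prop) (beta : V -> R).
Hypothesis beta_ge0 : forall x, 0 <= beta x.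
Hypothesis D_ex : forall u, exists r, D u r.
Hypothesis D_beta : forall u r, D u r -> \sum_(x <- u) beta x <= r.
Hypothesis D_cat : forall u v r s, D u r -> D v s -> D (u ++ v) (r + s).
Hypothesis D_move : forall u v r, move u v -> D u r <-> D v r.
Hypothesis D_scale : forall (t : R) u r, 0 < t -> D u r -> D (sc t u) (t ^+ 2 * r).
Hypothesis beta_scale : forall (t : R) x, 0 < t -> beta (t%:C *: x) = t ^+ 2 * beta x.
Hypothesis A_linear : forall g, linear (A g).

Let b (u : seq V) := \sum_(x <- u) beta x.

Let b_cat u v : b (u ++ v) = b u + b v.
Proof. exact: big_cat. Qed.

Let b_ge0 u : 0 <= b u.
Proof. exact: sumr_ge0. Qed.

Let b_scale t u : 0 < t -> b (sc t u) = t ^+ 2 * b u.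
Proof.
by move=> t0; rewrite /b big_map mulr_sumr; apply: eq_bigr => x _; rewrite beta_scale.
Qed.

(** The last condition says that adjoining [w] raises the value by at least [b w]. It gives
    [b <= q]; it is stated relative to [a] because the infimum in [tilt] is bounded below only by
    this stronger form. *)
Let C : set (seq V -> R) := [set q | [/\ forall u v, q (u ++ v) <= q u + q v,
  forall u v, move u v -> q u = q v,
  forall (t : R) u, 0 < t -> q (sc t u) = t ^+ 2 * q u &
  forall w a, b w + q a <= q (w ++ a)]].

Let C_nil q : C q -> q [::] = 0.
Proof. by move=> [_ _ /(_ 2 [::])/=]; rewrite ltr0n => /(_ isT); lra. Qed.

Let C_ge q u : C q -> b u <= q u.
Proof.
by move=> Cq; have [_ _ _ /(_ u [::])] := Cq; rewrite cats0 C_nil// addr0.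
Qed.

Let C_scale (q : seq V -> R) : (forall (t : R) u, 0 < t -> t ^+ 2 * q u <= q (sc t u)) ->
  forall (t : R) u, 0 < t -> q (sc t u) = t ^+ 2 * q u.
Proof.
move=> h t u t0; apply/eqP; rewrite eq_le h// andbT.
have := h t^-1 (sc t u); rewrite invr_gt0 => /(_ t0).
have -> : sc t^-1 (sc t u) = u.
  rewrite /sc -map_comp -[RHS]map_id; apply: eq_map => x /=.
  by rewrite scalerA -rmorphM /= mulVf ?lt0r_neq0// scale1r.
by rewrite exprVn ler_pdivrMl// exprn_gt0.
Qed.

(** The cost of an extension of [a], less the lower bound of what was added; the infimum over
    extensions builds the last condition of [C] into [q0]. *)
Let q0 a : R := inf [set x | exists w r, D (a ++ w) r /\ x = r - b w].

Let q0_inf a : has_inf [set x | exists w r, D (a ++ w) r /\ x = r - b w].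
Proof.
split.
  by have [r Dr] := D_ex (a ++ [::]); exists (r - b [::]), [::], r.
exists 0 => _ [w [r [/D_beta h ->]]]; rewrite subr_ge0 (le_trans _ h)//.
by rewrite -/(b _) b_cat lerDr.
Qed.

Let q0_le a w r : D (a ++ w) r -> q0 a <= r - b w.
Proof. by move=> h; apply: inf_lbound (q0_inf a).2 _ _; exists w, r. Qed.

Let q0_lt a (e : R) : 0 < e -> exists w r, D (a ++ w) r /\ r - b w < q0 a + e.
Proof.
by move=> e0; have [_ [w [r [h ->]]] hc] := inf_adherent e0 (q0_inf a); exists w, r.
Qed.

Let C_q0 : C q0.
Proof.
split.
- move=> u v; apply: ler_eps => e e0; have e2 : 0 < e / 2 by rewrite divr_gt0.
  have [w [r [h hc]]] := q0_lt u e2; have [w' [r' [h' hc']]] := q0_lt v e2.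
  have : D ((u ++ v) ++ w ++ w') (r + r').
    apply/(D_move _ (u := (u ++ w) ++ v ++ w')); last exact: D_cat.
    by apply: move_perm; apply/permP => P; rewrite !count_cat; lia.
  move=> /q0_le; rewrite b_cat; lra.
- move=> u v uv; rewrite /q0; congr inf; apply/seteqP; split=> _ [w [r [h ->]]];
    by exists w, r; split => //; apply/(D_move _ (move_cat w uv)).
- apply: C_scale => t u t0; apply: lb_le_inf (q0_inf _).1 _ => _ [w [r [h ->]]].
  have ti : 0 < t^-1 by rewrite invr_gt0.
  have := D_scale ti h; rewrite /sc map_cat.
  rewrite -/(sc t^-1 (sc t u)).
  have -> : sc t^-1 (sc t u) = u.
    rewrite /sc -map_comp -[RHS]map_id; apply: eq_map => x /=.
    by rewrite scalerA -rmorphM /= mulVf ?lt0r_neq0// scale1r.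
  move=> /q0_le; rewrite -/(sc t^-1 w) b_scale// -mulrBr exprVn.
  by rewrite ler_pdivlMl// exprn_gt0.
- move=> w a; rewrite -lerBrDl; apply: (@le_trans _ _ (q0 (w ++ a) - b w)) => //.
  rewrite lerBrDr; apply: lb_le_inf (q0_inf _).1 _ => _ [w' [r [h ->]]].
  rewrite -lerBrDr.
  have : D (a ++ w ++ w') r.
    have mv : move ((w ++ a) ++ w') (a ++ w ++ w').
      by apply: move_perm; apply/permP => P; rewrite !count_cat; lia.
    exact/(D_move r mv).
  move=> /q0_le; rewrite b_cat; lra.
Qed.

(* Applied to a minimal [q], this makes [q] additive for concatenation. *)
Let tilt q a : C q -> exists q', [/\ C q', forall u, q' u <= q u &
  forall u, q' u <= q (u ++ a) - q a].
Proof.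
move=> Cq; have [qD qm qZ qb] := Cq.
pose S u := [set q (u ++ sc t a) - t ^+ 2 * q a | t in [set t : R | 0 < t]].
have S1 u : S u (q (u ++ a) - q a).
  exists 1 => /=; rewrite ?ltr01// expr1n mul1r /sc.
  have -> : [seq (1 : R)%:C *: x | x <- a] = a; last by [].
  by rewrite -[RHS]map_id; apply: eq_map => x; rewrite scale1r.
have Slb u : lbound (S u) (b u).
  by move=> _ [t /= t0 <-]; rewrite lerBrDr -qZ.
have Si u : has_inf (S u) by split; [eexists; exact: S1|exists (b u)].
have leS u t : 0 < t -> inf (S u) <= q (u ++ sc t a) - t ^+ 2 * q a.
  by move=> t0; apply: (inf_lbound (Si u).2); exists t.
have leS1 u : inf (S u) <= q (u ++ a) - q a by exact: (inf_lbound (Si u).2).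
have adh u (e : R) : 0 < e -> exists2 t, 0 < t & q (u ++ sc t a) - t ^+ 2 * q a < inf (S u) + e.
  by move=> e0; have [_ [t t0 <-] h] := inf_adherent e0 (Si u); exists t.
exists (fun u => inf (S u)); split=> //; last first.
  by move=> u; rewrite (le_trans (leS1 _))// lerBlDr.
split.
- move=> u v; apply: ler_eps => e e0; have e2 : 0 < e / 2 by rewrite divr_gt0.
  have [s s0 hs] := adh u _ e2; have [t t0 ht] := adh v _ e2.
  pose r := Num.sqrt (s ^+ 2 + t ^+ 2).
  have r2 : r ^+ 2 = s ^+ 2 + t ^+ 2 by rewrite sqr_sqrtr// addr_ge0// sqr_ge0.
  have r0 : 0 < r by rewrite sqrtr_gt0 addr_gt0// exprn_gt0.
  apply: (le_trans (leS _ r r0)); rewrite r2 -(move_combine _ qm)//.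
  have -> : q ((u ++ v) ++ sc s a ++ sc t a) = q ((u ++ sc s a) ++ v ++ sc t a).
    by apply/qm/move_perm/permP => P; rewrite !count_cat; lia.
  have := qD (u ++ sc s a) (v ++ sc t a); lra.
- move=> u v uv; rewrite /S; congr inf; apply/seteqP; split=> _ [t t0 <-]; exists t => //;
    by rewrite (qm _ _ (move_cat _ uv)).
- apply: C_scale => t u t0; apply: lb_le_inf (Si _).1 _ => _ [s /= s0 <-].
  have st : 0 < s / t by rewrite divr_gt0.
  have := leS u _ st; rewrite -(ler_pM2l (exprn_gt0 2 t0)) => /le_trans; apply.
  have tE : t ^+ 2 * (s / t) ^+ 2 = s ^+ 2 by rewrite -exprMn mulrC divfK ?lt0r_neq0.
  rewrite mulrBr mulrA tE -[t ^+ 2 * q (u ++ _)]qZ//.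
  rewrite /sc map_cat -map_comp.
  rewrite (_ : [seq (_ \o _) i | i <- a] = sc s a)//; apply: eq_map => x.
  by rewrite -[LHS]/(t%:C *: ((s / t)%:C *: x)) scalerA -rmorphM /= mulrC divfK ?lt0r_neq0.
- move=> w u; apply: lb_le_inf (Si _).1 _ => _ [t t0 <-].
  have := leS u t t0; have := qb w (u ++ sc t a); rewrite -catA; lra.
Qed.

(** [D u r] reads: the list [u] has total energy at most [r]. A minimal [q] in [C] is additive for
    concatenation, as its tilts cannot lie strictly below it. So it is a sum of values of [N] over
    the entries, and its invariance under the moves gives the hypotheses of Jordan and von
    Neumann. *)
Lemma invariant_form : exists F : @psdForm R V,
  [/\ forall x, beta x <= complex.Re (F x x),
      forall u r, D u r -> \sum_(x <- u) complex.Re (F x x) <= r &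
      forall g x y, F (A g x) (A g y) = F x y].
Proof.
have [|q [Cq qq0 qmin]] := @minimal_function R (seq V) C q0 C_q0.
  move=> S SC S0 tS.
  have [|g [gS hg]] := @chain_inf R (seq V) S b S0.
    by move=> f /SC Cf t; exact: C_ge.
  exists g => //; split=> [u v|u v uv||w a].
  - apply: ler_eps => e e0; have e2 : 0 < e / 2 by rewrite divr_gt0.
    have [f1 Sf1 h1] := hg u _ e2; have [f2 Sf2 h2] := hg v _ e2.
    have [f [Sf f1' f2']] : exists f, [/\ S f, f u <= f1 u & f v <= f2 v].
      by have [h|h] := tS _ _ Sf1 Sf2; [exists f1|exists f2].
    have [fD _ _ _] := SC _ Sf.
    by rewrite (le_trans (gS _ Sf _))// (le_trans (fD _ _))//; lra.
  - apply/eqP; rewrite eq_le; apply/andP; split; apply: ler_eps => e e0.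
      have [f Sf hf] := hg v _ e0; have [_ fm _ _] := SC _ Sf.
      by rewrite (le_trans (gS _ Sf _))// (fm _ _ uv) ltW.
    have [f Sf hf] := hg u _ e0; have [_ fm _ _] := SC _ Sf.
    by rewrite (le_trans (gS _ Sf _))// -(fm _ _ uv) ltW.
  - apply: C_scale => t u t0; apply: ler_eps => e e0.
    have [f Sf hf] := hg (sc t u) _ e0; have [_ _ fZ _] := SC _ Sf.
    apply: le_trans (ltW hf); rewrite fZ// ler_wpM2l ?sqr_ge0//; exact: gS.
  - apply: ler_eps => e e0; have [f Sf hf] := hg (w ++ a) _ e0.
    have [_ _ _ fb] := SC _ Sf.
    by apply: le_trans (ltW hf); rewrite (le_trans _ (fb _ _))// lerD2l gS.
have [qD qm qZ qb] := Cq.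
have qadd u a : q (u ++ a) = q u + q a.
  apply/eqP; rewrite eq_le qD/=.
  have [q' [Cq' q'q q'a]] := tilt a Cq.
  have := q'a u; rewrite (qmin q')//; lra.
pose N x := q [:: x].
have q_cons x u : q (x :: u) = N x + q u by rewrite -cat1s qadd.
have qN u : q u = \sum_(x <- u) N x.
  by elim: u => [|x u IHu]; rewrite ?big_nil ?C_nil// big_cons q_cons IHu.
have NZ (t : R) x : 0 < t -> N (t%:C *: x) = t ^+ 2 * N x by move=> t0; rewrite -qZ.
have N0 : N 0 = 0 by rewrite /N (qm _ _ (move_zero _)) C_nil.
have Ni x : N ('i%C *: x) = N x by rewrite /N -(qm _ _ (move_phase _ _)).
have NA g x : N (A g x) = N x by rewrite /N -(qm _ _ (move_map _ _ _)).
have bN x : beta x <= N x by have := C_ge [:: x] Cq; rewrite /b big_seq1.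
have NN x : N (- x) = N x.
  have -> : - x = 'i%C *: ('i%C *: x) by rewrite scalerA -expr2 sqr_i scaleN1r.
  by rewrite !Ni.
(* Invariance under the rotation by 45 degrees is the parallelogram law. *)
have Npar x y : N (x + y) + N (x - y) = 2 * N x + 2 * N y.
  pose c : R := Num.sqrt 2^-1.
  have c2 : c ^+ 2 = 2^-1 by rewrite sqr_sqrtr// invr_ge0.
  have c0 : 0 < c by rewrite sqrtr_gt0 invr_gt0.
  have cc : c ^+ 2 + c ^+ 2 = 1 by rewrite c2; lra.
  have := qm _ _ (move_rot x y [::] cc).
  rewrite !q_cons C_nil// -scalerDr -scalerBr !NZ// c2 -[N (y - x)]NN opprB; lra.
have [||F [FN FA]] := @jordan_von_neumann R V N _ Npar Ni.
- by move=> x; rewrite (le_trans (beta_ge0 x)).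
- move=> c x /andP[c0 c1].
  have Nx : 0 <= N x by rewrite (le_trans (beta_ge0 x)).
  have [->|cn0] := eqVneq c 0; first by rewrite scale0r N0.
  rewrite NZ; last by rewrite lt_neqAle eq_sym cn0.
  by rewrite ler_piMl// expr_le1.
exists F; split=> [x|u r h|g]; first by rewrite FN.
- under eq_bigr do rewrite FN; rewrite -qN (le_trans (qq0 u))//.
  have : D (u ++ [::]) r by rewrite cats0.
  by move=> /q0_le; rewrite /b big_nil subr0.
- by apply: FA => //; exact: NA.
Qed.

End InvariantForm.

Section Submodule.
Context {R : realType} {V : lmodType R[i]} {M : set V}.

Definition sub_pred (sM : subspace M) : {pred V} := [pred x | `[< M x >]].

Variable sM : subspace M.

Lemma sub_submod : submod_closed (sub_pred sM).
Proof.
split; first by apply/asboolP; exact: sM.1.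
by move=> a x y /asboolP Mx /asboolP My; apply/asboolP; exact: sM.2.
Qed.

HB.instance Definition _ := GRing.isSubmodClosed.Build _ _ (sub_pred sM) sub_submod.

Record smod := SMod { smod_val :> V; smod_proof : smod_val \in sub_pred sM }.

HB.instance Definition _ := [isSub for @smod_val].
HB.instance Definition _ := [Choice of smod by <:].
HB.instance Definition _ := [SubChoice_isSubLmodule of smod by <:].

Lemma smodP (x : smod) : M (smod_val x).
Proof. by case: x => x /= /asboolP. Qed.

Definition smk x (Mx : M x) : smod := SMod (asboolT Mx : x \in sub_pred sM).

Lemma smod_inj (x y : smod) : smod_val x = smod_val y -> x = y.
Proof. exact: val_inj. Qed.

Lemma smod_sumE I (r : seq I) (P : pred I) (F : I -> smod) :
  smod_val (\sum_(i <- r | P i) F i) = \sum_(i <- r | P i) smod_val (F i).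
Proof. exact: (raddf_sum (\val : smod -> V)). Qed.

End Submodule.

Section Projections.
Context {R : realType} {H : hilbertType R}.

Lemma orthoprojection (M : set H) : subspace M -> closed M ->
  exists2 P : 'B(H, H), is_projection P & forall x, M x <-> P x = x.
Proof.
move=> sM cM; have /choice[f hf] : forall x, exists m, M m /\ forall y, M y -> hdot (x - m) y = 0.
  by move=> x; have [m Mm h] := projection_theorem sM cM x; exists m.
have fu x m : M m -> (forall y, M y -> hdot (x - m) y = 0) -> f x = m.
  move=> Mm h; have Md : M (f x - m) by apply: subspaceB => //; exact: (hf x).1.
  have E : hdot (f x - m) (f x - m) = 0.
    rewrite {1}(_ : f x - m = (x - m) - (x - f x)); first by rewrite hdotBl h// (hf x).2// subrr.
    by rewrite opprB [RHS]addrC addrA subrK.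
  apply/eqP; rewrite -subr_eq0; apply/eqP/rnorm_eq0/eqP; rewrite -sqrf_eq0.
  by move: E; rewrite hdotxx => /(congr1 (@complex.Re R))/= ->.
have lf : linear f.
  move=> a x y; apply: fu => [|z Mz]; first by apply: sM.2; exact: (hf _).1.
  have -> : a *: x + y - (a *: f x + f y) = a *: (x - f x) + (y - f y).
    by rewrite scalerBr opprD addrACA.
  by rewrite hdotDl hdotZl (hf x).2// (hf y).2// mulr0 addr0.
have fb x : rnorm (f x) <= 1 * rnorm x.
  rewrite mul1r -(@ler_pXn2r _ 2) ?nnegrE ?rnorm_ge0//.
  rewrite -[in leRHS](subrK (f x) x) rnormDE (hf x).2; last exact: (hf x).1.
  rewrite [complex.Re 0]/= mulr0 addr0.
  by rewrite lerDr sqr_ge0.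
have fid x : M x -> f x = x by move=> Mx; apply: fu => // y _; rewrite subrr hdot0l.
exists (mkbop lf fb); last first.
  by move=> x; split=> [/fid//|<-]; exact: (hf x).1.
split; first by apply: bopP => x /=; apply: fid; exact: (hf x).1.
move=> x y /=; have e1 := (hf x).2 _ (hf y).1; have e2 := (hf y).2 _ (hf x).1.
move: e1 e2; rewrite !hdotBl => /eqP; rewrite subr_eq0 => /eqP e1 /eqP.
by rewrite subr_eq0 => /eqP e2; rewrite e1 hdotC e2 -hdotC.
Qed.

Lemma projection_adj (p : 'B(H, H)) : is_projection p -> adj p = p.
Proof. by move=> [_ /adjE <-]. Qed.

Lemma projection_idem (p : 'B(H, H)) x : is_projection p -> p (p x) = p x.
Proof. by move=> [h _]; rewrite -[in RHS]h. Qed.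

Lemma projection_le (p : 'B(H, H)) x : is_projection p -> rnorm (p x) <= rnorm x.
Proof.
move=> hp; have [->|px] := eqVneq (rnorm (p x)) 0; first exact: rnorm_ge0.
have p0 : 0 < rnorm (p x) by rewrite lt_neqAle eq_sym px rnorm_ge0.
rewrite -(ler_pM2l p0) -expr2.
have -> : rnorm (p x) ^+ 2 = rnorm (hdot (p x) x : R[i]^o).
  rewrite -[in RHS](projection_idem x hp) adjP projection_adj//.
  by rewrite hdotxx rnormC ger0_norm// sqr_ge0.
exact: cauchy_schwarz.
Qed.

End Projections.

(** * Dilation of row-stable involutions to unitaries *)

Section Contractions.
Context {R : realType} {Z : lmodType R[i]} {H K : hilbertType R}.

(* The rows [X] form a matrix over [Z] whose image under [iota] has norm at most 1. *)
Definition contr (iota : Z -> 'B(H, K)) (J : finType) (X : seq (J -> Z)) : Prop :=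
  forall h : J -> H, \sum_(xi <- X) rnorm (\sum_j iota (xi j) (h j)) ^+ 2 <= \sum_j rnorm (h j) ^+ 2.

(** For operator spaces this condition singles out the contractive left multipliers. It refers to
    matrix norms only, so it passes through complete isometries. *)
Definition rowstable (iota : Z -> 'B(H, K)) (f : Z -> Z) : Prop :=
  forall (J : finType) (xi : J -> Z) X, contr iota (xi :: X) -> contr iota ((f \o xi) :: X).

End Contractions.

Lemma sum_unit (V : nmodType) (F : unit -> V) : \sum_a F a = F tt.
Proof. by rewrite (big_pred1 tt) // => -[]. Qed.

Lemma closed_kernel (R : realType) (V W : normedModType R[i]) I (S : I -> 'B(V, W)) :
  closed [set x | forall i, S i x = 0].
Proof.
have -> : [set x | forall i, S i x = 0] = \bigcap_(i in [set: I]) (S i @^-1` [set 0]).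
  by apply/seteqP; split=> x h i; [move=> _; exact: h|exact: (h i Logic.I)].
apply: closed_bigI => i _; apply: closed_comp => [x _|]; first exact: bop_continuous.
exact: (accessible_closed_set1 (hausdorff_accessible (@norm_hausdorff _ W))).
Qed.

Section Dilation.
Context {R : realType} {Z : lmodType R[i]} {H K : hilbertType R}.
Context (iota : Z -> 'B(H, K)) (iota_linear : linear iota).
Context {G : Type} (L : G -> Z -> Z).
Hypothesis L_linear : forall g, linear (L g).
Hypothesis L_invol : forall g z, L g (L g z) = z.
Hypothesis L_row : forall g, rowstable iota (L g).

Let iotaD x y : iota (x + y) = iota x + iota y.
Proof. by have := iota_linear 1 x y; rewrite !scale1r. Qed.

Let iota0 : iota 0 = 0.
Proof. by apply: (addrI (iota 0)); rewrite -iotaD !addr0. Qed.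

Let iotaZ a x : iota (a *: x) = a *: iota x.
Proof. by have := iota_linear a x 0; rewrite iota0 !addr0. Qed.

Let word_linear w : linear (fun z => foldr L z w).
Proof. by elim: w => [|g w IHw] a x y //=; rewrite IHw L_linear. Qed.

Let word0 w : foldr L 0 w = 0.
Proof. by have /= := word_linear w (-1) 0 0; rewrite scaler0 addr0 scaleN1r addNr. Qed.

Let wordZ w a z : foldr L (a *: z) w = a *: foldr L z w.
Proof. by have := word_linear w a z 0; rewrite word0 !addr0. Qed.

(* The vector [z (x) h], remembered through all the words in the involutions,
   so that each [L g] becomes a shift. *)
Definition orbit_fun z h : seq G -> K := fun w => iota (foldr L z w) h.

Definition orbit_space : set (seq G -> K) := lspan [set orbit_fun zh.1 zh.2 | zh in [set: Z * H]].

Definition orbit_mod := smod (lspan_subspace _ : subspace orbit_space).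

Let V := orbit_mod.

Lemma orbit_proof z h : orbit_space (orbit_fun z h).
Proof. by apply: lspan_sub; exists (z, h). Qed.

Let e z h : V := smk _ (orbit_proof z h).

Let eDl a z z' h : e (a *: z + z') h = a *: e z h + e z' h.
Proof.
by apply/smod_inj/funext => w; rewrite /= /orbit_fun word_linear iota_linear bopDE bopZE.
Qed.

Let eDr a z h h' : e z (a *: h + h') = a *: e z h + e z h'.
Proof. by apply/smod_inj/funext => w; rewrite /= /orbit_fun opD opZ. Qed.

Let eZl a z h : e (a *: z) h = a *: e z h.
Proof.
by apply/smod_inj/funext => w; rewrite /= /orbit_fun wordZ iotaZ bopZE.
Qed.

Let eZr a z h : e z (a *: h) = a *: e z h.
Proof. by apply/smod_inj/funext => w; rewrite /= /orbit_fun opZ. Qed.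

Lemma shift_proof g (f : seq G -> K) : orbit_space f -> orbit_space (fun w => f (rcons w g)).
Proof.
move=> [n [a [v [hv ->]]]]; have /choice[zh hzh] : forall i, exists zh : Z * H, orbit_fun zh.1 zh.2 = v i.
  by move=> i; have [zh _ <-] := hv i; exists zh.
exists n, a, (fun i => orbit_fun (L g (zh i).1) (zh i).2); split=> [i|].
  by exists (L g (zh i).1, (zh i).2).
apply/funext => w; rewrite !fct_sumE; apply: eq_bigr => i _.
rewrite -[LHS]/(a i *: v i (rcons w g)) -[RHS]/(a i *: orbit_fun _ _ w) -hzh.
by rewrite /orbit_fun foldr_rcons.
Qed.

Let U g (u : V) : V := smk _ (shift_proof g (smodP u)).

Let U_linear g : linear (U g).
Proof. by move=> a x y; apply/smod_inj/funext. Qed.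

Let U_e g z h : U g (e z h) = e (L g z) h.
Proof. by apply/smod_inj/funext => w /=; rewrite /orbit_fun foldr_rcons. Qed.

Let e_span (u : V) : exists n (z : 'I_n -> Z) (h : 'I_n -> H), u = \sum_i e (z i) (h i).
Proof.
have [n [a [v [hv hu]]]] := smodP u.
have /choice[zh hzh] : forall i, exists zh : Z * H, orbit_fun zh.1 zh.2 = v i.
  by move=> i; have [zh _ <-] := hv i; exists zh.
exists n, (fun i => a i *: (zh i).1), (fun i => (zh i).2).
apply/smod_inj; rewrite hu smod_sumE; apply: eq_bigr => i _.
by rewrite eZl -hzh.
Qed.

Let U_invol g u : U g (U g u) = u.
Proof.
have UD x y : U g (x + y) = U g x + U g y by have := U_linear g 1 x y; rewrite !scale1r.
have [n [z [h ->]]] := e_span u.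
elim/big_rec : _ => [|i x _ IH]; last by rewrite !UD !U_e L_invol IH.
by apply/smod_inj/funext.
Qed.

Let beta (u : V) : R := rnorm (smod_val u [::]) ^+ 2.

Let row (J : finType) (g : J -> H) (xi : J -> Z) : V := \sum_j e (xi j) (g j).

Let rowE J g xi w : smod_val (@row J g xi) w = \sum_j iota (foldr L (xi j) w) (g j).
Proof. by rewrite smod_sumE fct_sumE. Qed.

(** A form bounded above by [D] makes every contractive matrix contractive in the completion; a form
    bounded below by [beta] lets [iota] be recovered by a contraction. The dilation needs both. *)
Let D (u : seq V) (r : R) := exists (J : finType) (X : seq (J -> Z)) (g : J -> H),
  [/\ u = [seq row g xi | xi <- X], contr iota X & \sum_j rnorm (g j) ^+ 2 <= r].

Let D_beta u r : D u r -> \sum_(x <- u) beta x <= r.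
Proof.
move=> [J [X [g [-> cX gr]]]]; rewrite big_map; apply: le_trans gr.
by apply: le_trans (cX g); apply: ler_sum => xi _; rewrite /beta rowE.
Qed.

(** The two matrices are put on the diagonal of a block matrix; [l] and [l'] pad their rows with
    zeros. *)
Let D_cat u v r s : D u r -> D v s -> D (u ++ v) (r + s).
Proof.
move=> [J [X [g [-> cX gr]]]] [J' [X' [g' [-> cX' gr']]]].
pose l (xi : J -> Z) : (J + J')%type -> Z := fun j => match j with inl j => xi j | inr _ => 0 end.
pose l' (xi : J' -> Z) : (J + J')%type -> Z := fun j => match j with inl _ => 0 | inr j => xi j end.
pose gg : (J + J')%type -> H := fun j => match j with inl j => g j | inr j => g' j end.
exists (J + J')%type, (map l X ++ map l' X'), gg; split.
- rewrite map_cat -!map_comp; congr (_ ++ _); apply: eq_map => xi; apply/smod_inj/funext => w.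
    rewrite !rowE big_sumType /= [X in _ + X]big1 ?addr0// => j _.
    by rewrite word0 iota0 bop0E.
  rewrite !rowE big_sumType /= [X in X + _]big1 ?add0r// => j _.
  by rewrite word0 iota0 bop0E.
- move=> h; rewrite big_cat !big_map big_sumType /= lerD//.
    apply: le_trans (cX (fun j => h (inl j))); apply: ler_sum => xi _.
    rewrite big_sumType /= [X in _ + X]big1 ?addr0// => j _.
    by rewrite iota0 bop0E.
  apply: le_trans (cX' (fun j => h (inr j))); apply: ler_sum => xi _.
  rewrite big_sumType /= [X in X + _]big1 ?add0r// => j _.
  by rewrite iota0 bop0E.
- by rewrite big_sumType /= lerD.
Qed.

(** Every move of vectors is realized by a change of the rows of [X]. Row stability enters for the
    move by [L g]; the others are permutations, rotations, zero rows and phases. *)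
Let D_fwd u v r : move U u v -> D u r -> D v r.
Proof.
move=> [{}u {}v uv|c s x y {}u cs|{}u|x {}u|g x {}u] [J [X [g' [Eu cX gr]]]].
- move: uv; rewrite perm_sym => /(perm_iotaP 0)[Is pIs ->].
  exists J, [seq nth (fun=> 0) X i | i <- Is], g'; split => //.
    rewrite -map_comp; apply/eq_in_map => i; rewrite (perm_mem pIs) mem_iota add0n /= Eu size_map.
    by move=> iX; rewrite (nth_map (fun=> 0)).
  move=> h; apply: le_trans (cX h); rewrite big_map.
  rewrite (perm_big _ pIs) /= Eu size_map -[in leRHS](mkseq_nth (fun=> 0) X) [leRHS]big_map.
  exact: lexx.
- case: X Eu cX => [//|xi [//|eta X]] [-> -> ->] cX.
  exists J, [:: fun j => c%:C *: xi j + s%:C *: eta j, fun j => c%:C *: eta j - s%:C *: xi j & X], g'.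
  split=> //.
    rewrite /=; congr [:: _, _ & _]; rewrite /row !scaler_sumr ?sumrN -?big_split -?sumrB /=;
      apply: eq_bigr => j _; rewrite -?scaleNr eDl eZl//.
  move=> h; apply: le_trans (cX h); rewrite !big_cons !addrA lerD2r.
  pose a := \sum_j iota (xi j) (h j); pose b := \sum_j iota (eta j) (h j).
  have -> : \sum_j iota (c%:C *: xi j + s%:C *: eta j) (h j) = c%:C *: a + s%:C *: b.
    rewrite !scaler_sumr -big_split; apply: eq_bigr => j _.
    by rewrite iota_linear iotaZ bopDE !bopZE.
  have -> : \sum_j iota (c%:C *: eta j - s%:C *: xi j) (h j) = c%:C *: b - s%:C *: a.
    rewrite !scaler_sumr -sumrB; apply: eq_bigr => j _.
    by rewrite iota_linear -scaleNr iotaZ bopDE !bopZE scaleNr.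
  rewrite rnormDE rnormBE !rnormZr !hdotZl !hdotZr !conjR [hdot b a]hdotC.
  rewrite -/a -/b !exprMn !real_normK ?num_real//.
  have -> : complex.Re (c%:C * (s%:C * hdot a b)) = c * s * complex.Re (hdot a b).
    by case: (hdot a b) => p q /=; ring.
  have -> : complex.Re (c%:C * (s%:C * Num.conj (hdot a b))) = c * s * complex.Re (hdot a b).
    by case: (hdot a b) => p q /=; ring.
  by move: cs; move: (rnorm a ^+ 2) (rnorm b ^+ 2) => p q cs; rewrite [c ^+ 2](_ : _ = 1 - s ^+ 2); [lra|lra].
- case: X Eu cX => [//|xi X] [E0 ->] cX; exists J, X, g'; split => // h.
  by apply: le_trans (cX h); rewrite big_cons lerDr sqr_ge0.
- case: X Eu cX => [//|xi X] [-> ->] cX; exists J, ((fun j => 'i%C *: xi j) :: X), g'; split => //.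
    by rewrite /=; congr (_ :: _); rewrite /row scaler_sumr; apply: eq_bigr => j _; rewrite eZl.
  move=> h; apply: le_trans (cX h); rewrite !big_cons lerD2r.
  under eq_bigr do rewrite iotaZ bopZE.
  by rewrite -scaler_sumr rnormZ rnormi mul1r.
- case: X Eu cX => [//|xi X] [-> ->] cX; exists J, ((L g \o xi) :: X), g'; split => //.
    rewrite /=; congr (_ :: _); apply/smod_inj/funext => w.
    rewrite -[LHS]/(smod_val (row g' xi) (rcons w g)) !rowE; apply: eq_bigr => j _.
    by rewrite foldr_rcons.
  exact: L_row.
Qed.

Let D_move u v r : move U u v -> D u r <-> D v r.
Proof.
move=> uv; split; first exact: D_fwd.
case: uv => [{}u {}v uv|c s x y {}u cs|{}u|x {}u|g x {}u].
- by apply: D_fwd; apply: move_perm; rewrite perm_sym.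
- have cs' : c ^+ 2 + (- s) ^+ 2 = 1 by rewrite sqrrN.
  move=> /(D_fwd (move_rot U _ _ u cs')).
  have cc : c%:C * c%:C + s%:C * s%:C = 1 :> R[i] by rewrite -!rmorphM -rmorphD -!expr2 cs.
  have -> : c%:C *: (c%:C *: x + s%:C *: y) + (- s)%:C *: (c%:C *: y - s%:C *: x) = x.
    rewrite rmorphN /= scaleNr !scalerBr !scalerDr !scalerA opprB addrACA [s%:C * c%:C]mulrC.
    by rewrite subrr addr0 -scalerDl cc scale1r.
  have -> : c%:C *: (c%:C *: y - s%:C *: x) - (- s)%:C *: (c%:C *: x + s%:C *: y) = y.
    rewrite rmorphN /= scaleNr opprK !scalerBr !scalerDr !scalerA [s%:C * c%:C]mulrC.
    by rewrite addrA subrK -scalerDl cc scale1r.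
  by [].
- move=> [J [X [g' [-> cX gr]]]]; exists J, ((fun=> 0) :: X), g'; split => //.
    rewrite /=; congr (_ :: _); apply/smod_inj/funext => w; rewrite rowE big1// => j _.
    by rewrite word0 iota0 bop0E.
  move=> h; rewrite big_cons big1 => [|j _]; last by rewrite iota0 bop0E.
  by rewrite rnorm0 expr0n add0r.
(* Four phases compose to the identity, so three more undo one. *)
- move=> h; have := D_fwd (move_phase _ _ _) (D_fwd (move_phase _ _ _) (D_fwd (move_phase _ _ _) h)).
  have ii (y : V) : 'i%C *: ('i%C *: y) = - y by rewrite scalerA -expr2 sqr_i scaleN1r.
  by rewrite !ii opprK.
- by move=> /(D_fwd (move_map _ g _ _)); rewrite U_invol.
Qed.

Let D_scale (t : R) u r : 0 < t -> D u r -> D [seq t%:C *: x | x <- u] (t ^+ 2 * r).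
Proof.
move=> t0 [J [X [g [-> cX gr]]]]; exists J, X, (fun j => t%:C *: g j); split => //.
  rewrite -map_comp; apply: eq_map => xi.
  by rewrite /= /row scaler_sumr; apply: eq_bigr => j _; rewrite eZr.
under eq_bigr do rewrite rnormZr exprMn real_normK ?num_real//.
by rewrite -mulr_sumr ler_wpM2l// sqr_ge0.
Qed.

(** A single row becomes a contraction after division by [N], and the factor is moved to the vector
    [g]. *)
Let D_row (J : finType) (xi : J -> Z) : exists2 N : R, 0 < N &
  forall g : J -> H, D [:: row g xi] (N ^+ 2 * \sum_j rnorm (g j) ^+ 2).
Proof.
have [M M0 hM] := opb_exists (fun (a : unit) j => iota (xi j)).
pose N := M + 1; have N0 : 0 < N by rewrite ltr_wpDl.
exists N => // g.
exists J, [:: fun j => N^-1%:C *: xi j], (fun j => N%:C *: g j); split.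
- rewrite /=; congr [:: _]; apply: eq_bigr => j _; rewrite eZl eZr scalerA -rmorphM /=.
  by rewrite mulVf ?lt0r_neq0// scale1r.
- move=> h; rewrite big_seq1; under eq_bigr do rewrite iotaZ bopZE.
  rewrite -scaler_sumr rnormZr exprMn real_normK ?num_real// exprVn ler_pdivrMl ?exprn_gt0//.
  have hh : rnorm (\sum_j iota (xi j) (h j)) ^+ 2 <= M ^+ 2 * \sum_j rnorm (h j) ^+ 2.
    by have := hM h; rewrite sum_unit.
  apply: le_trans hh _; rewrite ler_wpM2r ?sumr_ge0// => [j _|]; first exact: sqr_ge0.
  by rewrite lerXn2r ?nnegrE ?(ltW N0)// lerDl.
- under eq_bigr do rewrite rnormZr exprMn real_normK ?num_real//.
  by rewrite -mulr_sumr.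
Qed.

Let D_ex u : exists r, D u r.
Proof.
elim: u => [|x u [r hr]].
  by exists 0, void, [::], (fun=> 0); split => // [h|]; rewrite ?big_nil ?sumr_ge0// big1.
have [n [z [h ->]]] := e_span x.
have [N _ /(_ h) hN] := D_row z.
exists (N ^+ 2 * \sum_j rnorm (h j) ^+ 2 + r); rewrite -cat1s.
exact: D_cat hr.
Qed.

(** Evaluation at the empty word becomes the contraction [T], and the shift [U g] becomes the
    self-adjoint unitary [W g]. *)
Let form_rep (F : @psdForm R V) : (forall x, beta x <= complex.Re (F x x)) ->
  (forall g x y, F (U g x) (U g y) = F x y) ->
  exists (T : 'B(gns F, K)) (W : G -> 'B(gns F, gns F)),
  [/\ forall u, T (gns_embed F u) = smod_val u [::], forall h, rnorm (T h) <= rnorm h,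
      forall g u, W g (gns_embed F u) = gns_embed F (U g u),
      forall g, adj (W g) = W g & forall g x, W g (W g x) = x].
Proof.
move=> Fb FU.
have [|//||T hT Tle] := @gns_extend R V F K (fun u => smod_val u [::]) 1.
- by move=> a x y.
- move=> u; rewrite mul1r -(@ler_pXn2r _ 2) ?nnegrE ?rnorm_ge0 ?seminorm_ge0//.
  by rewrite (le_trans (Fb u))// seminormE.
have /choice[W hW] : forall g, exists W : 'B(gns F, gns F), forall u, W (gns_embed F u) = gns_embed F (U g u).
  move=> g; have [|//||W hW _] := @gns_extend R V F (gns F) (fun u => gns_embed F (U g u)) 1.
  - by move=> a x y; rewrite U_linear gns_embed_linear.
  - by move=> u; rewrite mul1r rnorm_gns /seminorm FU.
  by exists W.
exists T, W; split => // [h|g|g x]; first by have := Tle h; rewrite mul1r.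
- apply: gns_bop_eq => u; apply: gns_hdot_eq => v.
  by rewrite -adjPr !hW !hdot_gns -[in RHS](U_invol g v) FU.
- suff E : bcomp (W g) (W g) = idop _ by rewrite -bcompE E.
  by apply: gns_bop_eq => u; rewrite bcompE !hW U_invol.
Qed.

Lemma dilation : exists (K' : hilbertType R) (Theta : Z -> 'B(H, K')) (T : 'B(K', K))
    (W : G -> 'B(K', K')),
  [/\ linear Theta, forall (J : finType) (X : seq (J -> Z)), contr iota X -> contr Theta X,
      forall z, bcomp T (Theta z) = iota z & forall h, rnorm (T h) <= rnorm h] /\
  [/\ forall g, adj (W g) = W g, forall g x, W g (W g x) = x,
      forall g z, bcomp (W g) (Theta z) = Theta (L g z) &
      forall x, (forall w, T (foldr (fun g y => W g y) x w) = 0) -> x = 0].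
Proof.
have beta_ge0 x : 0 <= beta x by exact: sqr_ge0.
have beta_scale (t : R) x : 0 < t -> beta (t%:C *: x) = t ^+ 2 * beta x.
  by move=> t0; rewrite /beta -[smod_val _ _]/(t%:C *: smod_val x [::]) rnormZr exprMn real_normK ?num_real.
have [F [Fb FD FU]] := invariant_form beta_ge0 D_ex D_beta D_cat D_move D_scale beta_scale U_linear.
have [T0 [W0 [T0e T0le W0e W0a W0i]]] := form_rep Fb FU.
pose Wd w : 'B(gns F, gns F) := foldr (fun g S => bcomp (W0 g) S) (idop _) w.
have WdE w x : Wd w x = foldr (fun g y => W0 g y) x w by elim: w => //= g w <-.
(* These vectors are invisible to [T0] after any word. They have to be removed, so that the words of
   the final dilation separate vectors. *)
pose K0 := [set x : gns F | forall w, bcomp T0 (Wd w) x = 0].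
have sK0 : subspace K0.
  split=> [w|a x y hx hy w]; first exact: op0.
  by rewrite opD opZ hx hy scaler0 addr0.
have [P hP PK0] := orthoprojection sK0 (@closed_kernel R _ _ _ (fun w => bcomp T0 (Wd w))).
have Pa := projection_adj hP.
have K0P x : K0 (P x) by apply/PK0; exact: projection_idem.
have T0P x : T0 (P x) = 0 by have := K0P x [::].
have W0K x g : K0 x -> K0 (W0 g x).
  move=> hx w; have := hx (rcons w g); rewrite !bcompE !WdE.
  by rewrite foldr_rcons.
have WP g : bcomp P (W0 g) = bcomp (W0 g) P.
  have h : bcomp P (bcomp (W0 g) P) = bcomp (W0 g) P.
    by apply: bopP => x; rewrite !bcompE; apply/PK0/W0K; exact: K0P.
  have := congr1 (@adj R _ _) h; rewrite !adj_comp Pa W0a -bcompA h.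
  by move=> ->.
pose Q := idop (gns F) - P.
have QE x : Q x = x - P x by rewrite bopBE.
have QQ x : Q (Q x) = Q x by rewrite !QE opB projection_idem// subrr subr0.
have Qa : adj Q = Q by rewrite adjB adj1 Pa.
have T0Q x : T0 (Q x) = T0 x by rewrite QE opB T0P subr0.
have QW g x : Q (W0 g x) = W0 g (Q x).
  by rewrite !QE opB; congr (_ - _); have := congr1 (fun S => bop_fun S x) (WP g).
have Qle x : rnorm (Q x) <= rnorm x.
  apply: projection_le; split; first by apply: bopP => y; rewrite bcompE QQ.
  by move=> y z; rewrite adjP Qa.
(* The orthogonal complement of [K0] is obtained as a space of its own by compressing the form with
   [Q] and completing again; [S] below is its inclusion into the first completion. *)
pose f' (u v : V) := hdot (Q (gns_embed F u)) (Q (gns_embed F v)).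
have f'l v : linear_for *%R (f' ^~ v).
  by move=> a x y; rewrite /f' gns_embed_linear opD opZ hdotDl hdotZl.
have f'h u v : f' v u = Num.conj (f' u v) by rewrite /f' -hdotC.
have f'E u : f' u u = (rnorm (Q (gns_embed F u)) ^+ 2)%:C by rewrite /f' hdotxx.
have f'g u : 0 <= complex.Re (f' u u) by rewrite f'E sqr_ge0.
pose F' := PsdForm f'l f'h f'g.
have F'b x : beta x <= complex.Re (F' x x).
  rewrite -[F' x x]/(f' x x) f'E /beta -T0e -T0Q /=.
  by rewrite lerXn2r ?nnegrE ?rnorm_ge0.
have F'U g x y : F' (U g x) (U g y) = F' x y.
  rewrite -[LHS]/(f' _ _) -[RHS]/(f' _ _) /f' -!W0e !QW.
  by rewrite adjP W0a W0i.
have [T [W [Te Tle We Wa Wi]]] := form_rep F'b F'U.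
have F'F u : complex.Re (F' u u) <= complex.Re (F u u).
  rewrite -[F' u u]/(f' u u); apply: (@le_trans _ _ (rnorm (gns_embed F u) ^+ 2)).
    rewrite f'E -[leLHS]/(rnorm (Q (gns_embed F u)) ^+ 2) lerXn2r ?nnegrE ?rnorm_ge0//.
  by rewrite rnorm_gns seminormE.
have semi u : seminorm F' u = rnorm (Q (gns_embed F u)).
  by rewrite /seminorm -[F' u u]/(f' u u) f'E sqrtr_sqr ger0_norm ?rnorm_ge0.
have [||u|S SE _] := @gns_extend R V F' (gns F) (fun u => Q (gns_embed F u)) 1.
- by move=> a x y; rewrite gns_embed_linear opD opZ.
- exact: ler01.
- by rewrite mul1r semi.
have TS : T = bcomp T0 S by apply: gns_bop_eq => u; rewrite bcompE SE Te T0Q T0e.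
have WS g : bcomp S (W g) = bcomp (W0 g) S.
  by apply: gns_bop_eq => u; rewrite !bcompE We !SE -QW W0e.
have QS : bcomp Q S = S by apply: gns_bop_eq => u; rewrite bcompE !SE QQ.
have SS : bcomp (adj S) S = idop _.
  apply: gns_bop_eq => u; apply: gns_hdot_eq => v.
  by rewrite bcompE -adjPr !SE idopE hdot_gns.
have Tbnd z : exists2 N : R, 0 < N & forall h, rnorm (gns_embed F' (e z h)) <= N * rnorm h.
  have [N N0 hN] := D_row (fun _ : unit => z); exists N => // h.
  rewrite -(@ler_pXn2r _ 2) ?nnegrE ?rnorm_ge0 ?mulr_ge0 ?rnorm_ge0 ?(ltW N0)//.
  have := FD _ _ (hN (fun=> h)); rewrite big_seq1 /row !sum_unit => hF.
  rewrite rnorm_gns exprMn (le_trans _ hF)// (le_trans _ (F'F _))//.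
  by rewrite seminormE.
have Tl z : linear (fun h => gns_embed F' (e z h)).
  by move=> a x y; rewrite eDr gns_embed_linear.
pose Theta z : 'B(H, gns F') := mkbop (Tl z) (s2valP' (cid2 (Tbnd z)) : forall h, rnorm (gns_embed F' (e z h)) <= _ * rnorm h).
have ThE z h : Theta z h = gns_embed F' (e z h) by [].
exists (gns F'), Theta, T, W; split; split=> //.
- by move=> a x y; apply: bopP => h; rewrite bopDE bopZE !ThE eDl gns_embed_linear.
- move=> J X cX h; apply: (@le_trans _ _ (\sum_(x <- [seq row h xi | xi <- X]) complex.Re (F x x))).
    rewrite big_map; apply: ler_sum => xi _; apply: le_trans (F'F _).
    have -> : \sum_j Theta (xi j) (h j) = gns_embed F' (row h xi).
      rewrite /row; apply/esym; apply: (big_morph (gns_embed F')) => [x y|].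
        by have := gns_embed_linear F' 1 x y; rewrite !scale1r.
      by have := gns_embed_linear F' (-1) 0 0; rewrite scaler0 addr0 scaleN1r addNr.
    by rewrite rnorm_gns seminormE.
  by apply: FD; exists J, X, h.
- by move=> z; apply: bopP => h; rewrite bcompE ThE Te.
- by move=> g z; apply: bopP => h; rewrite bcompE !ThE We U_e.
- move=> x hx.
  have K0S : K0 (S x).
    move=> w; rewrite bcompE WdE.
    have -> : foldr (fun g y => W0 g y) (S x) w = S (foldr (fun g y => W g y) x w).
      by elim: w => //= g w ->; rewrite -!bcompE WS.
    by have := hx w; rewrite TS.
  have S0 : S x = 0.
    have := congr1 (fun B => bop_fun B x) QS; rewrite bcompE QE => <-.
    by move/PK0 : K0S => ->; rewrite subrr.
  by have := congr1 (fun B => bop_fun B x) SS; rewrite bcompE S0 op0 idopE.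
Qed.

End Dilation.

(** * Adjoints, column moves and the two-sided dilation *)

Section Conjugate.
Context {R : realType} (Z : lmodType R[i]).

(** On the conjugate module the map [z |-> adj (iota z)] is linear, so results on rows can be
    applied to columns. *)
Definition conjmod : Type := Z.

HB.instance Definition _ := GRing.Zmodule.on conjmod.

Definition conj_scale (a : R[i]) (z : conjmod) : conjmod := Num.conj a *: (z : Z).

Lemma conj_scaleA a b z : conj_scale a (conj_scale b z) = conj_scale (a * b) z.
Proof. by rewrite /conj_scale scalerA conjM. Qed.

Lemma conj_scale1 : left_id 1 conj_scale.
Proof. by move=> z; rewrite /conj_scale conj1 scale1r. Qed.

Lemma conj_scaleDr : right_distributive conj_scale +%R.
Proof. by move=> a x y; rewrite /conj_scale scalerDr. Qed.

Lemma conj_scaleDl z : {morph conj_scale^~ z : a b / a + b}.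
Proof. by move=> a b; rewrite /conj_scale conjD scalerDl. Qed.

HB.instance Definition _ := GRing.Zmodule_isLmodule.Build R[i] conjmod
  conj_scaleA conj_scale1 conj_scaleDr conj_scaleDl.

End Conjugate.

Section OpbAdjoint.
Context {R : realType} {H K : hilbertType R}.

(** With [y] the adjoint matrix applied to [k] and [w] the matrix [T] applied to [y]: |y|^2 = Re <w,
    k> <= (|w|^2 + |k|^2) / 2, while |w| <= |y|. *)
Lemma opb_adj (A B : finType) (T : A -> B -> 'B(H, K)) :
  opb T 1 -> opb (fun b a => adj (T a b)) 1.
Proof.
move=> hT k; rewrite expr1n mul1r.
pose y b := \sum_a adj (T a b) (k a); pose w a := \sum_b T a b (y b).
have hw : \sum_a rnorm (w a) ^+ 2 <= \sum_b rnorm (y b) ^+ 2.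
  by have := hT y; rewrite expr1n mul1r.
have E : \sum_b rnorm (y b) ^+ 2 = \sum_a complex.Re (hdot (w a) (k a)).
  have E1 b : rnorm (y b) ^+ 2 = \sum_a complex.Re (hdot (T a b (y b)) (k a)).
    have -> : rnorm (y b) ^+ 2 = complex.Re (hdot (y b) (y b)) by rewrite hdotxx.
    rewrite {2}/y hdot_sumr (raddf_sum (@complex.Re R)).
    by apply: eq_bigr => a _; rewrite adjP.
  under eq_bigr do rewrite E1.
  rewrite exchange_big; apply: eq_bigr => a _; rewrite /w hdot_suml.
  by rewrite (raddf_sum (@complex.Re R)).
have E2 : \sum_a complex.Re (hdot (w a) (k a)) <=
    \sum_a (rnorm (w a) ^+ 2 + rnorm (k a) ^+ 2) / 2.
  apply: ler_sum => a _; have := rnormBE (w a) (k a).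
  have := sqr_ge0 (rnorm (w a - k a)); lra.
rewrite -mulr_suml big_split /= in E2.
rewrite -/y; move: hw E2; rewrite -E.
move: (\sum_b rnorm (y b) ^+ 2) (\sum_a rnorm (w a) ^+ 2) (\sum_a rnorm (k a) ^+ 2) => p q r; lra.
Qed.

End OpbAdjoint.

Lemma opb_adjK (R : realType) (H K : hilbertType R) (A B : finType) (T : A -> B -> 'B(H, K)) :
  opb (fun b a => adj (T a b)) 1 -> opb T 1.
Proof.
move=> /opb_adj; congr opb; apply/funext => a; apply/funext => b; exact: adjK.
Qed.

Section ContrOpb.
Context {R : realType} {Z : lmodType R[i]} {H K : hilbertType R} (iota : Z -> 'B(H, K)).

Lemma contr_nth (J : finType) (X : seq (J -> Z)) :
  contr iota X <-> opb (fun (k : 'I_(size X)) j => iota (nth (fun=> 0) X k j)) 1.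
Proof.
have E h : \sum_(xi <- X) rnorm (\sum_j iota (xi j) (h j)) ^+ 2 =
    \sum_(k < size X) rnorm (\sum_j iota (nth (fun=> 0) X k j) (h j)) ^+ 2.
  by rewrite (big_nth (fun=> 0)) big_mkord.
by split=> hX h; have := hX h; rewrite ?expr1n ?mul1r E.
Qed.

Lemma opb_contr (A B : finType) (x : A -> B -> Z) :
  opb (fun a b => iota (x a b)) 1 <-> contr iota [seq x a | a <- enum A].
Proof.
have E h : \sum_(xi <- [seq x a | a <- enum A]) rnorm (\sum_j iota (xi j) (h j)) ^+ 2 =
    \sum_a rnorm (\sum_j iota (x a j) (h j)) ^+ 2.
  by rewrite big_map big_enum.
by split=> hX h; have := hX h; rewrite ?expr1n ?mul1r E.
Qed.

Lemma contr_perm (J : finType) (X Y : seq (J -> Z)) : perm_eq X Y -> contr iota X -> contr iota Y.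
Proof. by move=> pXY cX h; rewrite -(perm_big _ pXY); exact: cX. Qed.

Lemma opb_rowmove (A B : finType) (x : A -> B -> Z) f a0 : rowstable iota f ->
  opb (fun a b => iota (x a b)) 1 ->
  opb (fun a b => iota (if a == a0 then f (x a b) else x a b)) 1.
Proof.
move=> hf /opb_contr cx; apply/opb_contr.
have pA : perm_eq (enum A) (a0 :: rem a0 (enum A)) by apply: perm_to_rem; rewrite mem_enum.
have /= := contr_perm (perm_map x pA) cx.
move=> /hf; apply: contr_perm; rewrite perm_sym.
apply: perm_trans (perm_map _ pA) _; rewrite /=.
have -> : [seq (fun b => if a == a0 then f (x a b) else x a b) | a <- rem a0 (enum A)] =
    [seq x a | a <- rem a0 (enum A)].
  apply/eq_in_map => a; rewrite mem_rem_uniq ?enum_uniq// inE => /andP[/negbTE -> _] //.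
by rewrite eqxx.
Qed.

End ContrOpb.

Section AdjointMoves.
Context {R : realType} {Z : lmodType R[i]} {H K : hilbertType R}.

Definition adjoint_map (iota : Z -> 'B(H, K)) (z : conjmod Z) : 'B(K, H) := adj (iota z).

Definition colstable (iota : Z -> 'B(H, K)) (f : Z -> Z) : Prop :=
  rowstable (adjoint_map iota) (f : conjmod Z -> conjmod Z).

Lemma opb_colmove (iota : Z -> 'B(H, K)) (A B : finType) (x : A -> B -> Z) f b0 :
  colstable iota f -> opb (fun a b => iota (x a b)) 1 ->
  opb (fun a b => iota (if b == b0 then f (x a b) else x a b)) 1.
Proof.
move=> hf /opb_adj hx; apply: opb_adjK.
exact: (opb_rowmove (iota := adjoint_map iota) (x := fun b a => x a b) b0 hf hx).
Qed.

End AdjointMoves.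

(** A matrix and its adjoint are contractive together, and the hypothesis covers rectangular
    matrices of every shape, hence also transposed ones. *)
Lemma contr_adjoint_map (R : realType) (Z : lmodType R[i]) (H K H' K' : hilbertType R)
    (iota : Z -> 'B(H, K)) (Theta : Z -> 'B(H', K')) :
  (forall (J : finType) (X : seq (J -> Z)), contr iota X -> contr Theta X) ->
  forall (J : finType) (X : seq (J -> conjmod Z)),
    contr (adjoint_map iota) X -> contr (adjoint_map Theta) X.
Proof.
move=> h J X /contr_nth/opb_adj.
have -> : (fun (b : J) (a : 'I_(size X)) => adj (adjoint_map iota (nth (fun=> 0) X a b))) =
    (fun (j : J) (k : 'I_(size X)) => iota (nth (fun=> 0) X k j)).
  by apply/funext => j; apply/funext => k; exact: adjK.
move=> /(opb_contr iota (fun j (k : 'I_(size X)) => nth (fun=> 0) X k j))/h/opb_contr/opb_adj.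
by move=> hh; apply/contr_nth.
Qed.

Section Commuting.
Context {R : realType} {Z : lmodType R[i]} {H K : hilbertType R}.
Context (iota : Z -> 'B(H, K)) (iota_linear : linear iota).
Hypothesis iota_inj : forall z, iota z = 0 -> z = 0.

(* The norm of the matrix [[x, b], [x, -b]] is unchanged when [L], [M] and [L]
   act successively on its first row, first column and first row. *)
Lemma moves_commute (L M : Z -> Z) : linear L -> linear M ->
  (forall z, L (L z) = z) -> rowstable iota L -> colstable iota M ->
  forall z, L (M z) = M (L z).
Proof.
move=> lL lM LL sL sM.
have L0 : L 0 = 0 by have := lL (-1) 0 0; rewrite scaler0 addr0 scaleN1r addNr.
have LZ a x : L (a *: x) = a *: L x by have := lL a x 0; rewrite L0 !addr0.
have M0 : M 0 = 0 by have := lM (-1) 0 0; rewrite scaler0 addr0 scaleN1r addNr.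
have MZ a x : M (a *: x) = a *: M x by have := lM a x 0; rewrite M0 !addr0.
have i0 : iota 0 = 0 by have := iota_linear (-1) 0 0; rewrite scaler0 addr0 scaleN1r addNr.
have iZ a x : iota (a *: x) = a *: iota x by have := iota_linear a x 0; rewrite i0 !addr0.
have iB x y : iota (x - y) = iota x - iota y.
  by rewrite -scaleN1r addrC iota_linear scaleN1r addrC.
have iN x : iota (- x) = - iota x by rewrite -scaleN1r iZ scaleN1r.
have key x : (forall h, rnorm (iota x h) ^+ 2 <= rnorm h ^+ 2 / 2) -> L (M (L x)) = M x.
  move=> hx; pose d := L (M (L x)) - M x.
  suff : iota d = 0 by move=> /iota_inj/eqP; rewrite subr_eq0 => /eqP.
  pose n := opn (iota d).
  have [n0|n0] := eqVneq n 0; first by apply: opn_eq0; rewrite -/n n0.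
  have np : 0 < n by rewrite lt_neqAle eq_sym n0 opn_ge0.
  (* This gives [b = t d] the norm 1 / sqrt 2, the bound imposed on [x]; the parallelogram law then
     makes the matrix with rows [x, b] and [x, - b] a contraction. *)
  pose t : R := (Num.sqrt 2 * n)^-1.
  have t2 : t ^+ 2 * n ^+ 2 = 2^-1.
    by rewrite exprVn exprMn sqr_sqrtr// invfM mulfVK// expf_neq0.
  have tp : 0 < t by rewrite invr_gt0 mulr_gt0// sqrtr_gt0.
  pose b := t%:C *: d.
  have hb h : rnorm (iota b h) ^+ 2 <= rnorm h ^+ 2 / 2.
    rewrite iZ bopZE rnormZr exprMn real_normK ?num_real//.
    have h1 : rnorm (iota d h) ^+ 2 <= n ^+ 2 * rnorm h ^+ 2.
      by rewrite -exprMn lerXn2r ?nnegrE ?mulr_ge0 ?rnorm_ge0 ?opnP// opn_ge0.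
    apply: le_trans (ler_wpM2l (sqr_ge0 t) h1) _.
    by rewrite mulrA t2 mulrC.
  pose X0 (i j : bool) := if j then x else if i then b else - b.
  have c0 : opb (fun i j => iota (X0 i j)) 1.
    move=> h; rewrite expr1n mul1r !big_bool /X0 /= iN bopNE.
    have := parallelogram (iota x (h true)) (iota b (h false)).
    have := hx (h true); have := hb (h false); lra.
  have c1 := opb_rowmove true sL c0.
  have c2 := opb_colmove true sM c1.
  have c3 := opb_rowmove true sL c2.
  have c4 h1 h2 : rnorm (iota (L (M (L x))) h1 + iota b h2) ^+ 2 +
      rnorm (iota (M x) h1 - iota b h2) ^+ 2 <= rnorm h1 ^+ 2 + rnorm h2 ^+ 2.
    have := c3 (fun j => if j then h1 else h2).
    by rewrite expr1n mul1r !big_bool /X0 /= LL iN bopNE.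
  (* On the vector [(h, 2 t h)] the two rows differ by [(1 + 4 t^2) d h], while for a contraction
     the squared norm of this difference is at most twice that of the vector. *)
  have c5 h : (1 + 4 * t ^+ 2) * rnorm (iota d h) ^+ 2 <= 2 * rnorm h ^+ 2.
    have := c4 h ((2 * t)%:C *: h).
    set p := iota (L (M (L x))) h + _; set q := iota (M x) h - _.
    have pq : p - q = (1 + 4 * t ^+ 2)%:C *: iota d h.
      rewrite /p /q /b iZ bopZE opZ scalerA -rmorphM /=.
      set A := (_ * _)%:C *: _.
      rewrite opprB [A - _]addrC addrACA -bopBE -iB -/d -[X in X + _]scale1r -!scalerDl.
      congr (_ *: _); apply/eqP; rewrite eq_complex /=; apply/andP.
      by split; apply/eqP; ring.
    have := rnormBE p q; have := rnormDE p q; have := sqr_ge0 (rnorm (p + q)).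
    have s0 : 0 < 1 + 4 * t ^+ 2 by rewrite ltr_pwDl// mulr_ge0// sqr_ge0.
    rewrite pq !rnormZr !exprMn !real_normK ?num_real//.
    have -> : (2 * t) ^+ 2 = 4 * t ^+ 2 by ring.
    move: (rnorm (p + q) ^+ 2) (rnorm p ^+ 2) (rnorm q ^+ 2) (complex.Re _) => a1 a2 a3 a4.
    move: (rnorm (iota d h) ^+ 2) (rnorm h ^+ 2) => a5 a6.
    move: s0; move: (t ^+ 2) => a7 s0 h1 h2 h3 h4; rewrite -(ler_pM2l s0).
    have -> : (1 + 4 * a7) * ((1 + 4 * a7) * a5) = (1 + 4 * a7) ^+ 2 * a5 by ring.
    have -> : (1 + 4 * a7) * (2 * a6) = 2 * (a6 + 4 * a7 * a6) by ring.
    lra.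
  have c6 : (1 + 4 * t ^+ 2) * n ^+ 2 <= 2.
    have s0 : 0 < 1 + 4 * t ^+ 2 by rewrite ltr_pwDl// mulr_ge0// sqr_ge0.
    rewrite -ler_pdivlMl//; pose B := Num.sqrt ((1 + 4 * t ^+ 2)^-1 * 2).
    have B2 : B ^+ 2 = (1 + 4 * t ^+ 2)^-1 * 2 by rewrite sqr_sqrtr// mulr_ge0// invr_ge0 ltW.
    rewrite -B2 lerXn2r ?nnegrE ?opn_ge0 ?sqrtr_ge0//.
    apply: opn_le => [|h]; first exact: sqrtr_ge0.
    rewrite -(@ler_pXn2r _ 2) ?nnegrE ?mulr_ge0 ?rnorm_ge0 ?sqrtr_ge0//.
    by rewrite exprMn B2 -mulrA -ler_pdivrMl ?invr_gt0// invrK.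
  (* As [t ^+ 2 * n ^+ 2] is 1 / 2, the bound [c6] reads [n ^+ 2 + 2 <= 2]. *)
  have : n ^+ 2 <= 0 by move: c6; rewrite mulrDl mul1r -mulrA t2; lra.
  by rewrite leNgt exprn_gt0.
have key2 z : L (M (L z)) = M z.
  pose c : R := Num.sqrt 2 * (opn (iota z) + 1).
  have c0 : 0 < c by rewrite mulr_gt0 ?sqrtr_gt0// ltr_wpDl// opn_ge0.
  have := key ((c^-1)%:C *: z).
  rewrite LZ !MZ LZ => h; apply: (scalerI (a := (c^-1)%:C)).
    by rewrite fmorph_eq0 invr_eq0 lt0r_neq0.
  apply: h => h.
  rewrite iZ bopZE rnormZr exprMn real_normK ?num_real// exprVn ler_pdivrMl ?exprn_gt0//.
  rewrite /c exprMn sqr_sqrtr// mulrC mulrA mulfVK// mulrC.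
  rewrite -exprMn lerXn2r ?nnegrE ?mulr_ge0 ?addr_ge0 ?rnorm_ge0 ?opn_ge0//.
  by rewrite (le_trans (opnP _ _))// ler_wpM2r ?rnorm_ge0// lerDl.
by move=> z; rewrite -[in LHS](LL z) key2.
Qed.

End Commuting.

Section TwoSided.
Context {R : realType} {Z : lmodType R[i]} {H K : hilbertType R}.
Context (iota : Z -> 'B(H, K)) (iota_linear : linear iota).
Hypothesis iota_inj : forall z, iota z = 0 -> z = 0.
Context {G1 G2 : Type} (L : G1 -> Z -> Z) (M : G2 -> Z -> Z).
Hypothesis L_linear : forall g, linear (L g).
Hypothesis L_invol : forall g z, L g (L g z) = z.
Hypothesis L_row : forall g, rowstable iota (L g).
Hypothesis M_linear : forall g, linear (M g).
Hypothesis M_invol : forall g z, M g (M g z) = z.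
Hypothesis M_col : forall g, colstable iota (M g).

(** The row moves are dilated first; the second dilation is applied to the adjoints of the result,
    with the column moves. What remains is that [U g] still implements [L g] on the twice dilated
    space. *)
Lemma two_sided_dilation : exists (H' K' : hilbertType R) (Omega : Z -> 'B(H', K'))
    (T1 : 'B(H', H)) (T2 : 'B(K', K)) (U : G1 -> 'B(K', K')) (W : G2 -> 'B(H', H')),
  [/\ linear Omega, forall (J : finType) (X : seq (J -> Z)), contr iota X -> contr Omega X,
      forall z, bcomp T2 (bcomp (Omega z) (adj T1)) = iota z,
      forall h, rnorm (T1 h) <= rnorm h & forall h, rnorm (T2 h) <= rnorm h] /\
  [/\ [/\ forall g, adj (U g) = U g, forall g x, U g (U g x) = x &
          forall g z, bcomp (U g) (Omega z) = Omega (L g z)],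
      [/\ forall g, adj (W g) = W g, forall g x, W g (W g x) = x &
          forall g z, bcomp (Omega z) (W g) = Omega (M g z)],
      forall x, (forall w, T2 (foldr (fun g y => U g y) x w) = 0) -> x = 0 &
      forall x, (forall w, T1 (foldr (fun g y => W g y) x w) = 0) -> x = 0].
Proof.
have [K' [Th1 [T2 [U [[lT cT TT T2le] [Ua Ui UT U0]]]]]] :=
  dilation iota_linear L_linear L_invol L_row.
have cT' (J : finType) (X : seq (J -> Z)) : contr Th1 X -> contr iota X.
  move=> cX h; apply: le_trans (cX h); apply: ler_sum => xi _.
  have -> : \sum_j iota (xi j) (h j) = T2 (\sum_j Th1 (xi j) (h j)).
    by rewrite op_sum; apply: eq_bigr => j _; rewrite -TT.
  by rewrite lerXn2r ?nnegrE ?rnorm_ge0.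
have lA : linear (adjoint_map Th1).
  move=> a x y; rewrite /adjoint_map.
  by rewrite -[a *: x + y]/(Num.conj a *: (x : Z) + (y : Z)) lT adjD adjZ conjCK.
have lM g : linear (M g : conjmod Z -> conjmod Z).
  by move=> a x y; exact: (M_linear g (Num.conj a) x y).
have sM g : rowstable (adjoint_map Th1) (M g : conjmod Z -> conjmod Z).
  move=> J xi X /(contr_adjoint_map cT') cX.
  by apply: (contr_adjoint_map cT); exact: M_col.
have [H' [Th2 [T1 [W [[lT2 cT2 TT2 T1le] [Wa Wi WT W0]]]]]] := dilation lA lM M_invol sM.
pose Omega (z : Z) : 'B(H', K') := adj (Th2 z).
have OT z : bcomp (Omega z) (adj T1) = Th1 z.
  by rewrite -adj_comp TT2 /adjoint_map adjK.
have OW g z : bcomp (Omega z) (W g) = Omega (M g z).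
  by rewrite /Omega -WT adj_comp Wa.
have lO : linear Omega.
  move=> a x y; rewrite /Omega.
  have := lT2 (Num.conj a) x y.
  rewrite -[_ *: (x : conjmod Z) + _]/(Num.conj (Num.conj a) *: (x : Z) + (y : Z)) conjCK => ->.
  by rewrite adjD adjZ conjCK.
exists H', K', Omega, T1, T2, U, W; split; split=> //.
- move=> J X cX.
  have h : forall (J : finType) (X : seq (J -> conjmod Z)),
      contr (adjoint_map iota) X -> contr Th2 X.
    by move=> J' X' /(contr_adjoint_map cT)/cT2.
  apply: (contr_adjoint_map h) => k; apply: le_trans (cX k); apply: ler_sum => xi _.
  by rewrite /adjoint_map; under eq_bigr do rewrite adjK.
- by move=> z; rewrite OT TT.
- split=> // g z.
  (* Words in [W] followed by [T1] separate vectors. Against them the defect [D] reduces, since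
     [L g] commutes with the column moves, to the relation known for the first dilation. *)
  pose D := bcomp (U g) (Omega z) - Omega (L g z).
  suff : D = 0 by move=> /eqP; rewrite subr_eq0 => /eqP.
  suff D0 : adj D = 0 by rewrite -[D]adjK D0 adj0.
  pose Wd w : 'B(H', H') := foldr (fun g S => bcomp (W g) S) (idop _) w.
  have WdE w x : Wd w x = foldr (fun g y => W g y) x w by elim: w => //= g' w <-.
  have OWd y w : bcomp (Omega y) (adj (Wd w)) = Omega (foldr M y w).
    elim: w => [|g' w IHw]; first by rewrite adj1 bcomp1r.
    by rewrite /= adj_comp bcompA IHw Wa OW.
  have LM y w : foldr M (L g y) w = L g (foldr M y w).
    elim: w => //= g' w ->; apply/esym.
    exact: (moves_commute iota_linear iota_inj (L_linear g) (M_linear g') (L_invol g) (L_row g) (M_col g')).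
  apply: bopP => k; rewrite bop0E; apply: W0 => w; rewrite -WdE.
  have E : bcomp D (bcomp (adj (Wd w)) (adj T1)) = 0.
    rewrite /D bcompDl bcompNl !bcompA OWd -[bcomp (bcomp (U g) _) _]bcompA OWd.
    by rewrite -[bcomp (bcomp (U g) _) _]bcompA !OT UT LM subrr.
  have := congr1 (fun S => bop_fun S k) (congr1 (@adj R _ _) E).
  by rewrite !adj_comp !adjK adj0 !bcompE bop0E.
Qed.

End TwoSided.

Section Scaling.
Context {R : realType} {Z : lmodType R[i]}.

Lemma linear_map0 (V : lmodType R[i]) (f : Z -> V) : linear f -> f 0 = 0.
Proof. by move=> lf; have := lf (-1) 0 0; rewrite scaler0 addr0 scaleN1r addNr. Qed.

Lemma linear_mapZ (V : lmodType R[i]) (f : Z -> V) : linear f -> forall a x, f (a *: x) = a *: f x.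
Proof. by move=> lf a x; have := lf a x 0; rewrite (linear_map0 lf) !addr0. Qed.

Lemma linear_mapB (V : lmodType R[i]) (f : Z -> V) : linear f -> {morph f : x y / x - y}.
Proof. by move=> lf x y; rewrite -scaleN1r addrC lf scaleN1r addrC. Qed.

(** Needed for [M = 0], where a bound cannot be normalized to 1 by division. *)
Lemma opb_pos (A B : finType) (V W : normedModType R[i]) (T : A -> B -> 'B(V, W)) (M : R) :
  0 <= M -> (forall e, 0 < e -> opb T (M + e)) -> opb T M.
Proof.
move=> M0 h k; pose S := \sum_b rnorm (k b) ^+ 2; rewrite -/S.
have S0 : 0 <= S by apply: sumr_ge0 => b _; exact: sqr_ge0.
apply: ler_eps => e e0.
have c0 : 0 <= (2 * M + 1) * S by rewrite mulr_ge0// addr_ge0// mulr_ge0.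
have [d d0 hd] := eps_split c0 e0.
pose d' := Num.min d 1.
have d'0 : 0 < d' by rewrite lt_min d0 ltr01.
have d'd : d' <= d by rewrite ge_min lexx.
have d'1 : d' <= 1 by rewrite ge_min lexx orbT.
apply: le_trans (h d' d'0 k) _; rewrite -/S.
have : (M + d') ^+ 2 * S <= (M ^+ 2 + (2 * M + 1) * d') * S.
  rewrite ler_wpM2r// sqrrD; nra.
move/le_trans; apply; rewrite mulrDl lerD2l mulrAC (le_trans _ hd)//.
by rewrite ler_wpM2l.
Qed.

Lemma opb_of_contr (H K H' K' : hilbertType R) (iota : Z -> 'B(H, K)) (Theta : Z -> 'B(H', K')) :
  linear iota -> linear Theta ->
  (forall (J : finType) (X : seq (J -> Z)), contr iota X -> contr Theta X) ->
  forall (A B : finType) (x : A -> B -> Z) (M : R), 0 <= M ->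
    opb (fun a b => iota (x a b)) M -> opb (fun a b => Theta (x a b)) M.
Proof.
move=> li lT h A B x M M0 hx; apply: opb_pos => // e e0.
have N0 : 0 < M + e by rewrite ltr_wpDl.
move: (M + e) N0 (lerDl M e : _) => N N0.
rewrite (ltW e0) => MN {e e0}.
have sc (L1 L2 : hilbertType R) (t : Z -> 'B(L1, L2)) (P Q : R) : linear t -> 0 < Q ->
    opb (fun a b => t (x a b)) P -> opb (fun a b => t (Q%:C *: x a b)) (Q * P).
  move=> lt Q0 hP k.
  have -> : \sum_a rnorm (\sum_b t (Q%:C *: x a b) (k b)) ^+ 2 =
      Q ^+ 2 * \sum_a rnorm (\sum_b t (x a b) (k b)) ^+ 2.
    rewrite mulr_sumr; apply: eq_bigr => a _.
    under eq_bigr do rewrite (linear_mapZ lt) bopZE.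
    by rewrite -scaler_sumr rnormZr exprMn real_normK ?num_real.
  have -> : (Q * P) ^+ 2 * \sum_b rnorm (k b) ^+ 2 = Q ^+ 2 * (P ^+ 2 * \sum_b rnorm (k b) ^+ 2).
    by rewrite exprMn mulrA.
  by rewrite ler_wpM2l ?sqr_ge0//; exact: hP.
have hN : opb (fun a b => iota (x a b)) N.
  move=> k; apply: le_trans (hx k) _; rewrite ler_wpM2r//.
    by apply: sumr_ge0 => b _; exact: sqr_ge0.
  by rewrite lerXn2r ?nnegrE// ltW.
have iN : 0 < N^-1 by rewrite invr_gt0.
have := sc _ _ _ _ _ li iN hN; rewrite mulVf ?lt0r_neq0//.
move=> /opb_contr/h/opb_contr hT.
have E (a : A) (b : B) : x a b = N%:C *: (N^-1%:C *: x a b).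
  by rewrite scalerA -rmorphM /= divff ?lt0r_neq0// scale1r.
move=> k.
have -> : \sum_a rnorm (\sum_b Theta (x a b) (k b)) ^+ 2 =
    N ^+ 2 * \sum_a rnorm (\sum_b Theta (N^-1%:C *: x a b) (k b)) ^+ 2.
  rewrite mulr_sumr; apply: eq_bigr => a _.
  under eq_bigr do rewrite E (linear_mapZ lT) bopZE.
  by rewrite -scaler_sumr rnormZr exprMn real_normK ?num_real.
by rewrite ler_wpM2l ?sqr_ge0//; have := hT k; rewrite expr1n mul1r.
Qed.

Lemma opb_unit (V W : normedModType R[i]) (T : 'B(V, W)) (M : R) : 0 <= M ->
  opb (fun _ _ : unit => T) M <-> forall h, rnorm (T h) <= M * rnorm h.
Proof.
move=> M0; split=> h k.
  have := h (fun=> k); rewrite !sum_unit -exprMn.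
  by rewrite ler_pXn2r// ?nnegrE ?mulr_ge0 ?rnorm_ge0.
by rewrite !sum_unit -exprMn ler_pXn2r// ?nnegrE ?mulr_ge0 ?rnorm_ge0.
Qed.

Lemma opn_of_contr (H K H' K' : hilbertType R) (iota : Z -> 'B(H, K)) (Theta : Z -> 'B(H', K')) :
  linear iota -> linear Theta ->
  (forall (J : finType) (X : seq (J -> Z)), contr iota X -> contr Theta X) ->
  forall z, opn (Theta z) <= opn (iota z).
Proof.
move=> li lT h z; apply: opn_le => [|x]; first exact: opn_ge0.
have hu := (opb_unit (Theta z) (opn_ge0 (iota z))).1; apply: hu => {x}.
have hh := opb_of_contr li lT h (x := fun _ _ : unit => z) (opn_ge0 (iota z)); apply: hh.
by apply/(opb_unit (iota z) (opn_ge0 _)) => k; exact: opnP.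
Qed.

End Scaling.

Section Total.
Context {R : realType} {H : hilbertType R}.

Lemma total_dense (S M : set H) : subspace M -> closed M -> S `<=` M ->
  (forall x, (forall s, S s -> hdot x s = 0) -> x = 0) -> forall x, M x.
Proof.
move=> sM cM SM hS x; have [m Mm h] := projection_theorem sM cM x.
suff : x - m = 0 by move=> /eqP; rewrite subr_eq0 => /eqP ->.
by apply: hS => s /SM; exact: h.
Qed.

Lemma closed_rnorm (M : set H) :
  (forall x, (forall e : R, 0 < e -> exists2 y, M y & rnorm (x - y) < e) -> M x) -> closed M.
Proof.
move=> h x cx; apply: h => e e0.
have [y [My hy]] : exists y, M y /\ rnorm (x - y) < e.
  have : nbhs x [set y | rnorm (x - y) < e].
    have := (@cvg_rnormP R H H (nbhs x) _ id x).1; apply => //.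
  by move=> /cx [y [My hy]]; exists y.
by exists y.
Qed.

End Total.

Section MoveRepresentation.
Context {R : realType} {H K : hilbertType R} {Z0 : set 'B(H, K)}.
Context (sZ : subspace Z0) (cZ : wstar_closed Z0).

Let Z := smod sZ.

Definition incl (z : Z) : 'B(H, K) := smod_val z.

(** The w*-continuity of [f], expressed through functionals; with it the matrix coefficients along
    words of moves stay normal. *)
Definition normal_move (f : Z -> Z) := forall n : 'B(H, K) -> R[i]^o, normal_functionals n ->
  exists2 n' : 'B(H, K) -> R[i]^o, normal_functionals n' & forall z, n (incl (f z)) = n' (incl z).

Definition lmove (f : Z -> Z) :=
  [/\ linear f, forall z, f (f z) = z, rowstable incl f & normal_move f].

Definition rmove (f : Z -> Z) :=
  [/\ linear f, forall z, f (f z) = z, colstable incl f & normal_move f].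

Lemma incl_linear : linear incl.
Proof. by []. Qed.

Lemma incl_inj0 z : incl z = 0 -> z = 0.
Proof. by move=> h; apply: smod_inj. Qed.

Lemma move_representation : exists (H' K' : hilbertType R) (Om : Z -> 'B(H', K')),
  [/\ linear Om, forall (J : finType) (X : seq (J -> Z)), contr incl X <-> contr Om X,
      forall f : 'B(H', K') -> R[i]^o, normal_functionals f ->
        exists2 n : 'B(H, K) -> R[i]^o, normal_functionals n & forall z, f (Om z) = n (incl z)
    & wstar_closed (range Om)] /\
  [/\ forall f, lmove f -> exists U : 'B(K', K'), [/\ adj U = U, forall x, U (U x) = x &
        forall z, bcomp U (Om z) = Om (f z)]
    & forall f, rmove f -> exists W : 'B(H', H'), [/\ adj W = W, forall x, W (W x) = x &
        forall z, bcomp (Om z) W = Om (f z)]].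
Proof.
(* All moves of Z serve as indices at once, so that a single representation implements those of both
   matrix descriptions of Z. *)
pose G1 := {f | lmove f}; pose G2 := {f | rmove f}.
pose L (g : G1) := sval g; pose M (g : G2) := sval g.
have Ll g : linear (L g) by case: g => f [].
have Li g z : L g (L g z) = z by case: g => f [].
have Lr g : rowstable incl (L g) by case: g => f [].
have Ln g : normal_move (L g) by case: g => f [].
have Ml g : linear (M g) by case: g => f [].
have Mi g z : M g (M g z) = z by case: g => f [].
have Mc g : colstable incl (M g) by case: g => f [].
have Mn g : normal_move (M g) by case: g => f [].
have [H' [K' [Om [T1 [T2 [U [W [[lO cO TOT T1le T2le] [[Ua Ui UO] [Wa Wi OW] tU tW]]]]]]]]] :=
  two_sided_dilation incl_linear incl_inj0 Ll Li Lr Ml Mi Mc.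
have OI z : opn (Om z) <= opn (incl z) by exact: (opn_of_contr incl_linear lO cO).
pose Ud w : 'B(K', K') := foldr (fun g S => bcomp (U g) S) (idop _) w.
have UdE w x : Ud w x = foldr (fun g y => U g y) x w by elim: w => //= g' w <-.
pose Wd w : 'B(H', H') := foldr (fun g S => bcomp (W g) S) (idop _) w.
have WdE w x : Wd w x = foldr (fun g y => W g y) x w by elim: w => //= g' w <-.
have OWd y w : bcomp (Om y) (adj (Wd w)) = Om (foldr M y w).
  elim: w => [|g' w IHw]; first by rewrite adj1 bcomp1r.
  by rewrite /= adj_comp bcompA IHw Wa OW.
have UdO y w : bcomp (Ud w) (Om y) = Om (foldr L y w).
  elim: w => [|g' w IHw]; first by rewrite bcomp1l.
  by rewrite /= -bcompA IHw UO.
have word (w1 : seq G1) (w2 : seq G2) z :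
    bcomp (bcomp T2 (Ud w1)) (bcomp (Om z) (bcomp (adj (Wd w2)) (adj T1))) =
    incl (foldr L (foldr M z w2) w1).
  by rewrite [bcomp (Om z) _]bcompA OWd -bcompA [bcomp (Ud w1) _]bcompA UdO TOT.
have word_normal w1 w2 (n : 'B(H, K) -> R[i]^o) : normal_functionals n ->
    exists2 n' : 'B(H, K) -> R[i]^o, normal_functionals n' &
      forall z, n (incl (foldr L (foldr M z w2) w1)) = n' (incl z).
  elim: w1 n => [|g w1 IHw] n nn /=; last first.
    have [n1 nn1 h1] := Ln g n nn; have [n2 nn2 h2] := IHw _ nn1.
    by exists n2 => // z; rewrite h1 h2.
  elim: w2 n nn => [|g w2 IHw] n nn /=; first by exists n.
  have [n1 nn1 h1] := Mn g n nn; have [n2 nn2 h2] := IHw _ nn1.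
  by exists n2 => // z; rewrite h1 h2.
pose th w h : H' := adj (Wd w) (adj T1 h); pose ka w k : K' := adj (Ud w) (adj T2 k).
have thka w1 w2 h k z : hdot (Om z (th w2 h)) (ka w1 k) =
    hdot (incl (foldr L (foldr M z w2) w1) h) k.
  by rewrite -word !bcompE /ka -!adjP.
have th_total x : (forall w h, hdot x (th w h) = 0) -> x = 0.
  move=> hx; apply: tW => w; rewrite -WdE; apply: hdot_ext => h.
  by rewrite hdot0l !adjP; exact: hx.
have ka_total x : (forall w k, hdot x (ka w k) = 0) -> x = 0.
  move=> hx; apply: tU => w; rewrite -UdE; apply: hdot_ext => h.
  by rewrite hdot0l !adjP; exact: hx.
pose P := [set f : 'B(H', K') -> R[i]^o | exists2 n : 'B(H, K) -> R[i]^o, normal_functionals n &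
  forall z, f (Om z) = n (incl z)].
have sP : subspace P.
  split; first by exists 0; [exact: (@normal_subspace R H K).1|].
  move=> a f g [n nn hn] [m nm hm]; exists (a *: n + m); first exact: (@normal_subspace R H K).2.
  by move=> z; rewrite -[LHS]/(a * f (Om z) + g (Om z)) hn hm.
(* [Om] does not increase norms, so an approximation on B(H', K') is one on [Z0], where norm limits
   of normal functionals are normal. *)
have limP (f : 'B(H', K') -> R[i]^o) : (forall e : R, 0 < e -> exists2 g, P g &
    forall T, rnorm (f T - g T) <= e * opn T) -> P f.
  move=> hf; have /choice[inv hinv] : forall T, exists z : Z, Z0 T -> incl z = T.
    move=> T; have [hT|nT] := pselect (Z0 T); last by exists 0.
    by exists (smk sZ hT).
  have invE z : inv (incl z) = z by apply/smod_inj/hinv; exact: smodP.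
  have [e e0|n nn hn] := @normal_limit R H K Z0 (fun T => f (Om (inv T))) sZ cZ.
    have [g [n nn hn] hg] := hf e e0; exists n => // T ZT.
    have -> : n T = g (Om (inv T)) by rewrite hn hinv.
    apply: le_trans (hg _) _; rewrite ler_wpM2l ?(ltW e0)//.
    by apply: le_trans (OI _) _; rewrite hinv.
  exists n => // z; rewrite -hn ?invE//; exact: smodP.
pose vec x y : 'B(H', K') -> R[i]^o := fun T => hdot (T x) y.
have Pvec0 w k x : P (vec x (ka w k)).
  move: x; apply: (@total_dense _ _ [set th v h | v in [set: seq G2] & h in [set: H]]) => /=.
  - split; first by have := sP.1; congr P; apply/funext => T; rewrite /vec op0 hdot0l.
    move=> a x y Px Py; have := sP.2 a _ _ Px Py; congr P; apply/funext => T.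
    by rewrite /vec opD opZ hdotDl hdotZl.
  - apply: closed_rnorm => x hx; apply: limP => e e0.
    have [d d0 hd] := eps_split (rnorm_ge0 (ka w k)) e0.
    have [y Py xy] := hx d d0; exists (vec y (ka w k)) => // T.
    rewrite /vec -hdotBl -opB (le_trans (cauchy_schwarz _ _))//.
    rewrite (le_trans (ler_wpM2r (rnorm_ge0 _) (opnP _ _)))// mulrC mulrCA mulrC.
    rewrite ler_wpM2r ?opn_ge0//; apply: le_trans hd; rewrite ler_wpM2l ?rnorm_ge0//.
    exact: ltW.
  - move=> _ [v _ [h _ <-]].
    have [n nn hn] := word_normal w v _ (vector_normal h k).
    by exists n => // z; rewrite /vec thka hn.
  - move=> x hx; apply: th_total => v h; apply: hx; by exists v => //; exists h.
have Pvec x y : P (vec x y).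
  move: y; apply: (@total_dense _ _ [set ka v h | v in [set: seq G1] & h in [set: K]]) => /=.
  - split; first by have := sP.1; congr P; apply/funext => T; rewrite /vec hdot0r.
    move=> a y y' Py Py'; have := sP.2 (Num.conj a) _ _ Py Py'; congr P; apply/funext => T.
    by rewrite /vec hdotDr hdotZr.
  - apply: closed_rnorm => y hy; apply: limP => e e0.
    have [d d0 hd] := eps_split (rnorm_ge0 x) e0.
    have [y' Py yy] := hy d d0; exists (vec x y') => // T.
    rewrite /vec -hdotBr (le_trans (cauchy_schwarz _ _))//.
    rewrite (le_trans (ler_wpM2r (rnorm_ge0 _) (opnP _ _)))// -mulrA mulrC.
    rewrite ler_wpM2r ?opn_ge0//; apply: le_trans hd; rewrite ler_wpM2l ?rnorm_ge0//.
    exact: ltW.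
  - by move=> _ [v _ [h _ <-]]; exact: Pvec0.
  - move=> y hy; apply: ka_total => v h; apply: hy; by exists v => //; exists h.
have PN (f : 'B(H', K') -> R[i]^o) : normal_functionals f -> P f.
  move=> /normal_nform[x [y ->]]; apply: limP => e e0.
  have [d d0 hd] := eps_split (rnorm_ge0 y) e0.
  have /(@cvg_rnormP R _ _ totally _)/(_ d d0) := @l2t_cvg R nat H' x.
  move=> /filter_ex[A hA]; exists (nform (l2t A x) y) => [|T].
    have -> : nform (l2t A x) y = \sum_(i <- A) vec (l2p i x) (l2p i y).
      apply/funext => T; rewrite fct_sumE nformE l2tE op_sum hdot_suml.
      by apply: eq_bigr => i _; rewrite ampl_l2i adjP.
    by apply: (subspace_sum sP).
  rewrite -[nform x y T - _]/((nform x y - nform (l2t A x) y) T) -nform_Bl.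
  rewrite (le_trans (nform_le _ _ _))// mulrC ler_wpM2r ?opn_ge0//.
  by apply: le_trans hd; rewrite mulrC ler_wpM2l ?rnorm_ge0// ltW.
exists H', K', Om; split; split.
- exact: lO.
- move=> J X; split=> [|cX h]; first exact: cO.
  pose h' j := adj T1 (h j).
  apply: (@le_trans _ _ (\sum_j rnorm (h' j) ^+ 2)).
    apply: le_trans (cX h'); apply: ler_sum => xi _.
    have -> : \sum_j incl (xi j) (h j) = T2 (\sum_j Om (xi j) (h' j)).
      by rewrite op_sum; apply: eq_bigr => j _; rewrite -TOT.
    by rewrite lerXn2r ?nnegrE ?rnorm_ge0.
  apply: ler_sum => j _; rewrite lerXn2r ?nnegrE ?rnorm_ge0//.
  have hT x : rnorm (T1 x) <= 1 * rnorm x by rewrite mul1r.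
  by have := adj_bound ler01 hT (h j); rewrite mul1r.
- exact: PN.
- have sO : subspace (range Om).
    split; first by exists 0 => //; exact: linear_map0.
    by move=> a _ _ [x _ <-] [y _ <-]; exists (a *: x + y); rewrite ?lO.
  apply/(closed_polar sO) => T hT.
  (* The candidate for the preimage of [T] is its compression to the original spaces, which lies in
     the w*-closed [Z0]. *)
  have ZT : Z0 (bcomp T2 (bcomp T (adj T1))).
    apply/(closed_polar sZ).1 => // f nf f0.
    rewrite bcompA; apply: (hT _ (normal_comp T2 (adj T1) nf)) => _ [z _ <-].
    by rewrite -bcompA TOT; apply: f0; exact: smodP.
  pose z0 : Z := smk sZ ZT.
  have z0E : incl z0 = bcomp T2 (bcomp T (adj T1)) by [].
  (* On the range of [Om] this coefficient is a normal functional of the compression by [T1] and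
     [T2]. Since [T] is in the bipolar of the range, the same identity holds for [T]. *)
  have E w1 w2 h k : hdot (T (th w2 h)) (ka w1 k) = hdot (Om z0 (th w2 h)) (ka w1 k).
    have [n nn hn] := word_normal w1 w2 _ (vector_normal h k).
    have nm : normal_functionals (vec (th w2 h) (ka w1 k) - (fun S => n (bcomp (bcomp T2 S) (adj T1)))).
      apply: subspaceB; [exact: normal_subspace|exact: vector_normal|exact: normal_comp].
    have := hT _ nm; rewrite -[_ T]/(vec _ _ T - n (bcomp (bcomp T2 T) (adj T1))) -bcompA -z0E.
    rewrite thka -hn => h0; apply/eqP; rewrite -subr_eq0; apply/eqP/h0 => _ [z _ <-].
    rewrite -[LHS]/(vec _ _ (Om z) - n (bcomp (bcomp T2 (Om z)) (adj T1))) /vec thka -bcompA TOT.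
    by rewrite -hn subrr.
  exists z0 => //; apply/eqP; rewrite eq_sym -subr_eq0; apply/eqP.
  suff D0 : adj (T - Om z0) = 0 by rewrite -[LHS]adjK D0 adj0.
  apply: bopP => k; rewrite bop0E; apply: th_total => w2 h.
  rewrite -adjPr hdotC.
  suff -> : (T - Om z0) (th w2 h) = 0 by rewrite hdot0l conj0.
  by apply: ka_total => w1 k'; rewrite bopBE hdotBl E subrr.
- by move=> f hf; exists (U (exist _ f hf)); split => // z; rewrite UO.
- by move=> f hf; exists (W (exist _ f hf)); split => // z; rewrite OW.
Qed.

End MoveRepresentation.

(** * From isomorphic matrix spaces to a TRO-embedding *)

Section MatrixSpaces.
Context {R : realType} {I : choiceType} {H K : hilbertType R} (X : set 'B(H, K)).
Hypothesis sX : subspace X.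

Lemma ent0 : ent (0 : 'B(l2 I H, l2 I K)) = 0.
Proof. by have := @ent_linear R I H K (-1) 0 0; rewrite scaler0 addr0 scaleN1r addNr. Qed.

Lemma MIop_subspace : subspace (MIop (I := I) X).
Proof.
split; first by move=> i j; rewrite ent0; exact: sX.1.
move=> a S T XS XT i j; rewrite ent_linear.
exact: sX.2 a _ _ (XS i j) (XT i j).
Qed.

Lemma MIop_closed : wstar_closed X -> wstar_closed (MIop (I := I) X).
Proof.
move=> cX; apply/(closed_polar MIop_subspace) => T hT i j.
apply/(closed_polar sX).1 => // f nf fX.
have := hT _ (normal_comp (l2p i) (l2i j) nf); rewrite /ent bcompA; apply.
by move=> S XS; rewrite -bcompA; apply: fX; exact: XS.
Qed.

Lemma MI_subspace : subspace (MI I X).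
Proof.
rewrite MIE; split; first by exists 0; [exact: MIop_subspace.1|exact: ent0].
move=> a _ _ [S XS <-] [T XT <-]; exists (a *: S + T); last exact: ent_linear.
exact: MIop_subspace.2.
Qed.

End MatrixSpaces.

Section Pullback.
Context {R : realType} {I : choiceType} {H1 H2 K1 K2 : hilbertType R}.
Context {X : set 'B(H1, H2)} {Y : set 'B(K1, K2)} {rho : infmx I H1 H2 -> infmx I K1 K2}.
Hypotheses (sX : subspace X) (hrho : wstar_MI_iso X Y rho).

(** [MI_normal_functionals] constrains values on bounded matrices only, so [continuous_span] is
    applied with the larger space [P] of all functionals that agree with some [nform] there. *)
Lemma pi_pullback (f : 'B(l2 I K1, l2 I K2) -> R[i]^o) : normal_functionals f ->
  exists2 g : 'B(l2 I H1, l2 I H2) -> R[i]^o, normal_functionals g &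
    forall S S', MIop X S -> ent S' = rho (ent S) -> f S' = g S.
Proof.
move=> /normal_nform[x [y ->]].
have [F nF hF] := MI_normal_extend x y.
have [lrho _ _ crho] := hrho.
pose P := [set g : infmx I H1 H2 -> R[i]^o | exists x y, forall S, g (ent S) = nform x y S].
have sP : subspace P.
  split; first by exists 0, 0 => S; rewrite nform0l.
  move=> a g g' [x1 [y1 h1]] [x2 [y2 h2]].
  exists (l2sh 0 (a *: x1) + l2sh 1 x2), (l2sh 0 y1 + l2sh 1 y2) => S.
  rewrite -[LHS]/(a * g (ent S) + g' (ent S)) h1 h2 -nform_sum2.
  by rewrite nform_Zl.
have PD g : P g -> lin_on (MI I X) g.
  rewrite MIE => -[x1 [y1 h1]] a _ _ [S XS <-] [T XT <-].
  by rewrite -ent_linear !h1 nform_linear.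
have lF : lin_on (MI I X) (F \o rho).
  have sub S : MI I X S -> exists2 T, ent T = rho S & True.
    move=> XS; have : (rho @` MI I X) (rho S) by exists S.
    have [_ -> _ _] := hrho; rewrite MIE => -[T _ <-]; by exists T.
  move=> a S T XS XT; rewrite /= lrho//.
  have [S' <- _] := sub _ XS; have [T' <- _] := sub _ XT.
  by rewrite -ent_linear !hF nform_linear.
have [t [x1 [y1 ht]] tE] : exists2 t, P t & forall S, MI I X S -> (F \o rho) S = t S.
  apply: (@continuous_span R (infmx I H1 H2) MI_normal_functionals P (MI I X)) => //.
  - by move=> g /MI_normal_pullback.
  - exact: MI_subspace.
  - move: crho; rewrite !subspace_continuousP => crho S XS.
    by apply: (cvg_comp _ _ (crho S XS)); exact: (ft_ev_continuous nF).
exists (nform x1 y1) => [|S S' XS E]; first by apply/normal_nform; exists x1, y1.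
have := tE (ent S); rewrite /= -E hF ht; apply.
by rewrite MIE; exists S.
Qed.

End Pullback.

Section SquareMatrices.
Context {R : realType} {V W : normedModType R[i]}.

(** Matrix norms are given for square matrices; a rectangular matrix becomes the upper right corner
    of a square one, with the same norm. *)
Definition mx_of (A B : finType) (x : A -> B -> 'B(V, W)) : 'M['B(V, W)]_#|{: A + B}| :=
  \matrix_(i, j) match enum_val i, enum_val j with inl a, inr b => x a b | _, _ => 0 end.

Lemma sum_enum_val (U : nmodType) (A : finType) (F : A -> U) :
  \sum_(i < #|A|) F (enum_val i) = \sum_a F a.
Proof. by rewrite -(big_enum_val F); apply: eq_bigl => a; rewrite inE. Qed.

Lemma opb_mx_of (A B : finType) (x : A -> B -> 'B(V, W)) (M : R) :
  opb (fun i j => mx_of x i j) M <-> opb x M.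
Proof.
pose y (p q : (A + B)%type) : 'B(V, W) := match p, q with inl a, inr b => x a b | _, _ => 0 end.
have E (h : (A + B)%type -> V) : \sum_i rnorm (\sum_j mx_of x i j (h (enum_val j))) ^+ 2 =
    \sum_a rnorm (\sum_b x a b (h (inr b))) ^+ 2.
  transitivity (\sum_(i < #|{: A + B}|) rnorm (\sum_q y (enum_val i) q (h q)) ^+ 2).
    apply: eq_bigr => i _; rewrite -(sum_enum_val (fun q => y (enum_val i) q (h q))).
    by congr (rnorm _ ^+ 2); apply: eq_bigr => j _; rewrite mxE.
  rewrite (sum_enum_val (fun p => rnorm (\sum_q y p q (h q)) ^+ 2)) big_sumType /=.
  rewrite [X in _ + X]big1 ?addr0 => [|b _]; last first.
    by rewrite big1 ?rnorm0 ?expr0n// => q _; rewrite bop0E.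
  apply: eq_bigr => a _; rewrite big_sumType /= big1 ?add0r//.
split=> hM h.
  pose h' (q : (A + B)%type) := if q is inr b then h b else 0.
  have := hM (fun j => h' (enum_val j)); rewrite E /=.
  rewrite (sum_enum_val (fun q => rnorm (h' q) ^+ 2)) big_sumType /= [X in X + _]big1 ?add0r//.
  by move=> a _; rewrite rnorm0 expr0n.
pose h' (q : (A + B)%type) := h (enum_rank q).
have -> : \sum_i rnorm (\sum_j mx_of x i j (h j)) ^+ 2 =
    \sum_i rnorm (\sum_j mx_of x i j (h' (enum_val j))) ^+ 2.
  apply: eq_bigr => i _; congr (rnorm _ ^+ 2); apply: eq_bigr => j _.
  by rewrite /h' enum_valK.
rewrite E; apply: le_trans (hM (fun b => h' (inr b))) _; rewrite ler_wpM2l ?sqr_ge0//.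
have -> : \sum_j rnorm (h j) ^+ 2 = \sum_(j < #|{: A + B}|) rnorm (h' (enum_val j)) ^+ 2.
  by apply: eq_bigr => j _; rewrite /h' enum_valK.
rewrite (sum_enum_val (fun q => rnorm (h' q) ^+ 2)) big_sumType /= lerDr.
by apply: sumr_ge0 => a _; exact: sqr_ge0.
Qed.

Lemma mxnorm_mx_of (A B : finType) (x : A -> B -> 'B(V, W)) (M : R) : 0 <= M ->
  bop_mxnorm (mx_of x) <= M <-> opb x M.
Proof. by move=> M0; rewrite -opb_mx_of; exact: opnorm_le. Qed.

End SquareMatrices.

Section MatrixIsometry.
Context {R : realType} {I : choiceType} {H1 H2 K1 K2 : hilbertType R}.
Context {X : set 'B(H1, H2)} {Y : set 'B(K1, K2)} {rho : infmx I H1 H2 -> infmx I K1 K2}.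
Hypotheses (sX : subspace X) (hrho : wstar_MI_iso X Y rho).

Lemma MI_iso_opb (A B : finType) (x : A -> B -> 'B(l2 I H1, l2 I H2))
    (x' : A -> B -> 'B(l2 I K1, l2 I K2)) (M : R) : 0 <= M ->
  (forall a b, MIop X (x a b)) -> (forall a b, ent (x' a b) = rho (ent (x a b))) ->
  opb x' M <-> opb x M.
Proof.
move=> M0 Xx xE; have [lrho _ irho _] := hrho.
have rho0 : rho 0 = 0.
  have := lrho (-1) 0 0 (MI_subspace (I := I) sX).1 (MI_subspace (I := I) sX).1.
  by rewrite scaler0 addr0 scaleN1r addNr.
have E : map_mx rho (map_mx ent (mx_of x)) = map_mx ent (mx_of x').
  apply/matrixP => i j; rewrite !mxE; case: (enum_val i) => a; case: (enum_val j) => b;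
    by rewrite ?xE ?ent0 ?rho0.
have := irho _ (map_mx ent (mx_of x)); rewrite E !MI_mxnorm_ent => h.
rewrite -!mxnorm_mx_of// h// => i j; rewrite mxE MIE; eexists; last reflexivity.
rewrite mxE; case: (enum_val i) => a; case: (enum_val j) => b //;
  exact: (MIop_subspace (I := I) sX).1.
Qed.

End MatrixIsometry.

Section CbIso.
Context {R : realType}.

Lemma bop_mxnorm_ge0 (V W : normedModType R[i]) n (T : 'M['B(V, W)]_n) : 0 <= bop_mxnorm T.
Proof. exact: opnorm_ge0. Qed.

Lemma bop_mxnorm1 (V W : normedModType R[i]) (T : 'B(V, W)) :
  bop_mxnorm (const_mx T : 'M['B(V, W)]_1) <= 0 -> T = 0.
Proof.
move=> /(opnorm_le (fun i j => (const_mx T : 'M['B(V, W)]_1) i j) (lexx 0)).1 h.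
apply: bopP => x; rewrite bop0E; apply: rnorm_eq0; apply/eqP; rewrite -sqrf_eq0.
have := h (fun=> x); rewrite !big_ord1 mxE expr0n mul0r => h0.
by rewrite eq_le h0 sqr_ge0.
Qed.

Lemma range_subspace (V W : lmodType R[i]) (f : {linear V -> W}) : subspace (range f).
Proof.
split; first by exists 0 => //; exact: linear0.
by move=> a _ _ [x _ <-] [y _ <-]; exists (a *: x + y); rewrite ?linearP.
Qed.

(** Used to replace [phi] by its composite with [tau], of which only the restriction to the range of
    [phi] is controlled; [C1] and [C2] are the complete bounds in the two directions. *)
Lemma wstar_cb_iso_comp (X : dualOperatorSpace R) (H1 H2 K1 K2 : hilbertType R)
    (phi : {linear X -> 'B(H1, H2)}) (phi' : {linear X -> 'B(K1, K2)})
    (tau : 'B(H1, H2) -> 'B(K1, K2)) (C1 C2 : R) : wstar_cb_iso phi ->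
  (forall x, phi' x = tau (phi x)) ->
  (forall n (T : 'M['B(H1, H2)]_n), (forall i j, range phi (T i j)) ->
    bop_mxnorm (map_mx tau T) <= C1 * bop_mxnorm T) ->
  (forall n (T : 'M['B(H1, H2)]_n), (forall i j, range phi (T i j)) ->
    bop_mxnorm T <= C2 * bop_mxnorm (map_mx tau T)) ->
  (forall f, normal_functionals f -> exists2 g, normal_functionals g &
    forall T, range phi T -> f (tau T) = g T) ->
  wstar_closed (range phi') -> wstar_cb_iso phi'.
Proof.
move=> [_ cphi [C hC] [inv invK [D hD]]] E h1 h2 hn cl; split => //.
- apply: ft_continuous => f nf; have [g ng hg] := hn f nf.
  have -> : f \o phi' = g \o phi by apply/funext => x /=; rewrite E hg//; exists x.
  by move=> x; apply: (cvg_comp _ _ (cphi x)); exact: (ft_ev_continuous ng).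
- exists (Num.max C1 0 * C) => n x _.
  have -> : map_mx phi' x = map_mx tau (map_mx phi x) by apply/matrixP => i j; rewrite !mxE.
  apply: le_trans (h1 _ _ _) _ => [i j|]; first by rewrite mxE; exists (x i j).
  apply: (@le_trans _ _ (Num.max C1 0 * bop_mxnorm (map_mx phi x))).
    by rewrite ler_wpM2r ?bop_mxnorm_ge0// le_max lexx.
  rewrite -mulrA ler_wpM2l//; first by rewrite le_max lexx orbT.
  exact: hC.
have inj x y : phi' x = phi' y -> x = y.
  move=> /eqP; rewrite -subr_eq0 -linearB => /eqP h.
  apply/eqP; rewrite -subr_eq0; apply/eqP/(can_inj invK); rewrite linear0.
  apply: bop_mxnorm1; apply: le_trans (h2 _ _ _) _ => [i j|]; first by rewrite mxE; exists (x - y).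
  have -> : map_mx tau (const_mx (phi (x - y))) = const_mx 0 :> 'M['B(K1, K2)]_1.
    by apply/matrixP => i j; rewrite !mxE -E h.
  suff -> : bop_mxnorm (const_mx 0 : 'M['B(K1, K2)]_1) = 0 by rewrite mulr0.
  apply/eqP; rewrite eq_le bop_mxnorm_ge0 andbT.
  apply/(opnorm_le (fun i j => (const_mx 0 : 'M['B(K1, K2)]_1) i j) (lexx 0)) => k.
  by rewrite big1 ?expr0n ?mul0r// => i _; rewrite big1 ?rnorm0 ?expr0n// => j _; rewrite mxE bop0E.
have /choice[inv' hinv'] : forall S, exists x, range phi' S -> phi' x = S.
  move=> S; have [[x _ xS]|nS] := pselect (range phi' S); last by exists 0.
  by exists x.
exists inv' => [x|]; first by apply: inj; apply: hinv'; exists x.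
exists (Num.max D 0 * C2) => n S hS.
pose x := map_mx inv' S.
have xS : S = map_mx tau (map_mx phi x) by apply/matrixP => i j; rewrite !mxE -E hinv'.
have xphi i j : range phi (map_mx phi x i j) by rewrite mxE; exists (x i j).
have -> : map_mx inv' S = map_mx inv (map_mx phi x).
  by apply/matrixP => i j; rewrite !mxE invK.
apply: le_trans (hD _ _ xphi) _.
apply: (@le_trans _ _ (Num.max D 0 * bop_mxnorm (map_mx phi x))).
  by rewrite ler_wpM2r ?bop_mxnorm_ge0// le_max lexx.
rewrite -mulrA ler_wpM2l//; first by rewrite le_max lexx orbT.
by rewrite xS; exact: h2.
Qed.

End CbIso.

(** * Corners, their multipliers and the symmetries of l2(I) *)

Section Corners.
Context {R : realType} {H K : hilbertType R} (O : set 'B(H, K)) (sO : subspace O).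

(** The condition on [adj a] makes this a self-adjoint algebra, so that it is stable under the
    ternary product of TROs. *)
Definition lmult : set 'B(K, K) :=
  [set a | forall T, O T -> O (bcomp a T) /\ O (bcomp (adj a) T)].

Definition rmult : set 'B(H, H) :=
  [set b | forall T, O T -> O (bcomp T b) /\ O (bcomp T (adj b))].

Lemma lmult_comp a b : lmult a -> lmult b -> lmult (bcomp a b).
Proof.
move=> ha hb T OT; rewrite adj_comp -!bcompA; split.
  exact: (ha _ (hb _ OT).1).1.
exact: (hb _ (ha _ OT).2).2.
Qed.

Lemma rmult_comp a b : rmult a -> rmult b -> rmult (bcomp a b).
Proof.
move=> ha hb T OT; rewrite adj_comp !bcompA; split.
  exact: (hb _ (ha _ OT).1).1.
exact: (ha _ (hb _ OT).2).2.
Qed.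

Lemma lmult_adj a : lmult a -> lmult (adj a).
Proof. by move=> ha T OT; rewrite adjK; have [] := ha T OT. Qed.

Lemma rmult_adj a : rmult a -> rmult (adj a).
Proof. by move=> ha T OT; rewrite adjK; have [] := ha T OT. Qed.

Lemma lmult_subspace : subspace lmult.
Proof.
split=> [T OT|a x y hx hy T OT]; first by rewrite adj0 !bcomp0l; split; exact: sO.1.
rewrite adjD adjZ !bcompDl !bcompZl.
by split; apply: sO.2; have [] := hx T OT; have [] := hy T OT.
Qed.

Lemma rmult_subspace : subspace rmult.
Proof.
split=> [T OT|a x y hx hy T OT]; first by rewrite adj0 !bcomp0r; split; exact: sO.1.
rewrite adjD adjZ !bcompDr !bcompZr.
by split; apply: sO.2; have [] := hx T OT; have [] := hy T OT.
Qed.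

Lemma lmult1 : lmult (idop K).
Proof. by move=> T OT; rewrite adj1 !bcomp1l. Qed.

Lemma rmult1 : rmult (idop H).
Proof. by move=> T OT; rewrite adj1 !bcomp1r. Qed.

Definition corner (E2 : 'B(K, K)) (E1 : 'B(H, H)) : set 'B(H, K) :=
  [set T | O T /\ bcomp E2 (bcomp T E1) = T].

(** The off-diagonal corner of the self-adjoint algebra [lmult] leading from [E] to [F]; as such it
    is a TRO. *)
Definition linter (F E : 'B(K, K)) : set 'B(K, K) :=
  [set n | [/\ lmult n, bcomp F n = n & bcomp n E = n]].

Definition rinter (F E : 'B(H, H)) : set 'B(H, H) :=
  [set n | [/\ rmult n, bcomp F n = n & bcomp n E = n]].

Lemma linter_TRO F E : is_TRO (linter F E).
Proof.
split.
- by split; [exact: lmult_subspace.1|exact: bcomp0r|exact: bcomp0l].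
- move=> a x y [lx Fx xE] [ly Fy yE]; split; first exact: lmult_subspace.2.
    by rewrite bcompDr bcompZr Fx Fy.
  by rewrite bcompDl bcompZl xE yE.
- move=> _ [_ [x [lx Fx _]] [y' [y [ly _ _] /adjE ->] <-] [z [lz _ zE] <-]]; split.
  + by apply: lmult_comp => //; apply: lmult_comp => //; exact: lmult_adj.
  + by rewrite !bcompA Fx.
  + by rewrite -bcompA zE.
Qed.

Lemma rinter_TRO F E : is_TRO (rinter F E).
Proof.
split.
- by split; [exact: rmult_subspace.1|exact: bcomp0r|exact: bcomp0l].
- move=> a x y [lx Fx xE] [ly Fy yE]; split; first exact: rmult_subspace.2.
    by rewrite bcompDr bcompZr Fx Fy.
  by rewrite bcompDl bcompZl xE yE.
- move=> _ [_ [x [lx Fx _]] [y' [y [ly _ _] /adjE ->] <-] [z [lz _ zE] <-]]; split.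
  + by apply: rmult_comp => //; apply: rmult_comp => //; exact: rmult_adj.
  + by rewrite !bcompA Fx.
  + by rewrite -bcompA zE.
Qed.

Section Projections.
Context {E2 F2 : 'B(K, K)} {E1 F1 : 'B(H, H)}.
Hypotheses (pE2 : is_projection E2) (pF2 : is_projection F2).
Hypotheses (pE1 : is_projection E1) (pF1 : is_projection F1).

Lemma corner_subspace : subspace (corner E2 E1).
Proof.
split; first by split; [exact: sO.1|rewrite bcomp0l bcomp0r].
move=> a S T [OS hS] [OT hT]; split; first exact: sO.2.
by rewrite bcompDl bcompZl bcompDr bcompZr hS hT.
Qed.

Lemma corner_l T : corner E2 E1 T -> bcomp E2 T = T.
Proof. by move=> [_ <-]; rewrite bcompA (pE2.1). Qed.

Lemma corner_r T : corner E2 E1 T -> bcomp T E1 = T.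
Proof. by move=> [_ <-]; rewrite -!bcompA (pE1.1). Qed.

Lemma corner_closed : wstar_closed O -> wstar_closed (corner E2 E1).
Proof.
move=> cO; apply/(closed_polar corner_subspace) => T hT; split.
  apply/(closed_polar sO).1 => // f nf f0; apply: hT => // S [OS _]; exact: f0.
apply: bopP => x; apply: hdot_ext => y; apply/eqP; rewrite -subr_eq0; apply/eqP.
have nf : normal_functionals ((fun S : 'B(H, K) => hdot (bcomp (bcomp E2 S) E1 x) y : R[i]^o) -
    (fun S : 'B(H, K) => hdot (S x) y : R[i]^o)).
  apply: subspaceB; [exact: normal_subspace|exact: (normal_comp _ _ (vector_normal x y))|].
  exact: vector_normal.
have := hT _ nf; rewrite -[_ T]/(hdot (bcomp (bcomp E2 T) E1 x) y - hdot (T x) y) -bcompA; apply.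
move=> S [_ hS].
by rewrite -[LHS]/(hdot (bcomp (bcomp E2 S) E1 x) y - hdot (S x) y) -bcompA hS subrr.
Qed.

Lemma inter_corner n T m : linter F2 E2 n -> O T -> rinter F1 E1 m ->
  corner F2 F1 (bcomp (bcomp n T) (adj m)).
Proof.
move=> [ln Fn _] OT [rm Fm _]; split; first exact: (rm _ (ln _ OT).1).2.
have mF : bcomp (adj m) F1 = adj m by rewrite -{1}(projection_adj pF1) -adj_comp Fm.
by rewrite -[bcomp (bcomp (bcomp n T) _) F1]bcompA mF !bcompA Fn.
Qed.

Lemma adj_inter_corner n T m : linter F2 E2 n -> O T -> rinter F1 E1 m ->
  corner E2 E1 (bcomp (bcomp (adj n) T) m).
Proof.
move=> [ln _ nE] OT [rm _ mE]; split; first exact: (rm _ (ln _ OT).2).1.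
by rewrite -bcompA mE !bcompA -[X in bcomp X (adj n)](projection_adj pE2) -adj_comp nE.
Qed.

Lemma linter_mul_corner n1 n2 T : linter F2 E2 n1 -> linter F2 E2 n2 -> corner E2 E1 T ->
  corner E2 E1 (bcomp (bcomp (adj n1) n2) T).
Proof.
move=> [l1 _ n1E] [l2 _ _] cT; have [OT _] := cT; split.
  rewrite -bcompA; exact: (l1 _ (l2 _ OT).1).2.
rewrite -bcompA (corner_r cT) !bcompA -[X in bcomp X (adj n1)](projection_adj pE2).
by rewrite -adj_comp n1E.
Qed.

Lemma rinter_mul_corner m1 m2 T : rinter F1 E1 m1 -> rinter F1 E1 m2 -> corner E2 E1 T ->
  corner E2 E1 (bcomp (bcomp T (adj m1)) m2).
Proof.
move=> [l1 _ _] [l2 _ m2E] cT; have [OT _] := cT; split.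
  exact: (l2 _ (l1 _ OT).2).1.
by rewrite -bcompA m2E !bcompA (corner_l cT).
Qed.

End Projections.
End Corners.

Section Coordinates.
Context {R : realType} {I : choiceType} {A : hilbertType R}.

Definition cproj (i : I) : 'B(l2 I A, l2 I A) := bcomp (l2i i) (l2p i).

Lemma l2p_l2i (i j : I) : bcomp (l2p i) (l2i j) = if i == j then idop A else 0.
Proof.
by apply: bopP => x; rewrite bcompE l2pi; case: eqP => // _; rewrite bop0E.
Qed.

Lemma cproj_adj i : adj (cproj i) = cproj i.
Proof. by rewrite adj_comp adjK. Qed.

Lemma cproj_idem i : bcomp (cproj i) (cproj i) = cproj i.
Proof. by rewrite /cproj -bcompA [bcomp (l2p i) _]bcompA l2p_l2i eqxx bcomp1l. Qed.

(** An involution, hence available as a move; [cproj i] is half the difference of the identity and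
    [crefl i]. *)
Definition crefl i : 'B(l2 I A, l2 I A) := idop _ - (2 : R[i]) *: cproj i.

Lemma crefl_adj i : adj (crefl i) = crefl i.
Proof. by rewrite adjB adj1 adjZ cproj_adj rmorph_nat. Qed.

Lemma crefl_invol i : bcomp (crefl i) (crefl i) = idop _.
Proof.
rewrite /crefl bcompDl bcomp1l bcompNl bcompDr bcomp1r bcompNr bcompZl bcompZr cproj_idem scalerA.
set c := 2 *: cproj i.
have -> : (2 * 2 : R[i]) *: cproj i = c + c by rewrite -scalerDl; congr (_ *: _); ring.
have -> : c - (c + c) = - c by rewrite opprD addrA subrr add0r.
by rewrite opprK subrK.
Qed.

(** The transposition of [i0] and [i]: it permutes coordinates, so it preserves every M_I(X), and it
    carries the coordinate [i0] to any other. *)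
Lemma swap_exists (i0 i : I) : exists S : 'B(l2 I A, l2 I A),
  [/\ adj S = S, bcomp S S = idop _, bcomp S (l2i i0) = l2i i &
      forall j, exists k, bcomp S (l2i j) = l2i k].
Proof.
pose g j := if j == i0 then i else if j == i then i0 else j.
have gg j : g (g j) = j.
  rewrite /g; have [->|ji0] := eqVneq j i0.
    by rewrite eqxx; case: eqVneq => // ->.
  have [->|ji] := eqVneq j i; first by rewrite eqxx.
  by rewrite (negbTE ji0) (negbTE ji).
have [S hS _] := @reindex_exists R I I A g (can_inj gg).
exists S; split.
- apply: l2_bop_eq => j x; apply: l2_hdot_eq => k y.
  rewrite -adjPr !hS !hdot_l2i.
  by have -> : (j == g k) = (g j == k) by rewrite -(inj_eq (can_inj gg)) gg.
- by apply: l2_bop_eq => j x; rewrite bcompE !hS gg.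
- by apply: bopP => x; rewrite bcompE hS /g eqxx.
- by move=> j; exists (g j); apply: bopP => x; rewrite bcompE hS.
Qed.

Definition swap i0 i := projT1 (cid (swap_exists i0 i)).

Lemma swap_adj i0 i : adj (swap i0 i) = swap i0 i.
Proof. by have [] := projT2 (cid (swap_exists i0 i)). Qed.

Lemma swap_invol i0 i : bcomp (swap i0 i) (swap i0 i) = idop _.
Proof. by have [] := projT2 (cid (swap_exists i0 i)). Qed.

Lemma swap_l2i i0 i : bcomp (swap i0 i) (l2i i0) = l2i i.
Proof. by have [] := projT2 (cid (swap_exists i0 i)). Qed.

Lemma swap_l2i_ex i0 i j : exists k, bcomp (swap i0 i) (l2i j) = l2i k.
Proof. by have [_ _ _ h] := projT2 (cid (swap_exists i0 i)); exact: h. Qed.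

Lemma swap_cproj i0 i : bcomp (swap i0 i) (bcomp (cproj i0) (swap i0 i)) = cproj i.
Proof.
rewrite /cproj -bcompA bcompA swap_l2i; congr bcomp.
by rewrite -[in LHS](swap_adj i0 i) -adj_comp swap_l2i.
Qed.

End Coordinates.

Section MIstable.
Context {R : realType} {I : choiceType} {A1 A2 : hilbertType R} (D : set 'B(A1, A2)).
Hypothesis sD : subspace D.

Lemma entE (S : 'B(l2 I A1, l2 I A2)) i j : ent S i j = bcomp (l2p i) (bcomp S (l2i j)).
Proof. by []. Qed.

Lemma MIop_single i d : D d -> MIop D (bcomp (l2i (I := I) i) (bcomp d (l2p i))).
Proof.
move=> Dd j k; rewrite entE !bcompA l2p_l2i; case: eqP => [_|_]; last first.
  by rewrite !bcomp0l; exact: sD.1.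
rewrite bcomp1l -bcompA l2p_l2i; case: eqP => [_|_]; first by rewrite bcomp1r.
by rewrite bcomp0r; exact: sD.1.
Qed.

Lemma MIop_swap_l i0 i T : MIop D T -> MIop D (bcomp (swap (I := I) i0 i) T).
Proof.
move=> DT j k; rewrite entE.
have -> : bcomp (l2p j) (bcomp (bcomp (swap i0 i) T) (l2i k)) =
   bcomp (adj (bcomp (swap i0 i) (l2i j))) (bcomp T (l2i k)).
  by rewrite adj_comp swap_adj !bcompA.
by have [k' ->] := swap_l2i_ex (A := A2) i0 i j; exact: DT.
Qed.

Lemma MIop_swap_r i0 i T : MIop D T -> MIop D (bcomp T (swap (I := I) i0 i)).
Proof.
move=> DT j k; rewrite entE -bcompA.
by have [k' ->] := swap_l2i_ex (A := A1) i0 i k; exact: DT.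
Qed.

Lemma MIop_cproj_l i T : MIop D T -> MIop D (bcomp (cproj (I := I) i) T).
Proof.
move=> DT j k; rewrite entE /cproj !bcompA l2p_l2i.
case: eqP => [_|_]; last by rewrite !bcomp0l; exact: sD.1.
by rewrite bcomp1l -bcompA; exact: DT.
Qed.

Lemma MIop_cproj_r i T : MIop D T -> MIop D (bcomp T (cproj (I := I) i)).
Proof.
move=> DT j k; rewrite entE /cproj -!bcompA l2p_l2i.
case: eqP => [_|_]; last by rewrite !bcomp0r; exact: sD.1.
by rewrite bcomp1r; exact: DT.
Qed.

Lemma MIop_crefl_l i T : MIop D T -> MIop D (bcomp (crefl (I := I) i) T).
Proof.
move=> DT; rewrite /crefl bcompDl bcompNl bcomp1l bcompZl.
apply: (subspaceB (MIop_subspace (I := I) sD)) => //; apply: (subspaceZ (MIop_subspace (I := I) sD)).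
exact: MIop_cproj_l.
Qed.

Lemma MIop_crefl_r i T : MIop D T -> MIop D (bcomp T (crefl (I := I) i)).
Proof.
move=> DT; rewrite /crefl bcompDr bcompNr bcomp1r bcompZr.
apply: (subspaceB (MIop_subspace (I := I) sD)) => //; apply: (subspaceZ (MIop_subspace (I := I) sD)).
exact: MIop_cproj_r.
Qed.

End MIstable.

(** * A matrix description of Z inside the common representation *)

Section Frame.
Context {R : realType} {H K : hilbertType R} {Z0 : set 'B(H, K)} {sZ : subspace Z0}.
Let Z := smod sZ.
Context {H' K' : hilbertType R} {Om : Z -> 'B(H', K')}.
Hypothesis Om_linear : linear Om.
Hypothesis Om_contr : forall (J : finType) (X : seq (J -> Z)), contr (@incl _ _ _ _ sZ) X <-> contr Om X.
Hypothesis Om_normal : forall f : 'B(H', K') -> R[i]^o, normal_functionals f ->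
  exists2 n : 'B(H, K) -> R[i]^o, normal_functionals n & forall z, f (Om z) = n (incl z).
Hypothesis Om_left : forall f, lmove f -> exists U : 'B(K', K'),
  [/\ adj U = U, forall x, U (U x) = x & forall z, bcomp U (Om z) = Om (f z)].
Hypothesis Om_right : forall f, rmove f -> exists W : 'B(H', H'),
  [/\ adj W = W, forall x, W (W x) = x & forall z, bcomp (Om z) W = Om (f z)].
Context {I : choiceType} (i0 : I) {A1 A2 : hilbertType R} {D : set 'B(A1, A2)} (sD : subspace D).
Context {th : Z -> 'B(l2 I A1, l2 I A2)} (th_linear : linear th).
Hypothesis th_inj : forall z, th z = 0 -> z = 0.
Hypothesis th_MI : forall z, MIop D (th z).
Hypothesis th_onto : forall T, MIop D T -> exists z, th z = T.
Hypothesis th_contr : forall (J : finType) (X : seq (J -> Z)), contr (@incl _ _ _ _ sZ) X <-> contr th X.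
Hypothesis th_normal : forall f : 'B(l2 I A1, l2 I A2) -> R[i]^o, normal_functionals f ->
  exists2 n : 'B(H, K) -> R[i]^o, normal_functionals n & forall z, f (th z) = n (incl z).
Hypothesis th_normal' : forall n : 'B(H, K) -> R[i]^o, normal_functionals n ->
  exists2 f : 'B(l2 I A1, l2 I A2) -> R[i]^o, normal_functionals f & forall z, n (incl z) = f (th z).

Local Notation O := (range Om).

Let th_eq x y : th x = th y -> x = y.
Proof.
move=> e; apply/eqP; rewrite -subr_eq0; apply/eqP/th_inj.
by rewrite (linear_mapB th_linear) e subrr.
Qed.

Let unitary_norm (L : hilbertType R) (u : 'B(L, L)) x : adj u = u -> bcomp u u = idop _ ->
  rnorm (u x) = rnorm x.
Proof.
move=> ua uu; apply/eqP; rewrite -(@eqrXn2 _ 2) ?rnorm_ge0//; apply/eqP/complexI.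
by rewrite -!hdotxx adjP ua -bcompE uu.
Qed.

(** [th] describes Z as M_I(D); it will be the inclusion in one case and the inverse of the given
    isomorphism in the other. Multiplying a row by the unitary [u] does not change its norm, so this
    multiplication is a move and has an implementing [U]. *)
Lemma frame_left (u : 'B(l2 I A2, l2 I A2)) : adj u = u -> bcomp u u = idop _ ->
  (forall T, MIop D T -> MIop D (bcomp u T)) -> exists U : 'B(K', K'),
  [/\ adj U = U, bcomp U U = idop _, lmult O U &
      forall z z', th z' = bcomp u (th z) -> bcomp U (Om z) = Om z'].
Proof.
move=> ua uu uD.
have /choice[f hf] : forall z, exists z', th z' = bcomp u (th z).
  by move=> z; apply: th_onto; apply: uD.
have [|U [Ua Ui UO]] := Om_left (f := f).
  split.
  - move=> a x y; apply: th_eq; rewrite hf !th_linear !hf.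
    by rewrite bcompDr bcompZr.
  - by move=> z; apply: th_eq; rewrite !hf bcompA uu bcomp1l.
  - move=> J xi X /th_contr cX; apply/th_contr => h; apply: le_trans (cX h).
    rewrite !big_cons lerD2r.
    have -> : \sum_j th ((f \o xi) j) (h j) = u (\sum_j th (xi j) (h j)).
      by rewrite op_sum; apply: eq_bigr => j _; rewrite /= hf.
    by rewrite unitary_norm.
  - move=> n /th_normal'[g ng hg].
    have [n' nn hn] := th_normal (normal_comp u (idop _) ng).
    by exists n' => // z; rewrite hg hf -hn bcomp1r.
have UE z z' : th z' = bcomp u (th z) -> bcomp U (Om z) = Om z'.
  by move=> e; rewrite UO; congr Om; apply: th_eq; rewrite hf.
exists U; split=> //; first by apply: bopP => x; exact: Ui.
by move=> _ [z _ <-]; rewrite Ua UO; split; exists (f z).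
Qed.

Lemma frame_right (u : 'B(l2 I A1, l2 I A1)) : adj u = u -> bcomp u u = idop _ ->
  (forall T, MIop D T -> MIop D (bcomp T u)) -> exists U : 'B(H', H'),
  [/\ adj U = U, bcomp U U = idop _, rmult O U &
      forall z z', th z' = bcomp (th z) u -> bcomp (Om z) U = Om z'].
Proof.
move=> ua uu uD.
have /choice[f hf] : forall z, exists z', th z' = bcomp (th z) u.
  by move=> z; apply: th_onto; apply: uD.
have [|U [Ua Ui UO]] := Om_right (f := f).
  split.
  - move=> a x y; apply: th_eq; rewrite hf !th_linear !hf.
    by rewrite bcompDl bcompZl.
  - by move=> z; apply: th_eq; rewrite !hf -bcompA uu bcomp1r.
  - move=> J xi X cX.
    have cA : forall (J : finType) (X : seq (J -> conjmod Z)),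
        contr (adjoint_map th) X -> contr (adjoint_map (@incl _ _ _ _ sZ)) X.
      by apply: contr_adjoint_map => J' X' /th_contr.
    have cA' : forall (J : finType) (X : seq (J -> conjmod Z)),
        contr (adjoint_map (@incl _ _ _ _ sZ)) X -> contr (adjoint_map th) X.
      by apply: contr_adjoint_map => J' X' /th_contr.
    apply: cA; move/cA' : cX.
    move=> cX h; apply: le_trans (cX h).
    rewrite !big_cons lerD2r.
    have -> : \sum_j adjoint_map th (((f : conjmod Z -> conjmod Z) \o xi) j) (h j) =
        u (\sum_j adjoint_map th (xi j) (h j)).
      by rewrite op_sum; apply: eq_bigr => j _; rewrite /adjoint_map /= hf adj_comp ua.
    by rewrite unitary_norm.
  - move=> n /th_normal'[g ng hg].
    have [n' nn hn] := th_normal (normal_comp (idop _) u ng).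
    by exists n' => // z; rewrite hg hf -hn bcomp1l.
have UE z z' : th z' = bcomp (th z) u -> bcomp (Om z) U = Om z'.
  by move=> e; rewrite UO; congr Om; apply: th_eq; rewrite hf.
exists U; split=> //; first by apply: bopP => x; exact: Ui.
by move=> _ [z _ <-]; rewrite Ua UO; split; exists (f z).
Qed.

Let sO : subspace O.
Proof.
split; first by exists 0 => //; exact: linear_map0.
by move=> a _ _ [x _ <-] [y _ <-]; exists (a *: x + y); rewrite ?Om_linear.
Qed.

Let half_projection (L : hilbertType R) (U : 'B(L, L)) : adj U = U -> bcomp U U = idop _ ->
  is_projection ((2^-1 : R[i]) *: (idop _ - U)).
Proof.
move=> Ua UU; split.
  rewrite bcompZl bcompZr bcompDl bcomp1l bcompNl bcompDr bcomp1r bcompNr UU.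
  have -> : idop L - U - (U - idop L) = (2 : R[i]) *: (idop L - U).
    by rewrite opprB scaler_nat mulr2n.
  by rewrite !scalerA mulfVK ?pnatr_eq0.
move=> x y; rewrite adjP adjZ adjB adj1 Ua.
by rewrite fmorphV rmorph_nat.
Qed.

(** [E2] and [E1] come from the reflections at [i0] and implement compression to the entry
    [(i0, i0)]. The symmetries implementing the swaps conjugate them to the other coordinates, which
    gives every single-entry compression. *)
Lemma frame_corner : exists (E2 : 'B(K', K')) (E1 : 'B(H', H')) (U : I -> 'B(K', K'))
    (W : I -> 'B(H', H')),
  [/\ is_projection E2, lmult O E2, is_projection E1 & rmult O E1] /\
  [/\ forall i, lmult O (U i), forall i, rmult O (W i),
      forall z z', th z' = bcomp (cproj i0) (bcomp (th z) (cproj i0)) ->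
        bcomp E2 (bcomp (Om z) E1) = Om z' &
      forall i j z z', th z' = bcomp (cproj i) (bcomp (th z) (cproj j)) ->
        Om z' = bcomp (bcomp (U i) (bcomp E2 (U i))) (bcomp (Om z) (bcomp (W j) (bcomp E1 (W j))))].
Proof.
have [U0 [U0a U0i U0l U0E]] := frame_left (crefl_adj i0) (crefl_invol i0) (@MIop_crefl_l _ _ _ _ _ sD i0).
have [W0 [W0a W0i W0r W0E]] := frame_right (crefl_adj i0) (crefl_invol i0) (@MIop_crefl_r _ _ _ _ _ sD i0).
have /choice[U hU] : forall i, exists U : 'B(K', K'),
  [/\ adj U = U, bcomp U U = idop _, lmult O U &
      forall z z', th z' = bcomp (swap i0 i) (th z) -> bcomp U (Om z) = Om z'].
  by move=> i; apply: frame_left (swap_adj i0 i) (swap_invol i0 i) (@MIop_swap_l _ _ _ _ _ i0 i).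
have /choice[W hW] : forall i, exists U : 'B(H', H'),
  [/\ adj U = U, bcomp U U = idop _, rmult O U &
      forall z z', th z' = bcomp (th z) (swap i0 i) -> bcomp (Om z) U = Om z'].
  by move=> i; apply: frame_right (swap_adj i0 i) (swap_invol i0 i) (@MIop_swap_r _ _ _ _ _ i0 i).
pose E2 := (2^-1 : R[i]) *: (idop K' - U0); pose E1 := (2^-1 : R[i]) *: (idop H' - W0).
have two (V : lmodType R[i]) (v : V) : (2^-1 : R[i]) *: ((2 : R[i]) *: v) = v.
  by rewrite scalerA mulVf ?scale1r// pnatr_eq0.
have half z z' : Om z - Om z' = (2 : R[i]) *: Om ((2^-1 : R[i]) *: (z - z')).
  by rewrite (linear_mapZ Om_linear) (linear_mapB Om_linear) scalerA divff ?scale1r// pnatr_eq0.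
have E2E z z' : th z' = bcomp (cproj i0) (th z) -> bcomp E2 (Om z) = Om z'.
  move=> e; have [z1 h1] := th_onto (MIop_crefl_l sD i0 (th_MI z)).
  rewrite /E2 bcompZl bcompDl bcompNl bcomp1l (U0E _ _ h1) half two.
  congr Om; apply: th_eq; rewrite (linear_mapZ th_linear) (linear_mapB th_linear) h1 e.
  by rewrite /crefl bcompDl bcomp1l bcompNl bcompZl subKr two.
have E1E z z' : th z' = bcomp (th z) (cproj i0) -> bcomp (Om z) E1 = Om z'.
  move=> e; have [z1 h1] := th_onto (MIop_crefl_r sD i0 (th_MI z)).
  rewrite /E1 bcompZr bcompDr bcompNr bcomp1r (W0E _ _ h1) half two.
  congr Om; apply: th_eq; rewrite (linear_mapZ th_linear) (linear_mapB th_linear) h1 e.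
  by rewrite /crefl bcompDr bcomp1r bcompNr bcompZr subKr two.
exists E2, E1, U, W; split; split.
- exact: half_projection.
- apply: (subspaceZ (lmult_subspace sO)); apply: (subspaceB (lmult_subspace sO)) => //.
  exact: lmult1.
- exact: half_projection.
- apply: (subspaceZ (rmult_subspace sO)); apply: (subspaceB (rmult_subspace sO)) => //.
  exact: rmult1.
- by move=> i; have [] := hU i.
- by move=> i; have [] := hW i.
- move=> z z' e; have [z1 h1] := th_onto (MIop_cproj_r sD i0 (th_MI z)).
  by rewrite (E1E _ _ h1); apply: E2E; rewrite h1.
- move=> i j z z' e; have [_ _ _ hUi] := hU i; have [_ _ _ hWj] := hW j.
  have [z1 h1] := th_onto (MIop_swap_r i0 j (th_MI z)).
  have [z2 h2] := th_onto (MIop_cproj_r sD i0 (th_MI z1)).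
  have [z3 h3] := th_onto (MIop_swap_r i0 j (th_MI z2)).
  have [z4 h4] := th_onto (MIop_swap_l i0 i (th_MI z3)).
  have [z5 h5] := th_onto (MIop_cproj_l sD i0 (th_MI z4)).
  have -> : bcomp (Om z) (bcomp (W j) (bcomp E1 (W j))) = Om z3.
    by rewrite !bcompA (hWj _ _ h1) (E1E _ _ h2) (hWj _ _ h3).
  rewrite -!bcompA (hUi _ _ h4) (E2E _ _ h5); apply/esym; apply: hUi.
  by rewrite e h5 h4 h3 h2 h1 -(swap_cproj i0 i) -(swap_cproj i0 j) !bcompA.
Qed.

(** [D] sits in M_I(D) as the matrices supported at [(i0, i0)], and these are what [E2] and [E1] cut
    out of the representation. *)
Lemma frame_map (E2 : 'B(K', K')) (E1 : 'B(H', H')) :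
  (forall z z', th z' = bcomp (cproj i0) (bcomp (th z) (cproj i0)) ->
     bcomp E2 (bcomp (Om z) E1) = Om z') ->
  exists t : 'B(A1, A2) -> 'B(H', K'),
  [/\ linear_on D t, t @` D = corner O E2 E1,
      forall (A B : finType) (x : A -> B -> 'B(A1, A2)) (M : R), 0 <= M ->
        (forall a b, D (x a b)) -> opb (fun a b => t (x a b)) M <-> opb x M &
      forall f, normal_functionals f -> exists2 g, normal_functionals g &
        forall d, D d -> f (t d) = g d].
Proof.
move=> hE.
have /choice[cz hcz] : forall d, exists z, D d -> th z = bcomp (l2i i0) (bcomp d (l2p i0)).
  move=> d; have [Dd|nD] := pselect (D d); last by exists 0.
  by have [z hz] := th_onto (MIop_single sD i0 Dd); exists z.
exists (fun d => Om (cz d)); split.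
- move=> a x y Dx Dy; have Dxy : D (a *: x + y) by exact: sD.2.
  rewrite -Om_linear; congr Om; apply: th_eq.
  by rewrite th_linear !hcz// bcompDl bcompDr bcompZl bcompZr.
- apply/seteqP; split=> [_ [d Dd <-]|_ [[z _ <-] hz]].
    split; first by exists (cz d).
    apply: hE; rewrite hcz// /cproj -!bcompA [bcomp (l2p i0) (bcomp (l2i i0) _)]bcompA.
    rewrite l2p_l2i eqxx bcomp1l [bcomp (l2p i0) (bcomp (l2i i0) _)]bcompA.
    by rewrite l2p_l2i eqxx bcomp1l.
  have Dd : D (ent (th z) i0 i0) by exact: th_MI.
  exists (ent (th z) i0 i0) => //; rewrite -hz; apply/esym/hE.
  by rewrite hcz// entE /cproj !bcompA.
- move=> A B x M M0 Dx.
  have li : linear (@incl _ _ _ _ sZ) := @incl_linear _ _ _ _ sZ.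
  have s1 : opb (fun a b => Om (cz (x a b))) M <-> opb (fun a b => th (cz (x a b))) M.
    split=> h.
      apply: (opb_of_contr li th_linear (fun J X => (th_contr X).1) M0 (x := fun a b => cz (x a b))).
      exact: (opb_of_contr Om_linear li (fun J X => (Om_contr X).2) M0 (x := fun a b => cz (x a b))).
    apply: (opb_of_contr li Om_linear (fun J X => (Om_contr X).1) M0 (x := fun a b => cz (x a b))).
    exact: (opb_of_contr th_linear li (fun J X => (th_contr X).2) M0 (x := fun a b => cz (x a b))).
  rewrite s1; have E a b k : th (cz (x a b)) k = l2i i0 (x a b (l2p i0 k)) by rewrite hcz.
  split=> h k.
    have := h (fun b => l2i i0 (k b)).
    under [X in _ <= _ * X]eq_bigr do rewrite rnorm_l2i.
    congr (_ <= _); apply: eq_bigr => a _.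
    under eq_bigr do rewrite E l2pi eqxx.
    by rewrite -op_sum rnorm_l2i.
  have := h (fun b => l2p i0 (k b)).
  have -> : \sum_a rnorm (\sum_b x a b (l2p i0 (k b))) ^+ 2 =
      \sum_a rnorm (\sum_b th (cz (x a b)) (k b)) ^+ 2.
    apply: eq_bigr => a _; under [in RHS]eq_bigr do rewrite E.
    by rewrite -op_sum rnorm_l2i.
  move/le_trans; apply; rewrite ler_wpM2l ?sqr_ge0//; apply: ler_sum => b _.
  rewrite lerXn2r ?nnegrE ?rnorm_ge0//.
  have hT y : rnorm (l2i (H := A1) i0 y) <= 1 * rnorm y by rewrite mul1r rnorm_l2i.
  by have := adj_bound ler01 hT (k b); rewrite mul1r.
- move=> f nf; have [n nn hn] := Om_normal nf; have [g ng hg] := th_normal' nn.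
  exists (fun d => g (bcomp (bcomp (l2i i0) d) (l2p i0))); first exact: normal_comp.
  by move=> d Dd; rewrite hn hg hcz// bcompA.
Qed.

(** The truncations of a matrix converge to it strongly and boundedly, and each is a finite sum of
    single-entry matrices, on which [f] vanishes. *)
Lemma frame_dense (f : 'B(H', K') -> R[i]^o) : normal_functionals f ->
  (forall i j z z', th z' = bcomp (cproj i) (bcomp (th z) (cproj j)) -> f (Om z') = 0) ->
  forall z, f (Om z) = 0.
Proof.
move=> nf h z; have [n nn hn] := Om_normal nf; have [g ng hg] := th_normal' nn.
have gE z' : g (th z') = f (Om z') by rewrite hn hg.
rewrite -gE.
pose Ker := [set T : 'B(l2 I A1, l2 I A2) | g T = 0].
have sKer : subspace Ker.
  split; first exact: normal0.
  by move=> a S T gS gT; rewrite /Ker /= normalD// normalZ// gS gT mulr0 addr0.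
have cKer : wstar_closed Ker by apply/(closed_polar sKer) => T; apply.
apply: (@sot_closed _ _ _ Ker _ (@totally I) _ (fun A => bcomp (l2t A) (bcomp (th z) (l2t A))) (th z) (opn (th z))) => //.
- move=> A; rewrite /l2t bcomp_suml; apply: (subspace_sum sKer) => i _.
  rewrite !bcomp_sumr; apply: (subspace_sum sKer) => j _.
  have [z' hz'] := th_onto (MIop_cproj_l sD i (MIop_cproj_r sD j (th_MI z))).
  by have := h i j z z' hz'; rewrite -gE hz'.
- move=> A x; rewrite !bcompE (le_trans (l2t_le _ _))// (le_trans (opnP _ _))//.
  by rewrite ler_wpM2l ?opn_ge0// l2t_le.
- move=> x; apply/cvg_rnormP => e e0.
  have e2 : 0 < e / 2 by rewrite divr_gt0.
  have [d d0 hd] := eps_split (opn_ge0 (th z)) e2.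
  have /cvg_rnormP/(_ _ e2) := @l2t_cvg _ _ _ (th z x).
  have /cvg_rnormP/(_ _ d0) := @l2t_cvg _ _ _ x.
  apply: filterS2 => A h1 h2; rewrite !bcompE.
  have -> : th z x - l2t A (th z (l2t A x)) = (th z x - l2t A (th z x)) + l2t A (th z (x - l2t A x)).
    by rewrite !opB addrA subrK.
  apply: le_lt_trans (ler_rnormD _ _) _; rewrite (splitr e) ltr_leD//.
  rewrite (le_trans (l2t_le _ _))// (le_trans (opnP _ _))//.
  by apply: le_trans hd; rewrite ler_wpM2l ?opn_ge0// ltW.
Qed.

End Frame.

Section Core.
Context {R : realType} {I : choiceType} (i0 : I) {V1 V2 Y1 Y2 : hilbertType R}.
Context {W : set 'B(V1, V2)} {Y : set 'B(Y1, Y2)} {rho : infmx I Y1 Y2 -> infmx I V1 V2}.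
Hypotheses (sW : subspace W) (cW : wstar_closed W) (sY : subspace Y) (cY : wstar_closed Y).
Hypothesis hrho : wstar_MI_iso Y W rho.

(** Both matrix descriptions are read in one representation: [W] is the corner cut out by [E2], [E1]
    and [Y] the one cut out by [F2], [F1]. [M2] and [M1] are the multipliers from the first corner
    to the second. *)
Lemma MI_iso_corners : exists (H K : hilbertType R) (M1 : set 'B(H, H)) (M2 : set 'B(K, K))
    (tW : 'B(V1, V2) -> 'B(H, K)) (tY : 'B(Y1, Y2) -> 'B(H, K)),
  [/\ is_TRO M1 /\ is_TRO M2, linear_on W tW /\ linear_on Y tY,
      wstar_closed (tW @` W) & wstar_closed (tY @` Y)] /\
  [/\ forall (A B : finType) (x : A -> B -> 'B(V1, V2)) (M : R), 0 <= M ->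
        (forall a b, W (x a b)) -> opb (fun a b => tW (x a b)) M <-> opb x M,
      forall (A B : finType) (x : A -> B -> 'B(Y1, Y2)) (M : R), 0 <= M ->
        (forall a b, Y (x a b)) -> opb (fun a b => tY (x a b)) M <-> opb x M,
      forall f, normal_functionals f -> exists2 g, normal_functionals g & forall w, W w -> f (tW w) = g w &
      forall f, normal_functionals f -> exists2 g, normal_functionals g & forall y, Y y -> f (tY y) = g y] /\
  [/\ forall n T m, M2 n -> (tW @` W) T -> M1 m -> (tY @` Y) (bcomp (bcomp n T) (adj m)),
      forall n T m, M2 n -> (tY @` Y) T -> M1 m -> (tW @` W) (bcomp (bcomp (adj n) T) m),
      forall n n' T, M2 n -> M2 n' -> (tW @` W) T -> (tW @` W) (bcomp (bcomp (adj n) n') T),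
      forall m m' T, M1 m -> M1 m' -> (tW @` W) T -> (tW @` W) (bcomp (bcomp T (adj m)) m') &
      forall f : 'B(H, K) -> R[i]^o, normal_functionals f ->
        (forall n T m, M2 n -> (tW @` W) T -> M1 m -> f (bcomp (bcomp n T) (adj m)) = 0) ->
        forall S, (tY @` Y) S -> f S = 0].
Proof.
pose sZ := MIop_subspace (I := I) sW; pose cZ := MIop_closed (I := I) sW cW.
pose sZY := MIop_subspace (I := I) sY; pose cZY := MIop_closed (I := I) sY cY.
have [lrho rhoim _ _] := hrho.
have /choice[Pi hPi] : forall S : 'B(l2 I Y1, l2 I Y2), exists S', MIop Y S ->
    MIop W S' /\ ent S' = rho (ent S).
  move=> S; have [YS|nY] := pselect (MIop Y S); last by exists 0.
  have : (rho @` MI I Y) (rho (ent S)) by exists (ent S) => //; rewrite MIE; exists S.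
  by rewrite rhoim MIE => -[T WT TE]; exists T.
have PiW S : MIop Y S -> MIop W (Pi S) by move=> /hPi[].
have PiE S : MIop Y S -> ent (Pi S) = rho (ent S) by move=> /hPi[].
have Piopb (A B : finType) (x : A -> B -> 'B(l2 I Y1, l2 I Y2)) (M : R) : 0 <= M ->
    (forall a b, MIop Y (x a b)) -> opb (fun a b => Pi (x a b)) M <-> opb x M.
  by move=> M0 hx; apply: (MI_iso_opb sY hrho M0 hx) => a b; exact: PiE.
have lPi : linear_on (MIop Y) Pi.
  move=> a x y Yx Yy; apply: ent_inj; rewrite ent_linear !PiE//; last exact: sZY.2.
  by rewrite ent_linear lrho// MIE; [exists x|exists y].
have nPi f : normal_functionals f -> exists2 g, normal_functionals g &
    forall T, MIop Y T -> f (Pi T) = g T.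
  move=> nf; have [g ng hg] := pi_pullback sY hrho nf; exists g => // T YT.
  by apply: hg => //; exact: PiE.
have PiY : Pi @` MIop Y = MIop W.
  apply/seteqP; split=> [_ [S YS <-]|T WT]; first exact: PiW.
  have : MI I W (ent T) by rewrite MIE; exists T.
  rewrite -rhoim MIE => -[_ [S YS <-] E].
  by exists S => //; apply: ent_inj; rewrite PiE.
have oPi T : MIop Y T -> opn (Pi T) = opn T.
  move=> YT; have h (M : R) : 0 <= M -> opb (fun _ _ : unit => Pi T) M <-> opb (fun _ _ : unit => T) M.
    by move=> M0; apply: (Piopb _ _ (fun _ _ => T)).
  apply/eqP; rewrite eq_le; apply/andP; split; apply: opn_le (opn_ge0 _) _.
    by apply/(opb_unit _ (opn_ge0 _))/(h _ (opn_ge0 _))/(opb_unit _ (opn_ge0 _)) => k; exact: opnP.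
  by apply/(opb_unit _ (opn_ge0 _))/(h _ (opn_ge0 _))/(opb_unit _ (opn_ge0 _)) => k; exact: opnP.
(* The description of Z through [Y] must exchange normal functionals in both directions, so [Pi]
   needs a w*-continuous inverse. *)
have nInv := normal_inverse sZY cZY sZ cZ lPi PiY oPi nPi.
have Pi0 : Pi 0 = 0.
  by have := lPi (-1) 0 0 sZY.1 sZY.1; rewrite scaler0 addr0 scaleN1r addNr.
have PiB x y : MIop Y x -> MIop Y y -> Pi (x - y) = Pi x - Pi y.
  by move=> Yx Yy; rewrite -scaleN1r addrC lPi// scaleN1r addrC.
have Piinj x y : MIop Y x -> MIop Y y -> Pi x = Pi y -> x = y.
  move=> Yx Yy e; apply/eqP; rewrite -subr_eq0; apply/eqP; apply: opn_eq0.
  rewrite -oPi; last exact: (subspaceB sZY).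
  rewrite PiB// e subrr; apply: opn_le => // z; by rewrite bop0E rnorm0 mul0r.
have /choice[ka hka] : forall z : smod sZ, exists S, MIop Y S /\ Pi S = incl z.
  move=> z; have : (Pi @` MIop Y) (incl z) by rewrite PiY; exact: smodP.
  by move=> [S YS SE]; exists S.
have kaY z : MIop Y (ka z) by have [] := hka z.
have kaE z : Pi (ka z) = incl z by have [] := hka z.
have lka : linear ka.
  move=> a x y; apply: Piinj => //; first exact: sZY.2.
  by rewrite lPi// !kaE.
have ka_inj z : ka z = 0 -> z = 0.
  by move=> h; apply: incl_inj0; rewrite -kaE h Pi0.
have ka_onto T : MIop Y T -> exists z, ka z = T.
  move=> YT; exists (smk sZ (PiW _ YT)); apply: Piinj => //; by rewrite kaE.
have ka_contr (J : finType) (X : seq (J -> smod sZ)) : contr (@incl _ _ _ _ sZ) X <-> contr ka X.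
  rewrite !contr_nth -(Piopb _ _ (fun (k : 'I_(size X)) j => ka (nth (fun=> 0) X k j)))//.
  have -> : (fun (k : 'I_(size X)) j => Pi (ka (nth (fun=> 0) X k j))) =
    (fun (k : 'I_(size X)) j => incl (nth (fun=> 0) X k j)); last by [].
  by apply/funext => k; apply/funext => j; rewrite kaE.
have ka_normal f : normal_functionals f -> exists2 n, normal_functionals n &
    forall z, f (ka z) = n (incl z).
  by move=> nf; have [n nn hn] := nInv f nf; exists n => // z; rewrite -kaE hn.
have ka_normal' n : normal_functionals n -> exists2 f, normal_functionals f &
    forall z, n (incl z) = f (ka z).
  by move=> nn; have [f nf hf] := nPi n nn; exists f => // z; rewrite -kaE hf.
have [H [K [Om [[lO cO nO clO] [OL OR]]]]] := move_representation sZ cZ.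
have in_linear : linear (@incl _ _ _ _ sZ) by [].
have in_inj z : @incl _ _ _ _ sZ z = 0 -> z = 0 by exact: incl_inj0.
have in_MI z : MIop W (@incl _ _ _ _ sZ z) by exact: smodP.
have in_onto T : MIop W T -> exists z, @incl _ _ _ _ sZ z = T.
  by move=> WT; exists (smk sZ WT).
have in_contr (J : finType) (X : seq (J -> smod sZ)) :
  contr (@incl _ _ _ _ sZ) X <-> contr (@incl _ _ _ _ sZ) X by [].
have in_normal (f : 'B(l2 I V1, l2 I V2) -> R[i]^o) : normal_functionals f ->
    exists2 n : 'B(l2 I V1, l2 I V2) -> R[i]^o, normal_functionals n &
    forall z, f (@incl _ _ _ _ sZ z) = n (@incl _ _ _ _ sZ z).
  by move=> nf; exists f.
have [E2 [E1 [U [Wr [[pE2 lE2 pE1 rE1] [lU rW hE hUW]]]]]] :=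
  frame_corner lO OL OR i0 sW in_linear in_inj in_MI in_onto in_contr in_normal in_normal.
have [F2 [F1 [_ [_ [[pF2 lF2 pF1 rF1] [_ _ hF _]]]]]] :=
  frame_corner lO OL OR i0 sY lka ka_inj kaY ka_onto ka_contr ka_normal ka_normal'.
have [tW [ltW tWE otW ntW]] :=
  frame_map lO cO nO sW in_linear in_inj in_MI in_onto in_contr in_normal hE.
have [tY [ltY tYE otY ntY]] :=
  frame_map lO cO nO sY lka ka_inj kaY ka_onto ka_contr ka_normal' hF.
have sO : subspace (range Om).
  split; first by exists 0 => //; exact: linear_map0.
  by move=> a _ _ [x _ <-] [y _ <-]; exists (a *: x + y); rewrite ?lO.
exists H, K, (rinter (range Om) F1 E1), (linter (range Om) F2 E2), tW, tY.
rewrite tWE tYE; split; [|split]; split=> //.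
- by split; [exact: rinter_TRO|exact: linter_TRO].
- exact: corner_closed.
- exact: corner_closed.
- by move=> n T m hn [OT _] hm; exact: (inter_corner pF1 hn OT hm).
- by move=> n T m hn [OT _] hm; exact: (adj_inter_corner pE2 hn OT hm).
- by move=> n n' T hn hn' cT; exact: (linter_mul_corner pE2 pE1 hn hn' cT).
- by move=> n n' T hn hn' cT; exact: (rinter_mul_corner pE2 hn hn' cT).
- move=> f nf f0 _ [[z _ <-] <-].
  have := frame_dense nO sW in_MI in_onto in_normal (f := fun S => f (bcomp (bcomp F2 S) F1))
    (normal_comp F2 F1 nf).
  move=> h; rewrite bcompA; apply: h => i j y y' e; rewrite (hUW _ _ _ _ e).
  (* A single-entry matrix in the coordinates of [W], compressed by [F2] and [F1], is (F2 U_i E2)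
     (E2 U_i y W_j E1) (E1 W_j F1): a multiplier, an element of the first corner, and the adjoint of
     a multiplier. *)
  have n1 : linter (range Om) F2 E2 (bcomp F2 (bcomp (U i) E2)).
    split; first by apply: lmult_comp => //; exact: lmult_comp.
      by rewrite bcompA pF2.1.
    by rewrite -!bcompA pE2.1.
  have m1 : rinter (range Om) F1 E1 (bcomp F1 (bcomp (adj (Wr j)) E1)).
    split; first by apply: rmult_comp => //; apply: rmult_comp => //; exact: rmult_adj.
      by rewrite bcompA pF1.1.
    by rewrite -!bcompA pE1.1.
  have cT : corner (range Om) E2 E1 (bcomp E2 (bcomp (bcomp (U i) (bcomp (Om y) (Wr j))) E1)).
    split; last by rewrite -!bcompA pE1.1 !bcompA pE2.1.
    have O1 : range Om (bcomp (Om y) (Wr j)) by apply: (rW j (Om y) _).1; exists y.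
    have O2 := (lU i _ O1).1; have O3 := (rE1 _ O2).1.
    exact: (lE2 _ O3).1.
  have := f0 _ _ _ n1 cT m1.
  rewrite !adj_comp adjK (projection_adj pE1) (projection_adj pF1) => h0.
  rewrite -[RHS]h0; congr f; rewrite -!bcompA.
  rewrite [bcomp E2 (bcomp E2 _)]bcompA pE2.1 [bcomp E1 (bcomp E1 _)]bcompA pE1.1.
  by [].
Qed.

End Core.

Section LinearPack.
Context {R : realType} {V W : lmodType R[i]} (f : V -> W) (lf : linear f).

(** Taking the proof of linearity as an argument gives the function a head symbol to which the
    linear structure can be attached. *)
Definition packed_fun (_ : linear f) := f.

HB.instance Definition _ := GRing.isLinear.Build R[i] V W _ (packed_fun lf) lf.

Lemma linear_pack : exists g : {linear V -> W}, forall x, g x = f x.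
Proof. by exists (packed_fun lf). Qed.

End LinearPack.

Section OpbOperations.
Context {R : realType} {A B : finType}.

(** From |s + t|^2 <= 2 |s|^2 + 2 |t|^2. Complete boundedness tolerates the loss against the sharp
    constant [M + N]. *)
Lemma opb_add (H K : hilbertType R) (S T : A -> B -> 'B(H, K)) (M N : R) :
  0 <= M -> 0 <= N -> opb S M -> opb T N -> opb (fun a b => S a b + T a b) (2 * (M + N)).
Proof.
move=> M0 N0 hS hT h; set Q := \sum_b rnorm (h b) ^+ 2.
have Q0 : 0 <= Q by apply: sumr_ge0 => b _; exact: sqr_ge0.
apply: (@le_trans _ _ (\sum_a (2 * rnorm (\sum_b S a b (h b)) ^+ 2 + 2 * rnorm (\sum_b T a b (h b)) ^+ 2))).
  apply: ler_sum => a _.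
  have -> : \sum_b (S a b + T a b) (h b) = \sum_b S a b (h b) + \sum_b T a b (h b).
    by rewrite -big_split; apply: eq_bigr => b _; rewrite bopDE.
  have := parallelogram (\sum_b S a b (h b)) (\sum_b T a b (h b)).
  have := sqr_ge0 (rnorm (\sum_b S a b (h b) - \sum_b T a b (h b))); lra.
rewrite big_split -!mulr_sumr /=; have := hS h; have := hT h; rewrite -/Q.
move: (\sum_a _) (\sum_a _) => s t hs ht.
apply: (@le_trans _ _ (2 * (M ^+ 2 * Q) + 2 * (N ^+ 2 * Q))); first by lra.
rewrite !mulrA -mulrDl ler_wpM2r// exprMn sqrrD.
have := mulr_ge0 M0 N0; have := sqr_ge0 M; have := sqr_ge0 N; lra.
Qed.

Lemma opb_opp (H K : hilbertType R) (T : A -> B -> 'B(H, K)) (M : R) :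
  opb T M -> opb (fun a b => - T a b) M.
Proof.
move=> hT h; apply: le_trans (hT h); apply: ler_sum => a _.
under eq_bigr do rewrite bopNE.
by rewrite sumrN rnormN.
Qed.

Lemma opb_comp (H K H' K' : hilbertType R) (T : A -> B -> 'B(H, K)) (M : R)
    (a : 'B(K, K')) (b : 'B(H', H)) :
  (forall x, rnorm (a x) <= rnorm x) -> (forall x, rnorm (b x) <= rnorm x) ->
  opb T M -> opb (fun i j => bcomp a (bcomp (T i j) b)) M.
Proof.
move=> ha hb hT h; apply: (@le_trans _ _ (\sum_i rnorm (\sum_j T i j (b (h j))) ^+ 2)).
  apply: ler_sum => i _; rewrite -op_sum lerXn2r ?nnegrE ?rnorm_ge0//; exact: ha.
apply: le_trans (hT (fun j => b (h j))) _; rewrite ler_wpM2l ?sqr_ge0//.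
by apply: ler_sum => j _; rewrite lerXn2r ?nnegrE ?rnorm_ge0.
Qed.

End OpbOperations.

Section Isometries.
Context {R : realType} {H K : hilbertType R} (a : 'B(H, K)) (ha : bcomp (adj a) a = idop H).

Lemma isometry_norm x : rnorm (a x) = rnorm x.
Proof.
apply/eqP; rewrite -(@eqrXn2 _ 2) ?rnorm_ge0//; apply/eqP/complexI.
by rewrite -!hdotxx adjP -bcompE ha.
Qed.

Lemma isometry_le x : rnorm (a x) <= rnorm x.
Proof. by rewrite isometry_norm. Qed.

Lemma coisometry_le x : rnorm (adj a x) <= rnorm x.
Proof.
have hT y : rnorm (a y) <= 1 * rnorm y by rewrite mul1r isometry_le.
by have := adj_bound ler01 hT x; rewrite mul1r.
Qed.

End Isometries.

Lemma TRO_dilate (R : realType) (H K L : hilbertType R) (M : set 'B(H, K)) (a : 'B(H, L)) :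
  bcomp (adj a) a = idop H -> is_TRO M -> is_TRO [set bcomp m (adj a) | m in M].
Proof.
move=> ha [M0 Ml Mt]; split.
- by exists 0 => //; rewrite bcomp0l.
- move=> c _ _ [x Mx <-] [y My <-]; exists (c *: x + y); first exact: Ml.
  by rewrite bcompDl bcompZl.
- move=> _ [_ [_ [x Mx <-] [y' [_ [y My <-] /adjE ->] <-]] [_ [z Mz <-] <-]].
  exists (bcomp (bcomp x (adj y)) z).
    apply: Mt; exists (bcomp x (adj y)); last by exists z.
    by exists x => //; exists (adj y) => //; exists y => //; exact: is_adjoint_adj.
  rewrite adj_comp adjK -!bcompA; congr bcomp.
  by rewrite [bcomp (adj a) (bcomp a _)]bcompA ha bcomp1l.
Qed.

Lemma compress_corner (R : realType) (H1 H2 : hilbertType R) (X : set 'B(H1, H2))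
    (p : 'B(H2, H2)) (q : 'B(H1, H1)) :
  is_projection p -> is_projection q ->
  op_mul [set p] X `<=` X -> op_mul X [set q] `<=` X -> compress p X q = corner X p q.
Proof.
move=> hp hq pX Xq; apply/seteqP; split=> [_ [T hT <-]|T [hT pTq]].
  split; last by rewrite !bcompA hp.1 -!bcompA hq.1.
  by apply: Xq; exists (bcomp p T); [apply: pX; exists p => //; exists T|exists q].
by exists T => //; rewrite -bcompA.
Qed.

Section Backward.
Context {R : realType}.

Lemma MI_iso_embeds (X Y : dualOperatorSpace R) (H1 H2 K1 K2 : hilbertType R)
    (psi : {linear Y -> 'B(K1, K2)}) (phi : {linear X -> 'B(H1, H2)})
    (p : 'B(H2, H2)) (q : 'B(H1, H1)) (I : choiceType) (i0 : I)
    (rho : infmx I K1 K2 -> infmx I H1 H2) :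
  wstar_cb_iso psi -> wstar_cb_iso phi -> is_projection p -> is_projection q ->
  op_mul [set p] (range phi) `<=` range phi ->
  op_mul (range phi) [set q] `<=` range phi ->
  wstar_MI_iso (range psi) (compress p (range phi) q) rho -> cbDelta_embeds Y X.
Proof.
move=> hpsi hphi hp hq pX Xq hrho.
have sX : subspace (range phi) := range_subspace phi.
have sY : subspace (range psi) := range_subspace psi.
have cX : wstar_closed (range phi) by have [] := hphi.
have cY : wstar_closed (range psi) by have [] := hpsi.
have pq T : range phi T -> range phi (bcomp (bcomp p T) q).
  by move=> hT; apply: Xq; exists (bcomp p T); [apply: pX; exists p => //; exists T|exists q].
have pqpq T : bcomp (bcomp p (bcomp (bcomp p T) q)) q = bcomp (bcomp p T) q.
  by rewrite !bcompA hp.1 -!bcompA hq.1.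
have WE := compress_corner hp hq pX Xq.
pose W := compress p (range phi) q.
have sW : subspace W by rewrite /W WE; exact: corner_subspace.
have cW : wstar_closed W by rewrite /W WE; exact: corner_closed.
have Wpq w : W w -> range phi w /\ bcomp (bcomp p w) q = w.
  by rewrite /W WE => -[hw e]; rewrite -bcompA.
have pqW T : range phi T -> W (bcomp (bcomp p T) q) by move=> hT; exists T.
have [H [K [M1 [M2 [tW [tY [[[tM1 tM2] [ltW ltY] clW clY] [[otW otY ntW ntY] [C1 C2 C3 C4 C5]]]]]]]]] :=
  MI_iso_corners i0 sW cW sY cY hrho.
have [a1 [a2 [a11 a22 a21 aI]]] := @dsum_structure R H H1.
have [b1 [b2 [b11 b22 b21 bI]]] := @dsum_structure R K H2.
have a12 : bcomp (adj a1) a2 = 0 by rewrite -[LHS]adjK adj_comp adjK a21 adj0.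
have b12 : bcomp (adj b1) b2 = 0 by rewrite -[LHS]adjK adj_comp adjK b21 adj0.
pose pc T := bcomp (bcomp p T) q.
(* The first summand carries the image of [p T q] in the common representation, where the TROs act;
   the second keeps [T - p T q], so that [tau] loses nothing of [T]. *)
pose tau (T : 'B(H1, H2)) : 'B(@dsum R H H1, @dsum R K H2) :=
  bcomp b1 (bcomp (tW (pc T)) (adj a1)) + bcomp b2 (bcomp (T - pc T) (adj a2)).
have pcl c S T : pc (c *: S + T) = c *: pc S + pc T.
  by rewrite /pc bcompDr bcompZr bcompDl bcompZl.
have tau_l c S T : range phi S -> range phi T -> tau (c *: S + T) = c *: tau S + tau T.
  move=> hS hT; rewrite /tau pcl ltW; [|exact: pqW|exact: pqW].
  have -> : c *: S + T - (c *: pc S + pc T) = c *: (S - pc S) + (T - pc T).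
    by rewrite scalerBr opprD addrACA.
  move: (S - pc S) (T - pc T) => S' T'.
  by rewrite !bcompDl !bcompZl !bcompDr !bcompZr scalerDr addrACA.
have [psi' psi'E] : exists g : {linear Y -> 'B(H, K)}, forall y, g y = tY (psi y).
  apply: (@linear_pack _ _ _ (fun y => tY (psi y))) => c x y.
  by rewrite linearP ltY.
have [phi' phi'E] : exists g : {linear X -> 'B(@dsum R H H1, @dsum R K H2)}, forall x, g x = tau (phi x).
  apply: (@linear_pack _ _ _ (fun x => tau (phi x))) => c x y.
  by rewrite linearP tau_l.
have rpsi' : range psi' = tY @` range psi.
  apply/seteqP; split=> [_ [y _ <-]|_ [_ [y _ <-] <-]]; first by exists (psi y); rewrite ?psi'E//; exists y.
  by exists y; rewrite ?psi'E.
have b1tau T : bcomp (adj b1) (tau T) = bcomp (tW (pc T)) (adj a1).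
  by rewrite /tau bcompDr !bcompA b11 b12 bcomp1l !bcomp0l addr0.
have taua1 T : bcomp (tau T) a1 = bcomp b1 (tW (pc T)).
  by rewrite /tau bcompDl -!bcompA a11 a21 bcomp1r !bcomp0r addr0.
have b1taua1 T : bcomp (adj b1) (bcomp (tau T) a1) = tW (pc T).
  by rewrite taua1 bcompA b11 bcomp1l.
have b2taua2 T : bcomp (adj b2) (bcomp (tau T) a2) = T - pc T.
  rewrite /tau bcompDl -!bcompA a22 a12 bcomp1r !bcomp0r add0r bcompA b22.
  by rewrite bcomp1l.
have b1taua2 T : bcomp (adj b1) (bcomp (tau T) a2) = 0.
  by rewrite bcompA b1tau -bcompA a12 bcomp0r.
have b2taua1 T : bcomp (adj b2) (bcomp (tau T) a1) = 0.
  by rewrite taua1 bcompA b21 bcomp0l.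
have tauW w : W w -> tau w = bcomp b1 (bcomp (tW w) (adj a1)).
  by move=> /Wpq[_ e]; rewrite /tau /pc e subrr bcomp0l bcomp0r addr0.
have rW w : W w -> range phi' (bcomp b1 (bcomp (tW w) (adj a1))).
  move=> hw; have [[x _ xw] _] := Wpq w hw.
  by exists x => //; rewrite phi'E xw tauW.
have pcle (A B : finType) (x : A -> B -> 'B(H1, H2)) M : opb x M -> opb (fun a b => pc (x a b)) M.
  move=> hx; have := opb_comp (fun k => projection_le k hp) (fun k => projection_le k hq) hx.
  by congr opb; apply/funext => a; apply/funext => b; rewrite bcompA.
(* The first summand contributes [M], and [T - pc T] contributes [2 * (M + M)]. *)
have up (A B : finType) (x : A -> B -> 'B(H1, H2)) M : 0 <= M -> (forall a b, range phi (x a b)) ->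
    opb x M -> opb (fun a b => tau (x a b)) (2 * (M + 2 * (M + M))).
  move=> M0 hx oM.
  apply: opb_add => //; first by rewrite mulr_ge0// addr_ge0.
    apply: opb_comp; [exact: isometry_le|exact: coisometry_le|].
    apply/(otW _ _ (fun a b => pc (x a b))) => //; last exact: pcle.
    by move=> a b; exact: pqW.
  apply: opb_comp; [exact: isometry_le|exact: coisometry_le|].
  by apply: opb_add => //; apply: opb_opp; exact: pcle.
have down (A B : finType) (x : A -> B -> 'B(H1, H2)) M : 0 <= M -> (forall a b, range phi (x a b)) ->
    opb (fun a b => tau (x a b)) M -> opb x (2 * (M + M)).
  move=> M0 hx oM.
  have o1 : opb (fun a b => pc (x a b)) M.
    apply/(otW _ _ (fun a b => pc (x a b))) => //; first by move=> a b; exact: pqW.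
    have := opb_comp (coisometry_le b11) (isometry_le a11) oM.
    by congr opb; apply/funext => a; apply/funext => b.
  have o2 : opb (fun a b => x a b - pc (x a b)) M.
    have := opb_comp (coisometry_le b22) (isometry_le a22) oM.
    by congr opb; apply/funext => a; apply/funext => b.
  have := opb_add M0 M0 o1 o2.
  by congr opb; apply/funext => a; apply/funext => b; rewrite addrC subrK.
(* An operator in the bipolar of the range has zero off-diagonal blocks. Its diagonal blocks are
   [tW w] with [w] in [W] and some [S] in the range of [phi] with [pc S = 0]; then [w + S] is mapped
   to it. *)
have cphi' : wstar_closed (range phi').
  apply/(closed_polar (range_subspace phi')) => T hT.
  have h1 : (tW @` W) (bcomp (adj b1) (bcomp T a1)).
    have sWW : subspace (tW @` W).
      split; first by exists 0; [exact: sW.1|have := ltW (-1) 0 0 sW.1 sW.1; rewrite scaler0 addr0 scaleN1r addNr].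
      move=> c _ _ [S hS <-] [S' hS' <-]; exists (c *: S + S'); first exact: sW.2.
      exact: ltW.
    apply/(closed_polar sWW).1 => // f nf f0.
    rewrite bcompA; apply: (hT _ (normal_comp (adj b1) a1 nf)) => _ [x _ <-].
    by rewrite -bcompA phi'E b1taua1; apply: f0; exists (pc (phi x)) => //; apply: pqW; exists x.
  have [w hw ew] := h1.
  pose S := bcomp (adj b2) (bcomp T a2).
  have hS : range phi S.
    apply/(closed_polar sX).1 => // f nf f0.
    rewrite /S bcompA; apply: (hT _ (normal_comp (adj b2) a2 nf)) => _ [x _ <-].
    rewrite -bcompA phi'E b2taua2; apply: f0; apply: (subspaceB sX); first by exists x.
    by apply: pq; exists x.
  (* Each coefficient of [u T v] is a normal functional of [T], so the vanishing of such a
     compression passes from the range to its bipolar. *)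
  have vec0 (L L' : hilbertType R) (u : 'B(@dsum R K H2, L')) (v : 'B(L, @dsum R H H1)) :
      (forall x, bcomp u (bcomp (phi' x) v) = 0) -> bcomp u (bcomp T v) = 0.
    move=> h; apply: bopP => k; apply: hdot_ext => l; rewrite bop0E hdot0l.
    rewrite bcompA; apply: (hT _ (normal_comp u v (vector_normal k l))) => _ [x _ <-].
    by rewrite -bcompA h bop0E hdot0l.
  have pS : pc S = 0.
    have -> : pc S = bcomp (bcomp p (adj b2)) (bcomp T (bcomp a2 q)) by rewrite /pc /S !bcompA.
    apply: vec0 => x.
    have -> : bcomp (bcomp p (adj b2)) (bcomp (phi' x) (bcomp a2 q)) =
        pc (bcomp (adj b2) (bcomp (phi' x) a2)) by rewrite /pc !bcompA.
    rewrite phi'E b2taua2 addrC -scaleN1r pcl scaleN1r.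
    by rewrite {1}/pc pqpq addNr.
  have e12 : bcomp (adj b1) (bcomp T a2) = 0 by apply: vec0 => x; rewrite phi'E.
  have e21 : bcomp (adj b2) (bcomp T a1) = 0 by apply: vec0 => x; rewrite phi'E.
  have [hwr pw] := Wpq w hw.
  have [x _ xE] : range phi (w + S) by exact: (subspaceD sX).
  exists x => //; rewrite phi'E xE /tau.
  have -> : pc (w + S) = w by rewrite -[w]scale1r pcl pS addr0 /pc pw.
  have -> : w + S - w = S by rewrite addrC addKr.
  rewrite ew.
  rewrite -[RHS]bcomp1r -[RHS]bcomp1l -aI -bI.
  rewrite [RHS]bcompDl !(bcompDr T) !bcompDr.
  have -> : bcomp (bcomp b2 (adj b2)) (bcomp T (bcomp a1 (adj a1))) =
    bcomp b2 (bcomp (bcomp (adj b2) (bcomp T a1)) (adj a1)) by rewrite !bcompA.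
  have -> : bcomp (bcomp b1 (adj b1)) (bcomp T (bcomp a2 (adj a2))) =
    bcomp b1 (bcomp (bcomp (adj b1) (bcomp T a2)) (adj a2)) by rewrite !bcompA.
  rewrite e12 e21 !bcomp0l !bcomp0r addr0 add0r /S.
  by rewrite !bcompA.
exists (@dsum R H H1), (@dsum R K H2), H, K, phi', psi'; split.
(* The constants of [up] and [down]: 2 (M + 2 (M + M)) = 10 M and 2 (M + M) = 4 M. *)
- apply: (@wstar_cb_iso_comp R X _ _ _ _ phi phi' tau 10 4 hphi phi'E) => //.
  + move=> n T hT; have := up _ _ (fun i j => T i j) _ (bop_mxnorm_ge0 T) hT (opb_opnorm _).
    move=> h; apply/opnorm_le; first by rewrite mulr_ge0// bop_mxnorm_ge0.
    move: h; rewrite -/(bop_mxnorm T).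
    have -> : 2 * (bop_mxnorm T + 2 * (bop_mxnorm T + bop_mxnorm T)) = 10 * bop_mxnorm T by ring.
    by congr opb; apply/funext => i; apply/funext => j; rewrite mxE.
  + move=> n T hT.
    have h0 : opb (fun i j => tau (T i j)) (bop_mxnorm (map_mx tau T)).
      have := opb_opnorm (fun i j => map_mx tau T i j).
      by congr opb; apply/funext => i; apply/funext => j; rewrite mxE.
    have := down _ _ (fun i j => T i j) _ (bop_mxnorm_ge0 _) hT h0.
    move=> h; apply/opnorm_le; first by rewrite mulr_ge0// bop_mxnorm_ge0.
    by move: h; congr opb; ring.
  + move=> f nf.
    have [g ng hg] := ntW _ (normal_comp b1 (adj a1) nf).
    have n2 := normal_comp b2 (adj a2) nf.
    exists ((fun T => g (bcomp (bcomp p T) q)) + ((fun T => f (bcomp (bcomp b2 T) (adj a2))) -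
      (fun T => f (bcomp (bcomp b2 (bcomp (bcomp p T) q)) (adj a2))))).
      apply: (subspaceD normal_subspace (normal_comp p q ng)).
      exact: (subspaceB normal_subspace n2 (normal_comp p q n2)).
    move=> T hT; rewrite /tau (normalD nf) !bcompA (hg _ (pqW _ hT)).
    rewrite -[RHS]/(g (pc T) + (f (bcomp (bcomp b2 T) (adj a2)) - f (bcomp (bcomp b2 (pc T)) (adj a2)))).
    by rewrite bcompDr bcompNr bcompDl bcompNl (normalB nf).
- apply: (@wstar_cb_iso_comp R Y _ _ _ _ psi psi' tY 1 1 hpsi psi'E) => //.
  + move=> n T hT; rewrite mul1r; apply/opnorm_le; first exact: bop_mxnorm_ge0.
    have := (otY _ _ (fun i j => T i j) _ (bop_mxnorm_ge0 T) hT).2 (opb_opnorm _).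
    by congr opb; apply/funext => i; apply/funext => j; rewrite mxE.
  + move=> n T hT; rewrite mul1r; apply/opnorm_le; first exact: bop_mxnorm_ge0.
    apply: (otY _ _ (fun i j => T i j) _ (bop_mxnorm_ge0 _) hT).1.
    have := opb_opnorm (fun i j => map_mx tY T i j).
    by congr opb; apply/funext => i; apply/funext => j; rewrite mxE.
  + by rewrite rpsi'.
(* The TROs act on the first summand only, so in all products the part [T - p T q] disappears. *)
- exists [set bcomp m (adj a1) | m in M1], [set bcomp n (adj b1) | n in M2]; split.
  + by split; exact: TRO_dilate.
  + have sub n T m : M2 n -> M1 m -> range phi' T ->
        bcomp (bcomp (bcomp n (adj b1)) T) (bcomp a1 (adj m)) =
        bcomp (bcomp n (bcomp (adj b1) (bcomp T a1))) (adj m) by rewrite !bcompA.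
    apply/seteqP; split=> [S hS|S].
      apply/wstar_span_polar => f nf f0; apply: (C5 f nf) => [n T m hn [w hw <-] hm|].
        have h := rW w hw.
        rewrite -[RHS](f0 (bcomp (bcomp (bcomp n (adj b1)) (bcomp b1 (bcomp (tW w) (adj a1)))) (bcomp a1 (adj m)))).
          congr f; rewrite !bcompA -[bcomp (bcomp n (adj b1)) b1]bcompA b11 bcomp1r.
          by rewrite -[bcomp (bcomp _ (adj a1)) a1]bcompA a11 bcomp1r.
        exists (bcomp (bcomp n (adj b1)) (bcomp b1 (bcomp (tW w) (adj a1)))).
          by exists (bcomp n (adj b1)); [exists n|exists (bcomp b1 (bcomp (tW w) (adj a1)))].
        exists (bcomp a1 (adj m)) => //; exists (bcomp m (adj a1)); first by exists m.
        by move=> u v; rewrite adjP adj_comp adjK.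
      by rewrite -rpsi'.
    move=> /wstar_span_polar h; apply/(closed_polar (range_subspace psi')).1.
      by rewrite rpsi'.
    move=> f nf f0; apply: h => // _ [_ [_ [n hn <-] [_ [x _ <-] <-]] [_ [_ [m hm <-] /adjE ->] <-]].
    apply: f0; rewrite rpsi' adj_comp adjK.
    have -> : bcomp (bcomp (bcomp n (adj b1)) (phi' x)) (bcomp a1 (adj m)) =
        bcomp (bcomp n (tW (pc (phi x)))) (adj m).
      by rewrite phi'E -b1taua1 !bcompA.
    by apply: C1 => //; exists (pc (phi x)) => //; apply: pqW; exists x.
  + move=> _ [_ [_ [_ [n hn <-] /adjE ->] [S hS <-]] [_ [m hm <-] <-]].
    rewrite rpsi' in hS; have [w hw we] := C2 n S m hn hS hm.
    rewrite adj_comp adjK.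
    have -> : bcomp (bcomp (bcomp b1 (adj n)) S) (bcomp m (adj a1)) =
        bcomp b1 (bcomp (bcomp (bcomp (adj n) S) m) (adj a1)) by rewrite !bcompA.
    by rewrite -we; exact: rW.
  + move=> _ [_ [_ [_ [n hn <-] /adjE ->] [_ [n' hn' <-] <-]] [_ [x _ <-] <-]].
    have hT : (tW @` W) (tW (pc (phi x))).
      by exists (pc (phi x)) => //; apply: pqW; exists x.
    have [w hw we] := C3 n n' _ hn hn' hT.
    rewrite adj_comp adjK phi'E.
    have -> : bcomp (bcomp (bcomp b1 (adj n)) (bcomp n' (adj b1))) (tau (phi x)) =
        bcomp b1 (bcomp (bcomp (bcomp (adj n) n') (tW (pc (phi x)))) (adj a1)).
      by rewrite -!bcompA b1tau.
    by rewrite -we; exact: rW.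
  + move=> _ [_ [_ [x _ <-] [_ [_ [m hm <-] /adjE ->] <-]] [_ [m' hm' <-] <-]].
    have hT : (tW @` W) (tW (pc (phi x))).
      by exists (pc (phi x)) => //; apply: pqW; exists x.
    have [w hw we] := C4 m m' _ hm hm' hT.
    rewrite adj_comp adjK phi'E.
    have -> : bcomp (bcomp (tau (phi x)) (bcomp a1 (adj m))) (bcomp m' (adj a1)) =
        bcomp b1 (bcomp (bcomp (bcomp (tW (pc (phi x))) (adj m)) m') (adj a1)).
      by rewrite !bcompA taua1.
    by rewrite -we; exact: rW.
Qed.

End Backward.

(** * From a TRO-embedding to isomorphic matrix spaces *)

Section Residuals.
Context {R : realType} {H1 H2 H3 : hilbertType R}.

(** The operators that every element of [M] multiplies into [Z]. It is w*-closed when [Z] is, which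
    allows passing to w*-limits in one factor of a product at a time. *)
Definition resid_l (M : set 'B(H2, H3)) (Z : set 'B(H1, H3)) : set 'B(H1, H2) :=
  [set b | forall m, M m -> Z (bcomp m b)].

Definition resid_r (M : set 'B(H1, H2)) (Z : set 'B(H1, H3)) : set 'B(H2, H3) :=
  [set a | forall m, M m -> Z (bcomp a m)].

Context {Z : set 'B(H1, H3)} (sZ : subspace Z).

Lemma resid_l_subspace M : subspace (resid_l M Z).
Proof.
split=> [m _|c x y hx hy m Mm]; first by rewrite bcomp0r; exact: sZ.1.
by rewrite bcompDr bcompZr; apply: sZ.2; [exact: hx|exact: hy].
Qed.

Lemma resid_r_subspace M : subspace (resid_r M Z).
Proof.
split=> [m _|c x y hx hy m Mm]; first by rewrite bcomp0l; exact: sZ.1.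
by rewrite bcompDl bcompZl; apply: sZ.2; [exact: hx|exact: hy].
Qed.

Lemma resid_l_closed M : wstar_closed Z -> wstar_closed (resid_l M Z).
Proof.
move=> /(closed_polar sZ) cZ; apply/(closed_polar (resid_l_subspace M)) => T hT m Mm.
apply: cZ => f nf f0; rewrite -[bcomp m T]bcomp1r.
apply: (hT _ (normal_comp m (idop H1) nf)) => S hS.
by rewrite bcomp1r; apply: f0; exact: hS.
Qed.

Lemma resid_r_closed M : wstar_closed Z -> wstar_closed (resid_r M Z).
Proof.
move=> /(closed_polar sZ) cZ; apply/(closed_polar (resid_r_subspace M)) => T hT m Mm.
apply: cZ => f nf f0; rewrite -[bcomp T m]bcomp1l bcompA.
apply: (hT _ (normal_comp (idop H3) m nf)) => S hS.
by rewrite bcomp1l; apply: f0; exact: hS.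
Qed.

End Residuals.

Section MatrixProducts.
Context {R : realType} {I : choiceType} {H1 H2 H3 : hilbertType R}.

(** An entry of the product is a bounded strong limit of finite sums of products of entries. *)
Lemma MIop_mul (X : set 'B(H2, H3)) (Y : set 'B(H1, H2)) (Z : set 'B(H1, H3))
    (S : 'B(l2 I H2, l2 I H3)) (T : 'B(l2 I H1, l2 I H2)) :
  subspace Z -> wstar_closed Z -> (forall x y, X x -> Y y -> Z (bcomp x y)) ->
  MIop X S -> MIop Y T -> MIop Z (bcomp S T).
Proof.
move=> sZ cZ XY hS hT i j.
pose W (A : {fset I}) : 'B(H1, H3) := bcomp (l2p i) (bcomp S (bcomp (l2t A) (bcomp T (l2i j)))).
have WE A : W A = \sum_(k <- A) bcomp (ent S i k) (ent T k j).
  rewrite /W /l2t bcomp_suml !bcomp_sumr; apply: eq_bigr => k _.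
  by rewrite !entE !bcompA.
have F1 : ProperFilter (@totally I) by exact: _.
apply: (@sot_closed _ _ _ Z _ (@totally I) _ W _ (opn (l2p (H := H3) i) * (opn S * (opn (bcomp T (l2i j)))))) => //.
- by move=> A; rewrite WE; apply: (subspace_sum sZ) => k _; exact: XY.
- move=> A x; rewrite /W !bcompE -!mulrA.
  apply: le_trans (opnP _ _) _; rewrite ler_wpM2l ?opn_ge0//.
  apply: le_trans (opnP _ _) _; rewrite ler_wpM2l ?opn_ge0//.
  by apply: le_trans (l2t_le _ _) _; exact: (opnP (bcomp T (l2i j)) x).
- move=> x; rewrite entE /W.
  have h : (fun A : {fset I} => l2t A (T (l2i j x))) @ totally --> T (l2i j x) by apply: l2t_cvg.
  exact: (bop_cvg (l2p i) (bop_cvg S h)).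
Qed.

Lemma ent_adj (S : 'B(l2 I H1, l2 I H2)) i j : ent (adj S) i j = adj (ent S j i).
Proof. by rewrite !entE !adj_comp /l2p adjK bcompA. Qed.

Lemma ent_ampl (T : 'B(H1, H2)) (i j : I) : ent (ampl T) i j = if i == j then T else 0.
Proof.
by apply: bopP => x; rewrite entE !bcompE ampl_l2i l2pi eq_sym; case: eqP.
Qed.

Lemma ent_ampl_l (a : 'B(H2, H3)) (T : 'B(l2 I H1, l2 I H2)) i j :
  ent (bcomp (ampl a) T) i j = bcomp a (ent T i j).
Proof. by apply: bopP => x; rewrite !entE !bcompE l2p_ampl. Qed.

Lemma ent_ampl_r (a : 'B(H1, H2)) (T : 'B(l2 I H2, l2 I H3)) i j :
  ent (bcomp T (ampl a)) i j = bcomp (ent T i j) a.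
Proof. by apply: bopP => x; rewrite !entE !bcompE ampl_l2i. Qed.

End MatrixProducts.

(** * Columns over a TRO and its support projection *)

Section Columns.
Context {R : realType} {G : choiceType} {H K : hilbertType R}.

Lemma column (v : G -> 'B(H, K)) :
  (forall (A : {fset G}) x, \sum_(d <- A) rnorm (v d x) ^+ 2 <= rnorm x ^+ 2) ->
  exists2 C : 'B(H, l2 G K), (forall d, bcomp (l2p d) C = v d) & forall x, rnorm (C x) <= rnorm x.
Proof.
move=> hv.
have /choice[f hf] : forall x, exists y : l2 G K, (forall d, l2p d y = v d x) /\ rnorm y ^+ 2 <= rnorm x ^+ 2.
  by move=> x; have [y h1 h2] := l2_vec (hv ^~ x); exists y.
have fl : linear f.
  move=> a x y; apply: l2_ext => d; rewrite opD opZ !(hf _).1.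
  by rewrite opD opZ.
have fle x : rnorm (f x) <= 1 * rnorm x.
  by rewrite mul1r -(@ler_pXn2r _ 2) ?nnegrE ?rnorm_ge0//; exact: (hf x).2.
exists (mkbop fl fle) => [d|x]; first by apply: bopP => x; exact: (hf x).1.
by have := fle x; rewrite mul1r.
Qed.

Lemma gram_cvg (C : 'B(H, l2 G K)) x :
  (fun A : {fset G} => (\sum_(d <- A) bcomp (adj (bcomp (l2p d) C)) (bcomp (l2p d) C)) x) @ totally
    --> bcomp (adj C) C x.
Proof.
rewrite (_ : (fun A => _) = fun A => adj C (l2t A (C x))); last first.
  apply/funext => A; rewrite bop_sumE l2tE op_sum; apply: eq_bigr => d _.
  by rewrite adj_comp /l2p adjK !bcompE.
have h : (fun A : {fset G} => l2t A (C x)) @ totally --> C x by apply: l2t_cvg.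
exact: (bop_cvg (adj C) h).
Qed.

Lemma gram_in (C : 'B(H, l2 G K)) (N : set 'B(H, H)) : subspace N -> wstar_closed N ->
  (forall d, N (bcomp (adj (bcomp (l2p d) C)) (bcomp (l2p d) C))) -> N (bcomp (adj C) C).
Proof.
move=> sN cN h; have F1 : ProperFilter (@totally G) by exact: _.
have cv x := gram_cvg (C := C) (x := x).
apply: (@sot_closed _ _ _ N _ (@totally G) _ _ _ (opn (adj C) * opn C)
  sN cN _ _ cv) => [A|A x]; first by apply: (subspace_sum sN).
have -> : (\sum_(d <- A) bcomp (adj (bcomp (l2p d) C)) (bcomp (l2p d) C)) x = adj C (l2t A (C x)).
  rewrite bop_sumE l2tE op_sum; apply: eq_bigr => d _.
  by rewrite adj_comp /l2p adjK !bcompE.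
rewrite -mulrA; apply: le_trans (opnP _ _) _; rewrite ler_wpM2l ?opn_ge0//.
by apply: le_trans (l2t_le _ _) _; exact: opnP.
Qed.

End Columns.

Lemma chain_finite T (F : set (set T)) (X0 : set T) (E : eqType) (g : E -> T) (r : seq E) :
  total_on F subset -> F X0 -> (forall t, t \in r -> (\bigcup_(X in F) X) (g t)) ->
  exists2 X, F X & forall t, t \in r -> X (g t).
Proof.
move=> tF F0; elim: r => [|a r IH] h; first by exists X0.
have [X FX hX] := IH (fun t tr => h t (mem_behead (s := a :: r) tr)).
have [Y FY hY] := h a (mem_head _ _).
have [XY|YX] := tF _ _ FX FY.
  by exists Y => // t; rewrite inE => /orP[/eqP ->//|/hX/XY].
by exists X => // t; rewrite inE => /orP[/eqP ->|/hX//]; exact: YX.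
Qed.

Section Supports.
Context {R : realType} {H K : hilbertType R} {M : set 'B(H, K)}.
Context (tM : is_TRO M) (cM : wstar_closed M).

Lemma TRO_subspace : subspace M.
Proof. by have [M0 Ml _] := tM; split. Qed.

Lemma TRO_triple x y z : M x -> M y -> M z -> M (bcomp x (bcomp (adj y) z)).
Proof.
move=> hx hy hz; have [_ _ Mt] := tM; rewrite bcompA; apply: Mt.
exists (bcomp x (adj y)); last by exists z.
by exists x => //; exists (adj y) => //; exists y => //; exact: is_adjoint_adj.
Qed.

Lemma gram_resid y z : M y -> M z -> resid_l M M (bcomp (adj y) z).
Proof. by move=> hy hz m hm; exact: TRO_triple. Qed.

(* The residual [s = 1 - C^* C] of a maximal family satisfies [m s = 0] for [m]
   in [M]: otherwise a multiple of [m s], which is in [M], could be added. The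
   second component of an index only serves to allow repetitions. *)
Lemma TRO_support : exists (v : 'B(H, K) * nat -> 'B(H, K)) (C : 'B(H, l2 ('B(H, K) * nat)%type K)),
  [/\ forall d, M (v d), forall d, bcomp (l2p d) C = v d &
      forall m, M m -> bcomp m (bcomp (adj C) C) = m].
Proof.
have sM := TRO_subspace.
pose P (D : set ('B(H, K) * nat)) := (forall d, D d -> M d.1) /\
  forall r : seq ('B(H, K) * nat), uniq r -> (forall d, d \in r -> D d) ->
    forall x, \sum_(d <- r) rnorm (d.1 x) ^+ 2 <= rnorm x ^+ 2.
have [F FP tF|D [[DM Db] maxD]] := @Zorn_bigcup _ P.
  split=> [d [D FD Dd]|r ur hr x]; first exact: (FP _ FD).1.
  case: r ur hr => [|d r] ur hr; first by rewrite big_nil sqr_ge0.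
  have [D0 FD0 _] := hr d (mem_head _ _).
  have [D FD hD] := chain_finite (g := id) tF FD0 hr.
  exact: (FP _ FD).2.
pose v (d : 'B(H, K) * nat) := if `[< D d >] then d.1 else 0.
have vD d : D d -> v d = d.1 by move=> Dd; rewrite /v asboolT.
have vM d : M (v d) by rewrite /v; case: asboolP => [/DM//|_]; exact: sM.1.
have hv (A : {fset 'B(H, K) * nat}) x : \sum_(d <- A) rnorm (v d x) ^+ 2 <= rnorm x ^+ 2.
  rewrite (bigID (fun d => `[< D d >])) /= [X in _ + X]big1 ?addr0; last first.
    by move=> d /negPf Dd; rewrite /v Dd bop0E rnorm0 expr0n.
  have -> : \sum_(d <- A | `[< D d >]) rnorm (v d x) ^+ 2 =
      \sum_(d <- [seq d <- A | `[< D d >]]) rnorm (d.1 x) ^+ 2.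
    by rewrite big_filter; apply: eq_bigr => d Dd; rewrite /v Dd.
  apply: Db => [|d]; first exact/filter_uniq/fset_uniq.
  by rewrite mem_filter => /andP[/asboolP].
have [C Cv Cle] := column hv.
exists v, C; split=> // m Mm; apply/eqP; rewrite eq_sym -subr_eq0; apply/negPn/negP => ms0.
set p := bcomp (adj C) C in ms0.
pose s := idop H - p.
have msE : bcomp m s = m - bcomp m p by rewrite /s bcompDr bcompNr bcomp1r.
(* [resid_l M M] is a w*-closed subspace that contains all [adj y z] with [y], [z] in [M]; so it
   contains the limit [p] of sums of such products. *)
have Ms : M (bcomp m s).
  rewrite msE; apply: (subspaceB sM) => //.
  have sR : subspace (resid_l M M) by exact: resid_l_subspace.
  have cR : wstar_closed (resid_l M M) by exact: resid_l_closed.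
  suff h : resid_l M M p by exact: h.
  by apply: (@gram_in _ _ _ _ C _ sR cR) => d; rewrite Cv; exact: gram_resid.
pose a : R := (opn m + 1)^-1.
have m1 : 0 < opn m + 1 by rewrite ltr_wpDl// opn_ge0.
pose c := a%:C *: bcomp m s.
have Mc : M c by exact: (subspaceZ sM).
have c0 : c != 0.
  rewrite /c scaler_eq0 negb_or msE ms0 andbT.
  by apply/eqP => /complexI /eqP; rewrite invr_eq0 gt_eqF.
(* The right side is the room left by the family. The factor in [c] makes [c] dominated by [s], so
   that [c] fits into this room. *)
have sle x : rnorm (s x) ^+ 2 <= rnorm x ^+ 2 - rnorm (C x) ^+ 2.
  have px : rnorm (p x) <= rnorm (C x).
    have hC y : rnorm (C y) <= 1 * rnorm y by rewrite mul1r.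
    by have := adj_bound ler01 hC (C x); rewrite mul1r.
  have -> : s x = x - p x by rewrite /s bopBE.
  rewrite rnormBE [p x]bcompE -adjP hdotxx /= -bcompE.
  have : rnorm (p x) ^+ 2 <= rnorm (C x) ^+ 2 by rewrite lerXn2r ?nnegrE ?rnorm_ge0.
  by rewrite -/p; lra.
have cle x : rnorm (c x) ^+ 2 <= rnorm x ^+ 2 - rnorm (C x) ^+ 2.
  apply: le_trans (sle x); rewrite lerXn2r ?nnegrE ?rnorm_ge0//.
  rewrite bopZE rnormZr ger0_norm ?invr_ge0 ?(ltW m1)// ler_pdivrMl//.
  apply: le_trans (opnP m (s x)) _; rewrite ler_wpM2r ?rnorm_ge0//.
  by rewrite lerDl.
(* If every copy of [c] belonged to [D], then [N * rnorm (c x) ^+ 2 <= rnorm x ^+ 2] for all [N],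
   which forces [c = 0]. *)
have [n Dn] : exists n, ~ D (c, n).
  apply: contrapT => hn; move/eqP: c0; apply.
  have Dn n : D (c, n) by apply: contrapT => h; apply: hn; exists n.
  apply: bopP => x; rewrite bop0E; apply: rnorm_eq0.
  have hN N : N%:R * rnorm (c x) ^+ 2 <= rnorm x ^+ 2.
    have -> : N%:R * rnorm (c x) ^+ 2 = \sum_(d <- [seq (c, k) | k <- iota 0 N]) rnorm (d.1 x) ^+ 2.
      by rewrite big_map /= big_const_seq count_predT iter_addr_0 size_iota mulr_natl.
    apply: Db => [|_ /mapP[k _ ->]//].
    by rewrite map_inj_uniq ?iota_uniq// => k l [].
  apply/eqP/negPn/negP => cx0.
  have cp : 0 < rnorm (c x) ^+ 2 by rewrite exprn_gt0// lt_neqAle eq_sym cx0 rnorm_ge0.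
  have := hN (Num.bound (rnorm x ^+ 2 / rnorm (c x) ^+ 2)); apply/negP.
  by rewrite -ltNge -ltr_pdivrMr// archi_boundP// divr_ge0// sqr_ge0.
apply: (maxD (D `|` [set (c, n)])); last split.
- split; first by move=> d; left.
  by move=> /(_ (c, n)) h; apply: Dn; apply: h; right.
- by move=> d [/DM//|->].
- move=> r ur hr x.
  have [cr|cr] := boolP ((c, n) \in r); last first.
    apply: Db => // d dr; have [//|/= dE] := hr d dr.
    by move: cr; rewrite -dE dr.
  rewrite (perm_big _ (perm_to_rem cr)) big_cons /=.
  have h : \sum_(d <- rem (c, n) r) rnorm (d.1 x) ^+ 2 <= rnorm (C x) ^+ 2.
    have pB : perm_eq [fset d in rem (c, n) r]%fset (rem (c, n) r).
      by apply: uniq_perm; [exact: fset_uniq|exact: rem_uniq|move=> d; rewrite inE].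
    rewrite -(perm_big _ pB); apply: le_trans (l2_norm_le (C x) _).
    rewrite big_seq [leRHS]big_seq; apply: ler_sum => d.
    rewrite inE mem_rem_uniq// inE => /andP[/= dc dr].
    have [Dd|/= dE] := hr d dr; last by rewrite dE eqxx in dc.
    by rewrite -bcompE Cv vD.
  by have := cle x; lra.
Qed.

End Supports.

Lemma gram0 (R : realType) (H K : hilbertType R) (T : 'B(H, K)) : bcomp (adj T) T = 0 -> T = 0.
Proof.
move=> h; apply: bopP => x; rewrite bop0E; apply: rnorm_eq0.
have := rnorm_adj_comp T x; rewrite h bop0E hdot0l => /complexI/eqP.
by rewrite sqrf_eq0 => /eqP.
Qed.

Section ColumnAmplification.
Context {R : realType} {I G : choiceType} {H K : hilbertType R}.

(** The injection [g] of pairs into [I] gives isometries of l2(G, K) into l2(I, K) with orthogonal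
    ranges, one for each [i]. Column [i] of [A] is [C] followed by the [i]-th of them, so distinct
    columns are orthogonal, while the nonzero entries are still entries of [C]. *)
Lemma column_ampl (C : 'B(H, l2 G K)) (g : G -> I -> I) :
  (forall d i d' i', g d i = g d' i' -> d = d' /\ i = i') ->
  exists2 A : 'B(l2 I H, l2 I K), bcomp (adj A) A = ampl (bcomp (adj C) C) &
    forall k i, ent A k i = 0 \/ exists d, ent A k i = bcomp (l2p d) C.
Proof.
move=> gi.
have /choice[S hS] : forall i, exists S : 'B(l2 G K, l2 I K), forall d x, S (l2i d x) = l2i (g d i) x.
  move=> i; have [|S hS _] := @reindex_exists R G I K (g ^~ i); last by exists S.
  by move=> d d' /gi[].
have SS i j u w : hdot (S i u) (S j w) = if i == j then hdot u w else 0.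
  have h : bcomp (adj (S j)) (S i) = if i == j then idop _ else 0.
    apply: l2_bop_eq => d x; apply: l2_hdot_eq => e y.
    rewrite bcompE -adjPr !hS hdot_l2i; case: (eqVneq i j) => [->|ij].
      rewrite idopE hdot_l2i; have [->|de] := eqVneq d e; first by rewrite eqxx.
      by case: eqP => // /gi[/eqP]; rewrite (negbTE de).
    by rewrite bop0E hdot0l; case: eqP => // /gi[_ /eqP]; rewrite (negbTE ij).
  by rewrite adjPr -bcompE h; case: eqP => // _; rewrite bop0E hdot0l.
have [||A AE _] := @l2_extend R I H _ (fun i => bcomp (S i) C) (opn C).
- exact: opn_ge0.
- move=> A h; rewrite pythagoras => [|i j ij]; last by rewrite SS (negbTE ij).
  rewrite mulr_sumr; apply: ler_sum => i _.
  have -> : rnorm (bcomp (S i) C (h i)) = rnorm (C (h i)).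
    apply/eqP; rewrite -(@eqrXn2 _ 2) ?rnorm_ge0//; apply/eqP/complexI.
    by rewrite -!hdotxx SS eqxx.
  by rewrite -exprMn lerXn2r ?nnegrE ?rnorm_ge0 ?mulr_ge0 ?opn_ge0 ?rnorm_ge0// opnP.
exists A.
- apply: l2_bop_eq => i x; apply: l2_hdot_eq => j y.
  rewrite bcompE -adjPr !AE SS ampl_l2i hdot_l2i; case: eqP => // _.
  by rewrite adjPr.
- move=> k i; have [[d ->]|hk] := pselect (exists d, k = g d i).
    right; exists d; apply: bopP => x; rewrite entE !bcompE AE; apply: hdot_ext => y.
    by rewrite /l2p -!adjPr bcompE -hS SS eqxx.
  left; apply: bopP => x; rewrite entE !bcompE AE bop0E.
  suff h : bcomp (l2p k) (S i) = 0 by rewrite -[LHS]/(bcomp (l2p k) (S i) (C x)) h bop0E.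
  apply: l2_bop_eq => d z; rewrite bcompE hS l2pi bop0E.
  by case: eqP => // e; case: hk; exists d.
Qed.

End ColumnAmplification.

(** * Merging two partial isometries, and the unitary of a TRO *)

Section SchroederBernstein.
Context {R : realType} {L L' : hilbertType R} {A : 'B(L, L')} {B : 'B(L', L)}.
Context {P : 'B(L, L)} {P' : 'B(L', L')} (hP : is_projection P) (hP' : is_projection P').
Context (AA : bcomp (adj A) A = P) (BB : bcomp (adj B) B = P').
Context (PA : bcomp P' A = A) (PB : bcomp P B = B).

(* [F] is the sum of the mutually orthogonal projections [D^k E D^{*k}] with
   [D = B A] and [E = P - B B^*]. *)
Lemma schroeder_bernstein : exists F : 'B(L, L),
  (forall N : set 'B(L, L), subspace N -> wstar_closed N ->
     (forall a b, N a -> N b -> N (bcomp a b)) -> N (idop L) -> N (bcomp B A) ->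
     N (adj (bcomp B A)) -> N (P - bcomp B (adj B)) -> N F) /\
  let U := bcomp A F + bcomp (adj B) (P - F) in
  bcomp (adj U) U = P /\ bcomp U (adj U) = P'.
Proof.
have aP : adj P = P by apply/esym/adjE; exact: hP.2.
have aP' : adj P' = P' by apply/esym/adjE; exact: hP'.2.
(* By [gram0]: the gram operator of A - A P is (1 - P) P (1 - P) = 0. *)
have AP : bcomp A P = A.
  apply/eqP; rewrite eq_sym -subr_eq0; apply/eqP; apply: gram0.
  rewrite adjB adj_comp aP bcompDr !bcompDl !bcompNr !bcompNl -!bcompA.
  by rewrite [bcomp (adj A) (bcomp A P)]bcompA AA !hP.1 !addrN addr0.
have BP : bcomp B P' = B.
  apply/eqP; rewrite eq_sym -subr_eq0; apply/eqP; apply: gram0.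
  rewrite adjB adj_comp aP' bcompDr !bcompDl !bcompNr !bcompNl -!bcompA.
  by rewrite [bcomp (adj B) (bcomp B P')]bcompA BB !hP'.1 !addrN addr0.
have [D DE] : exists D, D = bcomp B A by exists (bcomp B A).
have [E EE0] : exists E, E = P - bcomp B (adj B) by exists (P - bcomp B (adj B)).
have DD : bcomp (adj D) D = P.
  by rewrite DE adj_comp -bcompA [bcomp (adj B) _]bcompA BB PA AA.
have PD : bcomp P D = D by rewrite DE bcompA PB.
have DP : bcomp D P = D by rewrite DE -bcompA AP.
have BsP : bcomp (adj B) P = adj B by rewrite -[in LHS]aP -adj_comp PB.
have PE : bcomp P E = E by rewrite EE0 bcompDr bcompNr hP.1 bcompA PB.
have aE : adj E = E by rewrite EE0 adjB adj_comp adjK aP.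
have EP : bcomp E P = E by rewrite -[LHS]adjK adj_comp aP aE PE aE.
have EB : bcomp E B = 0.
  by rewrite EE0 bcompDl bcompNl PB -bcompA BB BP subrr.
have EE : bcomp E E = E.
  by rewrite {2}EE0 bcompDr bcompNr EP bcompA EB bcomp0l subr0.
have ED : bcomp E D = 0 by rewrite DE bcompA EB bcomp0l.
have DsE : bcomp (adj D) E = 0 by rewrite -[LHS]adjK adj_comp adjK aE ED adj0.
pose Dk k := iter k (bcomp D) (idop L).
have Dk0 : Dk 0%N = idop L by [].
have DkS k : Dk k.+1 = bcomp D (Dk k) by [].
have PDk k : bcomp P (bcomp (Dk k) E) = bcomp (Dk k) E.
  by case: k => [|k]; rewrite ?Dk0 ?DkS ?bcomp1l ?PE// !bcompA PD.
pose v k := bcomp E (adj (Dk k)).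
have av k : adj (v k) = bcomp (Dk k) E by rewrite /v adj_comp adjK aE.
have vv j k : bcomp (v j) (adj (v k)) = if j == k then E else 0.
  rewrite av /v; elim: j k => [|j IH] [|k].
  - by rewrite Dk0 adj1 bcomp1r bcomp1l EE.
  - by rewrite Dk0 adj1 bcomp1r DkS !bcompA ED !bcomp0l.
  - by rewrite Dk0 DkS adj_comp bcomp1l -!bcompA DsE !bcomp0r.
  - rewrite !DkS adj_comp eqSS -IH -!bcompA [bcomp (adj D) _]bcompA DD.
    by rewrite PDk.
have hv (S : {fset nat}) x : \sum_(k <- S) rnorm (v k x) ^+ 2 <= rnorm x ^+ 2.
  pose y := \sum_(k <- S) adj (v k) (v k x).
  pose s := \sum_(k <- S) rnorm (v k x) ^+ 2.
  have yx : hdot y x = s%:C.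
    rewrite /y hdot_suml rmorph_sum; apply: eq_bigr => k _.
    by rewrite -adjPr hdotxx.
  have vy k : k \in S -> v k y = v k x.
    move=> kS; rewrite /y op_sum (sum_fset_delta kS) => [|j jk].
      by rewrite -bcompE vv eqxx -bcompE /v bcompA EE.
    by rewrite -bcompE vv eq_sym (negbTE jk) bop0E.
  have yy : hdot y y = s%:C.
    rewrite {1}/y hdot_suml rmorph_sum; apply: eq_big_seq => k kS.
    by rewrite -adjPr vy// hdotxx.
  have := yy; rewrite hdotxx => /complexI yE.
  have := rnormBE x y; rewrite [hdot x y]hdotC yx conjR /=.
  have := sqr_ge0 (rnorm (x - y)); rewrite yE -/s.
  by move: (rnorm (x - y) ^+ 2) (rnorm x ^+ 2) => a b; lra.
have [C Cv Cle] := column hv.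
have [F FC] : exists F, F = bcomp (adj C) C by exists (bcomp (adj C) C).
have aF : adj F = F by rewrite FC adj_comp adjK.
have FF : bcomp F F = F.
  have CC : bcomp C (adj C) = ampl E.
    apply: ent_inj; apply/funext => j; apply/funext => k.
    by rewrite ent_ampl entE bcompA bcompA Cv -bcompA -{1}(adjK (l2i k)) -adj_comp Cv vv.
  rewrite FC -bcompA [bcomp C (bcomp _ _)]bcompA CC; congr bcomp.
  apply: bopP => x; apply: l2_ext => k; rewrite bcompE l2p_ampl.
  by rewrite -[l2p k (C x)]/(bcomp (l2p k) C x) Cv -bcompE /v bcompA EE.
(* Shifting the index of the sum that defines [F] by one; the identity for partial sums passes to
   the strong limit. *)
have FE : F = E + bcomp D (bcomp F (adj D)).
  pose Fn n := \sum_(0 <= k < n) bcomp (adj (v k)) (v k).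
  have cF x : (fun n => Fn n x) @ \oo --> F x.
    have h := gram_cvg (C := C) (x := x).
    have zE : (fun A0 : {fset nat} => (\sum_(d <- A0) bcomp (adj (bcomp (l2p d) C)) (bcomp (l2p d) C)) x) =
        (fun A0 : {fset nat} => \sum_(d <- A0) bcomp (adj (v d)) (v d) x).
      by apply/funext => A0; rewrite bop_sumE; apply: eq_bigr => d _; rewrite !Cv.
    rewrite zE -FC in h.
    rewrite (_ : (fun n => _) = series (fun d => bcomp (adj (v d)) (v d) x)); last first.
      by apply/funext => n; rewrite /Fn /series /= bop_sumE.
    exact: (totally_series h).
  have FnS n : Fn n.+1 = E + bcomp D (bcomp (Fn n) (adj D)).
    rewrite /Fn big_nat_recl//= bcomp_suml bcomp_sumr; congr (_ + _).
      by rewrite av Dk0 bcomp1l /v Dk0 adj1 bcomp1r EE.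
    apply: eq_bigr => k _; by rewrite !av /v DkS adj_comp !bcompA.
  apply: bopP => x.
  have h1 : (fun n => Fn n.+1 x) @ \oo --> F x.
    have h := cF x; rewrite -(cvg_shiftS (fun n => Fn n x)) in h; exact: h.
  have h2 : (fun n => Fn n.+1 x) @ \oo --> (E + bcomp D (bcomp F (adj D))) x.
    rewrite (_ : (fun n => _) = fun n => E x + D (Fn n (adj D x))); last first.
      by apply/funext => n; rewrite FnS bopDE.
    rewrite bopDE; apply: cvgD; first exact: cvg_cst.
    exact: (bop_cvg D (cF (adj D x))).
  exact: (cvg_unique (@norm_hausdorff _ L) h1 h2).
have EF : bcomp E F = E.
  by rewrite FE bcompDr EE !bcompA ED !bcomp0l addr0.
have FE' : bcomp F E = E by rewrite -[LHS]adjK adj_comp aE aF EF aE.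
have PF : bcomp P F = F by rewrite FE bcompDr PE bcompA PD.
have FP : bcomp F P = F by rewrite -[LHS]adjK adj_comp aP aF PF aF.
have DF : bcomp D F = bcomp F D.
  rewrite {2}FE bcompDl ED add0r -!bcompA DD FP.
  by [].
have [Q QD] : exists Q, Q = P - F by exists (P - F).
have aQ : adj Q = Q by rewrite QD adjB aP aF.
have QQ : bcomp Q Q = Q by rewrite QD bcompDr bcompNr !bcompDl !bcompNl hP.1 PF FP FF subrr subr0.
have QE : bcomp Q E = 0 by rewrite QD bcompDl bcompNl PE FE' subrr.
have QF : bcomp Q F = 0 by rewrite QD bcompDl bcompNl PF FF subrr.
have FQ : bcomp F Q = 0 by rewrite -[LHS]adjK adj_comp aF aQ QF adj0.
have QBB : bcomp Q (bcomp B (adj B)) = Q.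
  have -> : bcomp B (adj B) = P - E by rewrite EE0 opprB addrC subrK.
  by rewrite bcompDr bcompNr QE subr0 QD bcompDl bcompNl hP.1 FP.
exists F; split.
  move=> N sN cN NN N1 ND NDs NE.
  have NDk k : N (Dk k) /\ N (adj (Dk k)).
    elim: k => [|k [h1 h2]]; first by rewrite Dk0 adj1.
    by rewrite DkS adj_comp DE; split; exact: NN.
  rewrite FC; apply: (gram_in sN cN) => k; rewrite Cv av /v.
  by apply: (NN _ _ (NN _ _ (NDk k).1 _) (NN _ _ _ (NDk k).2)); rewrite EE0.
move=> U; have aU : adj U = bcomp F (adj A) + bcomp Q B.
  by rewrite /U adjD !adj_comp adjK aF -QD aQ.
have UE : U = bcomp A F + bcomp (adj B) Q by rewrite QD.
have QBAF : bcomp (bcomp Q B) (bcomp A F) = 0.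
  by rewrite -bcompA [bcomp B _]bcompA -DE DF bcompA QF bcomp0l.
split.
- rewrite aU UE bcompDl !bcompDr QBAF add0r.
  have -> : bcomp (bcomp F (adj A)) (bcomp (adj B) Q) = 0.
    by have := congr1 (@adj R L L) QBAF; rewrite !adj_comp aF aQ adj0.
  rewrite addr0.
  have -> : bcomp (bcomp F (adj A)) (bcomp A F) = F.
    by rewrite -bcompA [bcomp (adj A) _]bcompA AA PF FF.
  have -> : bcomp (bcomp Q B) (bcomp (adj B) Q) = Q.
    by rewrite -bcompA [bcomp B _]bcompA bcompA QBB QQ.
  by rewrite QD addrC subrK.
- rewrite aU UE bcompDl !bcompDr.
  have -> : bcomp (bcomp A F) (bcomp Q B) = 0 by rewrite -bcompA [bcomp F _]bcompA FQ bcomp0l bcomp0r.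
  have -> : bcomp (bcomp (adj B) Q) (bcomp F (adj A)) = 0.
    by rewrite -bcompA [bcomp Q _]bcompA QF bcomp0l bcomp0r.
  rewrite addr0 add0r.
  have -> : bcomp (bcomp A F) (bcomp F (adj A)) = bcomp A (bcomp F (adj A)).
    by rewrite -bcompA [bcomp F _]bcompA FF.
  have -> : bcomp (bcomp (adj B) Q) (bcomp Q B) = bcomp (adj B) (bcomp Q B).
    by rewrite -bcompA [bcomp Q _]bcompA QQ.
  have -> : bcomp (adj B) (bcomp Q B) = P' - bcomp (adj B) (bcomp F B).
    by rewrite QD bcompDl bcompNl bcompDr bcompNr PB BB.
  (* The part of [P'] missed by the second half of [U] is exactly the range projection of the first
     half. It follows from [FE], as [E B = 0] and [D = B A]. *)
  have -> : bcomp (adj B) (bcomp F B) = bcomp A (bcomp F (adj A)).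
    rewrite {1}FE bcompDl EB add0r DE adj_comp -!bcompA BB.
    have -> : bcomp (adj A) P' = adj A by rewrite -[in LHS]aP' -adj_comp PA.
    by rewrite [bcomp (adj B) _]bcompA BB bcompA PA.
  by rewrite addrC subrK.
Qed.

End SchroederBernstein.

Section AdjointSpace.
Context {R : realType} {H K : hilbertType R} {M : set 'B(H, K)} (tM : is_TRO M).

Definition adj_set : set 'B(K, H) := [set adj m | m in M].

Lemma adj_TRO : is_TRO adj_set.
Proof.
have sM := TRO_subspace tM; split.
- by exists 0; [exact: sM.1|rewrite adj0].
- move=> c _ _ [x hx <-] [y hy <-]; exists (Num.conj c *: x + y); first exact: sM.2.
  by rewrite adjD adjZ conjCK.
- move=> _ [_ [_ [x hx <-] [y' [_ [y hy <-] /adjE ->] <-]] [_ [z hz <-] <-]].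
  exists (bcomp z (bcomp (adj y) x)); first exact: TRO_triple.
  by rewrite !adj_comp.
Qed.

Lemma adj_closed : wstar_closed M -> wstar_closed adj_set.
Proof.
move=> /(closed_polar (TRO_subspace tM)) cM.
apply/(closed_polar (TRO_subspace adj_TRO)) => T hT; exists (adj T); last by rewrite adjK.
apply: cM => f nf f0; have := hT _ (normal_adj nf).
move=> h; apply: (can_inj conjCK); rewrite conj0; apply: h => _ [m hm <-].
by rewrite adjK f0// conj0.
Qed.

End AdjointSpace.

Section Unitary.
Context {R : realType} {I : choiceType} {H K : hilbertType R}.

Lemma ampl_projection (L : hilbertType R) (p : 'B(L, L)) : is_projection p -> is_projection (ampl (I := I) p).
Proof.
move=> [pp /adjE ap]; split; first by apply: bopP => x; rewrite bcompE -ampl_comp pp.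
by move=> x y; rewrite adjP adj_ampl -ap.
Qed.

Lemma ampl_idop : ampl (I := I) (idop H) = idop (l2 I H).
Proof. by apply: l2_bop_eq => i x; rewrite ampl_l2i. Qed.

Lemma MIop_ampl (N : set 'B(H, H)) a : subspace N -> N a -> MIop N (ampl (I := I) a).
Proof. by move=> sN Na i j; rewrite ent_ampl; case: eqP => // _; exact: sN.1. Qed.

Lemma MIop_adj (M : set 'B(H, K)) (S : 'B(l2 I H, l2 I K)) : MIop M S -> MIop (adj_set (M := M)) (adj S).
Proof. by move=> hS i j; rewrite ent_adj; exists (ent S j i). Qed.

Lemma MIop_adjr (M : set 'B(H, K)) (S : 'B(l2 I K, l2 I H)) : MIop (adj_set (M := M)) S -> MIop M (adj S).
Proof. by move=> hS i j; rewrite ent_adj; have [m hm <-] := hS j i; rewrite adjK. Qed.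

(** [A] has entries in [M], [B] in its adjoint space, and [ampl p], [ampl p'] are their initial
    projections. The ingredients of [F] have entries in the w*-closed algebra [resid_l M M], so [F]
    does too and [U] stays in M_I(M). The clause on [N] is what later makes [p] a multiplier of
    spaces that the products [adj x y] multiply into themselves. *)
Lemma TRO_unitary (M : set 'B(H, K)) (g : 'B(H, K) * nat -> I -> I) (g' : 'B(K, H) * nat -> I -> I) :
  is_TRO M -> wstar_closed M ->
  (forall d i d' i', g d i = g d' i' -> d = d' /\ i = i') ->
  (forall d i d' i', g' d i = g' d' i' -> d = d' /\ i = i') ->
  exists (p : 'B(H, H)) (p' : 'B(K, K)) (U : 'B(l2 I H, l2 I K)),
    [/\ is_projection p, is_projection p', forall m, M m -> bcomp m p = m,
        forall m, M m -> bcomp p' m = m &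
        forall N : set 'B(H, H), subspace N -> wstar_closed N ->
          (forall x y, M x -> M y -> N (bcomp (adj x) y)) -> N p] /\
    [/\ MIop M U, bcomp (adj U) U = ampl p & bcomp U (adj U) = ampl p'].
Proof.
move=> tM cM gi gi'; have sM := TRO_subspace tM.
have tM' := adj_TRO tM; have cM' := adj_closed tM cM; have sM' := TRO_subspace tM'.
have proj (L L' : hilbertType R) (G : choiceType) (C : 'B(L, l2 G L')) :
    (forall d, bcomp (bcomp (l2p d) C) (bcomp (adj C) C) = bcomp (l2p d) C) ->
    is_projection (bcomp (adj C) C).
  move=> hC; split; last by move=> x y; rewrite adjP adj_comp adjK.
  have -> : bcomp (bcomp (adj C) C) (bcomp (adj C) C) = bcomp (adj C) (bcomp C (bcomp (adj C) C)).
    by rewrite -bcompA.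
  congr bcomp; apply: bopP => x; apply: l2_ext => d.
  by have := congr1 (fun T : 'B(L, L') => T x) (hC d).
have [v [C [vM Cv Cp]]] := TRO_support tM cM.
have [v' [C' [vM' Cv' Cp']]] := TRO_support tM' cM'.
have [A AA Aent] := column_ampl C gi.
have [B BB Bent] := column_ampl C' gi'.
set p := bcomp (adj C) C in Cp AA; set p' := bcomp (adj C') C' in Cp' BB.
have hp : is_projection p by apply: proj => d; rewrite Cv; exact: Cp.
have hp' : is_projection p' by apply: proj => d; rewrite Cv'; exact: Cp'.
have ap : adj p = p by apply/esym/adjE; exact: hp.2.
have ap' : adj p' = p' by apply/esym/adjE; exact: hp'.2.
have pM m : M m -> bcomp p' m = m.
  move=> hm; rewrite -[LHS]adjK adj_comp ap' Cp' ?adjK//; by exists m.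
have hA : MIop M A.
  by move=> i j; have [->|[d ->]] := Aent i j; [exact: sM.1|rewrite Cv].
have hB : MIop (adj_set (M := M)) B.
  by move=> i j; have [->|[d ->]] := Bent i j; [exact: sM'.1|rewrite Cv'].
have hBa := MIop_adjr hB; have hAa := MIop_adj hA.
have gp (N : set 'B(H, H)) : subspace N -> wstar_closed N ->
    (forall x y, M x -> M y -> N (bcomp (adj x) y)) -> N p.
  by move=> sN cN h; apply: (gram_in sN cN) => d; rewrite Cv; exact: h.
pose N := resid_l M M.
have sN : subspace N by exact: resid_l_subspace.
have cN : wstar_closed N by exact: resid_l_closed.
have NN a b : N a -> N b -> N (bcomp a b).
  by move=> ha hb m hm; rewrite bcompA; apply: hb; exact: ha.
have MMN a b : adj_set (M := M) a -> M b -> N (bcomp a b).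
  by move=> [m hm <-] hb; exact: gram_resid.
have pA : bcomp (ampl p') A = A.
  apply: ent_inj; apply/funext => i; apply/funext => j.
  by rewrite ent_ampl_l pM.
have pB : bcomp (ampl p) B = B.
  apply: ent_inj; apply/funext => i; apply/funext => j.
  rewrite ent_ampl_l; have [m hm <-] := hB i j.
  by rewrite -[in LHS]ap -adj_comp Cp.
have [F [hF [UU UU']]] := schroeder_bernstein (ampl_projection hp) (ampl_projection hp') AA BB pA pB.
have sIN : subspace (MIop (I := I) N) by exact: MIop_subspace.
have cIN : wstar_closed (MIop (I := I) N) by exact: MIop_closed.
have Np : MIop N (ampl (I := I) p).
  by apply: MIop_ampl => //; apply: gp => // x y hx hy; exact: gram_resid.
have NF : MIop N F.
  apply: (hF (MIop N) sIN cIN) => //.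
  - by move=> a b; exact: MIop_mul.
  - by rewrite -ampl_idop; apply: MIop_ampl => // m; rewrite bcomp1r.
  - exact: (MIop_mul sN cN MMN).
  - by rewrite adj_comp; exact: (MIop_mul sN cN MMN).
  - by apply: (subspaceB sIN) => //; exact: (MIop_mul sN cN MMN).
exists p, p', (bcomp A F + bcomp (adj B) (ampl p - F)); split; split=> //.
have MN x y : M x -> N y -> M (bcomp x y) by move=> hx; exact.
apply: (subspaceD (MIop_subspace sM)); first exact: (MIop_mul sM cM MN).
by apply: (MIop_mul sM cM MN) => //; exact: (subspaceB sIN).
Qed.

End Unitary.

Section SpanMaps.
Context {R : realType} {H K H' K' : hilbertType R}.
Context {Z : set 'B(H', K')} (sZ : subspace Z) (cZ : wstar_closed Z).

(** Only the zero sets of [g] and of [f] after [Phi] are compared, so that conjugate-linear maps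
    such as [T |-> a (adj T) b] are covered too. *)
Lemma wstar_span_map (S : set 'B(H, K)) (Phi : 'B(H, K) -> 'B(H', K')) :
  (forall f, normal_functionals f -> exists2 g, normal_functionals g &
     forall T, g T = 0 <-> f (Phi T) = 0) ->
  (forall T, S T -> Z (Phi T)) -> forall T, wstar_span S T -> Z (Phi T).
Proof.
move=> hP hS T hT; apply: (closed_polar sZ).1 => // f nf f0.
have [g ng gf] := hP f nf; apply/gf; move/wstar_span_polar: hT; apply=> // s Ss.
by apply/gf/f0/hS.
Qed.

Lemma wstar_span_comp (S : set 'B(H, K)) (a : 'B(K, K')) (b : 'B(H', H)) :
  (forall T, S T -> Z (bcomp (bcomp a T) b)) ->
  forall T, wstar_span S T -> Z (bcomp (bcomp a T) b).
Proof.
apply: wstar_span_map => f nf.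
by exists (fun T => f (bcomp (bcomp a T) b)) => //; exact: normal_comp.
Qed.

Lemma wstar_span_compadj (S : set 'B(H, K)) (a : 'B(H, K')) (b : 'B(H', K)) :
  (forall T, S T -> Z (bcomp (bcomp a (adj T)) b)) ->
  forall T, wstar_span S T -> Z (bcomp (bcomp a (adj T)) b).
Proof.
apply: (@wstar_span_map S (fun T => bcomp (bcomp a (adj T)) b)) => f nf.
exists (fun T => Num.conj (f (bcomp (bcomp a (adj T)) b))); first exact: (normal_adj (normal_comp a b nf)).
move=> T; split=> [h|->]; last by rewrite conj0.
by apply: (can_inj conjCK); rewrite h conj0.
Qed.

End SpanMaps.

Lemma wstar_span_subspace (R : realType) (H K : hilbertType R) (S : set 'B(H, K)) :
  subspace (wstar_span S).
Proof.
split; first by apply/wstar_span_polar => f nf _; exact: normal0.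
move=> c x y /wstar_span_polar hx /wstar_span_polar hy; apply/wstar_span_polar => f nf f0.
by rewrite (normalD nf) (normalZ nf) hx// hy// mulr0 addr0.
Qed.

Lemma wstar_span_sub (R : realType) (H K : hilbertType R) (S : set 'B(H, K)) :
  S `<=` wstar_span S.
Proof. by move=> s hs; apply/wstar_span_polar => f nf; exact. Qed.

(** The factors of a triple product are moved from [M] to its closure one at a time: the right one,
    the middle one, then the left one. *)
Lemma wstar_span_TRO (R : realType) (H K : hilbertType R) (M : set 'B(H, K)) :
  is_TRO M -> is_TRO (wstar_span M) /\ wstar_closed (wstar_span M).
Proof.
move=> tM.
have sW : subspace (wstar_span M) := wstar_span_subspace M.
have cW : wstar_closed (wstar_span M) by exact: closed_closure.
have sub m : M m -> wstar_span M m by exact: wstar_span_sub.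
split=> //; split; [exact: sW.1|exact: sW.2|].
move=> _ [_ [x hx [y' [y hy /adjE ->] <-]] [z hz <-]].
have h1 x1 y1 z1 : M x1 -> M y1 -> wstar_span M z1 -> wstar_span M (bcomp (bcomp x1 (adj y1)) z1).
  move=> hx1 hy1 hz1; rewrite -[bcomp _ z1]bcomp1r.
  apply: (wstar_span_comp sW cW (b := idop H) _ hz1) => t ht.
  by rewrite bcomp1r -bcompA; apply/sub/TRO_triple.
have h2 x1 y1 z1 : M x1 -> wstar_span M y1 -> wstar_span M z1 -> wstar_span M (bcomp (bcomp x1 (adj y1)) z1).
  move=> hx1 hy1 hz1.
  by apply: (wstar_span_compadj sW cW _ hy1) => t ht; exact: h1.
rewrite -bcompA -[bcomp x _]bcomp1l bcompA.
apply: (wstar_span_comp sW cW _ hx) => t ht.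
by rewrite bcomp1l bcompA; exact: h2.
Qed.

Section Forward.
Context {R : realType}.

Lemma partial_isometry_le (H K : hilbertType R) (U : 'B(H, K)) P x :
  is_projection P -> bcomp (adj U) U = P -> rnorm (U x) <= rnorm x.
Proof.
move=> hP UU; rewrite -(@ler_pXn2r _ 2) ?nnegrE ?rnorm_ge0//.
have -> : rnorm (U x) ^+ 2 = rnorm (P x) ^+ 2.
  apply: complexI; rewrite rnorm_adj_comp UU -hdotxx -[in LHS]hP.1 bcompE.
  by rewrite hP.2.
by rewrite lerXn2r ?nnegrE ?rnorm_ge0// projection_le.
Qed.

Lemma embeds_MI_iso (H1 H2 K1 K2 : hilbertType R) (X : set 'B(H1, H2)) (Y : set 'B(K1, K2)) :
  subspace X -> wstar_closed X -> TRO_embeds Y X ->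
  exists (p : 'B(H2, H2)) (q : 'B(H1, H1)),
    [/\ is_projection p /\ is_projection q, op_mul [set p] X `<=` X,
        op_mul X [set q] `<=` X
      & exists I : choiceType, inhabited I /\
          exists rho : infmx I K1 K2 -> infmx I H1 H2, wstar_MI_iso Y (compress p X q) rho].
Proof.
move=> sX cX [M1 [M2 [[tM1 tM2] YE M2YM1 M2M2X XM1M1]]].
have sY : subspace Y by rewrite YE; exact: wstar_span_subspace.
have cY : wstar_closed Y by rewrite YE; exact: closed_closure.
have [tN1 cN1] := wstar_span_TRO tM1; have [tN2 cN2] := wstar_span_TRO tM2.
set N1 := wstar_span M1 in tN1 cN1; set N2 := wstar_span M2 in tN2 cN2.
have adjM (H K : hilbertType R) (M : set 'B(H, K)) m : M m -> adjoints M (adj m).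
  by move=> hm; exists m => //; exact: is_adjoint_adj.
(* This inclusion and the next three extend the conditions of the embedding from [M1], [M2] to their
   w*-closures, one factor at a time. *)
have hY n2 x n1 : N2 n2 -> X x -> N1 n1 -> Y (bcomp (bcomp n2 x) (adj n1)).
  move=> h2 hx h1; rewrite -bcompA -[bcomp n2 _]bcomp1l bcompA.
  apply: (wstar_span_comp sY cY _ h2) => m2 hm2.
  rewrite bcomp1l bcompA -[bcomp _ (adj n1)]bcomp1r.
  apply: (wstar_span_compadj sY cY _ h1) => m1 hm1.
  rewrite bcomp1r YE; apply: wstar_span_sub.
  by exists (bcomp m2 x); [exists m2 => //; exists x|exists (adj m1) => //; exact: adjM].
have hX n2 y n1 : N2 n2 -> Y y -> N1 n1 -> X (bcomp (bcomp (adj n2) y) n1).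
  move=> h2 hy h1; rewrite -bcompA -[bcomp (adj n2) _]bcomp1l bcompA.
  apply: (wstar_span_compadj sX cX _ h2) => m2 hm2.
  rewrite bcomp1l bcompA -[bcomp _ n1]bcomp1r.
  apply: (wstar_span_comp sX cX _ h1) => m1 hm1.
  rewrite bcomp1r; apply: M2YM1.
  by exists (bcomp (adj m2) y); [exists (adj m2); [exact: adjM|exists y]|exists m1].
have hXl n n' x : N2 n -> N2 n' -> X x -> X (bcomp (bcomp (adj n) n') x).
  move=> h h' hx; rewrite -bcompA -[bcomp (adj n) _]bcomp1l bcompA.
  apply: (wstar_span_compadj sX cX _ h) => m hm.
  rewrite bcomp1l bcompA.
  apply: (wstar_span_comp sX cX _ h') => m' hm'.
  apply: M2M2X.
  by exists (bcomp (adj m) m'); [exists (adj m); [exact: adjM|exists m']|exists x].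
have hXr n n' x : N1 n -> N1 n' -> X x -> X (bcomp (bcomp x (adj n)) n').
  move=> h h' hx.
  apply: (wstar_span_compadj sX cX _ h) => m hm.
  rewrite -[bcomp _ n']bcomp1r.
  apply: (wstar_span_comp sX cX _ h') => m' hm'.
  rewrite bcomp1r; apply: XM1M1.
  by exists (bcomp x (adj m)); [exists x => //; exists (adj m) => //; exact: adjM|exists m'].
(* The alphabet collects the indices of the four columns, two for each TRO. Prefixing a letter
   injects pairs of a letter and a word into words, as [TRO_unitary] requires. *)
pose G (H K : hilbertType R) := (('B(H, K) * nat) + ('B(K, H) * nat))%type.
pose J : choiceType := (G H1 K1 + G H2 K2)%type.
pose I : choiceType := seq J.
have [q [q' [U1 [[hq hq' N1q qN1 gq] [hU1 U1U1 U1U1']]]]] :=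
  @TRO_unitary R I H1 K1 N1 (fun d i => (inl (inl d) : J) :: i) (fun d i => (inl (inr d) : J) :: i) tN1 cN1
    (fun d i d' i' => ltac:(by move=> [-> ->])) (fun d i d' i' => ltac:(by move=> [-> ->])).
have [p [p' [U2 [[hp hp' N2p pN2 gp] [hU2 U2U2 U2U2']]]]] :=
  @TRO_unitary R I H2 K2 N2 (fun d i => (inr (inl d) : J) :: i) (fun d i => (inr (inr d) : J) :: i) tN2 cN2
    (fun d i d' i' => ltac:(by move=> [-> ->])) (fun d i d' i' => ltac:(by move=> [-> ->])).
have ap : adj p = p by apply/esym/adjE; exact: hp.2.
have aq' : adj q' = q' by apply/esym/adjE; exact: hq'.2.
(* The operators that multiply [X] into itself from the left form a w*-closed subspace containing
   all [adj n n']; hence it contains [p]. *)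
have pX : op_mul [set p] X `<=` X.
  move=> _ [_ -> [x hx <-]]; have : resid_r X X p; last exact.
  apply: gp => [||n n' hn hn' m hm]; [exact: resid_r_subspace|exact: resid_r_closed|exact: hXl].
have Xq : op_mul X [set q] `<=` X.
  move=> _ [x hx [_ -> <-]]; have : resid_l X X q; last exact.
  apply: gq => [||n n' hn hn' m hm]; [exact: resid_l_subspace|exact: resid_l_closed|].
  by rewrite bcompA; exact: hXr.
exists p, q; split=> //; exists I; split; first by constructor; exact: [::].
pose W := compress p X q.
have WE : W = corner X p q := compress_corner hp hq pX Xq.
have sW : subspace W by rewrite WE; exact: corner_subspace.
have cW : wstar_closed W by rewrite WE; exact: corner_closed.
have WX w : W w -> [/\ X w, bcomp p w = w & bcomp w q = w].
  by rewrite WE => hw; split; [exact: hw.1|exact: corner_l hw|exact: corner_r hw].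
(* The corner of the whole of B(K1, K2) cut out by [p'] and [q'] is w*-closed and contains the
   products that generate [Y]. *)
have Ypq y : Y y -> bcomp p' y = y /\ bcomp y q' = y.
  have sT : subspace [set: 'B(K1, K2)] by [].
  suff h : corner setT p' q' y -> bcomp p' y = y /\ bcomp y q' = y.
    rewrite YE => hy; apply: h.
    have cT : wstar_closed (corner setT p' q').
      by apply: corner_closed => //; exact: closedT.
    have sc : subspace (corner setT p' q') by exact: corner_subspace.
    apply: (@wstar_span_map _ _ _ _ _ _ sc cT _ id _ _ _ hy) => [f nf|]; first by exists f.
    move=> _ [_ [m2 hm2 [x hx <-]] [_ [m1 hm1 /adjE ->] <-]]; split=> //.
    rewrite -!bcompA; have -> : bcomp (adj m1) q' = adj m1.
      by rewrite -[in LHS]aq' -adj_comp qN1//; exact: wstar_span_sub.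
    by rewrite [LHS]bcompA pN2//; exact: wstar_span_sub.
  by move=> hy; split; [exact: (corner_l hp' hy)|exact: (corner_r hq' hy)].
pose fw (S : 'B(l2 I K1, l2 I K2)) := bcomp (adj U2) (bcomp S U1).
pose bw (V : 'B(l2 I H1, l2 I H2)) := bcomp U2 (bcomp V (adj U1)).
have fwW S : MIop Y S -> MIop W (fw S).
  move=> hS; rewrite /fw bcompA.
  (* The triple product of matrices is formed in two steps; the residual is the space in which the
     entries of the first product lie. *)
  have sZ : subspace (resid_r N1 W) by exact: resid_r_subspace.
  have cZ : wstar_closed (resid_r N1 W) by exact: resid_r_closed.
  apply: (@MIop_mul _ _ _ _ _ (resid_r N1 W) N1 W _ _ sW cW) => // [x y hx hy|]; first exact: hx.
  apply: (@MIop_mul _ _ _ _ _ (adj_set (M := N2)) Y _ _ _ sZ cZ) => //; last exact: MIop_adj.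
  move=> _ y [n hn <-] hy m hm; rewrite WE; split; first exact: hX.
  rewrite -!bcompA N1q// [bcomp p _]bcompA.
  by rewrite -{1}ap -adj_comp N2p.
have bwY V : MIop W V -> MIop Y (bw V).
  move=> hV; rewrite /bw bcompA.
  have sZ : subspace (resid_r (adj_set (M := N1)) Y) by exact: resid_r_subspace.
  have cZ : wstar_closed (resid_r (adj_set (M := N1)) Y) by exact: resid_r_closed.
  apply: (@MIop_mul _ _ _ _ _ (resid_r (adj_set (M := N1)) Y) (adj_set (M := N1)) Y _ _ sY cY) => // [x y hx hy| |].
  - exact: hx.
  - apply: (@MIop_mul _ _ _ _ _ N2 W _ _ _ sZ cZ) => // n w hn /WX[hw _ _] _ [m hm <-].
    exact: hY.
  - exact: MIop_adj.
have bwfw S : MIop Y S -> bw (fw S) = S.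
  move=> hS; have -> : bw (fw S) = bcomp (ampl p') (bcomp S (ampl q')).
    by rewrite /bw /fw -U2U2' -U1U1' !bcompA.
  apply: ent_inj; apply/funext => i; apply/funext => j.
  by rewrite ent_ampl_l ent_ampl_r (Ypq _ (hS i j)).2 (Ypq _ (hS i j)).1.
have fwbw V : MIop W V -> fw (bw V) = V.
  move=> hV; have -> : fw (bw V) = bcomp (ampl p) (bcomp V (ampl q)).
    by rewrite /bw /fw -U2U2 -U1U1 !bcompA.
  apply: ent_inj; apply/funext => i; apply/funext => j.
  by rewrite ent_ampl_l ent_ampl_r; have [_ e1 e2] := WX _ (hV i j); rewrite e2 e1.
(* The operator with the given entries, and 0 for matrices that are not bounded, where [rho] may be
   arbitrary. *)
pose op (T : infmx I K1 K2) : 'B(l2 I K1, l2 I K2) := xget 0 [set S | ent S = T].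
have opE S : op (ent S) = S.
  by apply: ent_inj; apply: (@xgetPex _ 0 [set S' | ent S' = ent S]); exists S.
pose rho T := ent (fw (op T)).
have rhoE S : rho (ent S) = ent (fw S) by rewrite /rho opE.
have le1 x : rnorm (U1 x) <= rnorm x := partial_isometry_le x (ampl_projection hq) U1U1.
have le2 x : rnorm (U2 x) <= rnorm x := partial_isometry_le x (ampl_projection hp) U2U2.
have le1' x : rnorm (adj U1 x) <= rnorm x.
  by apply: (partial_isometry_le x (ampl_projection hq')); rewrite adjK U1U1'.
have le2' x : rnorm (adj U2 x) <= rnorm x.
  by apply: (partial_isometry_le x (ampl_projection hp')); rewrite adjK U2U2'.
exists rho; split.
- move=> a T T'; rewrite MIE => -[S hS <-] [S' hS' <-].
  by rewrite -ent_linear !rhoE /fw bcompDl bcompZl bcompDr bcompZr ent_linear.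
- rewrite !MIE; apply/seteqP; split=> [_ [_ [S hS <-] <-]|_ [V hV <-]].
    by exists (fw S); [exact: fwW|rewrite rhoE].
  by exists (ent (bw V)); [exists (bw V) => //; exact: bwY|rewrite rhoE fwbw].
- move=> n T hT.
  have [S hS] : exists S : 'M['B(l2 I K1, l2 I K2)]_n, forall i j, MIop Y (S i j) /\ ent (S i j) = T i j.
    exists (\matrix_(i, j) op (T i j)) => i j.
    by have := hT i j; rewrite MIE mxE => -[V hV <-]; rewrite opE.
  have -> : T = map_mx ent S by apply/matrixP => i j; rewrite mxE (hS i j).2.
  have -> : map_mx rho (map_mx ent S) = map_mx ent (map_mx fw S).
    by apply/matrixP => i j; rewrite !mxE rhoE.
  rewrite !MI_mxnorm_ent; apply/eqP; rewrite eq_le; apply/andP; split.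
    apply/opnorm_le; first exact: bop_mxnorm_ge0.
    have := opb_comp le2' le1 (opb_opnorm (fun i j => S i j)).
    by congr opb; apply/funext => i; apply/funext => j; rewrite mxE.
  apply/opnorm_le; first exact: bop_mxnorm_ge0.
  have := opb_comp le2 le1' (opb_opnorm (fun i j => map_mx fw S i j)).
  by congr opb; apply/funext => i; apply/funext => j; rewrite mxE -[LHS]/(bw (fw (S i j))) bwfw//; exact: (hS i j).1.
(* On M_I(Y) the functional [f \o rho] agrees with a normal functional [h] of all bounded matrices,
   since [fw] multiplies by fixed operators. *)
- apply: ft_continuous => f /MI_normal_pullback[x [y fE]].
  have nf : normal_functionals (fun S => nform x y (fw S)).
    have h := normal_comp (adj U2) U1 ((normal_nform _).2 (ex_intro _ x (ex_intro _ y erefl))).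
    move: h; congr normal_functionals; apply/funext => S.
    by rewrite /fw bcompA.
  have [x' [y' xy]] := (normal_nform _).1 nf.
  have [h nh hE] := MI_normal_extend x' y'.
  have hc : {within (MI I Y : set (wstar_MI I K1 K2)), continuous (h : wstar_MI I K1 K2 -> R[i]^o)}.
    by apply: continuous_subspaceT; exact: ft_ev_continuous.
  have e : {in MI I Y, h =1 f \o rho}.
    move=> T; rewrite inE MIE => -[S hS <-].
    by rewrite hE -xy -fE -rhoE.
  exact: (@subspace_eq_continuous (wstar_MI I K1 K2) (MI I Y) (R[i]^o) h (f \o rho) e hc).
Qed.

End Forward.

Theorem theorem3p11 (R : realType) (X Y : dualOperatorSpace R) :
  cbDelta_embeds Y X <->
  exists (H1 H2 K1 K2 : hilbertType R)
    (psi : {linear Y -> 'B(K1, K2)}) (phi : {linear X -> 'B(H1, H2)})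
    (p : 'B(H2, H2)) (q : 'B(H1, H1)),
    [/\ wstar_cb_iso psi /\ wstar_cb_iso phi,
        is_projection p /\ is_projection q,
        op_mul [set p] (range phi) `<=` range phi,
        op_mul (range phi) [set q] `<=` range phi
      & exists I : choiceType, inhabited I /\
          exists pi : infmx I K1 K2 -> infmx I H1 H2,
            wstar_MI_iso (range psi) (compress p (range phi) q) pi].
Proof.
split=> [[H1 [H2 [K1 [K2 [phi [psi [hphi hpsi hT]]]]]]]|].
  have [cphi _ _ _] := hphi.
  have [p [q [[hp hq] pX Xq [I [i0 hI]]]]] := embeds_MI_iso (range_subspace phi) cphi hT.
  by exists H1, H2, K1, K2, psi, phi, p, q; split=> //; exists I.
move=> [H1 [H2 [K1 [K2 [psi [phi [p [q [[hpsi hphi] [hp hq] pX Xq [I [[i0] [rho hrho]]]]]]]]]]]].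
exact: (MI_iso_embeds i0 hpsi hphi hp hq pX Xq hrho).
Qed.
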